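(* Let $A$ and $B$ be countable groups, let $B\curvearrowright I$ be an action of $B$ on a set $I$, and let $G\in\mathcal{WR}(A,B\curvearrowright I)$ be a (countable) wreath-like product group. Assume that $A$ is amenable, that $B$ is bi-exact, and that the action $B\curvearrowright I$ has amenable stabilizers. Then the group von Neumann algebra $L(G)$ is solid.
   Context: All groups are countable and discrete. Wreath-like products: given countable groups $A,B$ and an action $B\curvearrowright I$, $\mathcal{WR}(A,B\curvearrowright I)$ denotes the collection of all groups $G$ for which there is a short exact sequence $1\to A^{(I)}\to G\xrightarrow{\varepsilon}B\to1$, where $A^{(I)}=\bigoplus_{i\in I}A_i$ is the direct sum of copies $A_i$ of $A$ (identified with its image in $G$), such that $gA_ig^{-1}=A_{\varepsilon(g)i}$ for all $g\in G$, $i\in I$. The action $B\curvearrowright I$ has amenable stabilizers if for every $i\in I$ the subgroup $\{b\in B: bi=i\}$ is amenable. Bi-exactness: for a countable discrete group $B$, $\operatorname{Prob}(B)\subset\ell^1(B)$ is the set of probability measures on $B$, with left translation action $(k\cdot\mu)(g)=\mu(k^{-1}g)$. $B$ is bi-exact if it is exact and there is a map $\mu:B\to\operatorname{Prob}(B)$ such that $\lim_{g\to\infty}\|\mu(kgh)-k\cdot\mu(g)\|_1=0$ for all $h,k\in B$, where $g\to\infty$ means that $g$ eventually leaves every finite subset of $B$. $L(G)$ is the von Neumann algebra generated by the left regular representation of $G$ on $\ell^2(G)$. A finite von Neumann algebra $M$ is solid if for every diffuse von Neumann subalgebra $Q\subset M$ the relative commutant $Q'\cap M$ is amenable (equivalently,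 injective). *)

(* Defs.v *)
From HB Require Import structures.
From mathcomp Require Import all_boot all_order all_algebra.
From mathcomp Require Import all_classical all_reals all_analysis.
From mathcomp Require Import complex lra.
From mathcomp.analysis.showcase Require summability.

Set Implicit Arguments.
Unset Strict Implicit.
Unset Printing Implicit Defensive.
Import Order.TTheory GRing.Theory Num.Theory.
Import numFieldNormedType.Exports.
Import ComplexField Normc.

Local Open Scope classical_set_scope.
Local Open Scope ring_scope.

Section DirectSum.
Variables (I : Type) (A : groupType).

Definition finite_support (f : I -> A) : bool :=
  `[< finite_set [set i | f i <> 1%g] >].

Definition direct_sum := {f : I -> A | finite_support f}.

HB.instance Definition _ := Choice.on direct_sum.

Fact finite_support1 : finite_support (fun=> 1%g).
Proof.
by apply/asboolP; rewrite (_ : [set i | _] = set0)//; apply/seteqP; split.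
Qed.

Fact finite_supportV (f : direct_sum) :
  finite_support (fun i => (sval f i)^-1)%g.
Proof.
apply/asboolP; apply: sub_finite_set (asboolW (svalP f)) => i /= + fi1.
by rewrite fi1 invg1.
Qed.

Fact finite_supportM (f g : direct_sum) :
  finite_support (fun i => sval f i * sval g i)%g.
Proof.
apply/asboolP.
have fin : finite_set ([set i | sval f i <> 1%g] `|` [set i | sval g i <> 1%g]).
  by rewrite finite_setU; split; [exact: (asboolW (svalP f)) |
                                  exact: (asboolW (svalP g))].
apply: sub_finite_set fin => i /= fgi.
have [f1|f1] := pselect (sval f i = 1%g); last by left.
by right => g1; apply: fgi; rewrite f1 g1 mulg1.
Qed.

Definition direct_sum1 : direct_sum := exist finite_support _ finite_support1.
Definition direct_sumV (f : direct_sum) : direct_sum :=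
  exist finite_support _ (finite_supportV f).
Definition direct_sumM (f g : direct_sum) : direct_sum :=
  exist finite_support _ (finite_supportM f g).

Fact direct_sumMA : associative direct_sumM.
Proof. by move=> f g h; apply/val_inj/funext => i /=; rewrite mulgA. Qed.
Fact direct_sum1M : left_id direct_sum1 direct_sumM.
Proof. by move=> f; apply/val_inj/funext => i /=; rewrite mul1g. Qed.
Fact direct_sumM1 : right_id direct_sum1 direct_sumM.
Proof. by move=> f; apply/val_inj/funext => i /=; rewrite mulg1. Qed.
Fact direct_sumVM : left_inverse direct_sum1 direct_sumV direct_sumM.
Proof. by move=> f; apply/val_inj/funext => i /=; rewrite mulVg. Qed.
Fact direct_sumMV : right_inverse direct_sum1 direct_sumV direct_sumM.
Proof. by move=> f; apply/val_inj/funext => i /=; rewrite mulgV. Qed.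

HB.instance Definition _ := isGroup.Build direct_sum
  direct_sumMA direct_sum1M direct_sumM1 direct_sumVM direct_sumMV.

Definition direct_summand (i : I) : set direct_sum :=
  [set f | forall j, j <> i -> sval f j = 1%g].

End DirectSum.

Definition is_group_action (B : groupType) (I : Type) (act : B -> I -> I) :=
  (forall i, act 1%g i = i) /\
  (forall b c i, act (b * c)%g i = act b (act c i)).

Definition stabilizer (B : groupType) (I : Type) (act : B -> I -> I) (i : I) :
  set B := [set b | act b i = i].

Definition wreath_like (A B : groupType) (I : Type) (act : B -> I -> I)
    (G : groupType) : Prop :=
  exists (iota : {multiplicative direct_sum I A -> G})
         (eps : {multiplicative G -> B}),
    [/\ injective iota, range iota = eps @^-1` [set 1%g], range eps = setT &
        forall (g : G) (i : I),
          (fun x => g * x * g^-1)%g @` (iota @` direct_summand i) =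
          iota @` direct_summand (act (eps g) i)].

(* [H] is meant to be a subgroup; [m] matters only on subsets of [H]. *)
Definition amenable (R : realType) (G : groupType) (H : set G) : Prop :=
  exists m : set G -> R,
    [/\ m H = 1,
        forall S, S `<=` H -> 0 <= m S,
        forall S T, S `<=` H -> T `<=` H -> S `&` T = set0 ->
          m (S `|` T) = m S + m T &
        forall h S, H h -> S `<=` H -> m ((fun x => h * x)%g @` S) = m S].

Section HilbertSpace.
Variables (R : realType) (X : choiceType).

Definition square_summable : {pred X -> R[i]} :=
  fun f => `[< (\esum_(x in setT) (normc (f x) ^+ 2)%:E < +oo)%E >].

Fact square_summable_submod : submod_closed square_summable.
Proof.
split.
  apply/asboolP; rewrite esum1// => x _.
  by rewrite /= expr0n /= addr0 sqrtr0 expr0n.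
move=> c f g /asboolP ff /asboolP gg; apply/asboolP.
have N0 (z : R[i]) : 0 <= normc z by case: z => a b; exact: sqrtr_ge0.
pose F x : \bar R := (normc (f x) ^+ 2)%:E.
pose G x : \bar R := (normc (g x) ^+ 2)%:E.
have F0 x : (0 <= F x)%E by rewrite lee_fin sqr_ge0.
have G0 x : (0 <= G x)%E by rewrite lee_fin sqr_ge0.
pose K := normc c ^+ 2 * 2.
have K0 : 0 <= K by rewrite mulr_ge0// sqr_ge0.
have esumZ (k : R) (a : X -> \bar R) : 0 <= k -> (forall x, (0 <= a x)%E) ->
    (\esum_(x in setT) a x < +oo -> \esum_(x in setT) (k%:E * a x) < +oo)%E.
  move=> k0 a0 afin.
  apply: (@le_lt_trans _ _ (k%:E * \esum_(x in setT) a x)%E); last first.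
    by rewrite lte_mul_pinfty// ge0_fin_numE// esum_ge0.
  apply: ge_ereal_sup => _ [S [finS _] <-].
  rewrite -ge0_mule_fsumr// lee_wpmul2l ?lee_fin//.
  by apply: ereal_sup_ubound; exists S.
have := lte_add_pinfty (esumZ K F K0 F0 ff) (esumZ 2 G (ler0n _ _) G0 gg).
rewrite -esumD; last 2 first.
- by move=> x _; apply: mule_ge0 => //; rewrite lee_fin.
- by move=> x _; apply: mule_ge0 => //; rewrite lee_fin ler0n.
apply: le_lt_trans; apply: le_esum => x _.
rewrite /F /G -!EFinM -EFinD lee_fin.
apply: (@le_trans _ _ ((normc c * normc (f x) + normc (g x)) ^+ 2)).
  rewrite ler_sqr ?nnegrE ?addr_ge0 ?mulr_ge0 ?N0//.
  by rewrite -normcM; exact: le_normcD.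
rewrite /K; move: (normc c) (normc (f x)) (normc (g x)) => a u v.
have := sqr_ge0 (a * u - v).
by nra.
Qed.

HB.instance Definition _ :=
  GRing.isSubmodClosed.Build R[i] (X -> R[i]) square_summable
    square_summable_submod.

(* The Hilbert space of square-summable complex families indexed by X. *)
Record l2 := L2 { l2_fun :> X -> R[i]; _ : l2_fun \in square_summable }.

HB.instance Definition _ := [isSub for l2_fun].
HB.instance Definition _ := [Choice of l2 by <:].
HB.instance Definition _ := [SubChoice_isSubLmodule of l2 by <:].

(* Unconditional summation along the net of finite subsets of X. *)
Definition csum (u : X -> R[i]) : R[i] :=
  Complex (summability.sum (fun x => complex.Re (u x) : R^o))
          (summability.sum (fun x => complex.Im (u x) : R^o)).

Definition inner (f g : l2) : R[i] := csum (fun x => f x * (g x)^*%C).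

Definition l2norm (f : l2) : R :=
  Num.sqrt (fine (\esum_(x in setT) (normc (f x) ^+ 2)%:E)).

End HilbertSpace.

Notation l2op R X := (l2 R X -> l2 R X).

Section Operators.
Variables (R : realType) (X : choiceType).
Implicit Types (S T U : l2op R X) (M N Q : set (l2op R X)).

Definition bounded_op : set (l2op R X) :=
  [set T | linear T /\ exists c : R, forall f, l2norm (T f) <= c * l2norm f].

Definition opnorm T : R :=
  sup [set r | exists2 f : l2 R X, l2norm f <= 1 & r = l2norm (T f)].

Definition is_adjoint T S := forall f g, inner (T f) g = inner f (S g).

Definition projection : set (l2op R X) :=
  [set p | [/\ bounded_op p, p \o p = p & is_adjoint p p]].

(* Positivity of an n x n matrix of operators, acting on the n-fold Hilbert
   sum; the order of R[i] makes [0 <= z] mean that z is real and nonnegative. *)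
Definition positive_mx n (a : 'I_n -> 'I_n -> l2op R X) :=
  forall xi : 'I_n -> l2 R X,
    0 <= \sum_(i < n) \sum_(j < n) inner (a i j (xi j)) (xi i).

Definition commutant M : set (l2op R X) :=
  [set T | bounded_op T /\ forall S, M S -> T \o S = S \o T].

Definition von_neumann_algebra M :=
  [/\ M `<=` bounded_op,
      forall T, M T -> exists2 S, M S & is_adjoint T S &
      commutant (commutant M) = M].

Definition finite_vna M := forall V W,
  M V -> M W -> is_adjoint V W -> W \o V = idfun -> V \o W = idfun.

Definition minimal_projection M (p : l2op R X) :=
  [/\ M p, projection p, p <> 0 &
      forall q, M q -> projection q -> p \o q = q -> q = 0 \/ q = p].

Definition diffuse M := forall p, ~ minimal_projection M p.

End Operators.

(* Maps between spaces of operators are total functions of which only the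
   restriction to a given set [D] matters. *)
Section CompletelyPositive.
Variables (R : realType) (X Y : choiceType).
Implicit Types (D : set (l2op R X)) (phi : l2op R X -> l2op R Y).

Definition linear_on D phi := forall (c : R[i]) T U,
  D T -> D U -> phi (c *: T + U) = c *: phi T + phi U.

Definition completely_positive_on D phi :=
  forall n (a : 'I_n -> 'I_n -> l2op R X),
    (forall i j, D (a i j)) -> positive_mx a ->
    positive_mx (fun i j => phi (a i j)).

(* contractive completely positive maps *)
Definition ccp D phi :=
  [/\ forall T, D T -> bounded_op (phi T),
      linear_on D phi,
      forall T, D T -> opnorm (phi T) <= opnorm T &
      completely_positive_on D phi].

Definition faithful_representation D phi :=
  [/\ forall T, D T -> bounded_op (phi T),
      linear_on D phi,
      forall T U, D T -> D U -> phi (T \o U) = phi T \o phi U,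
      forall T S, D T -> D S -> is_adjoint T S -> is_adjoint (phi T) (phi S) &
      forall T U, D T -> D U -> phi T = phi U -> T = U].

End CompletelyPositive.

(* Point-norm approximation by contractive completely positive maps factoring
   through matrix algebras; M_k(C) is taken to be [bounded_op] on the l2 space
   of 'I_k. *)
Definition nuclear_map (R : realType) (X Y : choiceType)
    (D : set (l2op R X)) (phi : l2op R X -> l2op R Y) :=
  forall (F : set (l2op R X)) (e : R), finite_set F -> F `<=` D -> 0 < e ->
    exists (k : nat) (a : l2op R X -> l2op R 'I_k)
           (b : l2op R 'I_k -> l2op R Y),
      [/\ ccp D a, ccp (@bounded_op R 'I_k) b &
          forall T, F T -> opnorm (b (a T) - phi T) < e].

(* Every Hilbert space is isomorphic to some [l2 R Y]. *)
Definition exact_cstar (R : realType) (X : choiceType) (D : set (l2op R X)) :=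
  exists (Y : choiceType) (pi : l2op R X -> l2op R Y),
    faithful_representation D pi /\ nuclear_map D pi.

Definition conditional_expectation (R : realType) (X : choiceType)
    (N : set (l2op R X)) (E : l2op R X -> l2op R X) :=
  [/\ ccp (@bounded_op R X) E,
      forall T, bounded_op T -> N (E T),
      forall T, N T -> E T = T &
      forall S T U, N S -> N U -> bounded_op T ->
        E (S \o T \o U) = S \o E T \o U].

(* Amenability of a von Neumann algebra, in the form of injectivity. *)
Definition amenable_vna (R : realType) (X : choiceType) (N : set (l2op R X)) :=
  exists E, conditional_expectation N E.

Definition solid (R : realType) (X : choiceType) (M : set (l2op R X)) :=
  [/\ von_neumann_algebra M, finite_vna M &
      forall Q, von_neumann_algebra Q -> Q `<=` M -> diffuse Q ->
        amenable_vna (commutant Q `&` M)].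

Section GroupOperators.
Variables (R : realType) (G : groupType).

Fact left_translate_subproof (g : G) (f : l2 R G) :
  (fun h => f (g^-1 * h)%g) \in @square_summable R G.
Proof.
apply/asboolP; have := valP f; rewrite /= => /asboolP.
rewrite (@reindex_esum _ _ _ setT setT (fun h => g^-1 * h)%g)//.
split=> // [x y _ _ /= /mulgI//|x _]; exists (g * x)%g => //.
by rewrite mulKg.
Qed.

Definition left_regular (g : G) : l2op R G :=
  fun f => L2 (left_translate_subproof g f).

Definition reduced_cstar : set (l2op R G) :=
  [set T | bounded_op T /\ forall e : R, 0 < e -> exists s : seq (R[i] * G),
     opnorm (T - \sum_(p <- s) p.1 *: left_regular p.2) < e].

Definition group_vna : set (l2op R G) :=
  commutant (commutant (range left_regular)).

Definition exact_group := exact_cstar reduced_cstar.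

Definition Prob : set (G -> R) :=
  [set mu | (forall g, 0 <= mu g) /\ (\esum_(g in setT) (mu g)%:E = 1)%E].

Definition translate (k : G) (mu : G -> R) : G -> R := fun g => mu (k^-1 * g)%g.

Definition l1dist (mu nu : G -> R) : \bar R :=
  \esum_(g in setT) `|mu g - nu g|%:E.

Definition biexact :=
  exact_group /\
  exists mu : G -> (G -> R),
    (forall g, Prob (mu g)) /\
    forall h k : G,
      l1dist (mu (k * g * h)%g) (translate k (mu g))
        @[g --> (@frechet_filter G : set_system G)] --> 0%E.

End GroupOperators.

Arguments group_vna R G _ : clear implicits.

(* Main.v *)
From HB Require Import structures.
From mathcomp Require Import all_boot all_order all_algebra.
From mathcomp Require Import all_classical all_reals all_analysis.
From mathcomp Require Import complex lra ring finmap.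
From mathcomp.analysis.showcase Require summability.
Require Import Defs.

(** For a sequence g leaving every finite subset of G, consider its image in B and
    its component in the direct sum.  If the image tends to infinity,
    bi-exactness of B gives asymptotically equivariant probabilities on B.
    Otherwise the component tends to infinity, and one weights every point
    of its support in I by a slowly varying proper length of the corresponding
    coordinate; left and right multiplication by fixed elements of G permute
    and hardly change these weights.  This gives asymptotically equivariant
    means on the G-set I + B.  All point stabilizers of the B-set I + B are
    amenable and B is exact, hence has property A; as A^(I) is amenable too,
    I + B carries an almost equivariant family of uniformly finitely supported
    probabilities on G.  Integrating it, one obtains probabilities mu_t on G,
    supported in one finite set, with mu_(ht) - mu_t -> 0 and
    mu_(tp) close to the translate of mu_t as t tends to infinity.

    For such mu, V delta_t = sum_z sqrt (mu_t z) delta_(z, t z) commutes, up to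
    terms vanishing at infinity, with left translations, and transports right
    translations to translations of the first coordinate.  If Q is a diffuse
    subalgebra of L(G), then Q contains unitaries u with u delta_1 uniformly
    small on any given finite set, so that the errors disappear on V u delta_1:
    limits of the vectors V u delta_1 behave, for Q' /\ L(G), like delta_1 for
    an operator algebra represented on the first coordinate alone.
    Compressing T (x) 1 along translates of these vectors defines a unital
    completely positive map from B(l2 G) to L(G) which is the identity on
    Q' /\ L(G); composed with the trace preserving expectation it shows that
    Q' /\ L(G) is injective. *)

Set Implicit Arguments.
Unset Strict Implicit.
Unset Printing Implicit Defensive.
Import Order.TTheory GRing.Theory Num.Theory.
Import numFieldNormedType.Exports.
Import ComplexField Normc.

Local Open Scope classical_set_scope.
Local Open Scope ring_scope.

(** * Means *)

(** The delicate point is the passage from the reduced C*-algebra to L(G). The vectors V u delta_1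
    converge only in an abstract limit Hilbert space, on which a priori only combinations of
    translations act. This is why the probabilities mu_t must live on one finite set E which depends
    on the tolerance for right translations alone, while the errors for left translations are sent
    to 0 with E fixed. The Gram kernel of the limit is then bounded in terms of |E|, the limit is
    realized inside a multiple of l2 G, and all of L(G) acts there. The errors for right
    translations keep a fixed size at this stage and disappear in a second limit. Every limit is a
    mean, that is, a positive functional respecting eventual inequalities; this takes the place of
    weak compactness and of ultraproducts. Convergence at infinity in a group is expressed by a
    finite exceptional set, and smallness modulo compact operators by a bound involving the mass of
    a vector on such a set. *)

Section Means.
Variable R : realType.

Definition bdd (Y : Type) (f : Y -> R) := exists C, forall y, `|f y| <= C.

Lemma bdd_cst Y (c : R) : bdd (fun _ : Y => c).
Proof. by exists `|c|. Qed.

Lemma bddD Y (f g : Y -> R) : bdd f -> bdd g -> bdd (fun y => f y + g y).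
Proof.
move=> [a fa] [b gb]; exists (a + b) => y.
by rewrite (le_trans (ler_normD _ _))// lerD.
Qed.

Lemma bddM Y (f g : Y -> R) : bdd f -> bdd g -> bdd (fun y => f y * g y).
Proof. by move=> [a fa] [b gb]; exists (a * b) => y; rewrite normrM ler_pM. Qed.

Lemma bddZ Y c (f : Y -> R) : bdd f -> bdd (fun y => c * f y).
Proof. exact/bddM/bdd_cst. Qed.

Lemma bddN Y (f : Y -> R) : bdd f -> bdd (fun y => - f y).
Proof. by move=> [a fa]; exists a => y; rewrite normrN. Qed.

Lemma bddB Y (f g : Y -> R) : bdd f -> bdd g -> bdd (fun y => f y - g y).
Proof. by move=> /[swap] /bddN/[swap]; exact: bddD. Qed.

Lemma bdd_sum Y J (r : seq J) (P : pred J) (f : J -> Y -> R) :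
  (forall j, P j -> bdd (f j)) -> bdd (fun y => \sum_(j <- r | P j) f j y).
Proof.
move=> fb; elim: r => [|j r IH].
  by exists 0 => y; rewrite big_nil normr0.
case Pj: (P j).
  have [C fC] := bddD (fb j Pj) IH.
  by exists C => y; rewrite big_cons Pj.
by have [C fC] := IH; exists C => y; rewrite big_cons Pj.
Qed.

Lemma bdd_comp Y Z (s : Z -> Y) (f : Y -> R) : bdd f -> bdd (fun z => f (s z)).
Proof. by move=> [a fa]; exists a => z. Qed.

Lemma bdd_le Y (f : Y -> R) C : (forall y, `|f y| <= C) -> bdd f.
Proof. by exists C. Qed.

(** A finitely additive probability on [Y], given by its integral. The functional is total but
    constrained on bounded functions only, so that a formula such as a supremum can define it. *)
Record mean (Y : Type) := Mean {
  mean_fun :> (Y -> R) -> R;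
  mean_linear : forall a f g, bdd f -> bdd g ->
    mean_fun (fun y => a * f y + g y) = a * mean_fun f + mean_fun g;
  mean_ge0 : forall f, bdd f -> (forall y, 0 <= f y) -> 0 <= mean_fun f;
  mean1 : mean_fun (fun=> 1) = 1 }.

Section MeanTheory.
Variables (Y : Type) (m : mean Y).
Implicit Types f g : Y -> R.

Lemma eq_mean f g : f =1 g -> m f = m g.
Proof. by move=> /funext ->. Qed.

Lemma mean_cst c : m (fun=> c) = c.
Proof.
have m0 : m (fun=> 0) = 0.
  have := mean_linear m (-1) (bdd_cst Y 0) (bdd_cst Y 0).
  rewrite (@eq_mean _ (fun=> 0)) => [|y]; last by rewrite mulr0 addr0.
  lra.
have := mean_linear m c (bdd_cst Y 1) (bdd_cst Y 0).
by rewrite m0 mean1 mulr1 !addr0.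
Qed.

Lemma meanD f g : bdd f -> bdd g -> m (fun y => f y + g y) = m f + m g.
Proof.
move=> fb gb; have := mean_linear m 1 fb gb; rewrite mul1r => <-.
by apply: eq_mean => y; rewrite mul1r.
Qed.

Lemma meanZ c f : bdd f -> m (fun y => c * f y) = c * m f.
Proof.
move=> fb; have := mean_linear m c fb (bdd_cst Y 0).
by rewrite mean_cst addr0 => <-; apply: eq_mean => y; rewrite addr0.
Qed.

Lemma meanN f : bdd f -> m (fun y => - f y) = - m f.
Proof.
move=> fb; rewrite -mulN1r -meanZ//.
by apply: eq_mean => y; rewrite mulN1r.
Qed.

Lemma meanB f g : bdd f -> bdd g -> m (fun y => f y - g y) = m f - m g.
Proof. by move=> fb gb; rewrite meanD ?meanN//; exact: bddN. Qed.

Lemma le_mean f g : bdd f -> bdd g -> (forall y, f y <= g y) -> m f <= m g.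
Proof.
move=> fb gb fg; rewrite -subr_ge0 -meanB//; apply: mean_ge0; first exact: bddB.
by move=> y; rewrite subr_ge0.
Qed.

Lemma mean_le C f : bdd f -> (forall y, f y <= C) -> m f <= C.
Proof. by move=> fb fC; rewrite -[C]mean_cst le_mean//; exact: bdd_cst. Qed.

Lemma mean_abs C f : (forall y, `|f y| <= C) -> `|m f| <= C.
Proof.
move=> fC; have fb := bdd_le fC; rewrite ler_norml; apply/andP; split.
  rewrite -[leLHS]mean_cst le_mean//; first exact: bdd_cst.
  by move=> y; have := fC y; rewrite ler_norml => /andP[].
apply: mean_le => // y.
by have := fC y; rewrite ler_norml => /andP[].
Qed.

Lemma mean_sum J (r : seq J) (P : pred J) (f : J -> Y -> R) :
  (forall j, P j -> bdd (f j)) ->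
  m (fun y => \sum_(j <- r | P j) f j y) = \sum_(j <- r | P j) m (f j).
Proof.
move=> fb; elim: r => [|j r IH].
  by rewrite big_nil (@eq_mean _ (fun=> 0)) ?mean_cst// => y; rewrite big_nil.
rewrite big_cons; case Pj: (P j); last first.
  by rewrite -IH; apply: eq_mean => y; rewrite big_cons Pj.
rewrite -IH -meanD; [|exact: fb|exact: bdd_sum].
by apply: eq_mean => y; rewrite big_cons Pj.
Qed.

Lemma mean_comp_subproof1 Z (s : Y -> Z) a (f g : Z -> R) : bdd f -> bdd g ->
  m (fun y => a * f (s y) + g (s y)) = a * m (f \o s) + m (g \o s).
Proof. by move=> fb gb; apply: mean_linear; exact: bdd_comp. Qed.

Lemma mean_comp_subproof2 Z (s : Y -> Z) (f : Z -> R) : bdd f ->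
  (forall z, 0 <= f z) -> 0 <= m (f \o s).
Proof. by move=> fb f0; apply: mean_ge0 => [|y]; [exact: bdd_comp|exact: f0]. Qed.

Definition mean_push Z (s : Y -> Z) : mean Z :=
  Mean (mean_comp_subproof1 s) (mean_comp_subproof2 s) (mean1 m).

End MeanTheory.

Section UltraMean.
Variables (Y : Type) (F : set_system Y).
Hypothesis FU : UltraFilter F.

Definition ulim (f : Y -> R) : R := sup [set c | F [set y | c <= f y]].

(** For c just below the supremum the set {c <= f} belongs to [F], whereas {ulim f + e <= f} does
    not, so its complement does: here the maximality of the ultrafilter enters. *)
Lemma ulimP f e : bdd f -> 0 < e -> F [set y | `|f y - ulim f| < e].
Proof.
move=> [C fC] e0.
have sC : has_sup [set c | F [set y | c <= f y]].
  split.
    exists (- C) => /=; apply: (@filterS _ _ _ setT); last exact: filterT.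
    by move=> y _ /=; have := fC y; rewrite ler_norml => /andP[].
  exists C => c /= /filter_ex[y cy]; apply: (le_trans cy).
  by have := fC y; rewrite ler_norml => /andP[].
have [c /= Fc cl] := sup_adherent e0 sC.
have nF : ~ F [set y | ulim f + e <= f y].
  by move=> /(sup_upper_bound sC) /=; rewrite -/(ulim f); lra.
have [//|Fn] := in_ultra_setVsetC [set y | ulim f + e <= f y] FU.
apply: filterS (filterI Fc Fn) => y [/= c1 /negP]; rewrite -ltNge => c2.
by rewrite ltr_norml; move: cl; rewrite -/(ulim f) => cl; apply/andP; split; lra.
Qed.

Lemma ulim_eq f l : bdd f ->
  (forall e, 0 < e -> F [set y | `|f y - l| < e]) -> ulim f = l.
Proof.
move=> fb fl; apply/eqP; rewrite -subr_eq0 -normr_le0.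
apply/ler_addgt0Pr => e e0; rewrite add0r.
have e20 : 0 < e / 2 by lra.
have [y /= [h1 h2]] := filter_ex (filterI (ulimP fb e20) (fl _ e20)).
have -> : ulim f - l = (f y - l) - (f y - ulim f) by ring.
by rewrite (le_trans (ler_normB _ _))//; lra.
Qed.

Lemma ulim_linear a f g : bdd f -> bdd g ->
  ulim (fun y => a * f y + g y) = a * ulim f + ulim g.
Proof.
move=> fb gb; apply: ulim_eq; first exact/bddD/gb/bddZ.
move=> e e0; have e1 : 0 < e / 2 by lra.
have e2 : 0 < e / (2 * (`|a| + 1)) by rewrite divr_gt0// mulr_gt0// ltr_pwDr.
apply: filterS (filterI (ulimP fb e2) (ulimP gb e1)) => y [/= h1 h2].
have -> : a * f y + g y - (a * ulim f + ulim g) =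
  a * (f y - ulim f) + (g y - ulim g) by ring.
apply: (le_lt_trans (ler_normD _ _)); rewrite normrM.
suff : `|a| * `|f y - ulim f| <= e / 2 by lra.
apply: (@le_trans _ _ (`|a| * (e / (2 * (`|a| + 1))))).
  by rewrite ler_wpM2l// ltW.
have a1 : 0 < `|a| + 1 by rewrite ltr_pwDr.
rewrite (_ : `|a| * (e / (2 * (`|a| + 1))) = e / 2 * (`|a| / (`|a| + 1))).
  2: by field; exact: lt0r_neq0.
by rewrite ler_piMr ?ler_pdivrMr ?mul1r//; lra.
Qed.

Lemma ulim_ge0 f : bdd f -> F [set y | 0 <= f y] -> 0 <= ulim f.
Proof.
move=> fb f0; apply/ler_addgt0Pr => e e0.
have [y /= [h1]] := filter_ex (filterI (ulimP fb e0) f0).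
by move: h1; rewrite ltr_norml => /andP[]; lra.
Qed.

Lemma ulim1 : ulim (fun=> 1) = 1.
Proof.
apply: ulim_eq; first exact: bdd_cst.
move=> e e0; apply: filterS (filterT) => y _ /=; by rewrite subrr normr0.
Qed.

Definition ulim_mean : mean Y :=
  Mean ulim_linear
    (fun f fb f0 => ulim_ge0 fb (filterS (fun y _ => f0 y) filterT)) ulim1.

End UltraMean.

Section DirectedMean.
Variables (Y : Type) (le : Y -> Y -> Prop) (y0 : Y).
Hypothesis lexx : forall x, le x x.
Hypothesis le_trans' : forall x y z, le x y -> le y z -> le x z.
Hypothesis le_dir : forall x y, exists z, le x z /\ le y z.

Lemma directed_mean : exists m : mean Y, forall f, bdd f ->
  (exists x, forall y, le x y -> 0 <= f y) -> 0 <= m f.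
Proof.
pose F : set_system Y := filter_from setT (fun x => [set y | le x y]).
have FF : ProperFilter F.
  apply: filter_from_proper; last by move=> x _; exists x => /=.
  apply: filter_fromT_filter; first by exists y0.
  move=> x y; have [z [xz yz]] := le_dir x y; exists z => t /= zt.
  by split; exact: le_trans' zt.
have [G [GU FG]] := ultraFilterLemma FF.
exists (ulim_mean GU) => f fb [x fx]; apply: ulim_ge0 => //.
by apply: FG; exists x.
Qed.

End DirectedMean.

(** The link between a mean and a directed set: eventual inequalities pass to the mean, which
    therefore equals the limit whenever the latter exists. *)
Definition tail_pos (Y : Type) (le : Y -> Y -> Prop) (m : mean Y) :=
  forall f, bdd f -> (exists x, forall y, le x y -> 0 <= f y) -> 0 <= m f.

Section TailPos.
Variables (Y : Type) (le : Y -> Y -> Prop) (m : mean Y).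
Hypothesis mt : tail_pos le m.
Hypothesis le_dir : forall x y, exists z, forall t, le z t -> le x t /\ le y t.

Lemma tail_le f c : bdd f -> (exists x, forall y, le x y -> f y <= c) ->
  m f <= c.
Proof.
move=> fb [x fx]; rewrite -subr_ge0 -{1}[c](mean_cst m) -meanB//;
  last exact: bdd_cst.
apply: mt; first exact/bddB/fb/bdd_cst.
by exists x => y /fx; rewrite subr_ge0.
Qed.

Lemma tail_abs f c : bdd f -> (exists x, forall y, le x y -> `|f y| <= c) ->
  `|m f| <= c.
Proof.
move=> fb [x fx]; rewrite ler_norml lerNl -meanN//.
apply/andP; split; apply: tail_le => //; [exact: bddN|exists x..] => y /fx;
  rewrite ler_norml => /andP[]; lra.
Qed.

Lemma tail_lim f l : bdd f ->
  (forall e, 0 < e -> exists x, forall y, le x y -> `|f y - l| <= e) -> m f = l.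
Proof.
move=> fb fl; apply/eqP; rewrite -subr_eq0 -normr_le0.
apply/ler_addgt0Pr => e e0; rewrite add0r -(mean_cst m l) -meanB//;
  last exact: bdd_cst.
apply: tail_abs; last exact: fl.
exact/bddB/bdd_cst.
Qed.

End TailPos.

Section AmenableMean.
Variables (G : groupType) (H : set G).
Hypothesis HM : forall x y, H x -> H y -> H (x * y)%g.
Hypothesis HV : forall x, H x -> H (x^-1)%g.

Let peval (p : seq (R * G)) (f : G -> R) := \sum_(x <- p) x.1 * f x.2.

(** The induction cuts [D] by one set of the list at a time; on each nonempty atom of the Boolean
    algebra so generated, the mass of [m] is put at a single point. *)
Lemma finitely_additive_approx (m : set G -> R) :
  (forall S, S `<=` H -> 0 <= m S) ->
  (forall S T, S `<=` H -> T `<=` H -> S `&` T = set0 ->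
     m (S `|` T) = m S + m T) ->
  forall (l : seq (set G)) (D : set G), D `<=` H -> exists p : seq (R * G),
  [/\ forall x, x \in p -> 0 <= x.1 /\ D x.2,
      \sum_(x <- p) x.1 = m D &
      forall S, S \in (l : seq {classic set G}) ->
        peval p \1_S = m (S `&` D)].
Proof.
move=> m0 mD.
have mset0 : m set0 = 0.
  have h : (set0 : set G) `<=` H by [].
  by have := mD set0 set0 h h (set0I _); rewrite setU0; lra.
elim=> [|T l IH] D DH.
  have [/set0P[d Dd]|] := boolP (D != set0).
    exists [:: (m D, d)]; split; rewrite ?big_seq1// => x.
    by rewrite inE => /eqP -> /=; split => //; exact: m0.
  by rewrite negbK => /eqP ->; exists [::]; split => //; rewrite big_nil mset0.
have [|p [p0 p1 p2]] := IH (D `&` T); first by move=> x [/DH].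
have [|q [q0 q1 q2]] := IH (D `\` T); first by move=> x [/DH].
have DE S : m (S `&` D) = m (S `&` (D `&` T)) + m (S `&` (D `\` T)).
  rewrite -mD; last 3 first.
  - by move=> x [_ [/DH]].
  - by move=> x [_ [/DH]].
  - by apply/seteqP; split=> // x [[_ [_ Tx]] [_ [_]]].
  congr m; apply/seteqP; split=> x /=; last by case=> [] [? [? _]].
  by move=> [Sx Dx]; have [Tx|Tx] := pselect (T x); [left|right].
exists (p ++ q); split.
- move=> x; rewrite mem_cat => /orP[/p0[? []]|/q0[? []]] //.
- by rewrite big_cat/= p1 q1 -[in RHS](setTI D) DE !setTI.
- move=> S; rewrite inE /peval big_cat/= => /orP[/eqP ->|Sl].
    rewrite DE; congr (_ + _).
      rewrite (eq_big_seq (fun x => x.1)) => [|x /p0[_ [_ Tx]]]; last first.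
        by rewrite indicE mem_set// mulr1.
      by rewrite p1; congr m; apply/seteqP; split=> x /=; [|case] => // [] [].
    rewrite big_seq big1 => [|x /q0[_ [_ Tx]]]; last first.
      by rewrite indicE memNset// mulr0.
    rewrite -mset0; congr m; apply/seteqP; split=> // x [? []] //.
  by rewrite DE -p2// -q2.
Qed.

(** The integral against the set function is a limit, over finite lists of sets, of finitely
    supported sums. On an indicator these sums are eventually constant, so invariance is inherited
    first by indicators and then, by binary expansion, by all bounded functions. *)
Lemma amenable_mean : amenable R H -> exists m : mean G,
  (forall f, bdd f -> (forall y, H y -> 0 <= f y) -> 0 <= m f) /\
  (forall h f, H h -> bdd f -> m (fun x => f (h * x)%g) = m f).
Proof.
move=> [mu [mu1 mu0 muD muV]].
have /cid2[/= p pP _] : exists2 p : seq {classic set G} -> seq (R * G),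
  (forall l, [/\ forall x, x \in p l -> 0 <= x.1 /\ H x.2,
      \sum_(x <- p l) x.1 = 1 &
      forall S, S \in l -> peval (p l) \1_S = mu (S `&` H)]) & True.
  have h l := finitely_additive_approx mu0 muD l (@subset_refl _ H).
  exists (fun l => projT1 (cid (h l))) => // l.
  by case: cid => /= q [? ? ?]; split; rewrite -?mu1.
have [|||m mt] := @directed_mean _
    (fun l l' : seq {classic set G} => {subset l <= l'}) [::].
- by move=> x y.
- by move=> x y z xy yz t /xy/yz.
- move=> x y; exists (x ++ y); split => t tx; by rewrite mem_cat tx ?orbT.
have pb f : bdd f -> bdd (fun l => peval (p l) f).
  move=> [C fC]; exists C => l'; have [p0 p1 _] := pP l'.
  rewrite (le_trans (ler_norm_sum _ _ _))//.
  rewrite -[leRHS]mul1r -p1 mulr_suml big_seq [leRHS]big_seq ler_sum// => x xp.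
  by rewrite normrM ger0_norm ?ler_wpM2l//; have [] := p0 x xp.
pose n f := m (fun l => peval (p l) f).
have nlin a f g : bdd f -> bdd g ->
    n (fun y => a * f y + g y) = a * n f + n g.
  move=> fb gb; rewrite /n -mean_linear; [|exact: pb..].
  apply: eq_mean => l; rewrite /peval mulr_sumr -big_split/=.
  by apply: eq_bigr => x _; ring.
have nH f : bdd f -> (forall y, H y -> 0 <= f y) -> 0 <= n f.
  move=> fb f0; apply: mean_ge0; first exact: pb.
  move=> l; rewrite /peval big_seq sumr_ge0// => x xp.
  by have [/(_ x xp)[x0 Hx] _ _] := pP l; rewrite mulr_ge0// f0.
have n1 : n (fun=> 1) = 1.
  rewrite -[RHS](mean_cst m); apply: eq_mean => l; rewrite /peval.
  by have [_ h _] := pP l; rewrite -[RHS]h; apply: eq_bigr => x _; rewrite mulr1.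
pose nm := Mean nlin (fun f fb f0 => nH f fb (fun y _ => f0 y)) n1.
exists nm; split; first exact: nH.
have nI S : nm \1_S = mu (S `&` H).
  apply: (tail_lim mt); first by apply: pb; exists 1 => y;
    rewrite indicE; case: (_ \in _); rewrite ?normr1// normr0.
  move=> e e0; exists [:: S] => l Sl; have [_ _ ->] := pP l.
    by rewrite subrr normr0 ltW.
  by apply: Sl; rewrite inE.
have nIh h S : H h -> nm (fun x => \1_S (h * x)%g) = nm \1_S.
  move=> Hh.
  rewrite (@eq_mean _ nm (fun x => \1_S (h * x)%g)
    \1_([set x | S (h * x)%g])); last first.
    by move=> x; rewrite !indicE.
  rewrite !nI -(muV h); last 2 first.
  - exact: Hh.
  - by move=> x [].
  congr mu; apply/seteqP; split=> x /=.
    by move=> [y [Sy Hy] <-]; split => //; exact: HM.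
  move=> [Sx Hx]; exists (h^-1 * x)%g; last by rewrite mulVKg.
  by split; [rewrite /= mulVKg|exact/HM/Hx/HV].
move=> h f Hh.
(* An affine change brings the values of [f] into [0, 1]; the summand 1 in 2 C + 1 keeps the
   denominator positive when C = 0. *)
wlog : f / forall y, 0 <= f y <= 1.
  move=> wl [C fC].
  have C0 : 0 <= C by rewrite (le_trans _ (fC 1%g)).
  pose g y := (f y + C) / (2 * C + 1).
  have gP y : 0 <= g y <= 1.
    have := fC y; rewrite ler_norml => /andP[c1 c2]; apply/andP; split.
      by rewrite divr_ge0//; lra.
    by rewrite ler_pdivrMr; lra.
  have gb : bdd g.
    by exists 1 => y; have /andP[? ?] := gP y; rewrite ger0_norm.
  have fE y : f y = (2 * C + 1) * g y + (- C).
    by rewrite /g mulrC divfK ?addrK//; apply/lt0r_neq0; lra.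
  rewrite (@eq_mean _ _ _ (fun x => (2 * C + 1) * g (h * x)%g + (- C)))//.
  rewrite (@eq_mean _ nm f (fun x => (2 * C + 1) * g x + (- C)))//.
  have gb' := @bdd_comp _ _ (fun x => h * x)%g _ gb.
  by rewrite !mean_linear ?wl ?mean_cst//; exact: bdd_cst.
move=> f01 _; apply/eqP; rewrite -subr_eq0 -normr_le0; apply/ler_addgt0Pr => e e0.
have [N Ne] : exists N, 2^-1 ^+ N <= e.
  have : (fun n : nat => 2^-1 ^+ n : R) @ \oo --> (0 : R).
    by apply: cvg_expr; rewrite ger0_norm; lra.
  move=> /cvgrPdist_le /(_ e e0)[N _ NP]; exists N.
  have := NP N (leqnn _); rewrite sub0r normrN; exact/le_trans/ler_norm.
rewrite add0r; apply: le_trans Ne.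
(* binary expansion: f = (1_{f >= 1/2} + f')/2 with 0 <= f' <= 1 *)
elim: N f f01 => [|N IH] f f01.
  have fb : bdd f by exists 1 => y; have /andP[? ?] := f01 y; rewrite ger0_norm.
  rewrite expr0 -meanB//; last exact: bdd_comp.
  apply: mean_abs => y; rewrite ler_norml.
  by have /andP[? ?] := f01 y; have /andP[? ?] := f01 (h * y)%g;
    apply/andP; split; lra.
pose S := [set y | 2^-1 <= f y].
pose g y := 2 * f y - \1_S y.
have g01 y : 0 <= g y <= 1.
  have /andP[? ?] := f01 y; rewrite /g indicE.
  have [Sy|Sy] := boolP (y \in S); rewrite /= ?mulr1n ?mulr0n.
    by move: Sy; rewrite in_setE /S /= => ?; apply/andP; split; lra.
  by move: Sy; rewrite notin_setE /S /= => /negP; rewrite -ltNge => ?;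
    apply/andP; split; lra.
have gb : bdd g by exists 1 => y; have /andP[? ?] := g01 y; rewrite ger0_norm.
have Ib : bdd (\1_S : G -> R).
  by exists 1 => y; rewrite indicE; case: (_ \in _); rewrite ?normr1// normr0.
have fE y : f y = 2^-1 * g y + 2^-1 * \1_S y.
  by rewrite /g mulrBr mulrA mulVf// mul1r subrK.
rewrite (@eq_mean _ _ _ (fun x => 2^-1 * g (h * x)%g + 2^-1 * \1_S (h * x)%g))//.
rewrite (@eq_mean _ nm f (fun x => 2^-1 * g x + 2^-1 * \1_S x))//.
have gb' := @bdd_comp _ _ (fun x => h * x)%g _ gb.
have Ib' := @bdd_comp _ _ (fun x => h * x)%g _ Ib.
clearbody g; rewrite !mean_linear //; try exact: bddZ.
rewrite !meanZ// ?nIh//.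
have := IH g g01; rewrite exprS; set a := nm _; set b := nm _ => ab.
have -> : 2^-1 * a + 2^-1 * nm \1_S - (2^-1 * b + 2^-1 * nm \1_S)
  = 2^-1 * (a - b) by ring.
by rewrite normrM gtr0_norm ?ler_wpM2l//; lra.
Qed.

End AmenableMean.
End Means.

(** * Complex means *)

Section ComplexNorm.
Variable R : realType.
Implicit Types x y z : R[i].

Lemma normc_ge0 z : 0 <= normc z.
Proof. by case: z => a b; exact: sqrtr_ge0. Qed.

Lemma sqr_normcE z : normc z ^+ 2 = complex.Re z ^+ 2 + complex.Im z ^+ 2.
Proof. by case: z => a b /=; rewrite sqr_sqrtr// addr_ge0 ?sqr_ge0. Qed.

Lemma normc_conj z : normc z^*%C = normc z.
Proof. by case: z => a b /=; rewrite sqrrN. Qed.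

Lemma mulcJ z : z * z^*%C = (normc z ^+ 2)%:C%C.
Proof.
rewrite sqr_normcE; case: z => a b /=; apply/eqP; rewrite eq_complex /=.
by apply/andP; split; apply/eqP; ring.
Qed.

Lemma normc_real (a : R) : normc a%:C%C = `|a|.
Proof. by rewrite /= expr0n addr0 sqrtr_sqr. Qed.

Lemma normr_Re_le z : `|complex.Re z| <= normc z.
Proof. by case: z => a b /=; rewrite -sqrtr_sqr ler_wsqrtr// lerDl sqr_ge0. Qed.

Lemma normr_Im_le z : `|complex.Im z| <= normc z.
Proof. by case: z => a b /=; rewrite -sqrtr_sqr ler_wsqrtr// lerDr sqr_ge0. Qed.

Lemma normcB x y : normc (x - y) = normc (y - x).
Proof. by rewrite -normcN opprB. Qed.

Lemma normc_sum J (r : seq J) (P : pred J) (F : J -> R[i]) :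
  normc (\sum_(j <- r | P j) F j) <= \sum_(j <- r | P j) normc (F j).
Proof.
elim/big_rec2: _ => [|j y1 y2 _ h]; first by rewrite normc0.
by rewrite (le_trans (le_normcD _ _))// lerD2l.
Qed.

Lemma normc_eq0P z : normc z <= 0 -> z = 0.
Proof. by move=> h; apply/eq0_normc/le_anti; rewrite h normc_ge0. Qed.

Lemma normc_le_eq0 z : (forall e : R, 0 < e -> normc z <= e) -> z = 0.
Proof. by move=> h; apply/normc_eq0P/ler_addgt0Pr => e e0; rewrite add0r h. Qed.

(** A phase reduces estimates of complex norms to estimates of real parts without losing a
    factor. *)
Lemma rotate z : exists2 c : R[i], normc c = 1 & c * z = (normc z)%:C%C.
Proof.
have [->|z0] := eqVneq z 0.
  by exists 1; rewrite ?normc1// normc0 mulr0.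
have n0 : normc z != 0 by apply: contra_neq z0 => /eq0_normc.
exists (z^*%C * ((normc z)^-1)%:C%C).
  by rewrite normcM normc_conj normc_real ger0_norm ?mulfV// invr_ge0 normc_ge0.
by rewrite mulrAC [_^*%C * _]mulrC mulcJ -rmorphM/= expr2 mulfK.
Qed.

Lemma Re_le z : complex.Re z <= normc z.
Proof. exact/(le_trans (ler_norm _))/normr_Re_le. Qed.

Lemma ge0_cE z : 0 <= z -> z = (complex.Re z)%:C%C.
Proof. by case: z => a b; rewrite lecE/= => /andP[/eqP -> _]. Qed.

Lemma ge0_Re z : 0 <= z -> 0 <= complex.Re z.
Proof. by rewrite lecE => /andP[]. Qed.

Lemma ReD x y : complex.Re (x + y) = complex.Re x + complex.Re y.
Proof. by case: x; case: y. Qed.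
Lemma ReN x : complex.Re (- x) = - complex.Re x.
Proof. by case: x. Qed.
Lemma ReJ x : complex.Re x^*%C = complex.Re x.
Proof. by case: x. Qed.
Lemma ReZ (a : R) x : complex.Re (a%:C%C * x) = a * complex.Re x.
Proof. by case: x => b c /=; rewrite mul0r subr0. Qed.

Lemma Re_sum J (r : seq J) (P : pred J) (F : J -> R[i]) :
  complex.Re (\sum_(j <- r | P j) F j) = \sum_(j <- r | P j) complex.Re (F j).
Proof. by apply: (big_morph _ ReD). Qed.
Lemma Im_sum J (r : seq J) (P : pred J) (F : J -> R[i]) :
  complex.Im (\sum_(j <- r | P j) F j) = \sum_(j <- r | P j) complex.Im (F j).
Proof. by apply: (big_morph (@complex.Im R) (id1 := 0)) => // -[? ?] []. Qed.

Lemma conjcM x y : (x * y)^*%C = x^*%C * y^*%C. Proof. exact: rmorphM. Qed.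
Lemma conjcD x y : (x + y)^*%C = x^*%C + y^*%C. Proof. exact: rmorphD. Qed.
Lemma conjcN x : (- x)^*%C = - x^*%C. Proof. exact: rmorphN. Qed.
Lemma realCM (a b : R) : (a * b)%:C%C = a%:C%C * b%:C%C.
Proof. exact: rmorphM. Qed.
Lemma realCB (a b : R) : (a - b)%:C%C = a%:C%C - b%:C%C.
Proof. exact: rmorphB. Qed.
Lemma realC_sum J (r : seq J) (P : pred J) (F : J -> R) :
  (\sum_(j <- r | P j) F j)%:C%C = \sum_(j <- r | P j) (F j)%:C%C.
Proof. exact: rmorph_sum. Qed.

Lemma conjc_sum J (r : seq J) (P : pred J) (F : J -> R[i]) :
  (\sum_(j <- r | P j) F j)^*%C = \sum_(j <- r | P j) (F j)^*%C.
Proof. exact: raddf_sum. Qed.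

End ComplexNorm.

Section ComplexMean.
Variable R : realType.

Definition cbdd (Y : Type) (u : Y -> R[i]) := exists C, forall y, normc (u y) <= C.

Definition cmean (Y : Type) (m : mean R Y) (u : Y -> R[i]) : R[i] :=
  Complex (m (fun y => complex.Re (u y))) (m (fun y => complex.Im (u y))).

Lemma cbddD Y (u v : Y -> R[i]) : cbdd u -> cbdd v -> cbdd (fun y => u y + v y).
Proof.
move=> [a ua] [b vb]; exists (a + b) => y.
by rewrite (le_trans (le_normcD _ _))// lerD.
Qed.

Lemma cbddM Y (u v : Y -> R[i]) : cbdd u -> cbdd v -> cbdd (fun y => u y * v y).
Proof.
move=> [a ua] [b vb]; exists (a * b) => y.
by rewrite normcM ler_pM// normc_ge0.
Qed.

Lemma cbdd_cst Y (c : R[i]) : cbdd (fun _ : Y => c).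
Proof. by exists (normc c). Qed.

Lemma cbddZ Y c (u : Y -> R[i]) : cbdd u -> cbdd (fun y => c * u y).
Proof. exact/cbddM/cbdd_cst. Qed.

Lemma cbddN Y (u : Y -> R[i]) : cbdd u -> cbdd (fun y => - u y).
Proof. by move=> [a ua]; exists a => y; rewrite normcN. Qed.

Lemma cbddB Y (u v : Y -> R[i]) : cbdd u -> cbdd v -> cbdd (fun y => u y - v y).
Proof. by move=> /[swap] /cbddN/[swap]; exact: cbddD. Qed.

Lemma cbdd_sum Y J (r : seq J) (P : pred J) (u : J -> Y -> R[i]) :
  (forall j, cbdd (u j)) -> cbdd (fun y => \sum_(j <- r | P j) u j y).
Proof.
move=> ub; elim: r => [|j r IH]; first by exists 0 => y; rewrite big_nil normc0.
have [C fC] := cbddD (ub j) IH; have [D fD] := IH.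
by case Pj: (P j); [exists C|exists D] => y; rewrite big_cons Pj.
Qed.

Lemma cbdd_Re Y (u : Y -> R[i]) : cbdd u -> bdd (fun y => complex.Re (u y)).
Proof. by move=> [a ua]; exists a => y; exact/(le_trans (normr_Re_le _)). Qed.

Lemma cbdd_Im Y (u : Y -> R[i]) : cbdd u -> bdd (fun y => complex.Im (u y)).
Proof. by move=> [a ua]; exists a => y; exact/(le_trans (normr_Im_le _)). Qed.

Section Theory.
Variables (Y : Type) (m : mean R Y).
Implicit Types u v : Y -> R[i].

Lemma eq_cmean u v : u =1 v -> cmean m u = cmean m v.
Proof. by move=> /funext ->. Qed.

Lemma cmean_cst c : cmean m (fun=> c) = c.
Proof. by case: c => a b; rewrite /cmean/= !mean_cst. Qed.

Lemma cmeanD u v : cbdd u -> cbdd v ->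
  cmean m (fun y => u y + v y) = cmean m u + cmean m v.
Proof.
move=> ub vb; apply/eqP; rewrite eq_complex; apply/andP; split; apply/eqP => /=.
  rewrite -meanD; [|exact: cbdd_Re..].
  by apply: eq_mean => y; case: (u y); case: (v y).
rewrite -meanD; [|exact: cbdd_Im..].
by apply: eq_mean => y; case: (u y); case: (v y).
Qed.

Lemma cmeanZ c u : cbdd u -> cmean m (fun y => c * u y) = c * cmean m u.
Proof.
case: c => a b ub; have rb := cbdd_Re ub; have ib := cbdd_Im ub.
apply/eqP; rewrite eq_complex; apply/andP; split; apply/eqP => /=.
  rewrite -!meanZ// -meanB; [|exact: bddZ..].
  by apply: eq_mean => y; case: (u y).
rewrite -!meanZ// -meanD; [|exact: bddZ..].
by apply: eq_mean => y; case: (u y).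
Qed.

Lemma cmeanN u : cbdd u -> cmean m (fun y => - u y) = - cmean m u.
Proof.
move=> ub; rewrite -mulN1r -cmeanZ//.
by apply: eq_cmean => y; rewrite mulN1r.
Qed.

Lemma cmeanB u v : cbdd u -> cbdd v ->
  cmean m (fun y => u y - v y) = cmean m u - cmean m v.
Proof. by move=> ub vb; rewrite cmeanD ?cmeanN//; exact: cbddN. Qed.

Lemma cmeanJ u : cbdd u -> cmean m (fun y => (u y)^*%C) = (cmean m u)^*%C.
Proof.
move=> ub; apply/eqP; rewrite eq_complex; apply/andP; split; apply/eqP => /=.
  by apply: eq_mean => y; case: (u y).
rewrite -meanN; last exact: cbdd_Im.
by apply: eq_mean => y; case: (u y).
Qed.

Lemma cmean_sum J (r : seq J) (u : J -> Y -> R[i]) : (forall j, cbdd (u j)) ->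
  cmean m (fun y => \sum_(j <- r) u j y) = \sum_(j <- r) cmean m (u j).
Proof.
move=> ub; elim: r => [|j r IH].
  by rewrite big_nil -[RHS]cmean_cst; apply: eq_cmean => y; rewrite big_nil.
rewrite big_cons -IH -cmeanD//; last exact: cbdd_sum.
by apply: eq_cmean => y; rewrite big_cons.
Qed.

Lemma cmean_norm C u : (forall y, normc (u y) <= C) -> normc (cmean m u) <= C.
Proof.
move=> uC; have ub : cbdd u by exists C.
have [c c1 cE] := rotate (cmean m u).
have -> : normc (cmean m u) = m (fun y => complex.Re (c * u y)).
  by rewrite -[LHS]/(complex.Re (normc (cmean m u))%:C%C) -cE -cmeanZ.
apply: mean_le; first exact/cbdd_Re/cbddZ.
by move=> y; rewrite (le_trans (Re_le _))// normcM c1 mul1r.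
Qed.

Lemma cmean_ge0 u : cbdd u -> (forall y, 0 <= u y) -> 0 <= cmean m u.
Proof.
move=> ub u0; rewrite lecE /=; apply/andP; split.
  rewrite (@eq_mean _ _ m _ (fun=> 0)) ?mean_cst// => y.
  by rewrite (ge0_cE (u0 y)).
by apply: mean_ge0 => [|y]; [exact: cbdd_Re|exact: ge0_Re].
Qed.

Section Tail.
Variable (le : Y -> Y -> Prop).
Hypothesis mt : tail_pos le m.

Lemma ctail_norm C u : cbdd u -> (exists x, forall y, le x y -> normc (u y) <= C) ->
  normc (cmean m u) <= C.
Proof.
move=> ub [x xC]; have [c c1 cE] := rotate (cmean m u).
have -> : normc (cmean m u) = m (fun y => complex.Re (c * u y)).
  by rewrite -[LHS]/(complex.Re (normc (cmean m u))%:C%C) -cE -cmeanZ.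
apply: (tail_le mt); first exact/cbdd_Re/cbddZ.
exists x => y /xC; apply: le_trans.
by rewrite (le_trans (Re_le _))// normcM c1 mul1r.
Qed.

Lemma ctail_lim l u : cbdd u ->
  (forall e, 0 < e -> exists x, forall y, le x y -> normc (u y - l) <= e) ->
  cmean m u = l.
Proof.
move=> ub ul; apply/subr0_eq/normc_le_eq0 => e /ul[x xe].
rewrite -[X in _ - X]cmean_cst -cmeanB//; last exact: cbdd_cst.
apply: ctail_norm; last by exists x.
exact/cbddB/cbdd_cst.
Qed.

Lemma ctail_eq u v : cbdd u -> cbdd v ->
  (forall e, 0 < e -> exists x, forall y, le x y -> normc (u y - v y) <= e) ->
  cmean m u = cmean m v.
Proof.
move=> ub vb uv; apply/subr0_eq; rewrite -cmeanB//.
apply: ctail_lim; first exact: cbddB.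
by move=> e /uv[x xe]; exists x => y /xe; rewrite subr0.
Qed.

End Tail.
End Theory.
End ComplexMean.

(** * Unconditional sums as means over finite sets *)

Section FinsetMean.
Variables (R : realType) (X : choiceType).
Implicit Types A B : {fset X}.
Local Open Scope fset_scope.

Fact fset_mean_subproof : exists m : mean R {fset X},
  tail_pos (fun A B : {fset X} => fsubset A B) m.
Proof.
apply: (@directed_mean R _ (fun A B : {fset X} => fsubset A B) fset0)
  => [A|A B C|A B].
- exact: fsubset_refl.
- exact: fsubset_trans.
- by exists (A `|` B); rewrite fsubsetUl fsubsetUr.
Qed.

Definition fset_mean : mean R {fset X} := projT1 (cid fset_mean_subproof).

Lemma fset_mean_tail : tail_pos (fun A B : {fset X} => fsubset A B) fset_mean.
Proof. exact: (projT2 (cid fset_mean_subproof)). Qed.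

Definition abs_summable (u : X -> R[i]) :=
  exists C, forall A, \sum_(x <- A) normc (u x) <= C.

Lemma abs_summable_cbdd u : abs_summable u ->
  cbdd (fun A : {fset X} => \sum_(x <- A) u x).
Proof. by move=> [C uC]; exists C => A; exact/(le_trans (normc_sum _ _ _)). Qed.

Lemma abs_summable_tail u e : abs_summable u -> 0 < e ->
  exists A0, forall A, A0 `<=` A ->
    normc (\sum_(x <- A) u x - \sum_(x <- A0) u x) <= e.
Proof.
move=> [C uC] e0.
pose S := [set s | exists A, s = \sum_(x <- A) normc (u x)]%classic.
have hS : has_sup S.
  split; first by exists (\sum_(x <- fset0) normc (u x)); exists fset0.
  by exists C => _ [A ->].
have [_ [A0 ->] hA0] := sup_adherent e0 hS.
exists A0 => A A0A; rewrite (big_fsetID _ (mem A0)) /=.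
have E : [fset x in A | x \in A0]%fset = A0.
  by apply/fsetP => x; rewrite !inE; apply: andb_idl; exact: (fsubsetP A0A).
rewrite E addrAC subrr add0r (le_trans (normc_sum _ _ _))//.
have : \sum_(x <- A) normc (u x) <= sup S by apply: (sup_upper_bound hS); exists A.
rewrite (big_fsetID _ (mem A0)) /= E => h.
by move: hA0 h; set a := \sum_(x <- A0) _; set b := \sum_(x <- _) _; lra.
Qed.

Lemma psum_cvg (u : X -> R) l :
  (forall e, 0 < e -> exists A0, forall A, A0 `<=` A ->
     `|\sum_(x <- A) u x - l| <= e) ->
  summability.sum (u : X -> R^o) = l.
Proof.
move=> h; have F := @summability.totally_filter X.
apply: cvg_lim => //; apply/(@cvgrPdist_le _ R^o) => e /h[A0 hA].
exists A0 => // A /= A0A; rewrite /summability.partial_sum distrC.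
by have := hA A A0A; rewrite big_seq_fsetE.
Qed.

Lemma psum_lim u e : abs_summable u -> 0 < e ->
  exists A0, forall A, A0 `<=` A ->
    normc (\sum_(x <- A) u x - cmean fset_mean (fun A => \sum_(x <- A) u x)) <= e.
Proof.
move=> us e0; have ub := abs_summable_cbdd us.
have e20 : 0 < e / 2 by lra.
have [A0 hA0] := abs_summable_tail us e20; exists A0 => A A0A.
rewrite -[X in X - _](cmean_cst fset_mean) -cmeanB//; last exact: cbdd_cst.
apply: (ctail_norm fset_mean_tail); first exact/cbddB/ub/cbdd_cst.
exists A0 => B A0B.
rewrite (_ : _ - _ = (\sum_(x <- A) u x - \sum_(x <- A0) u x) -
  (\sum_(x <- B) u x - \sum_(x <- A0) u x)); last by ring.
rewrite (le_trans (le_normcD _ _))// normcN.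
by have := hA0 A A0A; have := hA0 B A0B; lra.
Qed.

(** Turns the sum, defined as a limit, into the value of one fixed linear functional; the
    sesquilinearity of the inner product is then inherited from the mean. *)
Lemma csumE u : abs_summable u ->
  csum u = cmean fset_mean (fun A => \sum_(x <- A) u x).
Proof.
move=> us; have lim e (e0 : 0 < e) := psum_lim us e0.
apply/eqP; rewrite eq_complex; apply/andP; split; apply/eqP.
  apply: psum_cvg => e /lim[A0 hA]; exists A0 => A /hA; apply: le_trans.
  by rewrite -Re_sum -ReN -ReD normr_Re_le.
apply: psum_cvg => e /lim[A0 hA]; exists A0 => A /hA; apply: le_trans.
rewrite -Im_sum; case: (\sum_(x <- A) u x) => a b.
by case: cmean => c d; exact: (normr_Im_le (Complex (a - c) (b - d))).
Qed.

End FinsetMean.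

(** * Square-summable families and bounded operators *)

Section L2.
Variables (R : realType) (X : choiceType).
Implicit Types (f g h : l2 R X) (x y : X) (A B : {fset X}) (u v : X -> R[i]).

Lemma l2_ext f g : f =1 g -> f = g.
Proof. by move=> fg; apply/val_inj/funext. Qed.

Lemma l2DE f g x : (f + g) x = f x + g x. Proof. by []. Qed.
Lemma l2ZE a f x : (a *: f) x = a * f x. Proof. by []. Qed.
Lemma l2NE f x : (- f) x = - f x. Proof. by []. Qed.
Lemma l2_sumE J (r : seq J) (P : pred J) (F : J -> l2 R X) x :
  (\sum_(j <- r | P j) F j) x = \sum_(j <- r | P j) F j x.
Proof. by apply: (big_morph (fun f : l2 R X => f x)). Qed.

Definition sqs u A : R := \sum_(x <- A) normc (u x) ^+ 2.

Lemma sqs_ge0 u A : 0 <= sqs u A.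
Proof. by apply: sumr_ge0 => x _; rewrite sqr_ge0. Qed.

Lemma sqs_esum u A :
  ((sqs u A)%:E <= \esum_(x in setT) (normc (u x) ^+ 2)%:E)%E.
Proof.
apply: esum_ge; exists [set` A]; first by split; [exact: finite_fset|].
by rewrite fsbig_finite ?finite_fset//= set_fsetK sumEFin.
Qed.

Lemma esum_sqs u C : (forall A, sqs u A <= C) ->
  (\esum_(x in setT) (normc (u x) ^+ 2)%:E <= C%:E)%E.
Proof.
move=> uC; apply: ge_ereal_sup => _ [S [finS _] <-].
by rewrite fsbig_finite//= sumEFin lee_fin; exact: uC.
Qed.

Lemma sqs_summable u C : (forall A, sqs u A <= C) -> u \in @square_summable R X.
Proof.
by move=> uC; apply/asboolP; exact: (le_lt_trans (esum_sqs uC)) (ltry _).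
Qed.

Lemma l2norm_ge0 f : 0 <= l2norm f. Proof. exact: sqrtr_ge0. Qed.

Lemma esum_l2norm f :
  (\esum_(x in setT) (normc (f x) ^+ 2)%:E = (l2norm f ^+ 2)%:E)%E.
Proof.
have h : (\esum_(x in setT) (normc (f x) ^+ 2)%:E < +oo)%E.
  by case: f => ? /= /asboolP.
have e0 : (0 <= \esum_(x in setT) (normc (f x) ^+ 2)%:E)%E.
  by apply: esum_ge0 => x _; rewrite lee_fin sqr_ge0.
by rewrite sqr_sqrtr ?fine_ge0// fineK// ge0_fin_numE.
Qed.

Lemma sqs_le f A : sqs f A <= l2norm f ^+ 2.
Proof. by have := sqs_esum f A; rewrite esum_l2norm. Qed.

Lemma l2norm_sq_le f C : (forall A, sqs f A <= C) -> l2norm f ^+ 2 <= C.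
Proof. by move=> /esum_sqs; rewrite esum_l2norm. Qed.

Lemma l2norm_le f C : 0 <= C -> (forall A, sqs f A <= C ^+ 2) -> l2norm f <= C.
Proof. by move=> C0 /l2norm_sq_le; rewrite ler_sqr// nnegrE l2norm_ge0. Qed.

Lemma inner_summable f g : abs_summable (fun x => f x * (g x)^*%C).
Proof.
exists ((l2norm f ^+ 2 + l2norm g ^+ 2) / 2) => A.
apply: (@le_trans _ _ ((sqs f A + sqs g A) / 2)); last first.
  by rewrite ler_pM2r ?invr_gt0// lerD ?sqs_le.
rewrite /sqs -big_split mulr_suml ler_sum//= => x _.
rewrite normcM normc_conj; have := sqr_ge0 (normc (f x) - normc (g x)).
by rewrite sqrrB -mulr_natr; lra.
Qed.

Lemma innerE f g :
  inner f g = cmean (fset_mean R X) (fun A => \sum_(x <- A) f x * (g x)^*%C).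
Proof. by rewrite /inner csumE//; exact: inner_summable. Qed.

Let ib f g := abs_summable_cbdd (inner_summable f g).

Lemma innerDl f g h : inner (f + g) h = inner f h + inner g h.
Proof.
rewrite !innerE -cmeanD//; apply: eq_cmean => A; rewrite -big_split.
by apply: eq_bigr => x _; rewrite l2DE mulrDl.
Qed.

Lemma innerZl a f h : inner (a *: f) h = a * inner f h.
Proof.
rewrite !innerE -cmeanZ//; apply: eq_cmean => A; rewrite mulr_sumr.
by apply: eq_bigr => x _; rewrite l2ZE mulrA.
Qed.

Lemma innerJ f g : inner g f = (inner f g)^*%C.
Proof.
rewrite !innerE -cmeanJ//; apply: eq_cmean => A; rewrite conjc_sum.
by apply: eq_bigr => x _; rewrite conjcM conjcK mulrC.
Qed.

Lemma innerDr f g h : inner h (f + g) = inner h f + inner h g.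
Proof. by rewrite innerJ innerDl conjcD -!innerJ. Qed.

Lemma innerZr a f h : inner h (a *: f) = a^*%C * inner h f.
Proof. by rewrite innerJ innerZl conjcM -innerJ. Qed.

Lemma inner0l h : inner 0 h = 0.
Proof. by rewrite -(scale0r 0) innerZl mul0r. Qed.
Lemma inner0r h : inner h 0 = 0.
Proof. by rewrite innerJ inner0l conjc0. Qed.
Lemma innerNl f h : inner (- f) h = - inner f h.
Proof. by rewrite -scaleN1r innerZl mulN1r. Qed.
Lemma innerNr f h : inner h (- f) = - inner h f.
Proof. by rewrite innerJ innerNl conjcN -innerJ. Qed.
Lemma innerBl f g h : inner (f - g) h = inner f h - inner g h.
Proof. by rewrite innerDl innerNl. Qed.
Lemma innerBr f g h : inner h (f - g) = inner h f - inner h g.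
Proof. by rewrite innerDr innerNr. Qed.

Lemma inner_suml J (r : seq J) (P : pred J) (F : J -> l2 R X) h :
  inner (\sum_(j <- r | P j) F j) h = \sum_(j <- r | P j) inner (F j) h.
Proof.
by apply: (big_morph (fun f => inner f h)) => [f g|]; [exact: innerDl|exact: inner0l].
Qed.

Lemma inner_sumr J (r : seq J) (P : pred J) (F : J -> l2 R X) h :
  inner h (\sum_(j <- r | P j) F j) = \sum_(j <- r | P j) inner h (F j).
Proof.
by apply: (big_morph (inner h)) => [f g|]; [exact: innerDr|exact: inner0r].
Qed.

Lemma l2_sqs_lim f e : 0 < e -> exists A, l2norm f ^+ 2 <= sqs f A + e.
Proof.
move=> e0; have [h|] := pselect (exists A, l2norm f ^+ 2 <= sqs f A + e) => //.
move=> /forallNP h; suff : l2norm f ^+ 2 <= l2norm f ^+ 2 - e by lra.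
apply: l2norm_sq_le => A; have /negP := h A; rewrite -ltNge; lra.
Qed.

Lemma inner_self f : inner f f = (l2norm f ^+ 2)%:C%C.
Proof.
rewrite innerE; apply: (ctail_lim (@fset_mean_tail R X)) => //.
move=> e e0; have [A0 hA0] := l2_sqs_lim f e0; exists A0 => A A0A.
have -> : \sum_(x <- A) f x * (f x)^*%C = (sqs f A)%:C%C.
  by rewrite /sqs realC_sum; apply: eq_bigr => x _; rewrite mulcJ.
rewrite -realCB normc_real distrC ger0_norm ?subr_ge0 ?sqs_le//.
suff : sqs f A0 <= sqs f A by lra.
rewrite /sqs [leRHS](big_fsetID _ (mem A0)) /=.
have -> : [fset x in A | x \in A0]%fset = A0.
  by apply/fsetP => x; rewrite !inE; apply: andb_idl; exact: (fsubsetP A0A).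
by rewrite lerDl sumr_ge0// => x _; rewrite sqr_ge0.
Qed.

Lemma inner_ge0 f : 0 <= inner f f.
Proof. by rewrite inner_self ler0c sqr_ge0. Qed.

Lemma l2norm_sqE f : l2norm f ^+ 2 = complex.Re (inner f f).
Proof. by rewrite inner_self. Qed.

Lemma l2norm0 : l2norm (0 : l2 R X) = 0.
Proof. by apply/eqP; rewrite -sqrf_eq0 l2norm_sqE inner0l. Qed.

Lemma l2norm_eq0 f : l2norm f = 0 -> f = 0.
Proof.
move=> f0; apply: l2_ext => x; apply/eq0_normc/eqP; rewrite -sqrf_eq0.
rewrite eq_le sqr_ge0 andbT.
by have := sqs_le f [fset x]%fset; rewrite f0 expr0n/= /sqs big_seq_fset1.
Qed.

Lemma l2normZ a f : l2norm (a *: f) = normc a * l2norm f.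
Proof.
apply/eqP; rewrite -(@eqrXn2 _ 2)// ?mulr_ge0 ?normc_ge0 ?l2norm_ge0//.
by rewrite l2norm_sqE innerZl innerZr mulrA mulcJ inner_self -realCM exprMn.
Qed.

Lemma l2normN f : l2norm (- f) = l2norm f.
Proof. by rewrite -scaleN1r l2normZ normcN normc1 mul1r. Qed.

Lemma l2normB f g : l2norm (f - g) = l2norm (g - f).
Proof. by rewrite -l2normN opprB. Qed.

Lemma l2norm_sqD f g : l2norm (f + g) ^+ 2 =
  l2norm f ^+ 2 + l2norm g ^+ 2 + 2 * complex.Re (inner f g).
Proof.
rewrite !l2norm_sqE innerDl !innerDr !ReD (innerJ f g) ReJ; ring.
Qed.

Lemma l2norm_sqB f g : l2norm (f - g) ^+ 2 =
  l2norm f ^+ 2 + l2norm g ^+ 2 - 2 * complex.Re (inner f g).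
Proof. by rewrite l2norm_sqD l2normN innerNr ReN mulrN. Qed.

Lemma parallelogram f g : l2norm (f + g) ^+ 2 + l2norm (f - g) ^+ 2 =
  2 * l2norm f ^+ 2 + 2 * l2norm g ^+ 2.
Proof. by rewrite l2norm_sqD l2norm_sqB; ring. Qed.

Lemma Re_inner_le f g : complex.Re (inner f g) <= l2norm f * l2norm g.
Proof.
have [f0|f0] := eqVneq (l2norm f) 0.
  by rewrite (l2norm_eq0 f0) inner0l l2norm0 mul0r.
have [g0|g0] := eqVneq (l2norm g) 0.
  by rewrite (l2norm_eq0 g0) inner0r l2norm0 mulr0.
have a0 : 0 < l2norm f by rewrite lt_def f0 l2norm_ge0.
have b0 : 0 < l2norm g by rewrite lt_def g0 l2norm_ge0.
have := sqr_ge0 (l2norm ((l2norm g)%:C%C *: f - (l2norm f)%:C%C *: g)).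
rewrite l2norm_sqB !l2normZ !normc_real !ger0_norm ?l2norm_ge0//.
rewrite innerZl innerZr conjc_real 2!ReZ.
move: (complex.Re _) (l2norm f) (l2norm g) a0 b0 => r a b a0 b0.
have ab0 : 0 < a * b by rewrite mulr_gt0.
by move=> h; rewrite -subr_ge0 -(pmulr_rge0 _ ab0); nra.
Qed.

Lemma cauchy_schwarz f g : normc (inner f g) <= l2norm f * l2norm g.
Proof.
have [c c1 cE] := rotate (inner f g).
have := Re_inner_le (c *: f) g.
by rewrite innerZl cE l2normZ c1 mul1r.
Qed.

Lemma ler_l2normD f g : l2norm (f + g) <= l2norm f + l2norm g.
Proof.
rewrite -(@ler_pXn2r _ 2)// ?nnegrE ?addr_ge0 ?l2norm_ge0//.
by rewrite l2norm_sqD sqrrD; have := Re_inner_le f g; lra.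
Qed.

Lemma ler_l2normB f g : l2norm (f - g) <= l2norm f + l2norm g.
Proof. by rewrite -(l2normN g) ler_l2normD. Qed.

Lemma ler_l2dist h f g : l2norm (f - g) <= l2norm (f - h) + l2norm (h - g).
Proof. by rewrite (le_trans _ (ler_l2normD _ _))// addrA subrK. Qed.

Lemma l2norm_sum J (r : seq J) (P : pred J) (F : J -> l2 R X) :
  l2norm (\sum_(j <- r | P j) F j) <= \sum_(j <- r | P j) l2norm (F j).
Proof.
elim/big_rec2: _ => [|j y1 y2 _ h]; first by rewrite l2norm0.
by rewrite (le_trans (ler_l2normD _ _))// lerD2l.
Qed.

Lemma l2norm_small f : (forall e, 0 < e -> l2norm f <= e) -> f = 0.
Proof.
move=> h; apply/l2norm_eq0/le_anti; rewrite l2norm_ge0 andbT.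
by apply/ler_addgt0Pr => e e0; rewrite add0r h.
Qed.

Fact delta_subproof x :
  (fun y => if y == x then 1 else 0) \in @square_summable R X.
Proof.
apply: (@sqs_summable _ 1) => A; rewrite /sqs.
have [xA|xA] := boolP (x \in A).
  rewrite (big_fsetD1 x)//= eqxx normc1 expr1n big1_fset ?addr0// => y.
  by rewrite !inE => /andP[/negbTE -> _] _; rewrite normc0 expr0n.
rewrite big1_fset// => y yA _; case: eqVneq => [yx|]; last first.
  by rewrite normc0 expr0n.
by rewrite yx (negbTE xA) in yA.
Qed.

Definition delta x : l2 R X := L2 (delta_subproof x).

Lemma deltaE x y : delta x y = if y == x then 1 else 0. Proof. by []. Qed.

Lemma inner_delta f x : inner f (delta x) = f x.
Proof.
rewrite innerE; apply: (ctail_lim (@fset_mean_tail R X)); first exact: ib.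
move=> e e0; exists [fset x]%fset => A; rewrite fsub1set => xA.
rewrite (big_fsetD1 x xA) deltaE eqxx conjc1 mulr1 big1_fset => [|y] /=.
  by rewrite addr0 subrr normc0 ltW.
by rewrite !inE => /andP[/negbTE -> _] _; rewrite conjc0 mulr0.
Qed.

Lemma inner_deltal f x : inner (delta x) f = (f x)^*%C.
Proof. by rewrite innerJ inner_delta. Qed.

Lemma l2norm_delta x : l2norm (delta x) = 1.
Proof.
apply/eqP; rewrite -(@eqrXn2 _ 2) ?l2norm_ge0//.
by rewrite l2norm_sqE inner_delta deltaE eqxx expr1n.
Qed.

Lemma normc_le_l2norm f x : normc (f x) <= l2norm f.
Proof.
by rewrite -inner_delta (le_trans (cauchy_schwarz _ _))// l2norm_delta mulr1.
Qed.

Definition vec A u : l2 R X := \sum_(x <- A) u x *: delta x.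

Lemma vecE A u x : vec A u x = if x \in A then u x else 0.
Proof.
rewrite l2_sumE; have [xA|xA] := boolP (x \in A).
  rewrite (big_fsetD1 x xA) l2ZE deltaE eqxx mulr1 big1_fset; first exact: addr0.
  move=> y.
  by rewrite !inE l2ZE deltaE eq_sym => /andP[/negbTE -> _] _; rewrite mulr0.
rewrite big1_fset// => y yA _; rewrite l2ZE deltaE eq_sym.
by case: eqVneq => [yx|]; rewrite ?mulr0//; rewrite -yx yA in xA.
Qed.

Lemma inner_vec f A u : inner f (vec A u) = \sum_(x <- A) f x * (u x)^*%C.
Proof.
by rewrite inner_sumr; apply: eq_bigr => x _; rewrite innerZr inner_delta mulrC.
Qed.

Lemma l2norm_vec A u : l2norm (vec A u) ^+ 2 = sqs u A.
Proof.
rewrite l2norm_sqE inner_vec Re_sum big_seq [RHS]big_seq.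
by apply: eq_bigr => x xA; rewrite vecE xA mulcJ.
Qed.

Lemma vec_approx f e : 0 < e ->
  exists A, l2norm (f - vec A f) <= e.
Proof.
move=> e0; have e20 : 0 < e ^+ 2 by rewrite exprn_gt0.
have [A hA] := l2_sqs_lim f e20; exists A.
rewrite -(@ler_pXn2r _ 2)// ?nnegrE ?l2norm_ge0 ?(ltW e0)//.
rewrite l2norm_sqB l2norm_vec inner_vec.
have -> : complex.Re (\sum_(x <- A) f x * (f x)^*%C) = sqs f A.
  by rewrite Re_sum; apply: eq_bigr => x _; rewrite mulcJ.
by lra.
Qed.

Lemma inner_csum f g e : 0 < e -> exists A0, forall A, fsubset A0 A ->
  normc (\sum_(x <- A) f x * (g x)^*%C - inner f g) <= e.
Proof. by move=> e0; rewrite innerE; exact: psum_lim (inner_summable f g) e0. Qed.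

(* junk value 0 when the pointwise limit is not square-summable *)
Definition vlim (I : Type) (m : mean R I) (v : I -> l2 R X) : l2 R X :=
  insubd (0 : l2 R X) (fun x => cmean m (fun i => v i x)).

Section Vlim.
Variables (I : Type) (m : mean R I) (v : I -> l2 R X) (C : R).
Hypothesis vC : forall i, l2norm (v i) <= C.

Let vb x : cbdd (fun i => v i x).
Proof. by exists C => i; rewrite (le_trans (normc_le_l2norm _ _)). Qed.

Lemma cbdd_inner g : cbdd (fun i => inner (v i) g).
Proof.
exists (C * l2norm g) => i; rewrite (le_trans (cauchy_schwarz _ _))//.
by rewrite ler_wpM2r ?l2norm_ge0.
Qed.

Let C0 : 0 <= C.
Proof.
have := mean_cst m C; suff : 0 <= m (fun=> C) by move=> + <-.
apply: mean_ge0; first exact: bdd_cst.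
by move=> i; rewrite (le_trans _ (vC i))// l2norm_ge0.
Qed.

(** With s the partial sum, pairing the [v i] with the truncated limit gives s <= C sqrt s by
    Cauchy-Schwarz, hence s <= C^2. *)
Let vlim_sqs A : sqs (fun x => cmean m (fun i => v i x)) A <= C ^+ 2.
Proof.
set u := fun x => _; set s := sqs u A.
have : s%:C%C = cmean m (fun i => inner (v i) (vec A u)).
  under eq_cmean do rewrite inner_vec.
  rewrite cmean_sum => [|x]; last exact/cbddM/cbdd_cst.
  rewrite /s /sqs realC_sum; apply: eq_bigr => x _.
  rewrite -mulcJ mulrC /u -cmeanZ//; apply: eq_cmean => i; exact: mulrC.
move=> sE; have sC : s <= C * Num.sqrt s.
  have -> : Num.sqrt s = l2norm (vec A u).
    by rewrite -[RHS]ger0_norm ?l2norm_ge0// -sqrtr_sqr l2norm_vec.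
  rewrite -[leLHS]ger0_norm ?sqs_ge0// -normc_real sE.
  apply: cmean_norm => i; rewrite (le_trans (cauchy_schwarz _ _))//.
  by rewrite ler_wpM2r ?l2norm_ge0.
have s0 : 0 <= s by exact: sqs_ge0.
move: sC; rewrite -{1}(sqr_sqrtr s0) expr2; have := sqrtr_ge0 s.
rewrite le_eqVlt => /orP[/eqP s1 _|s1].
  by rewrite -(sqr_sqrtr s0) -s1 expr0n sqr_ge0.
rewrite ler_pM2r// => h; rewrite -(sqr_sqrtr s0) ler_sqr// nnegrE// sqrtr_ge0.
Qed.

Lemma vlimE x : vlim m v x = cmean m (fun i => v i x).
Proof.
by rewrite -[LHS]/(val (vlim m v) x) val_insubd (sqs_summable vlim_sqs).
Qed.

Lemma vlim_norm : l2norm (vlim m v) <= C.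
Proof.
apply: l2norm_le => // A; apply: le_trans (vlim_sqs A).
by rewrite /sqs ler_sum// => x _; rewrite vlimE.
Qed.

(** Coordinatewise limits of bounded families are weak limits: after truncating [g] to a finite set,
    only linearity of the mean is left. *)
Lemma inner_vlim g : inner (vlim m v) g = cmean m (fun i => inner (v i) g).
Proof.
apply/subr0_eq/normc_le_eq0 => e e0.
pose D := 2 * C + 1.
have D0 : 0 < D by rewrite /D ltr_pwDr// mulr_ge0.
have [A hA] := vec_approx g (divr_gt0 e0 D0).
have E : inner (vlim m v) (vec A g) = cmean m (fun i => inner (v i) (vec A g)).
  rewrite inner_vec; under [RHS]eq_cmean do rewrite inner_vec.
  rewrite cmean_sum => [|x]; last exact/cbddM/cbdd_cst.
  apply: eq_bigr => x _; rewrite vlimE mulrC -cmeanZ//.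
  by apply: eq_cmean => i; exact: mulrC.
have gE : g = (g - vec A g) + vec A g by rewrite subrK.
rewrite gE innerDr E.
have -> : cmean m (fun i => inner (v i) (g - vec A g + vec A g)) =
    cmean m (fun i => inner (v i) (g - vec A g)) +
    cmean m (fun i => inner (v i) (vec A g)).
  rewrite -cmeanD; [|exact: cbdd_inner..].
  by apply: eq_cmean => i; rewrite innerDr.
rewrite opprD addrACA subrr addr0 (le_trans (le_normcD _ _))// normcN.
have h1 : normc (inner (vlim m v) (g - vec A g)) <= C * (e / D).
  by rewrite (le_trans (cauchy_schwarz _ _))// ler_pM ?l2norm_ge0// vlim_norm.
have h2 : normc (cmean m (fun i => inner (v i) (g - vec A g))) <= C * (e / D).
  apply: cmean_norm => i.
  by rewrite (le_trans (cauchy_schwarz _ _))// ler_pM ?l2norm_ge0.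
apply: le_trans (lerD h1 h2) _; rewrite -mulrDl mulrCA ler_piMr ?(ltW e0)//.
by rewrite ler_pdivrMr// mul1r /D mulr2n mulrDl !mul1r lerDl.
Qed.

End Vlim.

End L2.

(** * Bounded operators between l2 spaces and their weak limits *)

Section Bop.
Variable R : realType.
Implicit Types X Y Z : choiceType.

Definition bop X Y (T : l2 R X -> l2 R Y) :=
  linear T /\ exists c : R, forall f, l2norm (T f) <= c * l2norm f.

Definition opbound X Y (T : l2 R X -> l2 R Y) (c : R) :=
  forall f, l2norm (T f) <= c * l2norm f.

Section Linear.
Variables (X Y : choiceType) (T : l2 R X -> l2 R Y).
Hypothesis Tb : bop T.

Lemma bopD f g : T (f + g) = T f + T g.
Proof. by have := Tb.1 1 f g; rewrite !scale1r. Qed.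
Lemma bop0 : T 0 = 0.
Proof. by have /eqP := bopD 0 0; rewrite addr0 -subr_eq0 opprD addrA subrr sub0r oppr_eq0 => /eqP. Qed.
Lemma bopZ a f : T (a *: f) = a *: T f.
Proof. by have := Tb.1 a f 0; rewrite bop0 !addr0. Qed.
Lemma bopN f : T (- f) = - T f.
Proof. by rewrite -scaleN1r bopZ scaleN1r. Qed.
Lemma bopB f g : T (f - g) = T f - T g.
Proof. by rewrite bopD bopN. Qed.
Lemma bop_sum J (r : seq J) (P : pred J) (F : J -> l2 R X) :
  T (\sum_(j <- r | P j) F j) = \sum_(j <- r | P j) T (F j).
Proof. by apply: (big_morph T) => [f g|]; [exact: bopD|exact: bop0]. Qed.
Lemma bop_vec A u : T (vec A u) = \sum_(x <- A) u x *: T (delta R x).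
Proof. by rewrite bop_sum; apply: eq_bigr => x _; rewrite bopZ. Qed.
Lemma bop_bound : exists2 c, 0 < c & opbound T c.
Proof.
have [c cT] := Tb.2; exists (`|c| + 1); first by rewrite ltr_pwDr.
move=> f; apply: (le_trans (cT f)); rewrite ler_wpM2r ?l2norm_ge0//.
by rewrite (le_trans (ler_norm _))// lerDl.
Qed.
End Linear.

Lemma bop_id X : bop (@id (l2 R X)).
Proof. by split=> [a f g //|]; exists 1 => f; rewrite mul1r. Qed.

Lemma opbound_comp X Y Z (T : l2 R Y -> l2 R Z) (S : l2 R X -> l2 R Y) c d :
  0 <= c -> opbound T c -> opbound S d -> opbound (T \o S) (c * d).
Proof. by move=> c0 Tc Sd f; rewrite (le_trans (Tc _))//= -mulrA ler_wpM2l. Qed.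

Lemma bop_comp X Y Z (T : l2 R Y -> l2 R Z) (S : l2 R X -> l2 R Y) :
  bop T -> bop S -> bop (T \o S).
Proof.
move=> Tb Sb; split=> [a f g|]; first by rewrite /= Sb.1 Tb.1.
have [c /ltW c0 cT] := bop_bound Tb; have [d _ dS] := bop_bound Sb.
by exists (c * d); exact: opbound_comp.
Qed.

Lemma bop_lin X Y a (T S : l2 R X -> l2 R Y) :
  bop T -> bop S -> bop (fun f => a *: T f + S f).
Proof.
move=> Tb Sb; split=> [b f g|].
  rewrite Tb.1 Sb.1 !scalerDr !scalerA mulrC -!addrA; congr (_ + _).
  by rewrite addrCA.
have [c c0 cT] := bop_bound Tb; have [d _ dS] := bop_bound Sb.
exists (normc a * c + d) => f; rewrite (le_trans (ler_l2normD _ _))// mulrDl.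
by rewrite lerD// l2normZ -mulrA ler_wpM2l ?normc_ge0.
Qed.

Lemma bop_zero X Y : bop (fun _ : l2 R X => 0 : l2 R Y).
Proof.
split=> [a f g|]; first by rewrite scaler0 addr0.
by exists 0 => f; rewrite l2norm0 mul0r.
Qed.

Lemma bop_scale X Y a (T : l2 R X -> l2 R Y) : bop T -> bop (fun f => a *: T f).
Proof.
move=> Tb; have := bop_lin a Tb (@bop_zero X Y).
by congr bop; apply/funext => f; rewrite addr0.
Qed.

Lemma bop_add X Y (T S : l2 R X -> l2 R Y) :
  bop T -> bop S -> bop (fun f => T f + S f).
Proof.
move=> Tb Sb; have := bop_lin 1 Tb Sb.
by congr bop; apply/funext => f; rewrite scale1r.
Qed.

Lemma bop_sub X Y (T S : l2 R X -> l2 R Y) :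
  bop T -> bop S -> bop (fun f => T f - S f).
Proof.
move=> Tb Sb; have := bop_lin (-1) Sb Tb.
by congr bop; apply/funext => f; rewrite scaleN1r addrC.
Qed.

Lemma bop_bigsum X Y J (r : seq J) (P : pred J) (T : J -> l2 R X -> l2 R Y) :
  (forall j, bop (T j)) -> bop (fun f => \sum_(j <- r | P j) T j f).
Proof.
move=> Tb; elim: r => [|j r IH].
  have := @bop_zero X Y; congr bop.
  by apply/funext => f; rewrite big_nil.
case Pj: (P j).
  have := bop_add (Tb j) IH; congr bop.
  by apply/funext => f; rewrite big_cons Pj.
by move: IH; congr bop; apply/funext => f; rewrite big_cons Pj.
Qed.

Lemma bop_ext X Y (T S : l2 R X -> l2 R Y) : bop T -> bop S ->
  (forall x, T (delta R x) = S (delta R x)) -> forall f, T f = S f.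
Proof.
move=> Tb Sb TS f; apply/subr0_eq; have Ub := bop_sub Tb Sb.
have [c c0 cU] := bop_bound Ub; apply: l2norm_small => e e0.
have [A hA] := vec_approx f (divr_gt0 e0 c0).
have E : T (vec A f) = S (vec A f).
  rewrite (bop_vec Tb) (bop_vec Sb); apply: eq_bigr => x _.
  by rewrite TS.
have -> : T f - S f = T (f - vec A f) - S (f - vec A f).
  by rewrite (bopB Tb) (bopB Sb) E opprB addrA subrK.
by rewrite (le_trans (cU _))// mulrC -ler_pdivlMr.
Qed.

Lemma eq_l2_inner X (f g : l2 R X) : (forall h, inner f h = inner g h) -> f = g.
Proof. by move=> fg; apply: l2_ext => x; rewrite -!inner_delta. Qed.

(** The finite form of the duality bound for norms: [sqs u A] is the square of the norm on the
    right, so one factor cancels. *)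
Lemma sqs_le_sqr X (A : {fset X}) u D : 0 <= D ->
  sqs u A <= D * l2norm (vec A u : l2 R X) -> sqs u A <= D ^+ 2.
Proof.
move=> D0; rewrite -l2norm_vec; have := l2norm_ge0 (vec A u).
rewrite le_eqVlt => /orP[/eqP <- _|n0]; first by rewrite expr0n sqr_ge0.
by rewrite expr2 ler_pM2r// => h; rewrite -expr2 ler_sqr// nnegrE// ltW.
Qed.

(* meaningful for bounded [T] only *)
Definition adj X Y (T : l2 R X -> l2 R Y) (g : l2 R Y) : l2 R X :=
  insubd (0 : l2 R X) (fun x => inner g (T (delta R x))).

Section Adjoint.
Variables (X Y : choiceType) (T : l2 R X -> l2 R Y).
Hypothesis Tb : bop T.

Let adj_sqs c g A : 0 <= c -> opbound T c ->
  sqs (fun x => inner g (T (delta R x))) A <= (c * l2norm g) ^+ 2.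
Proof.
move=> c0 cT; apply: sqs_le_sqr; first by rewrite mulr_ge0// l2norm_ge0.
set u := fun x => _; have : inner g (T (vec A u)) = (sqs u A)%:C%C.
  rewrite bop_vec// inner_sumr realC_sum; apply: eq_bigr => x _.
  by rewrite innerZr mulrC -mulcJ.
move=> /(congr1 (@normc R)); rewrite normc_real ger0_norm ?sqs_ge0// => <-.
rewrite (le_trans (cauchy_schwarz _ _))// [leLHS]mulrC mulrAC.
by rewrite ler_wpM2r ?l2norm_ge0//; exact: cT.
Qed.

Lemma adjE g x : adj T g x = inner g (T (delta R x)).
Proof.
have [c /ltW c0 cT] := bop_bound Tb.
rewrite -[LHS]/(val (adj T g) x) val_insubd.
by rewrite (sqs_summable (fun A => adj_sqs g A c0 cT)).
Qed.

Lemma adj_bound c : 0 <= c -> opbound T c -> opbound (adj T) c.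
Proof.
move=> c0 cT g; apply: l2norm_le; first by rewrite mulr_ge0// l2norm_ge0.
move=> A; apply: le_trans (adj_sqs g A c0 cT).
by rewrite /sqs ler_sum// => x _; rewrite adjE.
Qed.

Lemma bop_adj : bop (adj T).
Proof.
split=> [a f g|]; last first.
  by have [c /ltW c0 cT] := bop_bound Tb; exists c; exact: adj_bound.
by apply: l2_ext => x; rewrite l2DE l2ZE !adjE innerDl innerZl.
Qed.

Lemma adjP f g : inner (T f) g = inner f (adj T g).
Proof.
have [c c0 cT] := bop_bound Tb; have aT := adj_bound (ltW c0) cT.
have D0 : 0 < c * l2norm g + c * l2norm g + 1.
  by rewrite ltr_pwDr// addr_ge0// mulr_ge0 ?l2norm_ge0// ltW.
apply/subr0_eq/normc_le_eq0 => e e0.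
have [A hA] := vec_approx f (divr_gt0 e0 D0).
have E : inner (T (vec A f)) g = inner (vec A f) (adj T g).
  rewrite bop_vec// !inner_suml; apply: eq_bigr => x _.
  by rewrite !innerZl inner_deltal adjE -innerJ.
have -> : inner (T f) g - inner f (adj T g) =
    inner (T (f - vec A f)) g - inner (f - vec A f) (adj T g).
  by rewrite bopB// !innerBl E opprB addrA subrK.
rewrite (le_trans (le_normcD _ _))// normcN.
have h1 : normc (inner (T (f - vec A f)) g) <=
    c * l2norm g * (e / (c * l2norm g + c * l2norm g + 1)).
  rewrite (le_trans (cauchy_schwarz _ _))// mulrAC ler_wpM2r ?l2norm_ge0//.
  by rewrite (le_trans (cT _))// ler_wpM2l// ltW.
have h2 : normc (inner (f - vec A f) (adj T g)) <=
    c * l2norm g * (e / (c * l2norm g + c * l2norm g + 1)).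
  rewrite (le_trans (cauchy_schwarz _ _))// mulrC ler_pM ?l2norm_ge0//.
apply: le_trans (lerD h1 h2) _; rewrite -mulrDl mulrCA ler_piMr ?(ltW e0)//.
by rewrite ler_pdivrMr// mul1r lerDl.
Qed.

Lemma adjPr f g : inner (adj T g) f = inner g (T f).
Proof. by rewrite innerJ -adjP -innerJ. Qed.

End Adjoint.

Lemma adj_unique X Y (T : l2 R X -> l2 R Y) S : bop T ->
  (forall f g, inner (T f) g = inner f (S g)) -> S =1 adj T.
Proof.
move=> Tb TS g; apply: eq_l2_inner => h.
by rewrite innerJ -TS -innerJ -adjPr.
Qed.

Lemma is_adjoint_adj X (T : l2op R X) : bop T -> is_adjoint T (adj T).
Proof. by move=> Tb f g; exact: adjP. Qed.

Lemma is_adjoint_sym X (T S : l2op R X) : is_adjoint T S -> is_adjoint S T.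
Proof. by move=> h f g; rewrite innerJ -h -innerJ. Qed.

Lemma inner_ext X Y (T : l2 R X -> l2 R Y) S : bop T -> bop S ->
  (forall x y, inner (T (delta R x)) (delta R y) = inner (delta R x) (S (delta R y))) ->
  forall f g, inner (T f) g = inner f (S g).
Proof.
move=> Tb Sb TS f g; rewrite adjP//; congr inner.
apply: bop_ext => // [|y]; first exact: bop_adj.
by apply: l2_ext => x; rewrite adjE// innerJ TS -innerJ inner_delta.
Qed.

Lemma opbound_le X Y (T : l2 R X -> l2 R Y) c d : c <= d -> opbound T c -> opbound T d.
Proof. by move=> cd cT f; rewrite (le_trans (cT f))// ler_wpM2r ?l2norm_ge0. Qed.

Section FormOp.
Variables (X Y : choiceType) (phi : X -> Y -> R[i]) (C : R).
Hypothesis C0 : 0 <= C.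
Hypothesis phiC : forall (A : {fset X}) (B : {fset Y}) u v,
  normc (\sum_(x <- A) \sum_(y <- B) u x * (v y)^*%C * phi x y) <=
  C * l2norm (vec A u : l2 R X) * l2norm (vec B v : l2 R Y).

Let col_sqs x B : sqs (phi x) B <= C ^+ 2.
Proof.
apply: sqs_le_sqr => //.
have := phiC [fset x]%fset B (fun=> 1) (phi x).
have -> : vec [fset x]%fset (fun=> 1) = delta R x.
  by rewrite /vec big_seq_fset1 scale1r.
rewrite l2norm_delta mulr1 big_seq_fset1 => h; apply: le_trans h.
rewrite -[leLHS]ger0_norm ?sqs_ge0// -normc_real realC_sum.
suff -> : \sum_(y <- B) 1 * (phi x y)^*%C * phi x y =
  \sum_(y <- B) (normc (phi x y) ^+ 2)%:C%C by [].
by apply: eq_bigr => y _; rewrite mul1r mulrC mulcJ.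
Qed.

Let col x : l2 R Y := L2 (sqs_summable (col_sqs x)).

Let fin (A : {fset X}) (u : X -> R[i]) : l2 R Y := \sum_(x <- A) u x *: col x.

Let fin_bound A u : l2norm (fin A u) <= C * l2norm (vec A u : l2 R X).
Proof.
apply: l2norm_le => [|B]; first by rewrite mulr_ge0 ?l2norm_ge0.
apply: sqs_le_sqr; first by rewrite mulr_ge0 ?l2norm_ge0.
apply: le_trans (phiC A B u (fin A u)).
rewrite -[leLHS]ger0_norm ?sqs_ge0// -normc_real realC_sum exchange_big/=.
rewrite le_eqVlt; apply/orP; left; apply/eqP; congr normc.
apply: eq_bigr => y _; rewrite -mulcJ {1}l2_sumE mulr_suml.
by apply: eq_bigr => x _; rewrite l2ZE/= mulrAC.
Qed.

Lemma vec_norm_le (f : l2 R X) A : l2norm (vec A f) <= l2norm f.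
Proof.
by rewrite -(@ler_pXn2r _ 2)// ?nnegrE ?l2norm_ge0// l2norm_vec sqs_le.
Qed.

(** The bound makes every column [phi x] square-summable and controls finite combinations of
    columns. The operator is the weak limit of these combinations over finite subsets of [X], which
    defines it on all vectors at once. *)
Lemma form_op : exists T : l2 R X -> l2 R Y,
  [/\ bop T, opbound T C & forall x y, T (delta R x) y = phi x y].
Proof.
have finC (f : l2 R X) A : l2norm (fin A f) <= C * l2norm f.
  by rewrite (le_trans (fin_bound _ _))// ler_wpM2l// vec_norm_le.
pose m := fset_mean R X; pose T (f : l2 R X) := vlim m (fun A => fin A f).
have TC : opbound T C by move=> f; exact: vlim_norm.
have cb f y : cbdd (fun A => fin A (f : l2 R X) y).
  by exists (C * l2norm f) => A; rewrite (le_trans (normc_le_l2norm _ _)).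
have TE f y : T f y = cmean m (fun A => fin A f y) by exact: (vlimE m (finC f)).
exists T; split=> //.
  split; last by exists C.
  move=> a f g; apply: l2_ext => y.
  rewrite l2DE l2ZE !TE.
  rewrite -cmeanZ// -cmeanD//; last exact: cbddZ.
  apply: eq_cmean => A; rewrite !l2_sumE mulr_sumr -big_split.
  by apply: eq_bigr => x _; rewrite !l2ZE l2DE l2ZE mulrDl mulrA.
move=> x y; rewrite TE; apply: (ctail_lim (@fset_mean_tail R X)).
  exact: cb.
move=> e e0; exists [fset x]%fset => A; rewrite fsub1set => xA.
rewrite l2_sumE (big_fsetD1 x xA) l2ZE deltaE eqxx mul1r big1_fset => [|z].
  by rewrite /= addr0 subrr normc0 ltW.
by rewrite !inE l2ZE deltaE => /andP[/negbTE -> _] _; rewrite mul0r.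
Qed.

End FormOp.

Section OpLim.
Variables (X Y : choiceType) (I : Type) (m : mean R I).
Variables (T : I -> l2 R X -> l2 R Y) (C : R).
Hypothesis TC : forall i, opbound (T i) C.
Hypothesis Tl : forall i, linear (T i).

(** The weak operator limit along [m]; it replaces the weak compactness of bounded sets of
    operators. *)
Definition olim (f : l2 R X) : l2 R Y := vlim m (fun i => T i f).

Lemma inner_olim f g : inner (olim f) g = cmean m (fun i => inner (T i f) g).
Proof. by apply: (@inner_vlim _ _ _ _ _ (C * l2norm f)) => i; exact: TC. Qed.

Lemma cbdd_olim f g : cbdd (fun i => inner (T i f) g).
Proof. by apply: (@cbdd_inner _ _ _ _ (C * l2norm f)) => i; exact: TC. Qed.

Lemma olim_bound : opbound olim C.
Proof. by move=> f; apply: vlim_norm => i; exact: TC. Qed.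

Lemma bop_olim : bop olim.
Proof.
split; last by exists C; exact: olim_bound.
move=> a f g; apply: eq_l2_inner => h; rewrite innerDl innerZl !inner_olim.
rewrite -cmeanZ; last exact: cbdd_olim.
rewrite -cmeanD; [|exact/cbddZ/cbdd_olim|exact: cbdd_olim].
by apply: eq_cmean => i; rewrite Tl innerDl innerZl.
Qed.

End OpLim.

Section SelfAdjoint.
Variables (X : choiceType) (T : l2op R X) (rho : R).
Hypothesis Tb : bop T.
Hypothesis Tsa : is_adjoint T T.
Hypothesis rho0 : 0 <= rho.
Hypothesis Trho : forall f, `|complex.Re (inner (T f) f)| <= rho * l2norm f ^+ 2.

(** Polarization: four times the real part of <T f, g> is the difference of the quadratic form at f
    + g and at f - g, and the parallelogram law bounds the two together. Then g is T f, rescaled to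
    the norm of f. *)
Lemma selfadjoint_bound : opbound T rho.
Proof.
have key f g : 4 * complex.Re (inner (T f) g) <=
    rho * (2 * l2norm f ^+ 2 + 2 * l2norm g ^+ 2).
  rewrite -parallelogram mulrDr.
  have := Trho (f + g); have := Trho (f - g); rewrite !ler_norml.
  rewrite !(bopD Tb) !(bopN Tb) !innerDl !innerDr !innerNl !innerNr.
  have -> : inner (T g) f = (inner (T f) g)^*%C by rewrite Tsa innerJ.
  rewrite !ReD !ReN !ReJ; set a := complex.Re _; set b := complex.Re _.
  by set c := complex.Re _ => /andP[? ?] /andP[? ?]; lra.
move=> f; have [f0|f0] := eqVneq (l2norm f) 0.
  by rewrite (l2norm_eq0 f0) bop0// l2norm0 mulr0.
have [g0|g0] := eqVneq (l2norm (T f)) 0.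
  by rewrite g0 mulr_ge0// l2norm_ge0.
have a0 : 0 < l2norm f by rewrite lt_def f0 l2norm_ge0.
have b0 : 0 < l2norm (T f) by rewrite lt_def g0 l2norm_ge0.
have := key f ((l2norm f / l2norm (T f))%:C%C *: T f).
rewrite innerZr conjc_real ReZ inner_self /= l2normZ normc_real.
rewrite ger0_norm ?divr_ge0 ?l2norm_ge0// divfK// expr2.
rewrite (_ : l2norm f / l2norm (T f) * (l2norm (T f) * l2norm (T f)) =
  l2norm f * l2norm (T f)); last by field.
move: (l2norm f) (l2norm (T f)) a0 b0 => a b a0 b0 h.
by rewrite -(ler_pM2l a0); lra.
Qed.

End SelfAdjoint.

Section Pull.
Variables (X Y : choiceType) (s : X -> Y).
Hypothesis si : injective s.

Definition pull (f : l2 R Y) : l2 R X := insubd (0 : l2 R X) (fun x => f (s x)).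

Let pull_sqs (f : l2 R Y) A : sqs (fun x => f (s x)) A <= l2norm f ^+ 2.
Proof.
apply: le_trans (sqs_le f (s @` A)%fset); rewrite /sqs big_imfset//=.
by move=> x y _ _; exact: si.
Qed.

Lemma pullE f x : pull f x = f (s x).
Proof.
rewrite -[LHS]/(val (pull f) x) val_insubd.
by rewrite (sqs_summable (pull_sqs f)).
Qed.

Lemma pull_bound : opbound pull 1.
Proof.
move=> f; rewrite mul1r; apply: l2norm_le (l2norm_ge0 _) _ => A.
apply: le_trans (pull_sqs f A); rewrite /sqs ler_sum// => x _.
by rewrite pullE.
Qed.

Lemma bop_pull : bop pull.
Proof.
split=> [a f g|]; last by exists 1; exact: pull_bound.
by apply: l2_ext => x; rewrite l2DE l2ZE !pullE.
Qed.

Lemma adj_pull_delta x : adj pull (delta R x) = delta R (s x).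
Proof.
apply: l2_ext => y; rewrite adjE; last exact: bop_pull.
rewrite inner_deltal pullE !deltaE [RHS]/= eq_sym.
by case: ifP => _; rewrite ?conjc1 ?conjc0.
Qed.

End Pull.

Section Bijection.
Variables (X Y : choiceType) (s : X -> Y) (t : Y -> X).
Hypothesis st : cancel s t.
Hypothesis ts : cancel t s.

(** Only the products of corresponding coordinates are compared, so that one statement serves
    unitarity, adjoints and the trace identities of the regular representation. *)
Lemma inner_reindex (f g : l2 R X) (f' g' : l2 R Y) :
  (forall x, f x * (g x)^*%C = f' (s x) * (g' (s x))^*%C) ->
  inner f g = inner f' g'.
Proof.
move=> fg; apply/subr0_eq/normc_le_eq0 => e e0.
have e20 : 0 < e / 2 by lra.
have [A hA] := inner_csum f g e20; have [B hB] := inner_csum f' g' e20.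
pose A' := (A `|` t @` B)%fset.
have h1 := hA A' (fsubsetUl _ _).
have h2 := hB (s @` A')%fset.
rewrite big_imfset/= in h2; last by move=> x y _ _; exact: (can_inj st).
have SE : \sum_(x <- A') f x * (g x)^*%C =
    \sum_(x <- A') f' (s x) * (g' (s x))^*%C by apply: eq_bigr => x _; exact: fg.
rewrite SE in h1.
have /h2{}h2 : fsubset B (s @` A')%fset.
  apply/fsubsetP => y yB; apply/imfsetP; exists (t y); rewrite ?ts//=.
  by rewrite !inE; apply/orP; right; apply/imfsetP; exists y.
set S := \sum_(x <- _) _ in h1 h2.
have -> : inner f g - inner f' g' = (S - inner f' g') - (S - inner f g) by ring.
by rewrite (le_trans (le_normcD _ _))// normcN; lra.
Qed.

Lemma inner_pull_bij f g : inner (pull s f) (pull s g) = inner f (g : l2 R Y).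
Proof.
by apply: inner_reindex => x; rewrite !pullE//; exact: (can_inj st).
Qed.

Lemma l2norm_pull_bij f : l2norm (pull s f) = l2norm f.
Proof.
apply/eqP; rewrite -(@eqrXn2 _ 2) ?l2norm_ge0//.
by rewrite !l2norm_sqE inner_pull_bij.
Qed.

Lemma inner_pull_adj f g : inner (pull s f) g = inner f (pull t g).
Proof.
apply: inner_reindex => x; rewrite !pullE ?st//; first exact: (can_inj ts).
exact: (can_inj st).
Qed.

Lemma pull_delta y : pull s (delta R y) = delta R (t y).
Proof.
apply: l2_ext => x; rewrite pullE; last exact: (can_inj st).
by rewrite /= (can2_eq st ts).
Qed.

End Bijection.
End Bop.

Lemma fsum_pick (V : zmodType) (K : choiceType) (A : {fset K}) z (F : K -> V) :
  \sum_(j <- A) (if z == j then F j else 0) = if z \in A then F z else 0.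
Proof.
case: ifP => zA.
  rewrite (big_fsetD1 z zA) /= eqxx big1_fset ?addr0// => y.
  by rewrite !inE eq_sym => /andP[/negbTE ->].
rewrite big1_fset// => y yA _; case: eqVneq => // zy.
by rewrite zy yA in zA.
Qed.

(** * Amplifications and square roots *)

Section Amplification.
Variables (R : realType) (Z X : choiceType).
Implicit Types (f g : l2 R (Z * X)%type) (z : Z).

Let pair_inj z : injective (fun x : X => (z, x)).
Proof. by move=> x y []. Qed.

Definition slice z : l2 R (Z * X)%type -> l2 R X := pull (fun x => (z, x)).
Definition emb z : l2 R X -> l2 R (Z * X)%type := adj (slice z).

Lemma sliceE z f x : slice z f x = f (z, x).
Proof. exact: (pullE (@pair_inj z)). Qed.

Lemma bop_slice z : bop (slice z). Proof. exact: (bop_pull _ (@pair_inj z)). Qed.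
Lemma bop_emb z : bop (emb z). Proof. exact/bop_adj/bop_slice. Qed.

Lemma emb_delta z x : emb z (delta R x) = delta R (z, x).
Proof. exact: (adj_pull_delta _ (@pair_inj z)). Qed.

Lemma inner_emb z f h : inner (emb z h) f = inner h (slice z f).
Proof. exact: (adjPr (bop_slice z)). Qed.

Lemma slice_ext f g : (forall z, slice z f = slice z g) -> f = g.
Proof. by move=> fg; apply: l2_ext => -[z x]; rewrite -!sliceE fg. Qed.

Lemma slice_emb z z' h : slice z (emb z' h) = if z == z' then h else 0.
Proof.
apply: l2_ext => x; rewrite sliceE -inner_delta inner_emb.
have -> : slice z' (delta R (z, x)) = if z == z' then delta R x else 0.
  apply: l2_ext => y; rewrite sliceE deltaE xpair_eqE eq_sym.
  by case: eqP.
by case: ifP => _; rewrite ?inner_delta ?inner0r.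
Qed.

Lemma esum_slices (u : Z -> X -> R[i]) :
  (\esum_(p in [set: Z * X]) (normc (u p.1 p.2) ^+ 2)%:E =
   \esum_(z in [set: Z]) \esum_(x in [set: X]) (normc (u z x) ^+ 2)%:E)%E.
Proof.
rewrite esum_esum => [|z x]; last by rewrite lee_fin sqr_ge0.
by congr esum; apply/seteqP; split=> // -[].
Qed.

Lemma esum_slice_norm f :
  (\esum_(z in [set: Z]) (l2norm (slice z f) ^+ 2)%:E = (l2norm f ^+ 2)%:E)%E.
Proof.
rewrite -esum_l2norm -(eq_esum (a := fun p => (normc (f (p.1, p.2)) ^+ 2)%:E));
  last by move=> -[].
rewrite (esum_slices (fun z x => f (z, x))); apply: eq_esum => z _.
by rewrite -esum_l2norm; apply: eq_esum => x _; rewrite sliceE.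
Qed.

Lemma sum_slice_le f (A : {fset Z}) :
  \sum_(z <- A) l2norm (slice z f) ^+ 2 <= l2norm f ^+ 2.
Proof.
rewrite -lee_fin -esum_slice_norm.
apply: esum_ge; exists [set` A]; first by split; [exact: finite_fset|].
by rewrite fsbig_finite ?finite_fset//= set_fsetK sumEFin.
Qed.

Lemma sum_slice_lim f e : 0 < e ->
  exists A : {fset Z}, l2norm f ^+ 2 <= \sum_(z <- A) l2norm (slice z f) ^+ 2 + e.
Proof.
move=> e0; have [//|/forallNP h] := pselect (exists A : {fset Z},
  l2norm f ^+ 2 <= \sum_(z <- A) l2norm (slice z f) ^+ 2 + e).
suff : l2norm f ^+ 2 <= l2norm f ^+ 2 - e by lra.
rewrite -lee_fin -[leLHS]esum_slice_norm; apply: ge_ereal_sup => _ [S [finS _] <-].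
rewrite fsbig_finite//= sumEFin lee_fin.
by have /negP := h (fset_set S); rewrite -ltNge; lra.
Qed.

Definition restrict (A : {fset Z}) f := \sum_(z <- A) emb z (slice z f).

Lemma inner_restrict A f g :
  inner (restrict A f) g = \sum_(z <- A) inner (slice z f) (slice z g).
Proof. by rewrite inner_suml; apply: eq_bigr => z _; rewrite inner_emb. Qed.

Lemma slice_restrict A f z : slice z (restrict A f) = if z \in A then slice z f else 0.
Proof.
rewrite (bop_sum (bop_slice z)) -(fsum_pick A z (slice ^~ f)).
by apply: eq_bigr => y _; rewrite slice_emb.
Qed.

Lemma restrict_approx f e : 0 < e -> exists A0 : {fset Z},
  forall A, fsubset A0 A -> l2norm (f - restrict A f) <= e.
Proof.
move=> e0; have e20 : 0 < e ^+ 2 by rewrite exprn_gt0.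
have [A0 hA0] := sum_slice_lim f e20; exists A0 => A A0A.
rewrite -(@ler_pXn2r _ 2)// ?nnegrE ?l2norm_ge0 ?(ltW e0)//.
have E1 : l2norm (restrict A f) ^+ 2 = \sum_(z <- A) l2norm (slice z f) ^+ 2.
  rewrite l2norm_sqE inner_restrict Re_sum big_seq [RHS]big_seq.
  by apply: eq_bigr => z zA; rewrite slice_restrict zA l2norm_sqE.
have E2 : complex.Re (inner f (restrict A f)) = \sum_(z <- A) l2norm (slice z f) ^+ 2.
  rewrite innerJ ReJ inner_restrict Re_sum.
  by apply: eq_bigr => z zA; rewrite l2norm_sqE.
rewrite l2norm_sqB E1 E2.
suff : \sum_(z <- A0) l2norm (slice z f) ^+ 2 <= \sum_(z <- A) l2norm (slice z f) ^+ 2.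
  by lra.
rewrite [leRHS](big_fsetID _ (mem A0)) /=.
have -> : [fset x in A | x \in A0]%fset = A0.
  by apply/fsetP => x; rewrite !inE; apply: andb_idl; exact: (fsubsetP A0A).
by rewrite lerDl sumr_ge0// => x _; rewrite sqr_ge0.
Qed.

(** The uniform bound accompanies the formula because means are linear on bounded families only. *)
Lemma inner_slices f g : exists2 C, (forall A : {fset Z},
    normc (\sum_(z <- A) inner (slice z f) (slice z g)) <= C) &
  inner f g = cmean (fset_mean R Z)
    (fun A => \sum_(z <- A) inner (slice z f) (slice z g)).
Proof.
have rn (A : {fset Z}) : l2norm (restrict A f) <= l2norm f.
  rewrite -(@ler_pXn2r _ 2)// ?nnegrE ?l2norm_ge0//.
  apply: le_trans (sum_slice_le f A); rewrite l2norm_sqE inner_restrict Re_sum.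
  rewrite big_seq [leRHS]big_seq ler_sum// => z zA.
  by rewrite slice_restrict zA l2norm_sqE.
have bd (A : {fset Z}) : normc (\sum_(z <- A) inner (slice z f) (slice z g)) <= l2norm f * l2norm g.
  rewrite -inner_restrict (le_trans (cauchy_schwarz _ _))//.
  by rewrite ler_wpM2r ?l2norm_ge0.
exists (l2norm f * l2norm g) => //.
apply/esym/(ctail_lim (@fset_mean_tail R Z)); first by exists (l2norm f * l2norm g).
move=> e e0; have D0 : 0 < l2norm g + 1 by rewrite ltr_wpDl ?l2norm_ge0.
have [A0 hA0] := restrict_approx f (divr_gt0 e0 D0); exists A0 => A /hA0 h.
rewrite -inner_restrict -innerBl (le_trans (cauchy_schwarz _ _))// l2normB.
apply: (@le_trans _ _ (e / (l2norm g + 1) * l2norm g)).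
  by rewrite ler_wpM2r ?l2norm_ge0.
by rewrite mulrAC ler_pdivrMr// ler_pM2l// lerDl.
Qed.

Variable T : l2op R X.
Hypothesis Tb : bop T.

(** The operator 1 (x) T on l2 Z (x) l2 X. *)
Definition amp (f : l2 R (Z * X)%type) : l2 R (Z * X)%type :=
  insubd (0 : l2 R (Z * X)%type) (fun p => T (slice p.1 f) p.2).

Let amp_esum f c : 0 <= c -> opbound T c ->
  (\esum_(p in [set: Z * X]) (normc (T (slice p.1 f) p.2) ^+ 2)%:E <=
  ((c * l2norm f) ^+ 2)%:E)%E.
Proof.
move=> c0 cT; rewrite (esum_slices (fun z x => T (slice z f) x)).
rewrite (eq_esum (b := fun z => (normc (l2norm (T (slice z f)))%:C%C ^+ 2)%:E)).
  apply: esum_sqs => A; apply: (@le_trans _ _ (c ^+ 2 * l2norm f ^+ 2)).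
    apply: le_trans (ler_wpM2l (sqr_ge0 c) (sum_slice_le f A)).
    rewrite mulr_sumr ler_sum// => z _; rewrite normc_real ger0_norm ?l2norm_ge0//.
    rewrite -exprMn ler_sqr ?nnegrE ?l2norm_ge0 ?mulr_ge0 ?l2norm_ge0//.
  by rewrite exprMn.
by move=> z _; rewrite esum_l2norm normc_real ger0_norm// l2norm_ge0.
Qed.

Lemma ampE f z x : amp f (z, x) = T (slice z f) x.
Proof.
have [c /ltW c0 cT] := bop_bound Tb.
rewrite -[LHS]/(val (amp f) (z, x)) val_insubd.
suff -> : (fun p => T (slice p.1 f) p.2) \in @square_summable R (Z * X)%type by [].
by apply/asboolP; exact: (le_lt_trans (amp_esum f c0 cT)) (ltry _).
Qed.

Lemma slice_amp z f : slice z (amp f) = T (slice z f).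
Proof. by apply: l2_ext => x; rewrite sliceE ampE. Qed.

Lemma amp_bound c : 0 <= c -> opbound T c -> opbound amp c.
Proof.
move=> c0 cT f; rewrite -(@ler_pXn2r _ 2)// ?nnegrE ?mulr_ge0 ?l2norm_ge0//.
apply: l2norm_sq_le => A; rewrite -lee_fin; apply: le_trans (amp_esum f c0 cT).
apply: le_trans (sqs_esum _ _) _; apply: le_esum => -[z x] _ /=.
by rewrite ampE.
Qed.

Lemma bop_amp : bop amp.
Proof.
split; last first.
  by have [c /ltW c0 cT] := bop_bound Tb; exists c; exact: amp_bound.
move=> a f g; apply: slice_ext => z.
by rewrite (bop_slice z).1 !slice_amp (bop_slice z).1 Tb.1.
Qed.

End Amplification.

Lemma inner_amp (R : realType) (Z X : choiceType) (T S : l2op R X) (f g : l2 R (Z * X)%type) :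
  bop T -> bop S -> is_adjoint T S -> inner (amp T f) g = inner f (amp S g).
Proof.
move=> Tb Sb TS; have [C1 _ ->] := inner_slices (amp T f) g.
have [C2 _ ->] := inner_slices f (amp S g); apply: eq_cmean => A.
by apply: eq_bigr => z _; rewrite !slice_amp// TS.
Qed.

(** * Square roots of positive operators *)

Section Sqrt.
Variables (R : realType) (X : choiceType) (A : l2op R X).
Hypothesis Ab : bop A.
Hypothesis Asa : is_adjoint A A.
Hypothesis A1 : opbound A 1.

(* Visser's iteration for 1 - sqrt (1 - A) *)
Fixpoint viter (n : nat) : l2op R X :=
  if n is n'.+1 then fun f => (2^-1 : R)%:C%C *: (A f + viter n' (viter n' f)) else fun=> 0.

Lemma viterS n f :
  viter n.+1 f = (2^-1 : R)%:C%C *: (A f + viter n (viter n f)).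
Proof. by []. Qed.

(** The same iteration for the scalar A = 1. It majorizes the operator iteration and increases to
    1. *)
Fixpoint valpha (n : nat) : R :=
  if n is n'.+1 then 2^-1 * (1 + valpha n' ^+ 2) else 0.

Lemma valpha_bound n : 0 <= valpha n /\ 1 - 2 / (n.+1)%:R <= valpha n <= 1.
Proof.
elim: n => [|n [IH0 /andP[IH1 IH2]]] /=.
  by rewrite ler01 divr1 lexx; split=> //; rewrite andbT; lra.
split; first by rewrite mulr_ge0// addr_ge0// sqr_ge0.
apply/andP; split; last by nra.
have n1 : 0 < n.+1%:R :> R by rewrite ltr0n.
have n2 : n.+2%:R = n.+1%:R + 1 :> R by rewrite -[in LHS]addn1 natrD.
rewrite n2; move: IH0 IH1 IH2; set a := valpha n; set k : R := n.+1%:R in n1 *.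
move=> a0 a1 a2.
(* For small k the lower bound 1 - 2 / k may be negative, and then it cannot be squared. *)
have [k2|k2] := lerP k 2.
  have : 1 - 2 / (k + 1) <= 3^-1.
    rewrite lerBlDr -lerBlDl; apply: (@le_trans _ _ (2 / 3)); first by lra.
    by rewrite ler_pM2l// lef_pV2 ?posrE; lra.
  by have := sqr_ge0 a; lra.
have b0 : 0 <= 1 - 2 / k by rewrite subr_ge0 ler_pdivrMr//; lra.
apply: (@le_trans _ _ (2^-1 * (1 + (1 - 2 / k) ^+ 2))); last first.
  by rewrite ler_pM2l// lerD2l ler_sqr// nnegrE.
rewrite -subr_ge0.
have -> : 2^-1 * (1 + (1 - 2 / k) ^+ 2) - (1 - 2 / (k + 1)) = 2 / (k ^+ 2 * (k + 1)).
  by field; apply/andP; split; apply: lt0r_neq0; lra.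
by rewrite divr_ge0// mulr_ge0 ?sqr_ge0//; lra.
Qed.

Lemma valpha_le n : valpha n <= valpha n.+1.
Proof. by have [? /andP[? ?]] := valpha_bound n; rewrite /=; nra. Qed.

Lemma valpha_lim e : 0 < e -> exists N, forall n, (N <= n)%N -> 1 - valpha n <= e.
Proof.
move=> e0; exists (Num.bound (2 / e)) => n Nn.
have [_ /andP[h _]] := valpha_bound n.
move: h; set k := 2 / n.+1%:R => h; suff : k <= e by lra.
rewrite /k ler_pdivrMr ?ltr0n// mulrC -ler_pdivrMr//.
have := archi_boundP (divr_ge0 (ler0n R 2) (ltW e0)) => /ltW/le_trans; apply.
by rewrite ler_nat; exact: leqW.
Qed.

Lemma viterP n :
  [/\ bop (viter n), opbound (viter n) (valpha n), is_adjoint (viter n) (viter n) &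
   forall S, bop S -> (forall f, S (A f) = A (S f)) ->
     forall f, S (viter n f) = viter n (S f)].
Proof.
elim: n => [|n [IHb IHo IHa IHc]] /=.
  split; first exact: bop_zero.
  - by move=> f; rewrite l2norm0 mul0r.
  - by move=> f g; rewrite inner0l inner0r.
  - by move=> S Sb _ f; rewrite bop0.
split.
- exact/bop_scale/bop_add/(bop_comp IHb IHb).
- move=> f; rewrite l2normZ normc_real ger0_norm// -mulrA ler_pM2l//.
  apply: le_trans (ler_l2normD _ _) _; rewrite mulrDl.
  apply: lerD; first exact: (A1 f).
  rewrite expr2 -mulrA; apply: le_trans (IHo _) _.
  by apply: ler_wpM2l (IHo f); have [] := valpha_bound n.
- move=> f g; rewrite innerZl innerZr conjc_real innerDl innerDr Asa.
  by rewrite IHa IHa.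
- move=> S Sb SA f; by rewrite (bopZ Sb) (bopD Sb) SA !(IHc _ Sb SA).
Qed.

(** The iterates are polynomials in [A], so they commute, and v_(n+2) - v_(n+1) = (v_(n+1) -
    v_n)(v_(n+1) + v_n) / 2. The scalar sequence obeys the same identity, which yields the
    majorization. *)
Lemma viter_diff n f :
  l2norm (viter n.+1 f - viter n f) <= (valpha n.+1 - valpha n) * l2norm f.
Proof.
have vc i j g : viter i (viter j g) = viter j (viter i g).
  have [vb _ _ _] := viterP i; have [_ _ _ ->//] := viterP j.
  by move=> k; have [_ _ _ <-] := viterP i.
elim: n f => [|n IH] f.
  rewrite /= subr0 addr0 subr0 expr0n addr0 mulr1 l2normZ normc_real.
  by rewrite ger0_norm// ler_pM2l// -[leRHS]mul1r; exact: A1.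
have [b1 o1 _ _] := viterP n.+1; have [b0 o0 _ _] := viterP n.
have -> : viter n.+2 f - viter n.+1 f = (2^-1 : R)%:C%C *:
    (viter n.+1 (viter n.+1 f + viter n f) - viter n (viter n.+1 f + viter n f)).
  rewrite (bopD b1) (bopD b0) (vc n n.+1) (viterS n.+1) [X in _ - X](viterS n).
  rewrite -scalerBr.
  by congr (_ *: _); rewrite [A f + _]addrC !addrKA.
rewrite l2normZ normc_real ger0_norm//.
have -> : valpha n.+2 - valpha n.+1 =
    2^-1 * ((valpha n.+1 - valpha n) * (valpha n.+1 + valpha n)) by rewrite /=; ring.
rewrite -!mulrA ler_pM2l// (le_trans (IH _))// ler_wpM2l ?subr_ge0 ?valpha_le//.
by rewrite (le_trans (ler_l2normD _ _))// mulrDl lerD.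
Qed.

Lemma viter_cauchy n k f :
  l2norm (viter (n + k) f - viter n f) <= (1 - valpha n) * l2norm f.
Proof.
apply: (@le_trans _ _ ((valpha (n + k) - valpha n) * l2norm f)); last first.
  by rewrite ler_wpM2r ?l2norm_ge0// lerB//; have [_ /andP[]] := valpha_bound (n + k).
elim: k => [|k IH]; first by rewrite addn0 !subrr l2norm0 mul0r.
rewrite addnS (le_trans (ler_l2dist (viter (n + k) f) _ _))//.
by have := viter_diff (n + k) f; lra.
Qed.

(** The root is 1 minus the limit of the iterates. Its commutation with everything commuting with
    [A] places it in every von Neumann algebra that contains [A]. *)
Lemma sqrt_one_sub : exists L : l2op R X,
  [/\ bop L, is_adjoint L L, forall f, L (L f) = f - A f &
   forall S, bop S -> (forall f, S (A f) = A (S f)) -> forall f, S (L f) = L (S f)].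
Proof.
have [m mt] : exists m : mean R nat, tail_pos (fun i j => (i <= j)%N) m.
  apply: (@directed_mean R _ (fun i j => (i <= j)%N) 0%N) => //.
    by move=> x y z; exact: leq_trans.
  by move=> x y; exists (maxn x y); rewrite leq_maxl leq_maxr.
have vb n : bop (viter n) by have [] := viterP n.
have vo n : opbound (viter n) 1.
  by have [_ + _ _] := viterP n; apply: opbound_le; have [_ /andP[]] := valpha_bound n.
have vl n : linear (viter n) := (vb n).1.
pose Y := olim m viter; have Yb : bop Y := @bop_olim _ _ _ _ m _ _ vo vl.
have Yn n f : l2norm (Y f - viter n f) <= (1 - valpha n) * l2norm f.
  have a0 : 0 <= (1 - valpha n) * l2norm f.
    by rewrite mulr_ge0 ?l2norm_ge0// subr_ge0; have [_ /andP[]] := valpha_bound n.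
  set d := Y f - _; have [d0|d0] := eqVneq (l2norm d) 0; first by rewrite d0.
  have dp : 0 < l2norm d by rewrite lt_def d0 l2norm_ge0.
  rewrite -(ler_pM2r dp) -expr2 -[leLHS]ger0_norm ?sqr_ge0// -normc_real -inner_self.
  rewrite {1}/d innerBl /Y (inner_olim _ vo) -[X in _ - X](cmean_cst m).
  rewrite -cmeanB; [|exact: cbdd_olim|exact: cbdd_cst].
  apply: (ctail_norm mt).
    by apply: cbddB; [exact: cbdd_olim|exact: cbdd_cst].
  exists n => k nk; rewrite -innerBl (le_trans (cauchy_schwarz _ _))//.
  by rewrite ler_pM2r// -(subnKC nk) viter_cauchy.
have Yi f g : inner (Y f) g = cmean m (fun i => inner (viter i f) g).
  exact: inner_olim.
have Ysa : is_adjoint Y Y.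
  move=> f g; rewrite (innerJ _ f) !Yi -cmeanJ; last exact: cbdd_olim.
  by apply: eq_cmean => n; have [_ _ h _] := viterP n; rewrite h -innerJ.
exists (fun f => f - Y f); split.
- exact/bop_sub/Yb/bop_id.
- by move=> f g; rewrite innerBl innerBr Ysa.
- move=> f; apply/subr0_eq/l2norm_small => e e0.
  have Yo : opbound Y 1 := olim_bound m vo.
  (* Six error terms arise below, each at most e / D times the norm of f, where D is the number
     shown positive here. *)
  have D0 : 0 < 6 * l2norm f + 1 by rewrite ltr_wpDl// mulr_ge0// l2norm_ge0.
  have [N hN] := valpha_lim (divr_gt0 e0 D0).
  have h0 := hN N (leqnn _); have h1 := hN N.+1 (leqnSn _).
  (* (1-Y)^2 - (1-A) = (A + Y_N^2 - 2 Y_N) + (Y - Y_N)(Y - 2) + Y_N (Y - Y_N) + ... *)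
  have -> : f - Y f - Y (f - Y f) - (f - A f) =
      (viter N.+1 f - viter N f) + (viter N.+1 f - viter N f)
      + ((Y (Y f) - viter N (Y f)) + viter N (Y f - viter N f)
      - ((Y f - viter N f) + (Y f - viter N f))).
    have E : viter N.+1 f + viter N.+1 f = A f + viter N (viter N f).
      by rewrite /= -scalerDl -[RHS]scale1r; congr (_ *: _); apply/eqP;
        rewrite eq_complex /= addr0 eqxx andbT; apply/eqP; lra.
    rewrite (bopB Yb) (bopB (vb N)); move: E.
    move: (Y (Y f)) (Y f) (A f) (viter N f) (viter N (viter N f)) (viter N (Y f)).
    move: (viter N.+1 f) => v1 a b c d v g E; apply: l2_ext => x.
    have Ex : c x = v1 x + v1 x - v x.
      by move/(congr1 (fun h : l2 R X => h x)): E; rewrite !l2DE => ->; rewrite addrK.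
    by rewrite !(l2DE, l2NE) Ex; ring.
  have a1 : 0 <= valpha N by have [] := valpha_bound N.
  have k1 := viter_diff N f; have k2 := Yn N (Y f); have k3 := Yn N f.
  have k4 := vo N (Y f - viter N f); have k5 := Yo f.
  have := ler_l2normD ((viter N.+1 f - viter N f) + (viter N.+1 f - viter N f))
    ((Y (Y f) - viter N (Y f)) + viter N (Y f - viter N f)
      - ((Y f - viter N f) + (Y f - viter N f))).
  move=> /le_trans; apply.
  have := ler_l2normD (viter N.+1 f - viter N f) (viter N.+1 f - viter N f).
  have := ler_l2normB ((Y (Y f) - viter N (Y f)) + viter N (Y f - viter N f))
      ((Y f - viter N f) + (Y f - viter N f)).
  have := ler_l2normD (Y (Y f) - viter N (Y f)) (viter N (Y f - viter N f)).
  have := ler_l2normD (Y f - viter N f) (Y f - viter N f).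
  have n0 := l2norm_ge0 f; have [_ /andP[_ u1]] := valpha_bound N.+1.
  have [_ /andP[_ u0]] := valpha_bound N.
  have hf : e / (6 * l2norm f + 1) * (6 * l2norm f) <= e.
    by rewrite mulrAC ler_pdivrMr// ler_pM2l// lerDl.
  move: h0 h1 hf; set E := e / _ => h0 h1 hf.
  have m1 : (valpha N.+1 - valpha N) * l2norm f <= E * l2norm f.
    by rewrite ler_wpM2r//; lra.
  have m2 : (1 - valpha N) * l2norm f <= E * l2norm f by rewrite ler_wpM2r.
  have m3 : (1 - valpha N) * l2norm (Y f) <= (1 - valpha N) * l2norm f.
    by rewrite ler_wpM2l ?subr_ge0//; lra.
  by lra.
- move=> S Sb SA f; rewrite bopB//; congr (_ - _).
  apply: eq_l2_inner => h; rewrite (adjP Sb) !Yi.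
  by apply: eq_cmean => n; have [_ _ _ hc] := viterP n; rewrite -hc// (adjP Sb).
Qed.

End Sqrt.

Lemma sqrt_pos (R : realType) (X : choiceType) (H : l2op R X) :
  bop H -> (forall f, 0 <= inner (H f) f) -> is_adjoint H H ->
  exists L : l2op R X,
  [/\ bop L, is_adjoint L L, forall f, L (L f) = H f &
   forall S, bop S -> (forall f, S (H f) = H (S f)) -> forall f, S (L f) = L (S f)].
Proof.
move=> Hb Hp Hsa; have [c c0 cH] := bop_bound Hb.
(* From 0 <= H <= c it follows that 0 <= A <= 1; the root of H is sqrt c times that of 1 - A. *)
pose A f := f - (c^-1)%:C%C *: H f.
have Ab : bop A by apply: bop_sub; [exact: bop_id|exact: bop_scale].
have Asa : is_adjoint A A.
  by move=> f g; rewrite innerBl innerBr innerZl innerZr conjc_real Hsa.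
have A1 : opbound A 1.
  apply: selfadjoint_bound => // f; rewrite innerBl innerZl ReD ReN ReZ.
  rewrite -l2norm_sqE mul1r; have h0 := ge0_Re (Hp f).
  have h1 : c^-1 * complex.Re (inner (H f) f) <= l2norm f ^+ 2.
    rewrite mulrC ler_pdivrMr// (le_trans (Re_inner_le _ _))// expr2 -mulrA.
    by rewrite [leRHS]mulrCA mulrC ler_wpM2l ?l2norm_ge0// mulrC.
  have h2 : 0 <= c^-1 * complex.Re (inner (H f) f) by rewrite mulr_ge0// invr_ge0 ltW.
  by rewrite ger0_norm; lra.
have [L [Lb Lsa LL Lc]] := sqrt_one_sub Ab Asa A1.
have s2 : Num.sqrt c * Num.sqrt c = c by rewrite -expr2 sqr_sqrtr// ltW.
exists (fun f => (Num.sqrt c)%:C%C *: L f); split.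
- exact: bop_scale.
- by move=> f g; rewrite innerZl innerZr conjc_real Lsa.
- move=> f; rewrite bopZ// scalerA -realCM s2 LL opprB addrC subrK scalerA -realCM.
  by rewrite mulfV ?scale1r// lt0r_neq0.
- move=> S Sb SH f; rewrite bopZ// Lc// => g.
  by rewrite /A bopB// bopZ// SH.
Qed.

(** * Group von Neumann algebras *)

Section Commutants.
Variables (R : realType) (X : choiceType).
Implicit Types (C : set (l2op R X)) (T S : l2op R X).

Lemma commutantP C T :
  commutant C T <-> bop T /\ forall S, C S -> forall f, T (S f) = S (T f).
Proof.
split=> -[Tb TC]; split=> // S CS.
  by move=> f; have /(congr1 (fun U => U f)) := TC S CS.
by apply/funext => f /=; exact: TC.
Qed.

Lemma commutant_id C : commutant C id.
Proof. by apply/commutantP; split=> //; exact: bop_id. Qed.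

Lemma commutant_comp C T S : commutant C T -> commutant C S ->
  commutant C (fun f => T (S f)).
Proof.
move=> /commutantP[Tb TC] /commutantP[Sb SC]; apply/commutantP; split.
  exact: (bop_comp Tb Sb).
by move=> U CU f; rewrite (SC U CU) (TC U CU).
Qed.

Lemma commutant_lin C a T S : C `<=` @bop R X X -> commutant C T -> commutant C S ->
  commutant C (fun f => a *: T f + S f).
Proof.
move=> Cb /commutantP[Tb TC] /commutantP[Sb SC]; apply/commutantP; split.
  exact: bop_lin.
by move=> U CU f; rewrite (Cb U CU).1 (SC U CU) (TC U CU).
Qed.

Lemma commutant_adj C T : C `<=` @bop R X X ->
  (forall S, C S -> C (adj S)) -> commutant C T -> commutant C (adj T).
Proof.
move=> Cb Ca /commutantP[Tb TC]; apply/commutantP; split; first exact: bop_adj.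
move=> S CS f; apply: eq_l2_inner => h; have Sb := Cb S CS.
by rewrite (adjPr Tb) !(adjP Sb) (adjPr Tb) (TC _ (Ca S CS)).
Qed.

Lemma commutant_olim C (I : Type) (m : mean R I) (T : I -> l2op R X) c :
  C `<=` @bop R X X -> (forall i, opbound (T i) c) ->
  (forall i, commutant C (T i)) -> commutant C (olim m T).
Proof.
move=> Cb Tc TC; have Tl i : linear (T i) by have /commutantP[[]] := TC i.
apply/commutantP; split; first exact: (bop_olim m Tc Tl).
move=> S CS f; have Sb := Cb S CS; apply: eq_l2_inner => h.
rewrite (adjP Sb) !(inner_olim _ Tc); apply: eq_cmean => i.
by have /commutantP[_ ->//] := TC i; rewrite (adjP Sb).
Qed.

End Commutants.

Section VonNeumann.
Variables (R : realType) (X : choiceType) (Q : set (l2op R X)).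
Hypothesis Qv : von_neumann_algebra Q.

Lemma vna_bop T : Q T -> bop T.
Proof. by move=> QT; have [h _ _] := Qv; exact: h. Qed.

Lemma vnaP T : Q T <-> commutant (commutant Q) T.
Proof. by have [_ _ ->] := Qv. Qed.

Lemma commutant_bop (C : set (l2op R X)) : commutant C `<=` @bop R X X.
Proof. by move=> T /commutantP[]. Qed.

Lemma vna_id : Q id.
Proof. exact/vnaP/commutant_id. Qed.

Lemma vna_comp T S : Q T -> Q S -> Q (fun f => T (S f)).
Proof. by move=> /vnaP QT /vnaP QS; exact/vnaP/commutant_comp. Qed.

Lemma vna_lin a T S : Q T -> Q S -> Q (fun f => a *: T f + S f).
Proof.
by move=> /vnaP QT /vnaP QS; apply/vnaP/commutant_lin => //; exact: commutant_bop.
Qed.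

Lemma vna_sub T S : Q T -> Q S -> Q (fun f => T f - S f).
Proof.
move=> QT QS; have := vna_lin (-1) QS QT; congr (Q _).
by apply/funext => f; rewrite scaleN1r addrC.
Qed.

Lemma vna_add T S : Q T -> Q S -> Q (fun f => T f + S f).
Proof.
move=> QT QS; have := vna_lin 1 QT QS; congr (Q _).
by apply/funext => f; rewrite scale1r.
Qed.

Lemma vna_scale a T : Q T -> Q (fun f => a *: T f).
Proof.
move=> QT; have Q0 := vna_sub QT QT; have := vna_lin a QT Q0; congr (Q _).
by apply/funext => f; rewrite subrr addr0.
Qed.

Lemma vna_adj T : Q T -> Q (adj T).
Proof.
move=> QT; have [_ /(_ T QT)[S QS TS] _] := Qv.
suff -> : adj T = S by [].
by apply/funext => f; rewrite (adj_unique (vna_bop QT) TS).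
Qed.

Lemma vna_olim (I : Type) (m : mean R I) (T : I -> l2op R X) c :
  (forall i, opbound (T i) c) -> (forall i, Q (T i)) -> Q (olim m T).
Proof.
move=> Tc QT; apply/vnaP; apply: (commutant_olim m (@commutant_bop Q) Tc) => i.
exact/vnaP/QT.
Qed.

End VonNeumann.

Section GroupVna.
Variables (R : realType) (G : groupType).
Implicit Types (g h s t : G) (f : l2 R G) (a b : l2op R G).

Notation lam := (@left_regular R G).
Notation M := (group_vna R G).
Notation d0 := (delta R (1%g : G)).

Definition right_regular g : l2op R G := pull (fun s => (s * g)%g).
Notation rho := right_regular.

Lemma lamE g f h : lam g f h = f (g^-1 * h)%g. Proof. by []. Qed.

Lemma rhoE g f h : rho g f h = f (h * g)%g.
Proof. by apply: pullE => x y; exact: mulIg. Qed.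

Let lcan g : cancel (fun h => g^-1 * h)%g (fun h => g * h)%g.
Proof. by move=> h; rewrite mulVKg. Qed.
Let lcan' g : cancel (fun h => g * h)%g (fun h => g^-1 * h)%g.
Proof. by move=> h; rewrite mulKg. Qed.
Let rcan g : cancel (fun h => h * g)%g (fun h => h * g^-1)%g.
Proof. by move=> h; rewrite mulgK. Qed.
Let rcan' g : cancel (fun h => h * g^-1)%g (fun h => h * g)%g.
Proof. by move=> h; rewrite mulgVK. Qed.

Lemma lam_pull g : lam g = pull (fun h => (g^-1 * h)%g).
Proof.
apply/funext => f; apply: l2_ext => h; rewrite lamE pullE//.
exact: (can_inj (lcan g)).
Qed.

Lemma bop_lam g : bop (lam g).
Proof. by rewrite lam_pull; apply: bop_pull; exact: (can_inj (lcan g)). Qed.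

Lemma bop_rho g : bop (rho g).
Proof. by apply: bop_pull; exact: (can_inj (rcan g)). Qed.

Lemma lam_delta g h : lam g (delta R h) = delta R (g * h)%g.
Proof. by rewrite lam_pull (pull_delta _ (lcan g) (lcan' g)). Qed.

Lemma rho_delta g h : rho g (delta R h) = delta R (h * g^-1)%g.
Proof. exact: (pull_delta _ (rcan g) (rcan' g)). Qed.

Lemma rho_d0 g : rho g^-1 d0 = delta R g.
Proof. by rewrite rho_delta mul1g invgK. Qed.

Lemma lamM g h f : lam g (lam h f) = lam (g * h)%g f.
Proof. by apply: l2_ext => s; rewrite !lamE invgM mulgA. Qed.

Lemma lam1 f : lam 1%g f = f.
Proof. by apply: l2_ext => s; rewrite lamE invg1 mul1g. Qed.

Lemma lam_rho g h f : lam g (rho h f) = rho h (lam g f).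
Proof. by apply: l2_ext => s; rewrite lamE !rhoE lamE mulgA. Qed.

Lemma l2norm_lam g f : l2norm (lam g f) = l2norm f.
Proof. by rewrite lam_pull (l2norm_pull_bij (lcan g) (lcan' g)). Qed.

Lemma inner_lam g f f' : inner (lam g f) f' = inner f (lam g^-1 f').
Proof.
rewrite !lam_pull invgK; exact: (inner_pull_adj (lcan g) (lcan' g)).
Qed.

Lemma inner_rho g f f' : inner (rho g f) f' = inner f (rho g^-1 f').
Proof. exact: (inner_pull_adj (rcan g) (rcan' g)). Qed.

(** The commutation theorem for the two regular representations, by matrix coefficients: those of a
    b and of b a are sums of the same products, matched by the substitution r -> t r^-1 s. *)
Lemma commutation a b : bop a -> bop b ->
  (forall g f, a (rho g f) = rho g (a f)) ->
  (forall g f, b (lam g f) = lam g (b f)) -> forall f, a (b f) = b (a f).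
Proof.
move=> ab bb ac bc; apply: bop_ext => [||s].
- exact: (bop_comp ab bb).
- exact: (bop_comp bb ab).
have aE r t : a (delta R r) t = a d0 (t * r^-1)%g.
  by rewrite -{1}(rho_d0 r) ac rhoE.
have bE r t : b (delta R r) t = b d0 (r^-1 * t)%g.
  by rewrite -{1}(mulg1 r) -lam_delta bc lamE.
apply: l2_ext => t; rewrite -!inner_delta (adjP ab) [RHS](adjP bb).
apply: (@inner_reindex _ _ _ (fun r => t * r^-1 * s)%g (fun r => s * r^-1 * t)%g).
- by move=> r; rewrite !invgM invgK !mulgA mulgV mul1g mulgVK.
- by move=> r; rewrite !invgM invgK !mulgA mulgV mul1g mulgVK.
move=> r; rewrite (adjE ab) (adjE bb) !inner_deltal !conjcK mulrC (aE r) (bE s) (aE s) (bE (t * r^-1 * s)%g).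
by rewrite mulgK invgM invgM invgK -!mulgA mulVg mulg1.
Qed.

Lemma rho_commutant g : commutant (range lam) (rho g).
Proof.
apply/commutantP; split; first exact: bop_rho.
by move=> _ [h _ <-] f; rewrite lam_rho.
Qed.

(** L(G) is the commutant of the right translations, which makes membership a direct test. *)
Lemma group_vnaP a : M a <-> bop a /\ forall g f, a (rho g f) = rho g (a f).
Proof.
split=> [/commutantP[ab aM]|[ab ac]].
  by split=> // g f; apply: aM; exact: rho_commutant.
apply/commutantP; split=> // b /commutantP[bb bc] f.
apply: (commutation ab bb ac) => g f'; apply: (bc (lam g)).
by exists g.
Qed.

Lemma group_vna_vna : von_neumann_algebra M.
Proof.
split.
- by move=> a /group_vnaP[].
- move=> a /group_vnaP[ab ac]; exists (adj a); last exact: is_adjoint_adj.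
  apply/group_vnaP; split; first exact: bop_adj.
  move=> g f; apply: eq_l2_inner => h.
  by rewrite (adjPr ab) 2!inner_rho (adjPr ab) ac.
- apply/seteqP; split=> a.
    move=> /commutantP[ab ac]; apply/group_vnaP; split=> // g f; apply: ac.
    apply/commutantP; split; first exact: bop_rho.
    by move=> b /group_vnaP[_ bc] f'; rewrite bc.
  move=> Ma; apply/commutantP; split; first by have /group_vnaP[] := Ma.
  by move=> b /commutantP[_ bc] f; rewrite bc.
Qed.

Lemma lam_group_vna g : M (lam g).
Proof. by apply/group_vnaP; split=> [|h f]; [exact: bop_lam|exact: lam_rho]. Qed.

Lemma group_vna_delta a g : M a -> a (delta R g) = rho g^-1 (a d0).
Proof. by move=> /group_vnaP[_ ac]; rewrite -ac rho_d0. Qed.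

Lemma group_vna_ext a b : M a -> M b -> a d0 = b d0 -> forall f, a f = b f.
Proof.
move=> Ma Mb ab; apply: bop_ext => [||g].
- by have /group_vnaP[] := Ma.
- by have /group_vnaP[] := Mb.
- by rewrite (group_vna_delta g Ma) (group_vna_delta g Mb) ab.
Qed.

(** Both sides are the sum over r of a(r^-1) b(r), where a(r) and b(r) denote the coordinates of a
    d0 and b d0. *)
Lemma traceC a b : M a -> M b -> inner (a (b d0)) d0 = inner (b (a d0)) d0.
Proof.
move=> /[dup] Ma /group_vnaP[ab _] /[dup] Mb /group_vnaP[bb _].
rewrite [LHS](adjP ab) [RHS](adjP bb).
apply: (@inner_reindex _ _ _ (fun r : G => r^-1)%g (fun r : G => r^-1)%g).
- exact: invgK.
- exact: invgK.
move=> r; rewrite (adjE ab) (adjE bb) !inner_deltal !conjcK.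
rewrite (group_vna_delta r Ma) (group_vna_delta r^-1%g Mb) !rhoE !mul1g invgK.
exact: mulrC.
Qed.

Lemma l2norm_mul_unitary a u v : M a -> M u -> M v -> is_adjoint u v ->
  (forall f, u (v f) = f) -> l2norm (a (u d0)) = l2norm (a d0).
Proof.
move=> Ma Mu Mv uv uvK; have Mva := group_vna_vna.
have ab : bop a by have /group_vnaP[] := Ma.
apply/eqP; rewrite -(@eqrXn2 _ 2) ?l2norm_ge0// !l2norm_sqE; apply/eqP.
congr complex.Re; rewrite -[in LHS](adjPr ab) -[in RHS](adjPr ab).
rewrite -(is_adjoint_sym uv).
have Mw : M (fun f => adj a (a (u f))).
  by apply: (vna_comp Mva (vna_adj Mva Ma)); exact: (vna_comp Mva Ma Mu).
by have := traceC Mv Mw; rewrite /= uvK.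
Qed.

(** By traciality <V W d0, d0> = 1, and V W d0 has norm 1; hence V W d0 = d0, and this vector
    separates L(G). *)
Lemma group_vna_finite : finite_vna M.
Proof.
move=> V W MV MW VW WV; have Mva := group_vna_vna.
have Vb := vna_bop Mva MV; have Wb := vna_bop Mva MW.
have WVf f : W (V f) = f by have := congr1 (fun T => T f) WV.
have MP := vna_comp Mva MV MW.
have t1 : inner (V (W d0)) d0 = 1.
  by rewrite (traceC MV MW) WVf inner_delta deltaE eqxx.
suff z : V (W d0) = d0.
  by apply/funext => f; exact: (group_vna_ext MP (vna_id Mva)).
apply/subr0_eq/l2norm_eq0/eqP; rewrite -sqrf_eq0 l2norm_sqB.
have -> : l2norm (V (W d0)) ^+ 2 = 1.
  by rewrite l2norm_sqE VW WVf -VW t1.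
by rewrite l2norm_delta t1 /= expr1n; apply/eqP; ring.
Qed.

End GroupVna.

Lemma nat_mean (R : realType) :
  exists m : mean R nat, tail_pos (fun i j => (i <= j)%N) m.
Proof.
apply: (@directed_mean R _ (fun i j => (i <= j)%N) 0%N) => //.
  by move=> x y z; exact: leq_trans.
by move=> x y; exists (maxn x y); rewrite leq_maxl leq_maxr.
Qed.

(** * Diffuse subalgebras *)

Section Unitaries.
Variables (R : realType) (X : choiceType) (Q : set (l2op R X)).
Hypothesis Qv : von_neumann_algebra Q.

(** A unitary bundled with its inverse, so that conjugations by it can be written without [adj]. *)
Definition unitary_pair (u v : l2op R X) :=
  [/\ is_adjoint u v, forall f, u (v f) = f & forall f, v (u f) = f].

Lemma unitary_pair_sym u v : unitary_pair u v -> unitary_pair v u.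
Proof. by move=> [uv h1 h2]; split=> //; exact: is_adjoint_sym. Qed.

Variable T : l2op R X.
Hypothesis Tb : bop T.
Hypothesis TU : forall u v, Q u -> Q v -> unitary_pair u v ->
  forall f, T (u f) = u (T f).

Let ii : R[i] := Complex 0 1.
Let iiJ : ii^*%C = - ii.
Proof. by rewrite /ii; apply/eqP; rewrite eq_complex /= oppr0 !eqxx. Qed.
Let ii2 : ii * ii = -1.
Proof.
by rewrite /ii; apply/eqP; rewrite eq_complex /= !mul0r !mulr0 mul1r sub0r addr0 oppr0 !eqxx.
Qed.
Let ii0 : ii != 0.
Proof. by apply/eqP => i0; have /eqP := ii2; rewrite i0 mul0r eq_sym oppr_eq0 oner_eq0. Qed.

(** A self-adjoint contraction x is the half-sum of the unitaries x + i L and x - i L with L a root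
    of 1 - x^2; L belongs to [Q] because it commutes with everything that commutes with x^2. *)
Let comm_contraction x : Q x -> is_adjoint x x -> opbound x 1 ->
  forall f, T (x f) = x (T f).
Proof.
move=> Qx xx x1; have xb := vna_bop Qv Qx.
have [|||L [Lb LL L2 Lc]] := @sqrt_one_sub R X (fun f => x (x f)).
- exact: (bop_comp xb xb).
- by move=> f g; rewrite !xx.
- by move=> f; have := x1 f; have := x1 (x f); rewrite !mul1r; exact: le_trans.
have QL : Q L.
  apply/(vnaP Qv)/commutantP; split=> // S /commutantP[Sb SQ] f.
  by rewrite -Lc// => g; rewrite !(SQ _ Qx).
have xL f : x (L f) = L (x f) by rewrite Lc.
have Qu := vna_lin Qv ii QL Qx; have Qv' := vna_lin Qv (- ii) QL Qx.
have uv : unitary_pair (fun f => ii *: L f + x f) (fun f => - ii *: L f + x f).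
  split=> f.
  - by move=> g; rewrite innerDl innerDr innerZl innerZr conjcN iiJ opprK LL xx.
  - rewrite (bopD Lb) (bopZ Lb) (bopD xb) (bopZ xb) L2 xL.
    move: (x (x f)) (L (x f)) => y z; apply: l2_ext => t.
    rewrite !(l2DE, l2ZE, l2NE).
    rewrite (_ : _ + _ = - (ii * ii) * (f t - y t) + y t); last by ring.
    by rewrite ii2; ring.
  - rewrite (bopD Lb) (bopZ Lb) (bopD xb) (bopZ xb) L2 xL.
    move: (x (x f)) (L (x f)) => y z; apply: l2_ext => t.
    rewrite !(l2DE, l2ZE, l2NE).
    rewrite (_ : _ + _ = - (ii * ii) * (f t - y t) + y t); last by ring.
    by rewrite ii2; ring.
have h1 := TU Qu Qv' uv; have h2 := TU Qv' Qu (unitary_pair_sym uv).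
move=> f; have := h1 f; have := h2 f; rewrite !(bopD Tb) !(bopZ Tb).
move: (T (L f)) (T (x f)) (L (T f)) (x (T f)) => a b c d e1 e2.
apply: l2_ext => t; have := congr1 (fun h : l2 R X => h t) e1.
have := congr1 (fun h : l2 R X => h t) e2; rewrite !(l2DE, l2ZE).
move: (a t) (b t) (c t) (d t) => {a b c d e1 e2} a b c d e1 e2.
have two : (2%:R : R[i]) != 0 by rewrite pnatr_eq0.
apply: (mulfI two); rewrite !mulr_natl !mulr2n.
have := congr2 +%R e1 e2; rewrite !mulNr addrACA subrr add0r => ->.
by rewrite addrACA subrr add0r.
Qed.

Let comm_selfadjoint x : Q x -> is_adjoint x x -> forall f, T (x f) = x (T f).
Proof.
move=> Qx xx f; have xb := vna_bop Qv Qx; have [c c0 cx] := bop_bound xb.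
have cV0 : (c^-1)%:C%C != 0 :> R[i].
  by rewrite eq_complex /= negb_and invr_eq0 lt0r_neq0.
have := @comm_contraction _ (vna_scale Qv (c^-1)%:C%C Qx).
move=> /(_ _ _ f); rewrite (bopZ Tb) => h; apply: (scalerI cV0); apply: h.
  by move=> g h; rewrite innerZl innerZr conjc_real xx.
move=> g; rewrite l2normZ normc_real ger0_norm ?invr_ge0 ?(ltW c0)// mulrC mul1r.
by rewrite ler_pdivrMr// mulrC; exact: cx.
Qed.

(** Self-adjoint elements are scaled to contractions, and a general element is recovered from its
    sum with its adjoint and from i times the difference. *)
Lemma commute_unitaries : commutant Q T.
Proof.
apply/commutantP; split=> // y Qy f; have yb := vna_bop Qv Qy.
have Qa := vna_adj Qv Qy; have ya := is_adjoint_adj yb.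
have ay := is_adjoint_sym ya.
have h1 := comm_selfadjoint (vna_add Qv Qy Qa).
have h2 := comm_selfadjoint (vna_scale Qv ii (vna_sub Qv Qy Qa)).
have {}h1 : T (y f) + T (adj y f) = y (T f) + adj y (T f).
  rewrite -(bopD Tb); apply: h1 => g h.
  by rewrite innerDl innerDr ya ay addrC.
have {}h2 : T (y f) - T (adj y f) = y (T f) - adj y (T f).
  apply: (scalerI ii0); rewrite -(bopB Tb) -(bopZ Tb); apply: h2 => g h.
  by rewrite innerZl innerZr iiJ innerBl innerBr ya ay; ring.
move: (T (y f)) (T (adj y f)) (y (T f)) (adj y (T f)) h1 h2 => a b c d h1 h2.
apply: l2_ext => t; have := congr1 (fun h : l2 R X => h t) h1.
have := congr1 (fun h : l2 R X => h t) h2; rewrite !(l2DE, l2NE).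
move: (a t) (b t) (c t) (d t) => {a b c d h1 h2} a b c d e1 e2.
have two : (2%:R : R[i]) != 0 by rewrite pnatr_eq0.
apply: (mulfI two); rewrite !mulr_natl !mulr2n.
have := congr2 +%R e1 e2; rewrite addrACA [- b + b]addrC subrr addr0 => ->.
by rewrite addrACA [- d + d]addrC subrr addr0.
Qed.

End Unitaries.

Section SmallUnitary.
Variables (R : realType) (G : groupType) (Q : set (l2op R G)).
Hypothesis Qv : von_neumann_algebra Q.
Hypothesis QM : Q `<=` group_vna R G.
Hypothesis Qd : diffuse Q.
Notation d0 := (delta R (1%g : G)).
Notation tau p := (l2norm (p d0) ^+ 2).
Implicit Types p q r : l2op R G.

Definition proj_in p :=
  [/\ Q p, forall f, p (p f) = p f & is_adjoint p p].

Definition subproj q p := (forall f, p (q f) = q f) /\ (forall f, q (p f) = q f).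

Let d0_ext p q : Q p -> Q q -> p d0 = q d0 -> p = q.
Proof.
by move=> /QM Mp /QM Mq pq; apply/funext; exact: (group_vna_ext Mp Mq pq).
Qed.

Let subprojP p q : proj_in p -> proj_in q -> (forall f, p (q f) = q f) -> subproj q p.
Proof.
move=> [Qp _ pp] [Qq _ qq] pq; split=> // f; apply: eq_l2_inner => h.
by rewrite qq pp pq -qq.
Qed.

Let proj_sub p q : proj_in p -> proj_in q -> subproj q p ->
  proj_in (fun f => p f - q f).
Proof.
move=> [Qp p2 pp] [Qq q2 qq] [pq qp].
have pb := vna_bop Qv Qp; have qb := vna_bop Qv Qq; split.
- exact: vna_sub.
- by move=> f; rewrite (bopB pb) (bopB qb) p2 pq qp q2 subrr subr0.
- by move=> f g; rewrite innerBl innerBr pp qq.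
Qed.

Let tau_sub p q f : proj_in p -> proj_in q -> subproj q p ->
  l2norm (p f - q f) ^+ 2 = l2norm (p f) ^+ 2 - l2norm (q f) ^+ 2.
Proof.
move=> [Qp p2 pp] [Qq q2 qq] [pq qp]; rewrite l2norm_sqB.
have -> : complex.Re (inner (p f) (q f)) = l2norm (q f) ^+ 2.
  by rewrite l2norm_sqE pp pq qq q2.
ring.
Qed.

(** As p is not minimal, it has a subprojection q other than 0 and p, and one of q and p - q has at
    most half of the trace [tau p]. *)
Lemma halve_projection p : proj_in p -> p d0 <> 0 ->
  exists q, [/\ proj_in q, subproj q p, q d0 <> 0 & tau q <= tau p / 2].
Proof.
move=> pP p0; have [Qp p2 pp] := pP; have pb := vna_bop Qv Qp.
have [q [[Qq qproj pq] [q0 qp]]] : exists q,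
    [/\ Q q, projection q & p \o q = q] /\ q <> 0 /\ q <> p.
  apply: contrapT => /forallNP h; apply: (Qd (p := p)); split => //.
  - split => //; exact/funext.
  - by move=> p00; apply: p0; rewrite p00.
  - move=> q Qq qproj pq; have [->|q0] := pselect (q = 0); first by left.
    right; apply: contrapT => qp; exact: (h q).
have qP : proj_in q.
  by case: qproj => _ q2 qq; split => // f; have := congr1 (fun T => T f) q2.
have sq : subproj q p.
  by apply: subprojP => // f; have := congr1 (fun T => T f) pq.
have nz r : proj_in r -> r <> 0 -> r d0 <> 0.
  move=> [Qr _ _] r0 rd; apply: r0.
  have Q0 : Q (fun=> 0).
    have := vna_sub Qv (vna_id Qv) (vna_id Qv); congr (Q _).
    by apply/funext => f; rewrite subrr.
  exact: (d0_ext Qr Q0 rd).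
have tE := tau_sub d0 pP qP sq.
have [h|h] := lerP (tau q) (tau p / 2); first by exists q; split => //; exact: nz.
exists (fun f => p f - q f); split; first exact: proj_sub.
- split=> f.
    by rewrite (bopB pb) p2; have [-> _] := sq.
  by have [_ q2 _] := qP; rewrite p2; have [_ ->] := sq.
- move=> /subr0_eq /(d0_ext Qp Qq) pqE; exact/qp/esym.
- by rewrite tE; lra.
Qed.

Lemma small_projection p e : proj_in p -> p d0 <> 0 -> 0 < e ->
  exists q, [/\ proj_in q, subproj q p, q d0 <> 0 & tau q <= e].
Proof.
move=> pP p0 e0.
have H n : exists q, [/\ proj_in q, subproj q p, q d0 <> 0 & tau q <= 2^-1 ^+ n * tau p].
  elim: n => [|n [q [qP [s1 s2] q0 qt]]].
    by exists p; have [_ p2 _] := pP; split => //; rewrite mul1r.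
  have [r [rP [t1 t2] r0 rt]] := halve_projection qP q0.
  exists r; split => //.
    split=> f; first by rewrite -t1 s1 t1.
    by rewrite -t2 s2 t2.
  have -> : 2^-1 ^+ n.+1 * tau p = (2^-1 ^+ n * tau p) / 2 by rewrite exprS; ring.
  by lra.
have [N Ne] : exists N, 2^-1 ^+ N * tau p <= e.
  have : (fun n : nat => 2^-1 ^+ n : R) @ \oo --> (0 : R).
    by apply: cvg_expr; rewrite ger0_norm; lra.
  have t0 : 0 < tau p + 1 by rewrite ltr_wpDl// sqr_ge0.
  move=> /cvgrPdist_le /(_ _ (divr_gt0 e0 t0))[N _ NP]; exists N.
  have := NP N (leqnn _); rewrite sub0r normrN ger0_norm ?exprn_ge0//.
  move=> h; apply: (@le_trans _ _ (e / (tau p + 1) * tau p)).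
    by rewrite ler_wpM2r// sqr_ge0.
  by rewrite mulrAC ler_pdivrMr// ler_pM2l// lerDl.
have [q [? ? ? qt]] := H N; exists q; split => //; exact: le_trans qt Ne.
Qed.

Let vna_zero : Q (fun=> 0).
Proof.
have := vna_sub Qv (vna_id Qv) (vna_id Qv); congr (Q _).
by apply/funext => f; rewrite subrr.
Qed.

Let proj_zero : proj_in (fun=> 0).
Proof. by split => // f g; rewrite inner0l inner0r. Qed.

Let proj_le1 p f : proj_in p -> l2norm (p f) <= l2norm f.
Proof.
move=> [_ p2 pp]; have [p0|p0] := eqVneq (l2norm (p f)) 0.
  by rewrite p0 l2norm_ge0.
have h : 0 < l2norm (p f) by rewrite lt_def p0 l2norm_ge0.
rewrite -(ler_pM2l h) -expr2 l2norm_sqE pp p2 innerJ ReJ.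
exact: Re_inner_le.
Qed.

(** [rq n] consists of the remainder after n steps and of the piece removed next. Each piece has at
    least half of the supremum of the admissible traces. If the limit of the remainders were
    nonzero, it would contain a nonzero projection of trace at most e, and the traces of all pieces
    would stay bounded below, against the total trace 1. *)
Lemma exhaustion e : 0 < e -> exists rq : nat -> l2op R G * l2op R G, exists N,
  [/\ forall f, (rq 0%N).1 f = f,
      forall n, [/\ proj_in (rq n).1, proj_in (rq n).2, subproj (rq n).2 (rq n).1 &
        tau (rq n).2 <= e],
      forall n f, (rq n.+1).1 f = (rq n).1 f - (rq n).2 f &
      tau (rq N).1 <= e].
Proof.
move=> e0.
have stepE r : exists q, proj_in r -> [/\ proj_in q, subproj q r, tau q <= e &
    forall q', proj_in q' -> subproj q' r -> tau q' <= e -> tau q' <= 2 * tau q].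
  have [rP|//] := pselect (proj_in r); last by exists id.
  pose S := [set t | exists q, [/\ proj_in q, subproj q r, tau q <= e & t = tau q]].
  have [Qr _ _] := rP; have rb := vna_bop Qv Qr.
  have S0 : S 0.
    exists (fun=> 0); split => //; first by split => f; rewrite ?(bop0 rb).
      by rewrite l2norm0 expr0n ltW.
    by rewrite l2norm0 expr0n.
  have hS : has_sup S.
    by split; [exists 0|exists e => _ [q [_ _ ? ->]]].
  have [s0|s0] := eqVneq (sup S) 0.
    exists (fun=> 0) => _; split => //; first by split => f; rewrite ?(bop0 rb).
      by rewrite l2norm0 expr0n ltW.
    move=> q' q'P q'r q'e; rewrite l2norm0 expr0n mulr0 -s0.
    by apply: (sup_upper_bound hS); exists q'.
  have sp : 0 < sup S by rewrite lt_def s0 (sup_upper_bound hS).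
  have [_ [q [qP qr qe ->]] hq] := sup_adherent (divr_gt0 sp (ltr0n R 2)) hS.
  exists q => _; split => // q' q'P q'r q'e.
  have : tau q' <= sup S by apply: (sup_upper_bound hS); exists q'.
  by lra.
have [next nextP] := choice stepE.
pose rr n := iter n (fun r f => r f - next r f) (@id (l2 R G)).
have rP n : proj_in (rr n).
  elim: n => [|n IH]; first by split => //; exact: vna_id.
  by have [qP qr _ _] := nextP _ IH; exact: proj_sub.
have qP n := nextP _ (rP n).
have rS n f : rr n.+1 f = rr n f - next (rr n) f by [].
have rdec n k f : rr n (rr (n + k)%N f) = rr (n + k)%N f.
  elim: k f => [|k IH] f; first by rewrite addn0; have [_ ->] := rP n.
  have [Qr _ _] := rP n; have [_ [qr1 _] _ _] := qP (n + k)%N.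
  rewrite addnS rS (bopB (vna_bop Qv Qr)) IH; congr (_ - _).
  by rewrite -qr1 IH.
have tS n : tau (rr n.+1) = tau (rr n) - tau (next (rr n)).
  by have [h1 h2 _ _] := qP n; rewrite -tau_sub.
have [m mt] := nat_mean R.
have r1 n : opbound (rr n) 1 by move=> f; rewrite mul1r proj_le1.
have rl n : linear (rr n) by have [Qr _ _] := rP n; have [] := vna_bop Qv Qr.
pose r := olim m rr.
have ri f g : inner (r f) g = cmean m (fun n => inner (rr n f) g) by exact: inner_olim.
have rbd f g : cbdd (fun n => inner (rr n f) g) by exact: cbdd_olim.
have rnr n f : rr n (r f) = r f.
  have [Qr _ rsa] := rP n; apply: eq_l2_inner => h; rewrite rsa !ri.
  apply: (ctail_eq mt) => // d d0'; exists n => k nk.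
  by rewrite -rsa -(subnKC nk) rdec subrr normc0 ltW.
have rPP : proj_in r.
  split.
  - by apply: (vna_olim Qv m r1) => n; have [] := rP n.
  - move=> f; apply: eq_l2_inner => h; rewrite ri -[RHS](cmean_cst m).
    by apply: eq_cmean => n; rewrite rnr.
  - move=> f g; rewrite (innerJ _ f) !ri -cmeanJ//; apply: eq_cmean => n.
    by have [_ _ ->] := rP n; rewrite -innerJ.
have rsub n : subproj r (rr n) by apply: subprojP => // f; exact: rnr.
have r0 : r d0 = 0.
  apply: contrapT => rd0; have [q [qp [qr1 qr2] qd0 qe]] := small_projection rPP rd0 e0.
  have qpos : 0 < tau q.
    by rewrite lt_def sqr_ge0 andbT sqrf_eq0; apply/eqP => /l2norm_eq0.
  have h n : tau q / 2 <= tau (next (rr n)).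
    have [_ _ _ H] := qP n.
    have : tau q <= 2 * tau (next (rr n)).
      apply: H => //; split=> f; first by rewrite -qr1 rnr.
      by rewrite -qr2; have [_ ->] := rsub n; rewrite qr2.
    by lra.
  have tn n : tau (rr n) <= 1 - n%:R * (tau q / 2).
    elim: n => [|n IH]; first by rewrite mul0r subr0 /= l2norm_delta expr1n.
    by rewrite tS -[n.+1]addn1 natrD mulrDl mul1r; have := h n; lra.
  pose N := Num.bound (2 / tau q).
  have : 2 / tau q < N%:R by apply: archi_boundP; rewrite divr_ge0// ltW.
  rewrite ltr_pdivrMr// => hN; have := tn N; have := sqr_ge0 (l2norm (rr N d0)).
  by rewrite mulrA; lra.
(* Otherwise the mean of the traces of the remainders would be at least e, whereas it is the trace
   of their limit, which is 0. *)
have [N hN] : exists N, tau (rr N) <= e.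
  apply: contrapT => /forallNP h.
  have : e%:C%C <= cmean m (fun n => inner (rr n d0) d0).
    rewrite -[X in X <= _](cmean_cst m) -subr_ge0 -cmeanB//; last exact: cbdd_cst.
    apply: cmean_ge0; first exact/cbddB/cbdd_cst.
    move=> n; have [_ r2 rsa] := rP n.
    rewrite -r2 rsa inner_self -realCB ler0c subr_ge0.
    by have /negP := h n; rewrite -ltNge => /ltW.
  by rewrite -ri r0 inner0l lecR leNgt e0.
exists (fun n => (rr n, next (rr n))), N; split=> //= n.
by have [? ? ? _] := qP n; split.
Qed.

(** By the parallelogram law the masses for the two signs average to exactly the sum of the two
    masses. *)
Let sqs_sign (S : {fset G}) (f g : l2 R G) : exists c : R[i],
  [/\ c^*%C = c, c * c = 1 & sqs (f + c *: g : l2 R G) S <= sqs f S + sqs g S].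
Proof.
have par : sqs (f + g : l2 R G) S + sqs (f - g : l2 R G) S = 2 * sqs f S + 2 * sqs g S.
  rewrite /sqs -big_split 2!mulr_sumr -big_split; apply: eq_bigr => x _.
  rewrite !sqr_normcE !(l2DE, l2NE).
  by case: (f x) => a b; case: (g x) => c d /=; ring.
have [h|h] := lerP (sqs (f + g : l2 R G) S) (sqs f S + sqs g S).
  by exists 1; rewrite conjc1 mulr1 scale1r.
by exists (-1); rewrite conjcN conjc1 mulrNN mulr1 scaleN1r; split => //; lra.
Qed.

Let sqs_proj (S : {fset G}) q : proj_in q ->
  sqs (q d0) S <= tau q * \sum_(t <- S) l2norm (q (delta R t)) ^+ 2.
Proof.
move=> [_ q2 qq]; rewrite /sqs mulr_sumr ler_sum// => t _.
have -> : q d0 t = inner (q d0) (q (delta R t)) by rewrite -qq q2 inner_delta.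
rewrite -exprMn ler_sqr ?nnegrE ?normc_ge0 ?mulr_ge0 ?l2norm_ge0//.
exact: cauchy_schwarz.
Qed.

(** The unitary is a signed sum of the pieces of [exhaustion], the last remainder being the final
    piece. The signs are chosen so that the masses on [S] at most add up. A piece q contributes at
    most its trace times the sum over t in [S] of the squared norms of q delta_t, and for each t
    these squared norms add up to 1. *)
Lemma small_unitary (S : {fset G}) e : 0 < e -> exists u,
  [/\ Q u, is_adjoint u u, forall f, u (u f) = f & sqs (u d0) S <= e].
Proof.
move=> e0; pose K := (size S)%:R + 1 : R.
have K0 : 0 < K by rewrite ltr_wpDl.
have [rq [N [r0 rP rS rN]]] := exhaustion (divr_gt0 e0 K0).
pose r n := (rq n).1; pose q n := (rq n).2.
pose mass r' := \sum_(t <- S) (1 - l2norm (r' (delta R t)) ^+ 2).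
(* one greedy step: adding +-q, where q <= r *)
have step u r' q' : Q u -> is_adjoint u u -> (forall f, u (u f) = f - r' f) ->
    (forall f, u (r' f) = 0) -> proj_in r' -> proj_in q' -> subproj q' r' ->
    tau q' <= e / K -> sqs (u d0) S <= e / K * mass r' ->
    exists u', [/\ Q u', is_adjoint u' u', forall f, u' (u' f) = f - (r' f - q' f),
      forall f, u' (r' f - q' f) = 0 &
      sqs (u' d0) S <= e / K * mass (fun f => r' f - q' f)].
  move=> Qu uu u2 ur rP' qP' [rq' qr'] qe um.
  have [c [cJ c2 cS]] := sqs_sign S (u d0) (q' d0).
  have ub := vna_bop Qv Qu; have [Qr r2 rr] := rP'; have [Qq q2 qq] := qP'.
  have qb := vna_bop Qv Qq; have rb := vna_bop Qv Qr.
  have uq f : u (q' f) = 0 by rewrite -rq' ur.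
  have qu f : q' (u f) = 0.
    by apply: eq_l2_inner => h; rewrite qq uu uq inner0r inner0l.
  have Qu' := vna_lin Qv c Qq Qu.
  exists (fun f => c *: q' f + u f); split => //.
  - by move=> f g; rewrite innerDl innerDr innerZl innerZr cJ uu qq.
  - move=> f; rewrite (bopD qb) (bopD ub) (bopZ qb) (bopZ ub) uq qu scaler0 addr0 add0r.
    by rewrite q2 scalerA c2 scale1r u2 opprB addrCA.
  - move=> f; rewrite (bopB qb) (bopB ub) qr' q2 subrr scaler0 add0r ur uq subr0//.
  rewrite addrC; apply: (le_trans cS).
  have -> : mass (fun f => r' f - q' f) =
      mass r' + \sum_(t <- S) l2norm (q' (delta R t)) ^+ 2.
    rewrite /mass -big_split; apply: eq_bigr => t _ /=.
    by rewrite tau_sub//; ring.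
  rewrite mulrDr lerD//; apply: le_trans (sqs_proj S qP') _.
  by rewrite ler_wpM2r// sumr_ge0// => t _; rewrite sqr_ge0.
have H n : exists u, [/\ Q u, is_adjoint u u, forall f, u (u f) = f - r n f,
    forall f, u (r n f) = 0 & sqs (u d0) S <= e / K * mass (r n)].
  elim: n => [|n [u [h1 h2 h3 h4 h5]]].
    exists (fun=> 0); have [z1 z2 z3] := proj_zero; split => //.
    - by move=> f; rewrite /r r0 subrr.
    - suff -> : sqs (0 : l2 R G) S = 0.
        rewrite mulr_ge0//; first by rewrite divr_ge0 ?ltW.
        rewrite sumr_ge0// => t _; rewrite /r r0 l2norm_delta expr1n subrr//.
      by rewrite /sqs big1// => t _; rewrite normc0 expr0n.
  have [a1 a2 a3 a4] := rP n.
  have [u' [k1 k2 k3 k4 k5]] := step u (r n) (q n) h1 h2 h3 h4 a1 a2 a3 a4 h5.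
  have rE : r n.+1 = (fun f => r n f - q n f) by apply/funext => f; exact: rS.
  by exists u'; rewrite rE.
have [u [h1 h2 h3 h4 h5]] := H N.
have [a1 _ _ _] := rP N.
have sN : subproj (r N) (r N) by have [_ h _] := a1; split.
have [u' [k1 k2 k3 k4 k5]] := step u (r N) (r N) h1 h2 h3 h4 a1 a1 sN rN h5.
exists u'; split => //; first by move=> f; rewrite k3 subrr subr0.
apply: (le_trans k5).
have -> : mass (fun f => r N f - r N f) = (size S)%:R.
  rewrite /mass (eq_bigr (fun=> 1)) => [|t _].
    by rewrite big_const_seq count_predT iter_addr addr0.
  by rewrite subrr l2norm0 expr0n subr0.
by rewrite mulrAC ler_pdivrMr// ler_pM2l// lerDl.
Qed.

End SmallUnitary.

(** * The expectation onto the relative commutant *)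

Section RelativeCommutant.
Variables (R : realType) (G : groupType) (Q : set (l2op R G)).
Hypothesis Qv : von_neumann_algebra Q.
Hypothesis QM : Q `<=` group_vna R G.
Notation M := (group_vna R G).
Notation d0 := (delta R (1%g : G)).
Notation P := (commutant Q `&` M).
Notation half := ((2^-1 : R)%:C%C : R[i]).
Implicit Types (T S U x u v : l2op R G) (D : l2op R G -> l2op R G).

Let Mv := @group_vna_vna R G.
Let Mb T : M T -> bop T := @vna_bop R G M Mv T.
Let Qb : Q `<=` @bop R G G := fun T QT => vna_bop Qv QT.

Lemma relcomm_lin a T S : P T -> P S -> P (fun f => a *: T f + S f).
Proof.
move=> [T1 T2] [S1 S2]; split; last exact: vna_lin.
exact: (commutant_lin a Qb T1 S1).
Qed.

Lemma relcomm_sub T S : P T -> P S -> P (fun f => T f - S f).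
Proof.
move=> PT PS; have := relcomm_lin (-1) PS PT; congr (P _).
by apply/funext => f; rewrite scaleN1r addrC.
Qed.

Lemma relcomm_comp T S : P T -> P S -> P (fun f => T (S f)).
Proof.
move=> [T1 T2] [S1 S2]; split; [exact: commutant_comp|exact: (vna_comp Mv)].
Qed.

Lemma relcomm_adj T : P T -> P (adj T).
Proof.
move=> [T1 T2]; split; last exact: vna_adj.
apply: (commutant_adj Qb _ T1) => S; exact: vna_adj.
Qed.

Lemma relcomm_ext T S : P T -> P S ->
  (forall x, P x -> inner (T d0) (x d0) = inner (S d0) (x d0)) ->
  forall f, T f = S f.
Proof.
move=> PT PS h; have PD := relcomm_sub PT PS.
apply: group_vna_ext; [exact: PT.2|exact: PS.2|].
apply/subr0_eq/l2norm_eq0/eqP; rewrite -sqrf_eq0 l2norm_sqE.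
have hD : inner (T d0) (T d0 - S d0) = inner (S d0) (T d0 - S d0) := h _ PD.
by have -> := innerBl (T d0) (S d0) (T d0 - S d0); rewrite hD subrr.
Qed.

(** Traciality gathers both outer factors around x; averages thus keep their inner products with the
    relative commutant, and the expectation becomes a bimodule map. *)
Lemma trace_mul S T U x : M S -> M T -> M U -> M x ->
  inner (S (T (U d0))) (x d0) = inner (T d0) (adj S (x (adj U d0))).
Proof.
move=> MS MT MU Mx.
have My := vna_comp Mv (vna_adj Mv MS) Mx.
have MyT := vna_comp Mv (vna_adj Mv My) MT.
rewrite (adjP (Mb MS)) -(adjPr (Mb My)).
have -> := traceC MyT MU.
by rewrite (adjP (Mb MU)) (adjPr (Mb My)).
Qed.

(** Every such map is a finite convex combination of conjugations by unitaries of [Q]; the inductive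
    form reduces each preservation property to a single halving step. *)
Inductive averaging : (l2op R G -> l2op R G) -> Prop :=
| averaging_id : averaging id
| averaging_step D u v : averaging D -> Q u -> Q v -> unitary_pair u v ->
    averaging (fun T f => half *: (D T f + u (D T (v f)))).

Lemma averaging_vna D : averaging D -> forall T, M T -> M (D T).
Proof.
elim=> [//|{}D u v aD IH Qu Qv' uv T MT].
apply: (vna_scale Mv); apply: (vna_add Mv); first exact: IH.
apply: (vna_comp Mv (QM Qu)); exact: (vna_comp Mv (IH _ MT) (QM Qv')).
Qed.

Lemma unitary_norm u v f : unitary_pair u v -> l2norm (u f) = l2norm f.
Proof.
move=> [uv _ vu]; apply/eqP; rewrite -(@eqrXn2 _ 2) ?l2norm_ge0//.
by rewrite !l2norm_sqE uv vu.
Qed.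

Lemma averaging_bound D : averaging D -> forall T c, opbound T c -> opbound (D T) c.
Proof.
elim=> [//|{}D u v aD IH Qu Qv' uv T c Tc f].
rewrite l2normZ normc_real ger0_norm ?invr_ge0//.
have h1 := IH T c Tc f; have h2 := IH T c Tc (v f).
move: h2; rewrite (unitary_norm f (unitary_pair_sym uv)) => h2.
have := ler_l2normD (D T f) (u (D T (v f))); rewrite (unitary_norm _ uv).
by lra.
Qed.

Lemma half_double (z : R[i]) : half * (z + z) = z.
Proof.
case: z => a b; apply/eqP; rewrite eq_complex /= !mul0r subr0 addr0.
by apply/andP; split; apply/eqP; lra.
Qed.

Lemma averaging_inner D : averaging D -> forall T x, M T -> P x ->
  inner (D T d0) (x d0) = inner (T d0) (x d0).
Proof.
elim=> [//|{}D u v aD IH Qu Qv' uv T x MT Px].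
have [/commutantP[_ xQ] Mx] := Px.
have MD := averaging_vna aD MT.
rewrite innerZl innerDl (trace_mul (QM Qu) MD (QM Qv') Mx).
have [uv1 uv2 _] := uv.
have av f : adj v f = u f by rewrite (adj_unique (vna_bop Qv Qv') (is_adjoint_sym uv1)).
have au f : adj u f = v f by rewrite (adj_unique (vna_bop Qv Qu) uv1).
rewrite av au -(xQ v Qv') (_ : v (u d0) = d0); last by have [_ _ ->] := uv.
by rewrite (IH T x MT Px) half_double.
Qed.

Lemma averaging_positive D : averaging D -> forall n (a : 'I_n -> 'I_n -> l2op R G),
  positive_mx a -> positive_mx (fun i j => D (a i j)).
Proof.
elim=> [//|{}D u v aD IH Qu Qv' uv n a ap xi].
have -> : \sum_(i < n) \sum_(j < n)
    inner (half *: (D (a i j) (xi j) + u (D (a i j) (v (xi j))))) (xi i) =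
  half * (\sum_(i < n) \sum_(j < n) inner (D (a i j) (xi j)) (xi i) +
    \sum_(i < n) \sum_(j < n) inner (D (a i j) (v (xi j))) (v (xi i))).
  rewrite -big_split mulr_sumr; apply: eq_bigr => i _.
  rewrite -big_split mulr_sumr; apply: eq_bigr => j _ /=.
  by rewrite innerZl innerDl; have [-> _ _] := uv.
apply: mulr_ge0; first by rewrite ler0c invr_ge0.
by apply: addr_ge0; exact: IH.
Qed.

(* By the parallelogram law, averages of T over conjugations by unitaries of Q
   which almost minimize the norm at delta_1 are almost invariant under such
   conjugations; E is a weak limit of them.  A whole family is averaged at once
   in order to preserve matrix positivity. *)
Lemma cexp_family (J : finType) (T : J -> l2op R G) : (forall j, M (T j)) ->
  exists E : J -> l2op R G, [/\ forall j, P (E j),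
    forall j x, P x -> inner (E j d0) (x d0) = inner (T j d0) (x d0),
    forall j c, opbound (T j) c -> opbound (E j) c &
    forall n (k : 'I_n -> 'I_n -> J), positive_mx (fun i j => T (k i j)) ->
      positive_mx (fun i j => E (k i j))].
Proof.
move=> MT; pose F D := \sum_(j in J) l2norm (D (T j) d0) ^+ 2.
pose S := [set s | exists2 D, averaging D & s = F D].
have F0 D : 0 <= F D by apply: sumr_ge0 => j _; rewrite sqr_ge0.
have hS : has_inf S.
  by split; [exists (F id); exists id => //; exact: averaging_id|exists 0 => _ [D _ ->]].
have Dex (n : nat) : exists D, averaging D /\ F D < inf S + n.+1%:R^-1.
  have n0 : 0 < n.+1%:R^-1 :> R by rewrite invr_gt0 ltr0n.
  by have [_ [D aD ->] h] := inf_adherent n0 hS; exists D.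
have [D DP] := choice Dex.
have Dinv n u v : Q u -> Q v -> unitary_pair u v ->
    forall j, l2norm (D n (T j) d0 - u (D n (T j) (v d0))) ^+ 2 <= 4 / n.+1%:R.
  move=> Qu Qv' uv j; have [aD Dn] := DP n.
  have MD i := averaging_vna aD (MT i).
  have aD' := averaging_step aD Qu Qv' uv.
  have Fl : inf S <= F (fun T f => half *: (D n T f + u (D n T (v f)))).
    by apply: (inf_lbound hS.2); eexists; first exact: aD'.
  (* Traciality again: right multiplication by a unitary does not change the norm at [d0]. *)
  have nE i : l2norm (u (D n (T i) (v d0))) = l2norm (D n (T i) d0).
    rewrite (unitary_norm _ uv); have [uv1 _ vu] := uv.
    exact: (l2norm_mul_unitary (MD i) (QM Qv') (QM Qu) (is_adjoint_sym uv1) vu).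
  have : \sum_(i in J) l2norm (D n (T i) d0 - u (D n (T i) (v d0))) ^+ 2 =
      4 * F (D n) - 4 * F (fun T f => half *: (D n T f + u (D n T (v f)))).
    rewrite /F !mulr_sumr -sumrB; apply: eq_bigr => i _.
    rewrite l2normZ normc_real ger0_norm ?invr_ge0// exprMn.
    have := parallelogram (D n (T i) d0) (u (D n (T i) (v d0))); rewrite nE.
    set A := l2norm (_ + _) ^+ 2; set B := l2norm (_ - _) ^+ 2.
    have -> : (2^-1 : R) ^+ 2 = 4^-1 by rewrite exprVn; congr (_^-1); ring.
    lra.
  rewrite (bigD1 j)//= => hE.
  have : 0 <= \sum_(i in J | i != j) l2norm (D n (T i) d0 - u (D n (T i) (v d0))) ^+ 2.
    by apply: sumr_ge0 => i _; rewrite sqr_ge0.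
  move: hE Dn Fl; set a := F (D n); set b := F (fun T f => _); set s := inf S.
  by set k := n.+1%:R^-1; set y := _ ^+ 2; set z := \sum_(i in J | _) _; lra.
have [m mt] := nat_mean R.
pose E j := olim m (fun n => D n (T j)).
have bd j : exists2 c, 0 < c & forall n, opbound (D n (T j)) c.
  have [c c0 cT] := bop_bound (Mb (MT j)); exists c => // n.
  by apply: averaging_bound => //; have [] := DP n.
have MD n j : M (D n (T j)) by apply: averaging_vna => //; have [] := DP n.
have Ei j f g : inner (E j f) g = cmean m (fun n => inner (D n (T j) f) g).
  by have [c _ cT] := bd j; exact: inner_olim.
have Ebd j f g : cbdd (fun n => inner (D n (T j) f) g).
  by have [c _ cT] := bd j; exact: (cbdd_olim cT).
have ME j : M (E j).
  by have [c _ cT] := bd j; apply: (vna_olim Mv m cT) => n; exact: MD.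
have PE j : P (E j).
  split=> //; apply: commute_unitaries => //; first exact: Mb.
  move=> u v Qu Qv' uv f; have [uv1 _ vu] := uv.
  have MEu : M (fun f => u (E j (v f))).
    apply: (vna_comp Mv (QM Qu)); exact: (vna_comp Mv (ME j) (QM Qv')).
  have e0 : E j d0 = u (E j (v d0)).
    apply: eq_l2_inner => h; have := uv1 (E j (v d0)) h => ->; rewrite !Ei.
    apply: (ctail_eq mt) => // e e0.
    have D0 : 0 < l2norm h + 1 by rewrite ltr_wpDl ?l2norm_ge0.
    have e1 : 0 < (e / (l2norm h + 1)) ^+ 2 by rewrite exprn_gt0// divr_gt0.
    exists (Num.bound (4 / (e / (l2norm h + 1)) ^+ 2)) => n Nn.
    rewrite -uv1 -innerBl (le_trans (cauchy_schwarz _ _))//.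
    apply: (@le_trans _ _ (e / (l2norm h + 1) * l2norm h)); last first.
      by rewrite mulrAC ler_pdivrMr// ler_pM2l// lerDl.
    rewrite ler_wpM2r ?l2norm_ge0//.
    rewrite -(@ler_pXn2r _ 2)// ?nnegrE ?l2norm_ge0 ?divr_ge0 ?(ltW D0) ?(ltW e0)//.
    apply: (le_trans (Dinv n u v Qu Qv' uv j)).
    rewrite ler_pdivrMr ?ltr0n// mulrC -ler_pdivrMr//.
    have := archi_boundP (divr_ge0 (ler0n R 4) (ltW e1)) => /ltW/le_trans; apply.
    by rewrite ler_nat; exact: leqW.
  by rewrite (group_vna_ext (ME j) MEu e0 (u f)) vu.
exists E; split => //.
- move=> j x Px; rewrite Ei -[RHS](cmean_cst m); apply: eq_cmean => n.
  by have [aD _] := DP n; exact: averaging_inner.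
- move=> j c cT; apply: olim_bound => n.
  by apply: averaging_bound => //; have [] := DP n.
- move=> n k kp xi.
  have -> : \sum_(i < n) \sum_(j < n) inner (E (k i j) (xi j)) (xi i) =
      cmean m (fun l => \sum_(i < n) \sum_(j < n) inner (D l (T (k i j)) (xi j)) (xi i)).
    rewrite cmean_sum => [|i]; last exact: cbdd_sum.
    by apply: eq_bigr => i _; rewrite cmean_sum//; apply: eq_bigr => j _; rewrite Ei.
  apply: cmean_ge0; first by apply: cbdd_sum => i; exact: cbdd_sum.
  by move=> l; have [aD _] := DP l; exact: (averaging_positive aD kp).
Qed.

Lemma cexp_exists : exists E : l2op R G -> l2op R G, forall T, M T ->
  [/\ P (E T), forall x, P x -> inner (E T d0) (x d0) = inner (T d0) (x d0) &
   forall c, opbound T c -> opbound (E T) c].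
Proof.
have H T : exists E : l2op R G, M T ->
  [/\ P E, forall x, P x -> inner (E d0) (x d0) = inner (T d0) (x d0) &
   forall c, opbound T c -> opbound E c].
  have [MT|nMT] := pselect (M T); last by exists id.
  have [//|E [E1 E2 E3 _]] := @cexp_family 'I_1 (fun=> T).
  by exists (E ord0) => _; split; [exact: E1|exact: E2|exact: E3].
by have [E EP] := choice H; exists E.
Qed.

Definition cexp : l2op R G -> l2op R G := projT1 (cid cexp_exists).

Lemma cexpP T : M T -> [/\ P (cexp T),
  forall x, P x -> inner (cexp T d0) (x d0) = inner (T d0) (x d0) &
   forall c, opbound T c -> opbound (cexp T) c].
Proof. exact: (projT2 (cid cexp_exists)). Qed.

Lemma cexp_unique T S : M T -> P S ->
  (forall x, P x -> inner (S d0) (x d0) = inner (T d0) (x d0)) -> cexp T = S.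
Proof.
move=> MT PS h; have [PE hE _] := cexpP MT; apply/funext => f.
by apply: relcomm_ext => // x Px; rewrite hE// h.
Qed.

Lemma cexp_lin a T S : M T -> M S ->
  cexp (fun f => a *: T f + S f) = (fun f => a *: cexp T f + cexp S f).
Proof.
move=> MT MS; have [PT hT _] := cexpP MT; have [PS hS _] := cexpP MS.
apply: cexp_unique => [||x Px]; [exact: vna_lin|exact: relcomm_lin|].
by rewrite !innerDl !innerZl hT// hS.
Qed.

Lemma cexp_id T : P T -> cexp T = T.
Proof. by move=> PT; apply: cexp_unique => //; exact: PT.2. Qed.

Lemma cexp_bimodule S T U : P S -> P U -> M T ->
  cexp (fun f => S (T (U f))) = (fun f => S (cexp T (U f))).
Proof.
move=> PS PU MT; have [PT hT _] := cexpP MT.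
apply: cexp_unique => [||x Px].
- apply: (vna_comp Mv PS.2); exact: (vna_comp Mv MT PU.2).
- by apply: (relcomm_comp PS); exact: (relcomm_comp PT PU).
rewrite (trace_mul PS.2 PT.2 PU.2 Px.2) (trace_mul PS.2 MT PU.2 Px.2).
apply: (hT (fun f => adj S (x (adj U f)))).
by apply: (relcomm_comp (relcomm_adj PS)); exact: (relcomm_comp Px (relcomm_adj PU)).
Qed.

(** All entries are averaged as one family, and uniqueness identifies the outcome with [cexp], entry
    by entry. *)
Lemma cexp_positive n (a : 'I_n -> 'I_n -> l2op R G) : (forall i j, M (a i j)) ->
  positive_mx a -> positive_mx (fun i j => cexp (a i j)).
Proof.
move=> Ma ap.
have [[i j]|E [E1 E2 _ E4]] := @cexp_family ('I_n * 'I_n)%type (fun p => a p.1 p.2).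
  exact: Ma.
have Eij i j : cexp (a i j) = E (i, j).
  by apply: cexp_unique => //; exact: (E2 (i, j)).
have := E4 n (fun i j => (i, j)) ap => h xi; have := h xi.
congr (0 <= _); apply: eq_bigr => i _; apply: eq_bigr => j _.
by rewrite Eij.
Qed.

End RelativeCommutant.

Lemma l2BE (R : realType) (X : choiceType) (f g : l2 R X) x :
  (f - g : l2 R X) x = f x - g x.
Proof. by rewrite l2DE l2NE. Qed.

(** * Solidity from amenability at the boundary *)

Section Translation.
Variables (R : realType) (G : groupType) (Y : choiceType).
Implicit Types (p q z : G) (f g : l2 R (G * Y)%type).

(** The translation lam p^-1 (x) 1. With this direction the isometry V carries the right translation
    by p^-1 to [Lam p], and products are reversed. *)
Definition Lam p : l2 R (G * Y)%type -> l2 R (G * Y)%type :=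
  pull (fun x : G * Y => ((p * x.1)%g, x.2)).

Let Lcan p : cancel (fun x : G * Y => ((p * x.1)%g, x.2))
  (fun x : G * Y => ((p^-1 * x.1)%g, x.2)).
Proof. by move=> [z y] /=; rewrite mulKg. Qed.
Let Lcan' p : cancel (fun x : G * Y => ((p^-1 * x.1)%g, x.2))
  (fun x : G * Y => ((p * x.1)%g, x.2)).
Proof. by move=> [z y] /=; rewrite mulVKg. Qed.

Lemma LamE p f z y : Lam p f (z, y) = f ((p * z)%g, y).
Proof. by apply: pullE; exact: (can_inj (Lcan p)). Qed.

Lemma l2norm_Lam p f : l2norm (Lam p f) = l2norm f.
Proof. exact: (l2norm_pull_bij (Lcan p) (Lcan' p)). Qed.

Lemma slice_Lam p f z : slice z (Lam p f) = slice (p * z)%g f.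
Proof. by apply: l2_ext => y; rewrite (sliceE z) (sliceE (p * z)%g) LamE. Qed.

Lemma LamM p q f : Lam p (Lam q f) = Lam (q * p)%g f.
Proof. by apply: slice_ext => z; rewrite !slice_Lam mulgA. Qed.

Lemma Lam1 f : Lam 1%g f = f.
Proof. by apply: slice_ext => z; rewrite slice_Lam mul1g. Qed.

Lemma inner_Lam p f g : inner (Lam p f) g = inner f (Lam p^-1 g).
Proof.
rewrite [LHS](inner_pull_adj (Lcan p) (Lcan' p)); congr inner.
Qed.

Lemma Lam_amp (T : l2op R Y) p f : bop T -> Lam p (amp T f) = amp T (Lam p f).
Proof.
move=> Tb; apply: slice_ext => z.
rewrite slice_Lam (slice_amp Tb (p * z)%g f).
by rewrite (slice_amp Tb z (Lam p f)) slice_Lam.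
Qed.

End Translation.

Lemma amp_emb (R : realType) (Z X : choiceType) (T : l2op R X) (z : Z) f :
  bop T -> amp T (emb z f) = emb z (T f).
Proof.
move=> Tb; apply: slice_ext => z'; rewrite slice_amp// !slice_emb.
by case: ifP => // _; rewrite bop0.
Qed.

Lemma slice_norm (R : realType) (Z X : choiceType) (z : Z) (f : l2 R (Z * X)%type) :
  l2norm (slice z f) <= l2norm f.
Proof.
rewrite -(@ler_pXn2r _ 2)// ?nnegrE ?l2norm_ge0//.
by have := sum_slice_le f [fset z]%fset; rewrite big_seq_fset1.
Qed.

Lemma sum_mem_le (R : realType) (K : choiceType) (A S : {fset K}) (g : K -> R) :
  (forall x, 0 <= g x) ->
  \sum_(x <- A) (if x \in S then g x else 0) <= \sum_(x <- S) g x.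
Proof.
move=> g0; rewrite (big_fsetID _ (mem S)) /= [X in _ + X]big1_fset => [|x]; last first.
  by rewrite !inE => /andP[_ /negbTE ->].
rewrite addr0 [leRHS](big_fsetID _ (mem A)) /=.
have -> : [fset x in S | x \in A]%fset = [fset x in A | x \in S]%fset.
  by apply/fsetP => x; rewrite !inE andbC.
rewrite -[leLHS]addr0 lerD ?sumr_ge0// big_seq [leRHS]big_seq ler_sum// => x.
by rewrite !inE => /andP[_ ->].
Qed.

(** * The isometry attached to a family of probabilities *)

Section Bmul.
Variables (R : realType) (G : choiceType) (a : G -> G -> R) (K : R).
Hypothesis aK : forall t (A : {fset G}), \sum_(z <- A) a t z ^+ 2 <= K.

Definition bmul (f : l2 R G) : l2 R (G * G)%type :=
  insubd (0 : l2 R (G * G)%type) (fun p => (a p.1 p.2)%:C%C * f p.1).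

Let sqsa t (x : R[i]) (A : {fset G}) :
  sqs (fun z => (a t z)%:C%C * x) A = (\sum_(z <- A) a t z ^+ 2) * normc x ^+ 2.
Proof.
rewrite /sqs mulr_suml; apply: eq_bigr => z _.
by rewrite normcM normc_real exprMn real_normK// num_real.
Qed.

Let bmul_esum (f : l2 R G) d (S : {fset G}) : 0 <= d ->
  (forall t (A : {fset G}), t \notin S -> \sum_(z <- A) a t z ^+ 2 <= d) ->
  (\esum_(p in [set: G * G]) (normc ((a p.1 p.2)%:C%C * f p.1) ^+ 2)%:E <=
   (d * l2norm f ^+ 2 + K * sqs f S)%:E)%E.
Proof.
move=> d0 ad; have K0 (t : G) : 0 <= K by have := aK t fset0; rewrite big_seq_fset0.
rewrite (esum_slices (fun t z => (a t z)%:C%C * f t)).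
pose b t := (if t \in S then K else d) * normc (f t) ^+ 2.
apply: (@le_trans _ _ (\esum_(t in [set: G]) (b t)%:E)%E).
  apply: le_esum => t _; apply: esum_sqs => A; rewrite sqsa.
  rewrite ler_wpM2r ?sqr_ge0//; case: ifP => [_|/negbT tS]; first exact: aK.
  exact: ad.
apply: ge_ereal_sup => _ [S' [finS _] <-].
rewrite fsbig_finite//= sumEFin lee_fin.
set A := fset_set S'.
apply: (@le_trans _ _ (\sum_(t <- A) d * normc (f t) ^+ 2 +
    \sum_(t <- A) (if t \in S then K * normc (f t) ^+ 2 else 0))).
  rewrite -big_split ler_sum// => t _; rewrite /b; case: ifP => _ /=.
    by rewrite lerDr mulr_ge0// sqr_ge0.
  by rewrite addr0.
apply: lerD; first by rewrite -mulr_sumr ler_wpM2l//; exact: sqs_le.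
apply: le_trans (sum_mem_le _ _ _) _ => [t|]; first by rewrite mulr_ge0 ?sqr_ge0// K0.
by rewrite -mulr_sumr.
Qed.

Lemma bmulE f t z : bmul f (t, z) = (a t z)%:C%C * f t.
Proof.
have K0 : 0 <= K by have := aK t fset0; rewrite big_seq_fset0.
rewrite -[LHS]/(val (bmul f) (t, z)) val_insubd.
suff -> : (fun p => (a p.1 p.2)%:C%C * f p.1) \in @square_summable R (G * G)%type by [].
apply/asboolP; apply: (@le_lt_trans _ _ (K * l2norm f ^+ 2 + K * sqs f fset0)%:E).
  by apply: bmul_esum => // t' A _; exact: aK.
by rewrite ltry.
Qed.

(** The quantitative form of smallness modulo compact operators: the coefficients contribute d away
    from a finite set [S], and [S] itself enters only through the mass of [f] on it, which the
    choice of a small unitary removes. *)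
Lemma bmul_bound (f : l2 R G) d (S : {fset G}) : 0 <= d ->
  (forall t (A : {fset G}), t \notin S -> \sum_(z <- A) a t z ^+ 2 <= d) ->
  l2norm (bmul f) ^+ 2 <= d * l2norm f ^+ 2 + K * sqs f S.
Proof.
move=> d0 ad; apply: l2norm_sq_le => A; rewrite -lee_fin.
apply: le_trans (bmul_esum f d0 ad); apply: le_trans (sqs_esum _ _) _.
by apply: le_esum => -[t z] _; rewrite bmulE.
Qed.

Lemma bmul_isometry (E : {fset G}) (f : l2 R G) :
  (forall t, \sum_(z <- E) a t z ^+ 2 = 1) -> (forall t z, z \notin E -> a t z = 0) ->
  l2norm (bmul f) = l2norm f.
Proof.
move=> E1 E0; apply/eqP; rewrite -(@eqrXn2 _ 2) ?l2norm_ge0//; apply/eqP.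
apply: EFin_inj; rewrite -!esum_l2norm.
rewrite (eq_esum (b := fun p => (normc ((a p.1 p.2)%:C%C * f p.1) ^+ 2)%:E)); last first.
  by move=> [t z] _; rewrite bmulE.
rewrite (esum_slices (fun t z => (a t z)%:C%C * f t)); apply: eq_esum => t _.
apply/eqP; rewrite eq_le; apply/andP; split.
  apply: esum_sqs => A; rewrite sqsa -[leRHS]mul1r ler_wpM2r ?sqr_ge0// -(E1 t).
  apply: le_trans (sum_mem_le A E (fun z => sqr_ge0 (a t z))).
  by rewrite ler_sum// => z _; case: ifP => // /negbT /E0 ->; rewrite expr0n.
apply: le_trans (sqs_esum (fun z => (a t z)%:C%C * f t) E).
by rewrite sqsa E1 mul1r.
Qed.

End Bmul.

(** One finite set supports all members of the family. The parameter ranges over groups, over the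
    set I + B and, for a single probability, over [unit]. *)
Record fibre_prob (R : realType) (T : Type) (Z : choiceType) (E : {fset Z})
    (mu : T -> Z -> R) : Prop := FibreProb {
  fprob_ge0 : forall t z, 0 <= mu t z;
  fprob_supp : forall t z, z \notin E -> mu t z = 0;
  fprob_sum : forall t, \sum_(z <- E) mu t z = 1 }.

Lemma fprob_sum_le (R : realType) (T : Type) (Z : choiceType) (E : {fset Z})
    (mu : T -> Z -> R) t (A : {fset Z}) : fibre_prob E mu -> \sum_(z <- A) mu t z <= 1.
Proof.
move=> [mu0 muE mu1]; rewrite -(mu1 t).
apply: le_trans (sum_mem_le A E (mu0 t)).
by rewrite ler_sum// => z _; case: ifP => // /negbT/muE ->.
Qed.

Section BoundaryAmenable.
Variables (R : realType) (G : groupType).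

(** The order of the quantifiers is the point: the support [E] is fixed by [F] and [e] before [F']
    and [d] are given. Sums over arbitrary finite [A] stand for l1 norms, and outside the finite set
    [S] a point t counts as near infinity. *)
Definition boundary_amenable := forall (F : {fset G}) (e : R), 0 < e ->
  exists E : {fset G}, forall (F' : {fset G}) (d : R), 0 < d ->
  exists (mu : G -> G -> R) (S : {fset G}), [/\ fibre_prob E mu,
    forall t h (A : {fset G}), t \notin S -> h \in F' ->
      \sum_(z <- A) `|mu (h * t)%g z - mu t z| <= d &
    forall t p (A : {fset G}), t \notin S -> p \in F ->
      \sum_(z <- A) `|mu (t * p)%g (p^-1 * z)%g - mu t z| <= e].

End BoundaryAmenable.

Lemma sqrt_diff (R : realType) (a b : R) : 0 <= a -> 0 <= b ->
  (Num.sqrt a - Num.sqrt b) ^+ 2 <= `|a - b|.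
Proof.
move=> a0 b0; rewrite -{2}(sqr_sqrtr a0) -{2}(sqr_sqrtr b0).
move: (Num.sqrt a) (Num.sqrt b) (sqrtr_ge0 a) (sqrtr_ge0 b) => x y x0 y0.
rewrite subr_sqr normrM -[leLHS]real_normK ?num_real// expr2.
rewrite ler_wpM2l// [leRHS]ger0_norm ?addr_ge0// ler_norml; apply/andP; split; lra.
Qed.

Section Spread.
Variables (R : realType) (G : groupType) (E : {fset G}) (mu : G -> G -> R).
Hypothesis muP : fibre_prob E mu.
Implicit Types (f : l2 R G).

Let rt t z := Num.sqrt (mu t z).

Let rtK t (A : {fset G}) : \sum_(z <- A) rt t z ^+ 2 <= 1.
Proof.
apply: le_trans (fprob_sum_le t A muP); rewrite ler_sum// => z _.
by rewrite sqr_sqrtr//; have [] := muP.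
Qed.

Let tau_inj : injective (fun x : G * G => ((x.2 * x.1^-1)%g, x.1)).
Proof. by move=> [z s] [z' s'] /= [+ zz]; rewrite zz => /mulIg ->. Qed.

(* V delta_t = sum_z sqrt (mu t z) delta_(z, t z) *)
Definition spread f : l2 R (G * G)%type :=
  pull (fun x : G * G => ((x.2 * x.1^-1)%g, x.1)) (bmul rt f).

Lemma spreadE f z s : spread f (z, s) = (rt (s * z^-1)%g z)%:C%C * f (s * z^-1)%g.
Proof. by rewrite pullE ?(bmulE rtK)//; exact: tau_inj. Qed.

Lemma spread_linear : linear spread.
Proof.
move=> a f g; apply: l2_ext => -[z s]; rewrite l2DE l2ZE !spreadE l2DE l2ZE.
by rewrite mulrDr mulrCA.
Qed.

Lemma l2norm_spread f : l2norm (spread f) = l2norm f.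
Proof.
rewrite /spread (@l2norm_pull_bij _ _ _ _ (fun x : G * G => (x.2, (x.1 * x.2)%g))).
- apply: (bmul_isometry rtK (E := E)) => [t|t z zE].
    by have [mu0 _ mu1] := muP; rewrite -(mu1 t); apply: eq_bigr => z _; rewrite sqr_sqrtr.
  by rewrite /rt (fprob_supp muP _ zE) sqrtr0.
- by move=> [z s] /=; rewrite mulgVK.
- by move=> [t z] /=; rewrite mulgK.
Qed.

Lemma bop_spread : bop spread.
Proof.
split; first exact: spread_linear.
by exists 1 => f; rewrite l2norm_spread mul1r.
Qed.

Lemma slice_spread f z : z \notin E -> slice z (spread f) = 0.
Proof.
move=> zE; apply: l2_ext => s; rewrite sliceE spreadE /rt.
by rewrite (fprob_supp muP _ zE) sqrtr0 mul0r.
Qed.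

(** The bound 4 holds everywhere by (x - y)^2 <= 2 x^2 + 2 y^2; off [S], passing to square roots
    turns l1 closeness into l2 closeness. *)
Let diff_bound (s : G -> G) (r : G -> G -> G) (S : {fset G}) d :
  (forall t (A : {fset G}), t \notin S -> \sum_(z <- A) `|mu (s t) (r t z) - mu t z| <= d) ->
  (forall t (A : {fset G}), \sum_(z <- A) mu (s t) (r t z) <= 1) ->
  let a t z := rt t z - rt (s t) (r t z) in
  (forall t (A : {fset G}), \sum_(z <- A) a t z ^+ 2 <= 4) /\
  (forall t (A : {fset G}), t \notin S -> \sum_(z <- A) a t z ^+ 2 <= d).
Proof.
have [mu0 _ _] := muP; move=> hd h1 a; split=> t A.
  apply: (@le_trans _ _ (\sum_(z <- A) (2 * mu t z + 2 * mu (s t) (r t z)))).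
    apply: ler_sum => z _; rewrite /a /rt -{2}(sqr_sqrtr (mu0 t z)).
    rewrite -{2}(sqr_sqrtr (mu0 (s t) (r t z))).
    have := sqr_ge0 (Num.sqrt (mu t z) + Num.sqrt (mu (s t) (r t z))).
    by move: (Num.sqrt _) (Num.sqrt _) => x y; nra.
  by rewrite big_split -!mulr_sumr/=; have := fprob_sum_le t A muP; have := h1 t A; lra.
move=> tS; apply: le_trans (hd t A tS); apply: ler_sum => z _.
by rewrite distrC; exact: sqrt_diff.
Qed.

(** In the variable t = h^-1 s z^-1 the commutator multiplies f t by sqrt (mu t z) - sqrt (mu (h t)
    z), so [bmul_bound] applies to it. *)
Lemma spread_lam f h (S : {fset G}) d : 0 <= d ->
  (forall t (A : {fset G}), t \notin S -> \sum_(z <- A) `|mu (h * t)%g z - mu t z| <= d) ->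
  l2norm (amp (left_regular h) (spread f) - spread (left_regular h f)) ^+ 2 <=
  d * l2norm f ^+ 2 + 4 * sqs f S.
Proof.
move=> d0 hd; have [a4 ad] := @diff_bound (fun t => h * t)%g (fun _ z => z) S d hd
  (fun t A => fprob_sum_le _ A muP).
pose a t z := rt t z - rt (h * t)%g z.
apply: le_trans (bmul_bound a4 f d0 ad).
have inj : injective (fun x : G * G => ((h^-1 * x.2 * x.1^-1)%g, x.1)).
  by move=> [z s] [z' s'] /= [+ zz]; rewrite zz => /mulIg/mulgI ->.
suff -> : amp (left_regular h) (spread f) - spread (left_regular h f) =
    pull (fun x : G * G => ((h^-1 * x.2 * x.1^-1)%g, x.1)) (bmul a f).
  rewrite ler_sqr ?nnegrE ?l2norm_ge0//.
  by have := pull_bound inj (bmul a f); rewrite mul1r.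
apply: l2_ext => -[z s]; rewrite [LHS]l2BE [RHS](pullE inj) [RHS](bmulE a4) {inj}.
rewrite (ampE (bop_lam R h)) lamE sliceE spreadE [X in _ - X]spreadE lamE /a /=.
rewrite !mulgA mulgV mul1g.
by rewrite realCB mulrBl.
Qed.

Lemma spread_Lam f p (S : {fset G}) d : 0 <= d ->
  (forall t (A : {fset G}), t \notin S -> \sum_(z <- A) `|mu (t * p)%g (p^-1 * z)%g - mu t z| <= d) ->
  l2norm (Lam p (spread f) - spread (right_regular p^-1 f)) ^+ 2 <=
  d * l2norm f ^+ 2 + 4 * sqs f S.
Proof.
move=> d0 hd.
have h1 t (A : {fset G}) : \sum_(z <- A) mu (t * p)%g (p^-1 * z)%g <= 1.
  apply: le_trans (fprob_sum_le (t * p)%g ((fun z => p^-1 * z)%g @` A)%fset muP).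
  by rewrite big_imfset//= => x y _ _ /mulgI.
have [a4 ad] := @diff_bound (fun t => t * p)%g (fun _ z => p^-1 * z)%g S d hd h1.
pose a t z := rt t z - rt (t * p)%g (p^-1 * z)%g.
apply: le_trans (bmul_bound a4 f d0 ad).
have inj : injective (fun x : G * G => ((x.2 * x.1^-1 * p^-1)%g, (p * x.1)%g)).
  by move=> [z s] [z' s'] /= [+ /mulgI zz]; rewrite zz => /mulIg/mulIg ->.
suff -> : Lam p (spread f) - spread (right_regular p^-1 f) =
    pull (fun x : G * G => ((x.2 * x.1^-1 * p^-1)%g, (p * x.1)%g)) (bmul a f).
  rewrite ler_sqr ?nnegrE ?l2norm_ge0//.
  by have := pull_bound inj (bmul a f); rewrite mul1r.
apply: l2_ext => -[z s]; rewrite [LHS]l2BE [RHS](pullE inj) [RHS](bmulE a4) {inj}.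
rewrite LamE spreadE [X in _ - X]spreadE rhoE /a /= invgM !mulgA mulgVK mulVg mul1g.
by rewrite realCB mulrBl.
Qed.

End Spread.

Lemma sqr_sum_le (R : realType) (J : Type) (r : seq J) (x : J -> R) :
  (\sum_(z <- r) x z) ^+ 2 <= (size r)%:R * \sum_(z <- r) x z ^+ 2.
Proof.
elim: r => [|a r IH]; first by rewrite !big_nil expr0n mulr0.
rewrite !big_cons /= -natr1; move: IH.
set S := \sum_(z <- r) x z; set T := \sum_(z <- r) _; set n := (size r)%:R.
have T0 : 0 <= T by apply: sumr_ge0 => z _; exact: sqr_ge0.
have n0 : 0 <= n by rewrite ler0n.
move=> IH; have : 0 <= n * x a ^+ 2 + T - 2 * x a * S.
  have [nz|nz] := eqVneq n 0; last first.
    have n1 : 0 < n by rewrite lt_def nz.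
    rewrite -(pmulr_rge0 _ n1).
    by have := sqr_ge0 (n * x a - S); nra.
  have -> : S = 0 by apply/eqP; rewrite -sqrf_eq0 eq_le sqr_ge0 andbT; rewrite nz mul0r in IH.
  by rewrite nz mulr0 mul0r; lra.
by nra.
Qed.

Lemma discriminant_le (R : realType) (P X Q : R) : 0 <= Q ->
  (forall s, 0 <= P - 2 * s * X + s ^+ 2 * Q) -> X ^+ 2 <= P * Q.
Proof.
move=> Q0 pos.
have [Qz|Qz] := eqVneq Q 0; last first.
  have := pos (X / Q); rewrite -(pmulr_rge0 _ (_ : 0 < Q)) ?lt_def ?Qz//.
  by rewrite (_ : Q * _ = P * Q - X ^+ 2) ?subr_ge0//; field.
rewrite Qz mulr0; have [->|Xz] := eqVneq X 0; first by rewrite expr0n.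
(* When Q = 0 the quadratic is affine in s, and this s gives it the value -1. *)
have := pos ((P + 1) / (2 * X)); rewrite Qz mulr0 addr0.
rewrite (_ : P - _ = -1); last by field; rewrite Xz.
by rewrite lerNr oppr0 ler10.
Qed.

Lemma mean_cauchy (R : realType) (Y : Type) (m : mean R Y) (f g : Y -> R) :
  bdd f -> bdd g ->
  m (fun y => f y * g y) ^+ 2 <= m (fun y => f y ^+ 2) * m (fun y => g y ^+ 2).
Proof.
move=> fb gb; have f2 := bddM fb fb; have g2 := bddM gb gb; have fg := bddM fb gb.
set X := m _; set P := m _; set Q := m _.
have pos s : 0 <= P - 2 * s * X + s ^+ 2 * Q.
  have -> : P - 2 * s * X + s ^+ 2 * Q = m (fun y => (f y - s * g y) ^+ 2).
    transitivity (m (fun y => (- (2 * s)) * (f y * g y) + (s ^+ 2 * (g y * g y) + f y * f y))).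
      rewrite !mean_linear//; first by rewrite /P /X /Q; ring.
      exact/bddD/f2/bddZ/g2.
    by apply: eq_mean => y; ring.
  apply: mean_ge0; last by move=> y; exact: sqr_ge0.
  have hb := bddB fb (bddZ s gb); exact: (bddM hb hb).
have Q0 : 0 <= Q by apply: mean_ge0 => // y; exact: sqr_ge0.
exact: discriminant_le.
Qed.

Lemma cmean_norm_le (R : realType) (Y : Type) (m : mean R Y) (u : Y -> R[i]) (g : Y -> R) :
  bdd g -> (forall y, normc (u y) <= g y) -> normc (cmean m u) <= m g.
Proof.
move=> gb ug; have ub : cbdd u.
  by have [C gC] := gb; exists C => y; apply: le_trans (ug y) (le_trans (ler_norm _) (gC y)).
have [c c1 cE] := rotate (cmean m u).
have -> : normc (cmean m u) = m (fun y => complex.Re (c * u y)).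
  by rewrite -[LHS]/(complex.Re (normc (cmean m u))%:C%C) -cE -cmeanZ.
apply: le_mean => //; first exact/cbdd_Re/cbddZ.
by move=> y; rewrite (le_trans (Re_le _))// normcM c1 mul1r.
Qed.

Lemma cge0_close (R : realType) (z : R[i]) :
  (forall e : R, 0 < e -> exists2 z', 0 <= z' & normc (z - z') <= e) -> 0 <= z.
Proof.
move=> h; rewrite lecE /=; apply/andP; split.
  rewrite -normr_le0; apply/ler_addgt0Pr => e /h [z' z0 ze]; rewrite add0r.
  apply: le_trans (le_trans (normr_Im_le (z - z')) ze).
  by rewrite (ge0_cE z0) raddfB /= subr0.
apply/ler_addgt0Pr => e /h [z' /ge0_Re z0 ze].
have := le_trans (normr_Re_le (z - z')) ze.
by rewrite ReD ReN ler_norml => /andP[]; lra.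
Qed.

Lemma cauchy_schwarz_le (R : realType) (X : choiceType) (f g : l2 R X) a b :
  l2norm f <= a -> l2norm g <= b -> normc (inner f g) <= a * b.
Proof.
by move=> fa gb; apply: le_trans (cauchy_schwarz f g) _; rewrite ler_pM ?l2norm_ge0.
Qed.

Lemma positive_mx_dense (R : realType) (X : choiceType) n (a : 'I_n -> 'I_n -> l2op R X) :
  (forall i j, bop (a i j)) ->
  (forall (A : 'I_n -> {fset X}) u,
    0 <= \sum_(i < n) \sum_(j < n) inner (a i j (vec (A j) (u j))) (vec (A i) (u i))) ->
  positive_mx a.
Proof.
move=> ab apos xi; apply: cge0_close => e e0.
have [c cP] := choice (fun ij : 'I_n * 'I_n => (let: ex_intro2 c c0 h := bop_bound (ab ij.1 ij.2)
  in ex_intro _ c (conj c0 h) : exists c, 0 < c /\ opbound (a ij.1 ij.2) c)).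
pose C := \sum_ij c ij; pose B := \sum_i l2norm (xi i).
have C0 : 0 <= C by apply: sumr_ge0 => ij _; have [/ltW] := cP ij.
have B0 : 0 <= B by apply: sumr_ge0 => i _; exact: l2norm_ge0.
have cC i j : opbound (a i j) C.
  apply: opbound_le (cP (i, j)).2; rewrite /C (bigD1 (i, j))//= lerDl.
  by apply: sumr_ge0 => ij _; have [/ltW] := cP ij.
have xB i : l2norm (xi i) <= B.
  by rewrite /B (bigD1 i)//= lerDl; apply: sumr_ge0 => j _; exact: l2norm_ge0.
pose K := \sum_(i < n) \sum_(j < n) (2 * C * B) + 1.
have K0 : 0 < K.
  by rewrite ltr_wpDl//; apply: sumr_ge0 => i _; apply: sumr_ge0 => j _; rewrite !mulr_ge0.
have eK0 : 0 < e / K by rewrite divr_gt0.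
have [A AP] := choice (fun i => vec_approx (xi i) eK0).
exists (\sum_(i < n) \sum_(j < n) inner (a i j (vec (A j) (xi j))) (vec (A i) (xi i))) => //.
rewrite -sumrB (le_trans (normc_sum _ _ _))//.
apply: (@le_trans _ _ (\sum_(i < n) \sum_(j < n) (2 * C * B) * (e / K))).
  apply: ler_sum => i _; rewrite -sumrB (le_trans (normc_sum _ _ _))//.
  apply: ler_sum => j _; set v := vec (A j) _; set w := vec (A i) _.
  rewrite (_ : _ - _ = inner (a i j (xi j - v)) (xi i) + inner (a i j v) (xi i - w)); last first.
    by rewrite (bopB (ab i j)) innerBl innerBr; ring.
  have h1 : normc (inner (a i j (xi j - v)) (xi i)) <= C * (e / K) * B.
    apply: cauchy_schwarz_le (xB i).
    apply: le_trans (cC i j _) _; apply: ler_wpM2l => //; exact: AP.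
  have h2 : normc (inner (a i j v) (xi i - w)) <= C * B * (e / K).
    apply: cauchy_schwarz_le (AP i).
    apply: le_trans (cC i j _) _; apply: ler_wpM2l => //; apply: le_trans (xB j); exact: vec_norm_le.
  by apply: le_trans (le_normcD _ _) _; lra.
have -> : \sum_(i < n) \sum_(j < n) (2 * C * B) * (e / K) = (K - 1) * (e / K).
  by rewrite /K addrK mulr_suml; apply: eq_bigr => i _; rewrite mulr_suml.
by rewrite mulrBl mul1r mulrCA divff ?mulr1 ?lt0r_neq0//; lra.
Qed.

Lemma inner_supp (R : realType) (Z X : choiceType) (E : {fset Z}) (f g : l2 R (Z * X)%type) :
  (forall z, z \notin E -> slice z f = 0) ->
  inner f g = \sum_(z <- E) inner (slice z f) (slice z g).
Proof.
move=> fE; rewrite -inner_restrict; congr inner; apply: slice_ext => z.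
by rewrite slice_restrict; case: ifP => // /negbT; exact: fE.
Qed.

Lemma cmean_real (R : realType) (Y : Type) (m : mean R Y) (f : Y -> R) :
  cmean m (fun y => (f y)%:C%C) = (m f)%:C%C.
Proof. by congr Complex; exact: (mean_cst m 0). Qed.

(** * Realization of limit vectors by Gram operators *)

Section Gram.
Variables (R : realType) (G : groupType) (Z : choiceType) (N : Type) (m : mean R N).
Variables (kap : N -> l2 R (Z * G)%type) (E : {fset Z}).
Notation lam := (@left_regular R G).
Hypothesis kapE : forall n z, z \notin E -> slice z (kap n) = 0.
Hypothesis kap1 : forall n, l2norm (kap n) <= 1.
Hypothesis kap_orth : forall h h', cmean m (fun n =>
  inner (amp (lam h) (kap n)) (amp (lam h') (kap n))) = (h == h')%:R.

Let part n (x : Z * G) : l2 R G := lam x.2 (slice x.1 (kap n)).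
Let phi x y := cmean m (fun n => inner (part n x) (part n y)).
Let comb n (A : {fset Z * G}) u : l2 R G := \sum_(x <- A) u x *: part n x.

Let part1 n x : l2norm (part n x) <= 1.
Proof. by rewrite l2norm_lam; apply: le_trans (kap1 n); exact: slice_norm. Qed.

Let cb x y : cbdd (fun n => inner (part n x) (part n y)).
Proof.
exists 1 => n; apply: le_trans (cauchy_schwarz _ _) _.
by rewrite -[leRHS]mul1r ler_pM ?l2norm_ge0 ?part1.
Qed.

Let comb_bdd A u : bdd (fun n => l2norm (comb n A u)).
Proof.
exists (\sum_(x <- A) normc (u x)) => n; rewrite ger0_norm ?l2norm_ge0//.
apply: le_trans (l2norm_sum _ _ _) _; apply: ler_sum => x _.
by rewrite l2normZ -[leRHS]mulr1 ler_wpM2l ?normc_ge0 ?part1.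
Qed.

Let phi_comb (A B : {fset Z * G}) u v : \sum_(x <- A) \sum_(y <- B) u x * (v y)^*%C * phi x y =
  cmean m (fun n => inner (comb n A u) (comb n B v)).
Proof.
under eq_bigr => x _ do under eq_bigr => y _ do rewrite -cmeanZ//.
under eq_bigr => x _ do (rewrite -cmean_sum; [|by move=> y; exact: cbddZ]).
rewrite -cmean_sum; last by move=> x; apply: cbdd_sum => y; exact: cbddZ.
apply: eq_cmean => n; rewrite /comb inner_suml; apply: eq_bigr => x _.
rewrite inner_sumr; apply: eq_bigr => y _.
by rewrite innerZl innerZr mulrA.
Qed.

Let amp_cb h h' : cbdd (fun n => inner (amp (lam h) (kap n)) (amp (lam h') (kap n))).
Proof.
exists 1 => n; apply: le_trans (cauchy_schwarz _ _) _.
have k1 g : l2norm (amp (lam g) (kap n)) <= 1.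
  have h1 : opbound (lam g) 1 by move=> f; rewrite l2norm_lam mul1r.
  have := amp_bound (Z := Z) (bop_lam R g) ler01 h1 (kap n); rewrite mul1r => /le_trans; exact.
by rewrite -[leRHS]mul1r ler_pM ?l2norm_ge0.
Qed.

(** The place where finiteness of [E] is used. For fixed z the vectors (1 (x) lam h) kap n are
    orthonormal in the limit; grouping by z and applying Cauchy-Schwarz over the |E| values of z
    costs a factor bounded in terms of |E|. *)
Let comb_sq A u : m (fun n => l2norm (comb n A u) ^+ 2) <=
  ((size E)%:R * l2norm (vec A u : l2 R (Z * G)%type)) ^+ 2.
Proof.
pose c z x := if z == x.1 then u x else 0.
pose D n z : l2 R (Z * G)%type := \sum_(x <- A) c z x *: amp (lam x.2) (kap n).
have combE n : comb n A u = \sum_(z <- E) slice z (D n z).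
  rewrite (eq_bigr (fun z => \sum_(x <- A) (if x.1 == z then u x *: part n x else 0))).
    rewrite exchange_big; apply: eq_bigr => x _.
    rewrite (fsum_pick E x.1 (fun=> u x *: part n x)); case: ifP => // /negbT xE.
    by rewrite /part (kapE n xE) (bop0 (bop_lam R x.2)) scaler0.
  move=> z _; rewrite /D (bop_sum (bop_slice R G z)); apply: eq_bigr => x _.
  rewrite (bopZ (bop_slice R G z)) (slice_amp (bop_lam R x.2) z) /c eq_sym.
  by case: eqP => [<-|_]; rewrite ?scale0r.
have Db z : bdd (fun n => l2norm (D n z)).
  exists (\sum_(x <- A) normc (c z x)) => n; rewrite ger0_norm ?l2norm_ge0//.
  apply: le_trans (l2norm_sum _ _ _) _; apply: ler_sum => x _.
  rewrite l2normZ -[leRHS]mulr1 ler_wpM2l ?normc_ge0//.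
  have h1 : opbound (lam x.2) 1 by move=> f; rewrite l2norm_lam mul1r.
  by have := amp_bound (Z := Z) (bop_lam R x.2) ler01 h1 (kap n); rewrite mul1r => /le_trans; exact.
have Dsq z : m (fun n => l2norm (D n z) ^+ 2) = \sum_(x <- A) normc (c z x) ^+ 2.
  have -> : m (fun n => l2norm (D n z) ^+ 2) = complex.Re (cmean m (fun n => inner (D n z) (D n z))).
    by apply: eq_mean => n; rewrite l2norm_sqE.
  have -> : cmean m (fun n => inner (D n z) (D n z)) = \sum_(x <- A) \sum_(y <- A)
      c z x * (c z y)^*%C * (x.2 == y.2)%:R.
    under [RHS]eq_bigr => x _ do under eq_bigr => y _ do rewrite -kap_orth -cmeanZ//.
    under [RHS]eq_bigr => x _ do (rewrite -cmean_sum; [|by move=> y; exact: cbddZ]).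
    rewrite -cmean_sum; last by move=> x; apply: cbdd_sum => y; exact: cbddZ.
    apply: eq_cmean => n; rewrite /D inner_suml; apply: eq_bigr => x _.
    rewrite inner_sumr; apply: eq_bigr => y _.
    by rewrite innerZl innerZr mulrA.
  rewrite Re_sum big_seq [RHS]big_seq; apply: eq_bigr => x xA.
  rewrite (eq_bigr (fun y => if x == y then (normc (c z y) ^+ 2)%:C%C else 0)).
    by rewrite (fsum_pick A x (fun y => (normc (c z y) ^+ 2)%:C%C)) xA.
  move=> y _; have [->|/negP xy] := eqVneq x y; first by rewrite eqxx mulr1 mulcJ.
  rewrite /c; case: eqP => [zx|_]; last by rewrite !mul0r.
  case: eqP => [zy|_]; last by rewrite conjc0 mulr0 mul0r.
  case: eqP => [x2|_]; last by rewrite mulr0.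
  by case: xy; apply/eqP; move: x y zx zy x2 {xA} => [? ?] [? ?] /= -> -> ->.
apply: (@le_trans _ _ (m (fun n => (size E)%:R * \sum_(z <- E) l2norm (D n z) ^+ 2))).
  apply: le_mean; first exact: bddM.
    by apply/bddZ/bdd_sum => z _; exact: bddM.
  move=> n; apply: le_trans (sqr_sum_le _ _).
  rewrite ler_sqr ?nnegrE ?l2norm_ge0 ?sumr_ge0// => [|z _]; last exact: l2norm_ge0.
  rewrite combE (le_trans (l2norm_sum _ _ _))// ler_sum// => z _; exact: slice_norm.
rewrite meanZ; last by apply/bdd_sum => z _; exact: bddM.
rewrite mean_sum; last by move=> z _; exact: bddM.
rewrite (eq_bigr _ (fun z _ => Dsq z)) exchange_big exprMn l2norm_vec /sqs.
apply: (@le_trans _ _ ((size E)%:R * \sum_(x <- A) normc (u x) ^+ 2)).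
  rewrite ler_wpM2l//; apply: ler_sum => x _.
  rewrite (eq_bigr (fun z => if x.1 == z then normc (u x) ^+ 2 else 0)).
    by rewrite (fsum_pick E x.1 (fun=> normc (u x) ^+ 2)); case: ifP => //; rewrite sqr_ge0.
  by move=> z _; rewrite /c eq_sym; case: ifP; rewrite ?normc0 ?expr0n.
rewrite ler_wpM2r ?sumr_ge0// => [x _|]; first exact: sqr_ge0.
by rewrite -natrX ler_nat; case: (size E) => // k; rewrite expnS leq_pmulr.
Qed.

Let phi_bound (A B : {fset Z * G}) u v :
  normc (\sum_(x <- A) \sum_(y <- B) u x * (v y)^*%C * phi x y) <=
  (size E)%:R ^+ 2 * l2norm (vec A u : l2 R (Z * G)%type) * l2norm (vec B v : l2 R (Z * G)%type).
Proof.
rewrite phi_comb.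
apply: le_trans (cmean_norm_le (g := fun n => l2norm (comb n A u) * l2norm (comb n B v)) m _ _) _.
- exact: bddM.
- by move=> n; exact: cauchy_schwarz.
rewrite (_ : _ * _ * _ = ((size E)%:R * l2norm (vec A u : l2 R (Z * G)%type)) *
   ((size E)%:R * l2norm (vec B v : l2 R (Z * G)%type))); last by ring.
rewrite -(@ler_pXn2r _ 2)// ?nnegrE ?mulr_ge0 ?ler0n ?l2norm_ge0//; last first.
  by apply: mean_ge0 => [|n]; [exact: bddM|rewrite mulr_ge0 ?l2norm_ge0].
apply: le_trans (mean_cauchy _ _ _) _ => //; rewrite exprMn.
apply: ler_pM => //; try (apply: mean_ge0 => [|n]; [exact: bddM|exact: sqr_ge0]); exact: comb_sq.
Qed.

Let phi_conj x y : phi y x = (phi x y)^*%C.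
Proof. by rewrite /phi -cmeanJ//; apply: eq_cmean => n; exact: innerJ. Qed.

Let amp_lam_delta g (x : Z * G) :
  amp (lam g) (delta R x) = delta R (x.1, (g * x.2)%g).
Proof.
case: x => z h /=; rewrite -[delta R (z, h)]emb_delta (amp_emb _ _ (bop_lam R g)).
by rewrite lam_delta emb_delta.
Qed.

Let phi_lam g x y : phi (x.1, (g * x.2)%g) y = phi x (y.1, (g^-1 * y.2)%g).
Proof.
apply: eq_cmean => n; rewrite /part /= -lamM inner_lam lamM//.
Qed.

(** If H has kernel [phi] and L is a root of H, then the vectors L delta_x have Gram matrix [phi].
    Since [phi] is invariant under left translation, H commutes with 1 (x) lam g, and so does L. *)
Let gram_root : exists L : l2op R (Z * G)%type, [/\ bop L,
  forall x y, inner (L (delta R x)) (L (delta R y)) = phi x y &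
  forall g f, amp (lam g) (L f) = L (amp (lam g) f)].
Proof.
have [H [Hb _ HE]] := form_op (sqr_ge0 _) phi_bound.
have Hsa : is_adjoint H H.
  move=> f g; apply: (inner_ext Hb Hb) => x y.
  by rewrite inner_delta inner_deltal !HE; exact: phi_conj.
have Hpos f : 0 <= inner (H f) f.
  have := @positive_mx_dense R (Z * G)%type 1 (fun _ _ => H) (fun _ _ => Hb).
  move=> /(_ _ (fun=> f)); rewrite !big_ord1; apply=> A u; rewrite !big_ord1.
  set B := A _; set v := u _; rewrite (bop_vec Hb) inner_suml.
  rewrite (eq_bigr (fun x => \sum_(y <- B) v x * (v y)^*%C * phi x y)); last first.
    move=> x _; rewrite innerZl inner_vec mulr_sumr; apply: eq_bigr => y _.
    by rewrite HE; ring.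
  rewrite phi_comb; apply: cmean_ge0 => [|n]; last exact: inner_ge0.
  have [C CP] := comb_bdd B v; exists (C * C) => n.
  apply: le_trans (cauchy_schwarz _ _) _.
  by have := CP n; rewrite ger0_norm ?l2norm_ge0// => h; rewrite ler_pM ?l2norm_ge0.
have [L [Lb Lsa LL Lc]] := sqrt_pos Hb Hpos Hsa.
exists L; split=> // [x y|g f].
  by rewrite Lsa LL -Hsa inner_delta.
apply: Lc; first exact/bop_amp/bop_lam.
apply: bop_ext; try (apply: (@bop_comp _ _ _ _ (amp (lam g)) H) => //; exact/bop_amp/bop_lam).
  by apply: (@bop_comp _ _ _ _ H (amp (lam g))) => //; exact/bop_amp/bop_lam.
move=> x; rewrite amp_lam_delta; apply: l2_ext => -[z h].
by rewrite (ampE (bop_lam R g)) lamE sliceE !HE phi_lam.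
Qed.

Let phi_supp x y : (x.1 \notin E) || (y.1 \notin E) -> phi x y = 0.
Proof.
move=> xy; rewrite -[RHS](cmean_cst m); apply: eq_cmean => n; rewrite /part.
case/orP: xy => /kapE ->; rewrite (bop0 (bop_lam R _)) ?inner0l ?inner0r//.
Qed.

(** Gam delta_h represents the limit of (1 (x) lam h) kap n by an actual vector. Its components are
    operators on l2 G commuting with left translations, hence with the whole double commutant
    L(G). *)
Lemma gram_isometry : exists Gam : l2 R G -> l2 R (Z * (Z * G))%type, [/\ bop Gam,
  forall f, l2norm (Gam f) = l2norm f,
  forall x, group_vna R G x -> forall f, amp (amp x) (Gam f) = Gam (x f),
  forall z f, z \notin E -> slice z (Gam f) = 0 &
  forall z z' h h', inner (slice z (Gam (delta R h))) (slice z' (Gam (delta R h'))) =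
    cmean m (fun n => inner (lam h (slice z (kap n))) (lam h' (slice z' (kap n))))].
Proof.
have [L [Lb LL Lc]] := gram_root.
pose Gam f : l2 R (Z * (Z * G))%type := \sum_(z <- E) emb z (L (emb z f)).
have Gb : bop Gam.
  apply: bop_bigsum => z; apply: (bop_comp (bop_emb R _ z)).
  exact: (bop_comp Lb (bop_emb R _ z)).
have Gs z f : slice z (Gam f) = if z \in E then L (emb z f) else 0.
  rewrite /Gam (bop_sum (bop_slice R _ z)) -(fsum_pick E z (fun z => L (emb z f))).
  by apply: eq_bigr => z' _; rewrite slice_emb.
have Glam g f : amp (amp (lam g)) (Gam f) = Gam (lam g f).
  have ab := bop_amp Z (bop_lam R g).
  rewrite /Gam (bop_sum (bop_amp Z ab)); apply: eq_bigr => z _.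
  by rewrite (amp_emb _ _ ab) Lc (amp_emb _ _ (bop_lam R g)).
clearbody Gam.
have Gsupp z f : z \notin E -> slice z (Gam f) = 0 by move=> /negbTE zE; rewrite Gs zE.
have Gphi z z' h h' : inner (slice z (Gam (delta R h))) (slice z' (Gam (delta R h'))) =
    phi (z, h) (z', h').
  rewrite (Gs z (delta R h)) (Gs z' (delta R h')).
  have [zE|zE] := boolP (z \in E); last by rewrite inner0l phi_supp ?zE.
  have [zE'|zE'] := boolP (z' \in E); last by rewrite inner0r phi_supp ?zE' ?orbT.
  by rewrite !emb_delta LL.
exists Gam; split=> //.
  have Gid : forall f, adj Gam (Gam f) = f.
    apply: bop_ext; [exact: (bop_comp (bop_adj Gb) Gb)|exact: bop_id|].
    move=> h; apply: l2_ext => h'; rewrite (adjE Gb) (inner_supp _ (fun z => Gsupp z _)).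
    rewrite (eq_bigr _ (fun z _ => Gphi z z h h')) /phi -cmean_sum// deltaE.
    transitivity ((h == h')%:R : R[i]); last by rewrite eq_sym; case: eqP.
    rewrite -kap_orth; apply: eq_cmean => n; rewrite [RHS](@inner_supp _ _ _ E).
      apply: eq_bigr => z _.
      by rewrite (slice_amp (bop_lam R h) z) (slice_amp (bop_lam R h') z).
    by move=> z zE; rewrite (slice_amp (bop_lam R _)) kapE// (bop0 (bop_lam R h)).
  move=> f; apply/eqP; rewrite -(@eqrXn2 _ 2) ?l2norm_ge0// !l2norm_sqE.
  by rewrite (adjP Gb) Gid.
move=> x xM f; have xb := vna_bop (@group_vna_vna R G) xM.
apply: slice_ext => z; apply: slice_ext => z'.
rewrite (slice_amp (bop_amp Z xb)) (slice_amp xb).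
pose S f := slice z' (slice z (Gam f)); rewrite -!/(S _).
have := xM; rewrite /group_vna => /commutantP[_]; apply.
apply/commutantP; split.
  apply: (bop_comp (bop_slice R _ z')); exact: (bop_comp (bop_slice R _ z) Gb).
move=> _ [g _ <-] h; rewrite /S -Glam (slice_amp (bop_amp Z (bop_lam R g))).
by rewrite (slice_amp (bop_lam R g)).
Qed.

End Gram.

Section TranslatedGram.
Variables (R : realType) (G : groupType) (N : Type) (m : mean R N).
Variables (kap : N -> l2 R (G * G)%type) (E : {fset G}).
Notation lam := (@left_regular R G).
Hypothesis kapE : forall n z, z \notin E -> slice z (kap n) = 0.
Hypothesis kap1 : forall n, l2norm (kap n) <= 1.
Hypothesis kap_orth : forall h h', cmean m (fun n =>
  inner (amp (lam h) (kap n)) (amp (lam h') (kap n))) = (h == h')%:R.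

(** The vector is Gam delta_1. The inner products of its translates are the limits of those of kap
    n, so the norms of all finite combinations survive the limit; the last clause holds because Gam
    is an isometry intertwining the actions of L(G). *)
Lemma gram_vector : exists w : l2 R (G * (G * G))%type,
  [/\ forall r : seq (R[i] * (G * G)),
    l2norm (\sum_(x <- r) x.1 *: Lam x.2.1 (amp (amp (lam x.2.2)) w)) ^+ 2 =
    m (fun n => l2norm (\sum_(x <- r) x.1 *: Lam x.2.1 (amp (lam x.2.2) (kap n))) ^+ 2),
   forall p q, inner (Lam p w) (Lam q w) = cmean m (fun n => inner (Lam p (kap n)) (Lam q (kap n))) &
   forall x (A : {fset G}) c, group_vna R G x ->
     l2norm (amp (amp x) w - \sum_(h <- A) c h *: amp (amp (lam h)) w) =
     l2norm (x (delta R 1%g) - vec A c)].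
Proof.
have [Gam [Gb Giso GM Gs Gphi]] := gram_isometry kapE kap1 kap_orth.
pose w := Gam (delta R 1%g).
have wh h : amp (amp (lam h)) w = Gam (delta R h).
  by rewrite GM ?lam_delta ?mulg1//; exact: lam_group_vna.
have cb p q h h' : cbdd (fun n => inner (Lam p (amp (lam h) (kap n))) (Lam q (amp (lam h') (kap n)))).
  have k1 n g : l2norm (amp (lam g) (kap n)) <= 1.
    have h1 : opbound (lam g) 1 by move=> f; rewrite l2norm_lam mul1r.
    have := amp_bound (Z := G) (bop_lam R g) ler01 h1 (kap n); rewrite mul1r => /le_trans; exact.
  exists (1 * 1) => n; apply: cauchy_schwarz_le.
    by rewrite (l2norm_Lam p) k1.
  by rewrite (l2norm_Lam q) k1.
have sl n p h z : slice z (Lam p (amp (lam h) (kap n))) = lam h (slice (p * z)%g (kap n)).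
  by rewrite slice_Lam (slice_amp (bop_lam R h)).
have key p q h h' : inner (Lam p (amp (amp (lam h)) w)) (Lam q (amp (amp (lam h')) w)) =
    cmean m (fun n => inner (Lam p (amp (lam h) (kap n))) (Lam q (amp (lam h') (kap n)))).
  (* [Lam p] moves the set of nonzero slices from [E] into p^-1 [E]. *)
  pose E' := ((fun z => p^-1 * z)%g @` E)%fset.
  have E'P z : z \notin E' -> (p * z)%g \notin E.
    apply: contra => pz; apply/imfsetP; exists (p * z)%g => //.
    by rewrite mulKg.
  rewrite !wh (@inner_supp _ _ _ E'); last by move=> z /E'P pz; rewrite slice_Lam Gs.
  under eq_bigr => z _ do rewrite !slice_Lam Gphi.
  rewrite -cmean_sum; last first.
    move=> z; exists (1 * 1) => n; apply: cauchy_schwarz_le.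
      by rewrite l2norm_lam (le_trans (slice_norm _ _)).
    by rewrite l2norm_lam (le_trans (slice_norm _ _)).
  apply: eq_cmean => n; rewrite [RHS](@inner_supp _ _ _ E').
    by apply: eq_bigr => z _; rewrite (sl n p h z) (sl n q h' z).
  move=> z /E'P pz.
  by rewrite (sl n p h z) kapE// (bop0 (bop_lam R h)).
exists w; split.
- move=> r; apply: complexI; rewrite -inner_self inner_suml.
  transitivity (cmean m (fun n => inner
    (\sum_(x <- r) x.1 *: Lam x.2.1 (amp (lam x.2.2) (kap n)))
    (\sum_(x <- r) x.1 *: Lam x.2.1 (amp (lam x.2.2) (kap n))))); last first.
    by rewrite -cmean_real; apply: eq_cmean => n; rewrite inner_self.
  under [RHS]eq_cmean => n do rewrite inner_suml.
  rewrite cmean_sum; last first.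
    move=> x; set u := (fun n => _); rewrite (_ : u = fun n => \sum_(y <- r)
      x.1 * (y.1^*%C * inner (Lam x.2.1 (amp (lam x.2.2) (kap n))) (Lam y.2.1 (amp (lam y.2.2) (kap n))))).
      by apply: cbdd_sum => y; do 2 apply: cbddZ.
    by apply/funext => n; rewrite /u inner_sumr; apply: eq_bigr => y _; rewrite innerZl innerZr.
  apply: eq_bigr => x _; rewrite inner_sumr.
  under [RHS]eq_cmean => n do rewrite inner_sumr.
  rewrite cmean_sum; last first.
    move=> y; set u := (fun n => _); rewrite (_ : u = fun n => 
      x.1 * (y.1^*%C * inner (Lam x.2.1 (amp (lam x.2.2) (kap n))) (Lam y.2.1 (amp (lam y.2.2) (kap n))))).
      by do 2 apply: cbddZ.
    by apply/funext => n; rewrite /u innerZl innerZr.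
  apply: eq_bigr => y _; rewrite innerZl innerZr key -!cmeanZ//; last exact: cbddZ.
  by apply: eq_cmean => n; rewrite innerZl innerZr.
- have lamid f : amp (lam 1%g) f = f :> l2 R (G * G)%type.
    by apply: slice_ext => z; rewrite (slice_amp (bop_lam R _)) lam1.
  have lamid2 f : amp (amp (lam 1%g)) f = f :> l2 R (G * (G * G))%type.
    by apply: slice_ext => z; rewrite (slice_amp (bop_amp G (bop_lam R _))) lamid.
  move=> p q; have := key p q 1%g 1%g; rewrite !lamid2 => ->.
  by apply: eq_cmean => n; rewrite !lamid.
- move=> x A c xM; rewrite -Giso (bopB Gb) (bop_vec Gb) -GM//.
  by under eq_bigr => h _ do rewrite wh.
Qed.

End TranslatedGram.

Lemma isometry_inner (R : realType) (X Y : choiceType) (V : l2 R X -> l2 R Y) f g :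
  bop V -> (forall f, l2norm (V f) = l2norm f) -> inner (V f) (V g) = inner f g.
Proof.
move=> Vb Vi.
have re h k : complex.Re (inner (V h) (V k)) = complex.Re (inner h k).
  have := l2norm_sqD (V h) (V k); rewrite -(bopD Vb) !Vi l2norm_sqD; lra.
have im (z : R[i]) : complex.Im z = complex.Re ((Complex 0 1)^*%C * z).
  by case: z => a b /=; ring.
apply/eqP; rewrite eq_complex; apply/andP; split; apply/eqP; first exact: re.
by rewrite im [RHS]im -!innerZr -(bopZ Vb) re.
Qed.

Lemma inner_close (R : realType) (X : choiceType) (f g f' g' : l2 R X) (e : R) :
  l2norm f' <= 1 -> l2norm g <= 1 -> l2norm (f - f') <= e -> l2norm (g - g') <= e ->
  normc (inner f g - inner f' g') <= 2 * e.
Proof.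
move=> f1 g1 fe ge.
have -> : inner f g - inner f' g' = inner (f - f') g + inner f' (g - g').
  by rewrite innerBl innerBr; ring.
apply: le_trans (le_normcD _ _) _.
have := cauchy_schwarz_le fe g1; have := cauchy_schwarz_le f1 ge.
by lra.
Qed.

Lemma inv_nat_le (R : realType) (c : R) : 0 < c ->
  exists K : nat, forall k, (K <= k)%N -> 5 / k.+1%:R <= c.
Proof.
move=> c0; exists (Num.truncn (5 / c)) => k Kk.
rewrite ler_pdivrMr ?ltr0n// mulrC -ler_pdivrMr//.
by apply: le_trans (ltW (truncnS_gt _)) _; rewrite ler_nat ltnS.
Qed.

(** * Approximate substitutes of delta_1 for the relative commutant *)

Section Window.
Variables (R : realType) (G : groupType) (Q : set (l2op R G)).
Hypothesis Qv : von_neumann_algebra Q.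
Hypothesis QM : Q `<=` group_vna R G.
Hypothesis Qd : diffuse Q.
Hypothesis GB : boundary_amenable R G.
Notation lam := (@left_regular R G).
Notation M := (group_vna R G).
Notation d0 := (delta R (1%g : G)).

Let Mv := @group_vna_vna R G.

(** By traciality the left translates of u d0 have the same Gram matrix as those of d0. *)
Lemma inner_lam_unitary u h h' : M u -> is_adjoint u u -> (forall f, u (u f) = f) ->
  inner (lam h (u d0)) (lam h' (u d0)) = (h == h')%:R.
Proof.
move=> Mu uu u2; rewrite -(invgK h') -inner_lam lamM -uu invgK.
have Ma : M (fun f => u (lam (h'^-1 * h)%g f)).
  by apply: (vna_comp Mv Mu); exact: lam_group_vna.
rewrite (traceC Ma Mu) u2 lam_delta mulg1 inner_delta deltaE eq_sym.
have -> : ((h'^-1 * h)%g == 1%g) = (h == h').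
  apply/eqP/eqP => [hh|->]; last by rewrite mulVg.
  by rewrite -[h](mulVKg h') hh mulg1.
by case: eqP.
Qed.

Lemma lam_comb_vna (A : {fset G}) c : M (fun f => \sum_(h <- A) c h *: lam h f).
Proof.
apply/group_vnaP; split.
  by apply: bop_bigsum => h; apply: bop_scale; exact: bop_lam.
move=> g f; rewrite (bop_sum (bop_rho R g)); apply: eq_bigr => h _.
by rewrite (bopZ (bop_rho R g)) lam_rho.
Qed.

(** The combination of the lam h approximates x, and x commutes with u: applied to u d0 it is near x
    u d0 = u x d0, which is near u of the truncation. Each of the two steps costs the norm of x d0 -
    vec A c, the first one by traciality. *)
Lemma translate_unitary u x (A : {fset G}) c : Q u -> is_adjoint u u ->
  (forall f, u (u f) = f) -> M x -> commutant Q x ->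
  l2norm (\sum_(h <- A) c h *: lam h (u d0) - u (vec A c)) <= 2 * l2norm (x d0 - vec A c).
Proof.
move=> Qu uu u2 Mx Px; have Mu := QM Qu; have ub := vna_bop Mv Mu.
have Ma := lam_comb_vna A c.
have [_ xu] := (commutantP _ _).1 Px.
apply: le_trans (ler_l2dist (x (u d0)) _ _) _.
have un f : l2norm (u f) = l2norm f.
  by apply: (@unitary_norm _ _ u u).
rewrite xu// -(bopB ub) un mulr_natl mulr2n lerD2r.
have Md := vna_sub Mv Ma Mx.
rewrite -xu// (l2norm_mul_unitary Md Mu Mu uu u2) l2normB.
rewrite (_ : \sum_(h <- A) _ = vec A c)//.
by apply: eq_bigr => h _; rewrite lam_delta mulg1.
Qed.

(** The vector is V u d0, with u small on the exceptional set of mu. For n = (F', k) both the left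
    tolerance of mu and the mass of u d0 on that set are 1 / (k + 1), and the constant 4 of the
    commutator bounds yields 5 / (k + 1). The support does not depend on n. *)
Let spread_vector (F : {fset G}) e : 0 < e -> exists E : {fset G},
  forall n : {fset G} * nat, exists kuV : l2 R (G * G)%type * l2op R G * (l2 R G -> l2 R (G * G)%type),
  let: (kap, u, V) := kuV in
  [/\ forall z, z \notin E -> slice z kap = 0, l2norm kap = 1,
    [/\ Q u, is_adjoint u u, forall f, u (u f) = f, bop V &
        forall f, l2norm (V f) = l2norm f],
    forall h, h \in n.1 -> l2norm (amp (lam h) kap - V (lam h (u d0))) ^+ 2 <= 5 / n.2.+1%:R &
    forall p, p \in F -> l2norm (Lam p kap - V (u (delta R p))) ^+ 2 <= e + 4 / n.2.+1%:R].
Proof.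
move=> e0; have [E hE] := GB F e0; exists E => -[F' k] /=.
have k0 : 0 < 1 / k.+1%:R :> R by rewrite divr_gt0.
have [mu [S [muP muF' muF]]] := hE F' _ k0.
have [u [Qu uu u2 uS]] := small_unitary Qv QM Qd S k0.
have Mu := QM Qu; have ub := vna_bop Mv Mu.
have un f : l2norm (u f) = l2norm f by apply: (@unitary_norm _ _ u u).
have u1 : l2norm (u d0) = 1 by rewrite un l2norm_delta.
exists (spread mu (u d0), u, spread mu); split.
- by move=> z; exact: slice_spread.
- by rewrite (l2norm_spread muP).
- split=> //; [exact: (bop_spread muP)|exact: (l2norm_spread muP)].
- move=> h hF'; apply: le_trans (spread_lam muP (S := S) _ (ltW k0) _) _.
    by move=> t A tS; exact: muF'.
  by rewrite u1 expr1n mulr1; move: uS; rewrite !mul1r; move: (k.+1%:R^-1) (sqs _ _) => x y; lra.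
- move=> p pF; have := spread_Lam muP (p := p) (S := S) (u d0) (ltW e0).
  rewrite u1 expr1n mulr1 -(group_vna_delta p Mu) => /(_ _) h.
  apply: le_trans (h _) _; first by move=> t A tS; exact: muF.
  by move: uS; rewrite mul1r; move: (k.+1%:R^-1) (sqs _ _) => x y; lra.
Qed.

(* For the operators x (x) 1 (x) 1 with x in Q' /\ M and the translations Lam p,
   the vector w is an approximate substitute of delta_1. *)
Lemma window (F : {fset G}) e : 0 < e -> exists w : l2 R (G * (G * G))%type,
  (forall p q, p \in F -> q \in F ->
     normc (inner (Lam p w) (Lam q w) - (p == q)%:R) <= e) /\
  (forall x (A : {fset G}) c, (commutant Q `&` M) x -> fsubset A F ->
     l2norm (amp (amp x) w - \sum_(p <- A) c p *: Lam p w) <=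
     3 * l2norm (x d0 - vec A c) + (\sum_(p <- A) normc (c p)) * e).
Proof.
(* Two approximations within eta make up e; taking a fifth of eta^2 as tolerance leaves room for the
   term 4 / (k + 1). *)
move=> e0; pose eta := e / 2; have eta0 : 0 < eta by rewrite divr_gt0.
have e'0 : 0 < eta ^+ 2 / 5 by rewrite divr_gt0// exprn_gt0.
have [E hE] := spread_vector F e'0.
have [kuV kP] := choice hE.
pose kap n := (kuV n).1.1; pose u n := (kuV n).1.2; pose V n := (kuV n).2.
have {hE}kP n : [/\ forall z, z \notin E -> slice z (kap n) = 0, l2norm (kap n) = 1,
    [/\ Q (u n), is_adjoint (u n) (u n), forall f, u n (u n f) = f, bop (V n) &
        forall f, l2norm (V n f) = l2norm f],
    forall h, h \in n.1 -> l2norm (amp (lam h) (kap n) - V n (lam h (u n d0))) ^+ 2 <= 5 / n.2.+1%:R &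
    forall p, p \in F -> l2norm (Lam p (kap n) - V n (u n (delta R p))) ^+ 2 <= eta ^+ 2 / 5 + 4 / n.2.+1%:R].
  by have := kP n; rewrite /kap /u /V; case: (kuV n) => [[a b] c].
clearbody kap u V.
pose le (n n' : {fset G} * nat) := fsubset n.1 n'.1 /\ (n.2 <= n'.2)%N.
have [m mt] : exists m : mean R ({fset G} * nat), tail_pos le m.
  apply: (@directed_mean R _ le (fset0, 0%N)) => [x|x y z [h1 h2] [h3 h4]|x y].
  - by split.
  - by split; [exact: fsubset_trans h1 h3|exact: leq_trans h2 h4].
  - exists (x.1 `|` y.1, maxn x.2 y.2)%fset; split; split=> /=; rewrite ?leq_maxl ?leq_maxr//.
      exact: fsubsetUl.
    exact: fsubsetUr.
have kapE n z : z \notin E -> slice z (kap n) = 0 by case: (kP n) => h _ _ _ _; exact: h.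
have kap1 n : l2norm (kap n) <= 1 by case: (kP n) => _ -> _ _ _.
have amp1 n h : l2norm (amp (lam h) (kap n)) <= 1.
  have h1 : opbound (lam h) 1 by move=> f; rewrite l2norm_lam mul1r.
  have := amp_bound (Z := G) (bop_lam R h) ler01 h1 (kap n); rewrite mul1r => /le_trans; exact.
have Vlam1 n h : l2norm (V n (lam h (u n d0))) = 1.
  have [_ _ [Qu uu u2 _ ->] _ _] := kP n; rewrite l2norm_lam.
  by rewrite (@unitary_norm _ _ (u n) (u n))// l2norm_delta.
have Vd1 n p : l2norm (V n (u n (delta R p))) = 1.
  have [_ _ [Qu uu u2 _ ->] _ _] := kP n.
  by rewrite (@unitary_norm _ _ (u n) (u n))// l2norm_delta.
have small a : 0 < a -> exists K : nat, forall n, (K <= n.2)%N -> forall h, h \in n.1 ->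
    l2norm (amp (lam h) (kap n) - V n (lam h (u n d0))) <= a.
  move=> a0; have a20 : 0 < a ^+ 2 by rewrite exprn_gt0.
  have [K KP] := inv_nat_le a20; exists K => n /KP nK h hn.
  have [_ _ _ h1 _] := kP n.
  rewrite -(@ler_pXn2r _ 2)// ?nnegrE ?l2norm_ge0 ?(ltW a0)//.
  exact: le_trans (h1 h hn) nK.
have smallF : exists K : nat, forall n, (K <= n.2)%N -> forall p, p \in F ->
    l2norm (Lam p (kap n) - V n (u n (delta R p))) <= eta.
  have [K KP] := inv_nat_le e'0; exists K => n /KP nK p pF.
  have [_ _ _ _ h1] := kP n.
  rewrite -(@ler_pXn2r _ 2)// ?nnegrE ?l2norm_ge0 ?(ltW eta0)//.
  apply: le_trans (h1 p pF) _; move: nK e'0; move: (n.2.+1%:R^-1) (eta ^+ 2) => x y; lra.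
have kap_orth h h' : cmean m (fun n =>
    inner (amp (lam h) (kap n)) (amp (lam h') (kap n))) = (h == h')%:R.
  apply: (ctail_lim mt) => [|a a0]; first by exists (1 * 1) => n; exact: cauchy_schwarz_le.
  have a20 : 0 < a / 2 by rewrite divr_gt0.
  have [K KP] := small _ a20; exists ([fset h; h']%fset, K) => n [/fsubsetP hn Kn].
  have [_ _ [Qu uu u2 Vb Vi] _ _] := kP n.
  rewrite -(inner_lam_unitary h h' (QM Qu) uu u2) -(isometry_inner _ _ Vb Vi).
  rewrite [leRHS](_ : _ = 2 * (a / 2)); last by field.
  apply: inner_close; [by rewrite Vlam1|exact: amp1| |].
    by apply: KP => //; apply: hn; rewrite !inE eqxx.
  by apply: KP => //; apply: hn; rewrite !inE eqxx orbT.
have [w [wg wLam wx]] := gram_vector kapE kap1 kap_orth.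
exists w; split.
  move=> p q pF qF; rewrite wLam -(cmean_cst m (p == q)%:R) -cmeanB; last 2 first.
  - by exists (1 * 1) => n; apply: cauchy_schwarz_le; rewrite l2norm_Lam.
  - exact: cbdd_cst.
  have [K KP] := smallF; apply: (ctail_norm mt).
    apply: cbddB; last exact: cbdd_cst.
    by exists (1 * 1) => n; apply: cauchy_schwarz_le; rewrite l2norm_Lam.
  exists (fset0, K) => n [_ Kn].
  have [_ _ [Qu uu u2 Vb Vi] _ _] := kP n.
  have -> : (p == q)%:R = inner (V n (u n (delta R p))) (V n (u n (delta R q))) :> R[i].
    by rewrite (isometry_inner _ _ Vb Vi) uu u2 inner_delta deltaE eq_sym; case: eqP.
  rewrite [leRHS](_ : _ = 2 * eta); last by rewrite /eta; field.
  by apply: inner_close; [rewrite Vd1|rewrite l2norm_Lam|exact: KP|exact: KP].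
move=> x A c [Px Mx] AF; set D := l2norm (x d0 - vec A c).
apply: le_trans (ler_l2dist (\sum_(h <- A) c h *: amp (amp (lam h)) w) _ _) _.
(* One D is the price of replacing x by a combination of left translations; the other two come from
   [translate_unitary]. *)
rewrite wx// -/D (_ : 3 * D + _ = D + (2 * D + (\sum_(p <- A) normc (c p)) * e)); last by ring.
rewrite lerD2l.
(* The difference of the two combinations becomes a single list, to which the norm identity of
   [gram_vector] applies. *)
pose r : seq (R[i] * (G * G)) := [seq (c h, (1%g, h)) | h <- A] ++ [seq (- c p, (p, 1%g)) | p <- A].
have lamid f : amp (lam 1%g) f = f :> l2 R (G * G)%type.
  by apply: slice_ext => z; rewrite (slice_amp (bop_lam R _)) lam1.
have lamid2 f : amp (amp (lam 1%g)) f = f :> l2 R (G * (G * G))%type.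
  by apply: slice_ext => z; rewrite (slice_amp (bop_amp G (bop_lam R _))) lamid.
have rw : \sum_(x <- r) x.1 *: Lam x.2.1 (amp (amp (lam x.2.2)) w) =
   \sum_(h <- A) c h *: amp (amp (lam h)) w - \sum_(p <- A) c p *: Lam p w.
  rewrite big_cat !big_map /= -sumrN; congr (_ + _); apply: eq_bigr => h _.
    by rewrite Lam1.
  by rewrite lamid2 scaleNr.
have rk n : \sum_(x <- r) x.1 *: Lam x.2.1 (amp (lam x.2.2) (kap n)) =
   \sum_(h <- A) c h *: amp (lam h) (kap n) - \sum_(p <- A) c p *: Lam p (kap n).
  rewrite big_cat !big_map /= -sumrN; congr (_ + _); apply: eq_bigr => h _.
    by rewrite Lam1.
  by rewrite lamid scaleNr.
have s0 : 0 <= \sum_(p <- A) normc (c p) by apply: sumr_ge0 => p _; exact: normc_ge0.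
rewrite -(@ler_pXn2r _ 2)// ?nnegrE ?l2norm_ge0 ?addr_ge0 ?mulr_ge0 ?l2norm_ge0// ?(ltW e0)//.
rewrite -rw wg.
have [K1 K1P] := small _ eta0; have [K2 K2P] := smallF.
apply: (tail_le mt).
  have cb : bdd (fun n => l2norm (\sum_(x <- r) x.1 *: Lam x.2.1 (amp (lam x.2.2) (kap n)))).
    exists (\sum_(x <- r) normc x.1) => n; rewrite ger0_norm ?l2norm_ge0//.
    apply: le_trans (l2norm_sum _ _ _) _; apply: ler_sum => y _.
    by rewrite l2normZ -[leRHS]mulr1 ler_wpM2l ?normc_ge0// l2norm_Lam.
  exact: (bddM cb cb).
exists (A, maxn K1 K2) => n [An]; rewrite /= geq_max => /andP[K1n K2n].
have [_ _ [Qu uu u2 Vb Vi] _ _] := kP n.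
rewrite ler_sqr ?nnegrE ?l2norm_ge0 ?addr_ge0 ?mulr_ge0 ?l2norm_ge0// ?(ltW e0)//.
rewrite rk.
pose a := \sum_(h <- A) c h *: V n (lam h (u n d0)).
pose b := \sum_(p <- A) c p *: V n (u n (delta R p)).
apply: le_trans (ler_l2dist a _ _) _.
have h1 : l2norm (\sum_(h <- A) c h *: amp (lam h) (kap n) - a) <= (\sum_(p <- A) normc (c p)) * eta.
  rewrite /a -sumrB (le_trans (l2norm_sum _ _ _))// mulr_suml big_seq [leRHS]big_seq.
  apply: ler_sum => h hA; rewrite -scalerBr l2normZ ler_wpM2l ?normc_ge0//.
  by apply: K1P => //; exact: (fsubsetP An).
have h2 : l2norm (\sum_(p <- A) c p *: Lam p (kap n) - b) <= (\sum_(p <- A) normc (c p)) * eta.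
  rewrite /b -sumrB (le_trans (l2norm_sum _ _ _))// mulr_suml big_seq [leRHS]big_seq.
  apply: ler_sum => h hA; rewrite -scalerBr l2normZ ler_wpM2l ?normc_ge0//.
  by apply: K2P => //; exact: (fsubsetP AF).
have h3 : l2norm (a - b) <= 2 * D.
  have ub := vna_bop Qv Qu.
  have -> : a - b = V n (\sum_(h <- A) c h *: lam h (u n d0) - u n (vec A c)).
    rewrite (bopB Vb) (bop_sum Vb) (bop_vec ub) (bop_sum Vb).
    by congr (_ - _); apply: eq_bigr => h _; rewrite (bopZ Vb).
  by rewrite Vi; exact: translate_unitary.
apply: le_trans (lerD h1 (ler_l2dist b _ _)) _.
rewrite (l2normB b) -[e](_ : eta + eta = e); last by rewrite /eta; field.
move: h2 h3; move: (l2norm (a - b)) (l2norm _) (\sum_(p <- A) normc _) => x1 x2 x3 h2 h3.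
by lra.
Qed.

End Window.

(** * Compression along asymptotically orthonormal vectors, and injectivity *)

Section Compression.
Variables (R : realType) (X Y : choiceType) (N : Type) (m : mean R N).
Variables (xi : N -> X -> l2 R Y) (K : R).
Hypothesis xiK : forall n p, l2norm (xi n p) <= K.
Hypothesis xi_orth : forall p q, cmean m (fun n => inner (xi n p) (xi n q)) = (p == q)%:R.
Implicit Types (T S : l2op R Y).

Let comb n (A : {fset X}) u : l2 R Y := \sum_(p <- A) u p *: xi n p.

Let comb_bdd A u : bdd (fun n => l2norm (comb n A u)).
Proof.
exists (\sum_(x <- A) normc (u x) * K) => n; rewrite ger0_norm ?l2norm_ge0//.
apply: le_trans (l2norm_sum _ _ _) _; apply: ler_sum => x _.
by rewrite l2normZ ler_wpM2l ?normc_ge0.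
Qed.

Let cb T p q : bop T -> cbdd (fun n => inner (T (xi n p)) (xi n q)).
Proof.
move=> /bop_bound[c c0 Tc]; exists (c * K * K) => n; apply: cauchy_schwarz_le => //.
by apply: le_trans (Tc _) _; rewrite ler_wpM2l// ltW.
Qed.

Let phi T p q := cmean m (fun n => inner (T (xi n p)) (xi n q)).

Let phi_comb T (A B : {fset X}) u v : bop T ->
  \sum_(p <- A) \sum_(q <- B) u p * (v q)^*%C * phi T p q =
  cmean m (fun n => inner (T (comb n A u)) (comb n B v)).
Proof.
move=> Tb.
under eq_bigr => p _ do under eq_bigr => q _ do (rewrite -cmeanZ; [|exact: cb]).
under eq_bigr => p _ do (rewrite -cmean_sum; [|by move=> q; apply: cbddZ; exact: cb]).
rewrite -cmean_sum; last by move=> p; apply: cbdd_sum => q; apply: cbddZ; exact: cb.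
apply: eq_cmean => n; rewrite /comb (bop_sum Tb) inner_suml; apply: eq_bigr => p _.
rewrite inner_sumr; apply: eq_bigr => q _.
by rewrite (bopZ Tb) innerZl innerZr mulrA.
Qed.

Let comb_sq A u : m (fun n => l2norm (comb n A u) ^+ 2) = l2norm (vec A u : l2 R X) ^+ 2.
Proof.
apply: complexI; rewrite -cmean_real.
under eq_cmean => n do rewrite -inner_self.
rewrite -(phi_comb A A u u (bop_id R Y)) -inner_self inner_vec.
rewrite big_seq [RHS]big_seq; apply: eq_bigr => p pA.
rewrite /phi vecE pA (eq_bigr (fun q => if p == q then u p * (u q)^*%C else 0)).
  by rewrite (fsum_pick A p (fun q => u p * (u q)^*%C)) pA.
by move=> q _; rewrite xi_orth; case: eqP; rewrite ?mulr1 ?mulr0.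
Qed.

Let phi_bound T c (A B : {fset X}) u v : bop T -> 0 <= c -> opbound T c ->
  normc (\sum_(p <- A) \sum_(q <- B) u p * (v q)^*%C * phi T p q) <=
  c * l2norm (vec A u : l2 R X) * l2norm (vec B v : l2 R X).
Proof.
move=> Tb c0 Tc; rewrite phi_comb//.
have bb := bddM (comb_bdd A u) (comb_bdd B v).
apply: le_trans (cmean_norm_le (g := fun n => c * (l2norm (comb n A u) * l2norm (comb n B v))) m _ _) _.
- exact: bddZ.
- by move=> n; rewrite mulrA; exact: cauchy_schwarz_le.
rewrite meanZ// -mulrA ler_wpM2l//.
rewrite -(@ler_pXn2r _ 2)// ?nnegrE ?mulr_ge0 ?l2norm_ge0//; last first.
  by apply: mean_ge0 => // n; rewrite mulr_ge0 ?l2norm_ge0.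
apply: le_trans (mean_cauchy _ _ _) _ => //.
by rewrite !comb_sq exprMn.
Qed.

Let compress_exists T : exists S : l2op R X, bop T ->
  [/\ bop S, forall p q, S (delta R p) q = phi T p q &
    forall c, 0 <= c -> opbound T c -> opbound S c].
Proof.
have [Tb|nTb] := pselect (bop T); last by exists (fun=> 0).
have [c c0 Tc] := bop_bound Tb.
have [S [Sb _ SE]] := form_op (ltW c0) (fun A B u v => phi_bound A B u v Tb (ltW c0) Tc).
exists S => _; split=> // d d0 Td.
have [S' [S'b S'd S'E]] := form_op d0 (fun A B u v => phi_bound A B u v Tb d0 Td).
move=> f; rewrite (bop_ext Sb S'b) ?S'd// => p; apply: l2_ext => q.
by rewrite SE S'E.
Qed.

(** The compression by the isometry which the families [xi n] define in the limit, given by its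
    matrix coefficients; it has junk values on unbounded maps. *)
Definition compress T : l2op R X := projT1 (cid (compress_exists T)).

Lemma compressP T : bop T -> [/\ bop (compress T),
  forall p q, compress T (delta R p) q = cmean m (fun n => inner (T (xi n p)) (xi n q)) &
  forall c, 0 <= c -> opbound T c -> opbound (compress T) c].
Proof. by rewrite /compress; case: cid. Qed.

Lemma compress_lin a T S : bop T -> bop S ->
  compress (fun f => a *: T f + S f) = (fun f => a *: compress T f + compress S f).
Proof.
move=> Tb Sb; apply/funext.
have [Cb CE _] := compressP (bop_lin a Tb Sb).
have [Tb' TE _] := compressP Tb; have [Sb' SE _] := compressP Sb.
apply: bop_ext => // [|p]; first exact: bop_lin.
apply: l2_ext => q; rewrite CE [RHS]l2DE l2ZE TE SE -cmeanZ; last exact: cb.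
rewrite -cmeanD; [|by apply: cbddZ; exact: cb|exact: cb].
by apply: eq_cmean => n; rewrite innerDl innerZl.
Qed.

Lemma compress_id : compress id = id.
Proof.
have [Cb CE _] := compressP (bop_id R Y).
apply/funext; apply: bop_ext => // [|p]; first exact: bop_id.
by apply: l2_ext => q; rewrite CE xi_orth deltaE eq_sym; case: eqP.
Qed.

Lemma compress_adj T : bop T -> compress (adj T) = adj (compress T).
Proof.
move=> Tb; have [Cb CE _] := compressP Tb; have [Ab AE _] := compressP (bop_adj Tb).
apply/funext; apply: bop_ext => // [|p]; first exact: bop_adj.
apply: l2_ext => q; rewrite AE adjE// inner_deltal CE -cmeanJ; last exact: cb.
by apply: eq_cmean => n; rewrite (adjPr Tb) innerJ.
Qed.

Lemma compress_positive n (a : 'I_n -> 'I_n -> l2op R Y) : (forall i j, bop (a i j)) ->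
  positive_mx a -> positive_mx (fun i j => compress (a i j)).
Proof.
move=> ab ap; apply: positive_mx_dense => [i j|A u]; first by have [] := compressP (ab i j).
rewrite (eq_bigr (fun i => \sum_(j < n)
    cmean m (fun k => inner (a i j (comb k (A j) (u j))) (comb k (A i) (u i))))); last first.
  move=> i _; apply: eq_bigr => j _; rewrite -phi_comb//.
  have [Cb CE _] := compressP (ab i j).
  rewrite (bop_vec Cb) inner_suml; apply: eq_bigr => p _.
  by rewrite innerZl inner_vec mulr_sumr; apply: eq_bigr => q _; rewrite CE /phi; ring.
have bb i j : cbdd (fun k => inner (a i j (comb k (A j) (u j))) (comb k (A i) (u i))).
  have [c c0 Tc] := bop_bound (ab i j).
  have [C1 C1P] := comb_bdd (A j) (u j); have [C2 C2P] := comb_bdd (A i) (u i).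
  exists (c * C1 * C2) => k; apply: cauchy_schwarz_le.
    apply: le_trans (Tc _) _; rewrite ler_wpM2l ?(ltW c0)//.
    exact: le_trans (ler_norm _) (C1P k).
  exact: le_trans (ler_norm _) (C2P k).
under eq_bigr => i _ do rewrite -cmean_sum//.
rewrite -cmean_sum; last by move=> i; exact: cbdd_sum.
apply: cmean_ge0; first by apply: cbdd_sum => i; exact: cbdd_sum.
by move=> k; exact: ap.
Qed.

End Compression.

Lemma amp_lin (R : realType) (Z X : choiceType) a (T S : l2op R X) : bop T -> bop S ->
  amp (fun f => a *: T f + S f) = (fun f : l2 R (Z * X)%type => a *: amp T f + amp S f).
Proof.
move=> Tb Sb; apply/funext => f; apply: slice_ext => z.
rewrite (slice_amp (bop_lin a Tb Sb)) (bopD (bop_slice R X z)) (bopZ (bop_slice R X z)).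
by rewrite (slice_amp Tb) (slice_amp Sb).
Qed.

Lemma amp_comp (R : realType) (Z X : choiceType) (T S : l2op R X) : bop T -> bop S ->
  amp (fun f => T (S f)) = (fun f : l2 R (Z * X)%type => amp T (amp S f)).
Proof.
move=> Tb Sb; apply/funext => f; apply: slice_ext => z.
by rewrite (slice_amp (bop_comp Tb Sb)) (slice_amp Tb) (slice_amp Sb).
Qed.

Lemma amp_id (R : realType) (Z X : choiceType) :
  amp (@id (l2 R X)) = @id (l2 R (Z * X)%type).
Proof.
apply/funext => f; apply: slice_ext => z.
by rewrite (slice_amp (bop_id R X)).
Qed.

Lemma amp_adj (R : realType) (Z X : choiceType) (T : l2op R X) : bop T ->
  amp (adj T) = adj (amp T : l2op R (Z * X)%type).
Proof.
move=> Tb; apply/funext => f; apply: (adj_unique (bop_amp Z Tb)) => g h.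
exact: (inner_amp _ _ Tb (bop_adj Tb) (is_adjoint_adj Tb)).
Qed.

Lemma amp_positive (R : realType) (Z X : choiceType) n (a : 'I_n -> 'I_n -> l2op R X) :
  (forall i j, bop (a i j)) -> positive_mx a ->
  positive_mx (fun i j => amp (a i j) : l2op R (Z * X)%type).
Proof.
move=> ab ap xi.
rewrite (eq_bigr (fun i => \sum_(j < n) cmean (fset_mean R Z) (fun A : {fset Z} =>
   \sum_(z <- A) inner (slice z (amp (a i j) (xi j))) (slice z (xi i))))); last first.
  by move=> i _; apply: eq_bigr => j _; have [_ _ ->] := inner_slices (amp (a i j) (xi j)) (xi i).
have bb i j : cbdd (fun A : {fset Z} =>
   \sum_(z <- A) inner (slice z (amp (a i j) (xi j))) (slice z (xi i))).
  by have [C CP _] := inner_slices (amp (a i j) (xi j)) (xi i); exists C.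
under eq_bigr => i _ do rewrite -cmean_sum//.
rewrite -cmean_sum; last by move=> i; exact: cbdd_sum.
apply: cmean_ge0; first by apply: cbdd_sum => i; exact: cbdd_sum.
move=> A; under eq_bigr => i _ do rewrite exchange_big.
rewrite exchange_big; apply: sumr_ge0 => z _.
have := ap (fun i => slice z (xi i)); congr (0 <= _).
by apply: eq_bigr => i _; apply: eq_bigr => j _; rewrite (slice_amp (ab i j)).
Qed.

Lemma opnorm_bound (R : realType) (X : choiceType) (T : l2op R X) :
  bop T -> 0 <= opnorm T /\ opbound T (opnorm T).
Proof.
move=> Tb; have [c c0 Tc] := bop_bound Tb.
have ub : has_ubound [set r | exists2 f : l2 R X, l2norm f <= 1 & r = l2norm (T f)].
  exists c => _ [f f1 ->]; apply: le_trans (Tc f) _.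
  by rewrite -[leRHS]mulr1 ler_wpM2l// ltW.
have up f : l2norm f <= 1 -> l2norm (T f) <= opnorm T.
  by move=> f1; apply: ub_le_sup => //; exists f.
split; first by apply: le_trans (up 0 _); rewrite ?l2norm_ge0// l2norm0.
move=> f; have [f0|f0] := eqVneq (l2norm f) 0.
  by rewrite (l2norm_eq0 f0) (bop0 Tb) !l2norm0 mulr0.
have fp : 0 < l2norm f by rewrite lt_def f0 l2norm_ge0.
have := up ((l2norm f)^-1%:C%C *: f).
rewrite (bopZ Tb) !l2normZ normc_real ger0_norm ?invr_ge0 ?(ltW fp)// mulVf// => /(_ (lexx _)).
by rewrite mulrC ler_pdivrMr.
Qed.

Lemma opnorm_le (R : realType) (X : choiceType) (T : l2op R X) c :
  0 <= c -> opbound T c -> opnorm T <= c.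
Proof.
move=> c0 Tc; apply: ge_sup; first by exists (l2norm (T 0)), 0; rewrite ?l2norm0.
move=> _ [f f1 ->]; apply: le_trans (Tc f) _.
by rewrite -[leRHS]mulr1 ler_wpM2l.
Qed.

Section Injectivity.
Variables (R : realType) (G : groupType) (Q : set (l2op R G)).
Hypothesis Qv : von_neumann_algebra Q.
Hypothesis QM : Q `<=` group_vna R G.
Hypothesis Qd : diffuse Q.
Hypothesis GB : boundary_amenable R G.
Notation lam := (@left_regular R G).
Notation M := (group_vna R G).
Notation d0 := (delta R (1%g : G)).
Notation P := (commutant Q `&` M).
Notation W := (G * (G * G))%type.

Let Mv := @group_vna_vna R G.

(** The second limit, in which the tolerance for right translations tends to 0. The last clause
    speaks of any bounded [u] dominated by the error, so that it applies directly to the matrix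
    coefficients in which the error occurs. *)
Lemma window_family : exists (N : Type) (m : mean R N) (w : N -> l2 R W),
  [/\ forall n, l2norm (w n) <= 2,
    forall p q, cmean m (fun n => inner (Lam p (w n)) (Lam q (w n))) = (p == q)%:R &
    forall x (A : {fset G}) c e, P x -> 0 < e -> forall u : N -> R[i], 
      (forall n, normc (u n) <= l2norm (amp (amp x) (w n) - \sum_(p <- A) c p *: Lam p (w n))) ->
      cbdd u ->
      normc (cmean m u) <= 3 * l2norm (x d0 - vec A c) + e].
Proof.
(* Adding the unit to the finite set and keeping the tolerance 5 / (5 + k) below 1 serves to bound
   the norm of w. *)
have h n : exists w : l2 R W,
  (forall p q, p \in (1%g |` n.1)%fset -> q \in (1%g |` n.1)%fset ->
     normc (inner (Lam p w) (Lam q w) - (p == q)%:R) <= 5 / (5 + n.2)%:R) /\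
  (forall x (A : {fset G}) c, P x -> fsubset A (1%g |` n.1)%fset ->
     l2norm (amp (amp x) w - \sum_(p <- A) c p *: Lam p w) <=
     3 * l2norm (x d0 - vec A c) + (\sum_(p <- A) normc (c p)) * (5 / (5 + n.2)%:R)).
  by apply: (window Qv QM Qd GB); rewrite divr_gt0// ltr0n.
have [w wP] := choice h.
pose le (n n' : {fset G} * nat) := fsubset n.1 n'.1 /\ (n.2 <= n'.2)%N.
have [m mt] : exists m : mean R ({fset G} * nat), tail_pos le m.
  apply: (@directed_mean R _ le (fset0, 0%N)) => [x|x y z [h1 h2] [h3 h4]|x y].
  - by split.
  - by split; [exact: fsubset_trans h1 h3|exact: leq_trans h2 h4].
  - exists (x.1 `|` y.1, maxn x.2 y.2)%fset; split; split=> /=; rewrite ?leq_maxl ?leq_maxr//.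
      exact: fsubsetUl.
    exact: fsubsetUr.
have small a : 0 < a -> exists K : nat, forall k, (K <= k)%N -> 5 / (5 + k)%:R <= a :> R.
  move=> /inv_nat_le[K KP]; exists K => k /KP; apply: le_trans.
  by rewrite ler_wpM2l// lef_pV2 ?posrE ?ltr0n// ler_nat addSn ltnS leq_addl.
have w2 n : l2norm (w n) <= 2.
  have [+ _] := wP n => /(_ 1%g 1%g); rewrite !in_fset1U eqxx => /(_ isT isT).
  rewrite Lam1 inner_self => h1.
  have : `|l2norm (w n) ^+ 2 - 1| <= 1.
    rewrite -normc_real realCB; apply: le_trans h1 _.
    by rewrite ler_pdivrMr ?ltr0n// mul1r ler_nat leq_addr.
  rewrite ler_norml => /andP[_ h2]; rewrite -(@ler_pXn2r _ 2)// ?nnegrE ?l2norm_ge0//.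
  by move: h2; lra.
exists _, m, w; split=> //.
  move=> p q; apply: (ctail_lim mt).
    by exists (2 * 2) => n; apply: cauchy_schwarz_le; rewrite l2norm_Lam.
  move=> e /small[K KP]; exists ([fset p; q]%fset, K) => n [/fsubsetP pq Kn].
  have [h1 _] := wP n; apply: le_trans (h1 p q _ _) (KP _ Kn).
    by rewrite in_fset1U pq ?orbT// !inE eqxx.
  by rewrite in_fset1U pq ?orbT// !inE eqxx orbT.
move=> x A c e Px e0 u uw ub.
have s0 : 0 <= \sum_(p <- A) normc (c p) by apply: sumr_ge0 => p _; exact: normc_ge0.
have e'0 : 0 < e / (\sum_(p <- A) normc (c p) + 1) by rewrite divr_gt0// ltr_wpDl.
have [K KP] := small _ e'0.
apply: (ctail_norm mt) => //; exists (A, K) => n [An Kn].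
have [_ h2] := wP n; apply: le_trans (uw n) _; apply: le_trans (h2 x A c Px _) _.
  by apply: fsubset_trans An _; exact: fsubsetUr.
rewrite lerD2l; apply: le_trans (ler_wpM2l s0 (KP _ Kn)) _.
by rewrite mulrA ler_pdivrMr ?ltr_wpDl// mulrC ler_pM2l// lerDl.
Qed.

Lemma relative_commutant_injective : amenable_vna P.
Proof.
have [N [m [w [w2 worth wx]]]] := window_family.
pose xi n p := Lam p (w n).
have xi2 n p : l2norm (xi n p) <= 2 by rewrite l2norm_Lam.
pose cG (T : l2op R G) := compress xi2 worth (amp (amp T)).
have aab (T : l2op R G) : bop T -> bop (amp (amp T) : l2op R W).
  by move=> Tb; exact/bop_amp/bop_amp.
have cGE T p q : bop T -> cG T (delta R p) q =
    cmean m (fun n => inner (amp (amp T) (xi n p)) (xi n q)).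
  by move=> Tb; have [_ -> _] := compressP xi2 worth (aab T Tb).
have cGb T : bop T -> bop (cG T) by move=> Tb; have [] := compressP xi2 worth (aab T Tb).
have cGc T c : bop T -> 0 <= c -> opbound T c -> opbound (cG T) c.
  move=> Tb c0 Tc; have [_ _] := compressP xi2 worth (aab T Tb); apply=> //.
  by apply: amp_bound => //; [exact: bop_amp|exact: amp_bound].
(* A right translation relabels p and q simultaneously, and 1 (x) 1 (x) T commutes with [Lam]. *)
have cGM T : bop T -> M (cG T).
  move=> Tb; apply/group_vnaP; split; first exact: cGb.
  move=> g; apply: bop_ext.
  - exact: (bop_comp (cGb T Tb) (bop_rho R g)).
  - exact: (bop_comp (bop_rho R g) (cGb T Tb)).
  move=> p; rewrite rho_delta; apply: l2_ext => q; rewrite rhoE (cGE T (p * g^-1)%g q Tb) (cGE T p (q * g)%g Tb).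
  apply: eq_cmean => n; rewrite /xi -(LamM g^-1 p) -(LamM g q).
  by rewrite -(Lam_amp _ _ (bop_amp G Tb)) inner_Lam invgK.
have cGlin a T S : bop T -> bop S ->
    cG (fun f => a *: T f + S f) = (fun f => a *: cG T f + cG S f).
  move=> Tb Sb; rewrite /cG -compress_lin; [|exact: aab|exact: aab].
  by rewrite (amp_lin G a Tb Sb) (amp_lin G a (bop_amp G Tb) (bop_amp G Sb)).
have cGadj T : bop T -> cG (adj T) = adj (cG T).
  move=> Tb; rewrite /cG -compress_adj; last exact: aab.
  by rewrite (amp_adj G Tb) (amp_adj G (bop_amp G Tb)).
have cGid : cG id = id by rewrite /cG !amp_id compress_id.
have cGpos n (a : 'I_n -> 'I_n -> l2op R G) : (forall i j, bop (a i j)) ->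
    positive_mx a -> positive_mx (fun i j => cG (a i j)).
  move=> ab ap; apply: compress_positive => [i j|]; first exact: aab.
  by apply: amp_positive => [i j|]; [exact: bop_amp|exact: amp_positive].
have cbq (S : l2op R G) p q : bop S -> cbdd (fun n => inner (amp (amp S) (xi n p)) (xi n q)).
  move=> /aab/bop_bound[c c0 Sc]; exists (c * 2 * 2) => n; apply: cauchy_schwarz_le => //.
  by apply: le_trans (Sc _) _; rewrite ler_wpM2l// ltW.
clearbody cG.
(* Both sides lie in L(G), so they are compared at [d0]; there x applied to w is replaced by the
   combination of translates of w whose coefficients are those of x d0. The case T = 1 shows that x
   is fixed. *)
have cGr T x : bop T -> P x -> cG (fun f => T (x f)) = (fun f => cG T (x f)).
  move=> Tb Px; have [_ Mx] := Px; have xb := vna_bop Mv Mx.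
  have Txb := bop_comp Tb xb.
  apply/funext; apply: (group_vna_ext (cGM _ Txb)).
    by apply: (vna_comp Mv) => //; exact: cGM.
  have [c c0 Tc] := bop_bound Tb; have cTc := cGc T c Tb (ltW c0) Tc.
  apply: l2_ext => q; apply/subr0_eq/normc_le_eq0 => e e0.
  (* The two errors below are 8 c e1 = 2 c (3 e1 + e1) and c e1. *)
  pose e1 := e / (10 * c); have e10 : 0 < e1 by rewrite divr_gt0// mulr_gt0.
  have [A Ae] := vec_approx (x d0) e10; set k := (x d0 : G -> R[i]) in Ae.
  have -> : cG (fun f => T (x f)) d0 q - cG T (x d0) q =
      (cG (fun f => T (x f)) d0 q - cG T (vec A k) q) - cG T (x d0 - vec A k) q.
    by rewrite (bopB (cGb T Tb)) l2BE; ring.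
  have h1 : normc (cG T (x d0 - vec A k) q) <= c * e1.
    apply: le_trans (normc_le_l2norm _ _) _; apply: le_trans (cTc _) _.
    by rewrite ler_wpM2l// ltW.
  have h2 : normc (cG (fun f => T (x f)) d0 q - cG T (vec A k) q) <= 8 * c * e1.
    pose y n : l2 R W := amp (amp x) (w n) - \sum_(p <- A) k p *: Lam p (w n).
    pose v n := inner (amp (amp T) (y n)) (Lam q (w n)).
    have aTb : bop (amp (amp T) : l2op R W) by exact: aab.
    have vy n : normc (v n) <= 2 * c * l2norm (y n).
      rewrite -mulrA mulrC; apply: cauchy_schwarz_le; last by rewrite l2norm_Lam.
      by apply: amp_bound (ltW c0) _ _ => //; [exact: bop_amp|exact: amp_bound (ltW c0) Tc].
    have vb : cbdd v.
      have [cx cx0 xc] := bop_bound (aab x xb).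
      exists (2 * c * (cx * 2 + \sum_(p <- A) normc (k p) * 2)) => n; apply: le_trans (vy n) _.
      rewrite ler_wpM2l ?mulr_ge0 ?(ltW c0)//; apply: le_trans (ler_l2normB _ _) _.
      apply: lerD; first by apply: le_trans (xc _) _; rewrite ler_wpM2l ?(ltW cx0).
      apply: le_trans (l2norm_sum _ _ _) _; apply: ler_sum => p _.
      by rewrite l2normZ l2norm_Lam ler_wpM2l ?normc_ge0.
    have -> : cG (fun f => T (x f)) d0 q - cG T (vec A k) q = cmean m v.
      rewrite (bop_vec (cGb T Tb)) l2_sumE (cGE _ _ _ Txb).
      under eq_bigr => p _ do rewrite l2ZE (cGE _ _ _ Tb) -(cmeanZ _ _ (cbq T p q Tb)).
      rewrite -cmean_sum; last by move=> p; apply: cbddZ; exact: cbq.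
      rewrite -cmeanB; [|exact: cbq|by apply: cbdd_sum => p; apply: cbddZ; exact: cbq].
      apply: eq_cmean => n; rewrite /v /y /xi Lam1 (bopB aTb) innerBl.
      rewrite (amp_comp G Tb xb) (amp_comp G (bop_amp G Tb) (bop_amp G xb)).
      congr (_ - _); rewrite (bop_sum aTb) inner_suml; apply: eq_bigr => p _.
      by rewrite (bopZ aTb) innerZl.
    have c20 : 0 < 2 * c by rewrite mulr_gt0.
    have -> : cmean m v = (2 * c)%:C%C * cmean m (fun n => ((2 * c)^-1)%:C%C * v n).
      by rewrite cmeanZ// mulrA -realCM divff ?mul1r// lt0r_neq0.
    rewrite normcM normc_real gtr0_norm// (_ : 8 * c * e1 = (2 * c) * (3 * e1 + e1)); last by ring.
    rewrite ler_pM2l//; apply: le_trans (wx x A k e1 Px e10 _ _ _) _.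
    + move=> n; rewrite normcM normc_real gtr0_norm ?invr_gt0//.
      by rewrite ler_pdivrMl//; exact: vy.
    + exact: cbddZ.
    + by rewrite lerD2r ler_pM2l.
  apply: le_trans (le_normcD _ _) _; rewrite normcN; apply: le_trans (lerD h2 h1) _.
  rewrite (_ : e = 10 * c * e1); last by rewrite /e1; field; rewrite lt0r_neq0.
  by have : 0 < c * e1; [exact: mulr_gt0|lra].
(* The left module property is the right one applied to adjoints. *)
have cGl T y : bop T -> P y -> cG (fun f => y (T f)) = (fun f => y (cG T f)).
  move=> Tb Py; have [_ My] := Py; have yb := vna_bop Mv My.
  have yT : (fun f => y (T f)) = adj (fun f => adj T (adj y f)).
    apply/funext; apply: adj_unique; first exact: (bop_comp (bop_adj Tb) (bop_adj yb)).
    by move=> f g; rewrite (adjPr Tb) (adjPr yb).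
  rewrite yT cGadj; last exact: (bop_comp (bop_adj Tb) (bop_adj yb)).
  rewrite (cGr (adj T)); [|exact: bop_adj|exact: (relcomm_adj Qv)].
  rewrite (cGadj T Tb); have Sb := cGb T Tb; apply/esym/funext.
  apply: (adj_unique (bop_comp (bop_adj Sb) (bop_adj yb))) => f g.
  by rewrite [LHS](adjPr Sb) [LHS](adjPr yb).
exists (fun T => cexp Qv QM (cG T)).
have Eb T : bop T -> bop (cexp Qv QM (cG T)).
  by move=> /cGM /(cexpP Qv QM)[[_ /(vna_bop Mv)]].
split.
- split=> //.
  + move=> c T U Tb Ub; rewrite -[LHS]/(cexp Qv QM (cG (fun f => c *: T f + U f))).
    by rewrite cGlin// cexp_lin//; exact: cGM.
  + move=> T Tb; have [n0 nT] := opnorm_bound Tb; apply: opnorm_le => //.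
    by have [_ _] := cexpP Qv QM (cGM T Tb); apply; exact: cGc.
  + move=> n a ab ap; apply: (@cexp_positive _ _ _ Qv QM n (fun i j => cG (a i j))).
      by move=> i j; apply: cGM; exact: ab.
    by apply: cGpos.
- by move=> T Tb; have [] := cexpP Qv QM (cGM T Tb).
- move=> T PT; rewrite -[X in _ = X](cexp_id Qv QM PT); congr (cexp _ _).
  by have := cGr id T (bop_id R G) PT; rewrite cGid.
- move=> S T U PS PU Tb; have [_ MU] := PU.
  transitivity (cexp Qv QM (fun f => S (cG T (U f)))); last first.
    by apply: cexp_bimodule => //; exact: cGM.
  congr (cexp _ _).
  rewrite [LHS](cGl (fun f => T (U f)) S) ?(cGr T U Tb PU)//.
  exact: (bop_comp Tb (vna_bop Mv MU)).
Qed.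

End Injectivity.

Lemma solid_boundary_amenable (R : realType) (G : groupType) :
  boundary_amenable R G -> solid (group_vna R G).
Proof.
move=> GB; split; [exact: group_vna_vna|exact: group_vna_finite|].
by move=> Q Qv QM Qd; exact: relative_commutant_injective.
Qed.

(** * Exactness implies property A *)

Section Cone.
Variables (R : realType) (T : choiceType) (C : set (l2 R T)) (z : l2 R T) (K : R).
Hypothesis C0 : C 0.
Hypothesis CD : forall c d, C c -> C d -> C (c + d).
Hypothesis CZ : forall (s : R) c, 0 <= s -> C c -> C (s%:C%C *: c).
Hypothesis K0 : 0 <= K.
Hypothesis zK : forall (y : l2 R T) eta, 0 < eta ->
  (forall c, C c -> complex.Re (inner c y) <= eta * l2norm c) ->
  complex.Re (inner z y) <= eta * K.

(** The cone is not assumed closed, so a near minimizer replaces the nearest point; accordingly the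
    separation hypothesis on [z] carries a slack eta. *)
Let near_min d : 0 < d -> exists2 c0, C c0 &
  forall c, C c -> l2norm (z - c0) ^+ 2 <= l2norm (z - c) ^+ 2 + d.
Proof.
move=> d0; pose S := [set r | exists2 c, C c & r = l2norm (z - c) ^+ 2].
have Slb : has_lbound S by exists 0 => _ [c _ ->]; exact: sqr_ge0.
have S0 : S !=set0 by exists (l2norm (z - 0) ^+ 2), 0.
have [_ [c0 Cc0 ->] h] := inf_adherent d0 (conj S0 Slb).
exists c0 => // c Cc; apply: le_trans (ltW h) _; rewrite lerD2r.
by apply: ge_inf => //; exists c.
Qed.

(* c0 nearly minimizes the distance to z, so that <c, z - c0> is small for c in
   the cone, and then <z, z - c0> is small by hypothesis. *)
Lemma cone_approx e : 0 < e -> exists2 c, C c & l2norm (z - c) <= e.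
Proof.
move=> e0; pose B := K + ((2 * l2norm z + 1) ^+ 2 + 1).
have B0 : 0 < B by rewrite /B ltr_wpDl// ltr_wpDl ?sqr_ge0.
pose r := Num.min 1 (e ^+ 2 / B).
have r0 : 0 < r by rewrite lt_min ltr01 divr_gt0// exprn_gt0.
have r1 : r <= 1 by rewrite ge_min lexx.
have rB : r * B <= e ^+ 2 by rewrite -ler_pdivlMr// ge_min lexx orbT.
have [c0 Cc0 min0] := near_min (exprn_gt0 2 r0).
exists c0 => //; set y := z - c0.
have sep c : C c -> complex.Re (inner c y) <= r * l2norm c.
  move=> Cc; have [cz|cz] := eqVneq (l2norm c) 0.
    by rewrite (l2norm_eq0 cz) inner0l l2norm0 mulr0.
  have cp : 0 < l2norm c by rewrite lt_def cz l2norm_ge0.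
  pose t := r / l2norm c; have t0 : 0 < t by rewrite divr_gt0.
  have := min0 (c0 + t%:C%C *: c) (CD Cc0 (CZ (ltW t0) Cc)).
  rewrite -/y (_ : z - _ = y - t%:C%C *: c); last by rewrite opprD addrA.
  rewrite (l2norm_sqB y) (l2normZ t%:C%C) normc_real gtr0_norm// innerZr conjc_real ReZ.
  rewrite (_ : t * l2norm c = r); last by rewrite /t divfK.
  rewrite innerJ ReJ => h; have : t * complex.Re (inner c y) <= r ^+ 2 by lra.
  by move=> h2; rewrite -(ler_pM2l t0) (le_trans h2)// mulrCA /t divfK// expr2.
have z1 := zK r0 sep.
have yz : l2norm y <= l2norm z + 1.
  rewrite -(@ler_pXn2r _ 2)// ?nnegrE ?addr_ge0 ?l2norm_ge0//.
  have := min0 0 C0; rewrite subr0 -/y; have := l2norm_ge0 z.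
  have : r ^+ 2 <= 1 by rewrite expr_le1// ltW.
  by move: (l2norm y) (l2norm z) => a b; nra.
have c0n : l2norm c0 <= 2 * l2norm z + 1.
  rewrite (_ : c0 = z - y); last by rewrite /y opprB addrC subrK.
  by have := ler_l2normB z y; lra.
have h2 : - complex.Re (inner c0 y) <= r * ((2 * l2norm z + 1) ^+ 2 + 1).
  have r10 : 0 <= 1 - r by lra.
  have := min0 _ (CZ r10 Cc0).
  have -> : z - (1 - r)%:C%C *: c0 = y + r%:C%C *: c0.
    by rewrite realCB scalerBl scale1r /y opprB addrA addrAC.
  rewrite -/y (l2norm_sqD y) (l2normZ r%:C%C) normc_real gtr0_norm// innerZr conjc_real ReZ innerJ ReJ.
  move=> h; have : - (r * complex.Re (inner c0 y)) <= r * (r * ((2 * l2norm z + 1) ^+ 2 + 1)).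
    have : l2norm c0 ^+ 2 <= (2 * l2norm z + 1) ^+ 2.
      by rewrite ler_sqr ?nnegrE ?addr_ge0 ?mulr_ge0 ?l2norm_ge0.
    have := sqr_ge0 r; have := sqr_ge0 (l2norm c0); move: h; rewrite exprMn.
    by move: (l2norm c0 ^+ 2) ((2 * l2norm z + 1) ^+ 2) (complex.Re _) => a b x; nra.
  by rewrite -mulrN ler_pM2l.
rewrite -(@ler_pXn2r _ 2)// ?nnegrE ?l2norm_ge0 ?(ltW e0)//.
apply: le_trans rB; rewrite l2norm_sqE {1}/y innerBl ReD ReN.
by move: z1 h2; rewrite /B; lra.
Qed.

End Cone.

Section CompletelyPositive.
Variables (R : realType) (X Y : choiceType).

Lemma linear_on0 (D : set (l2op R X)) (phi : l2op R X -> l2op R Y) :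
  linear_on D phi -> D 0 -> phi 0 = 0.
Proof.
move=> lin D0; have := lin 1 0 0 D0 D0.
by rewrite scaler0 addr0 scale1r => /eqP; rewrite -subr_eq subrr => /eqP <-.
Qed.

Lemma linear_on_sum (D : set (l2op R X)) (phi : l2op R X -> l2op R Y)
    (J : Type) (r : seq J) (c : J -> R[i]) (T : J -> l2op R X) :
  linear_on D phi -> (forall r, D (\sum_(j <- r) c j *: T j)) -> (forall j, D (T j)) ->
  phi (\sum_(j <- r) c j *: T j) = \sum_(j <- r) c j *: phi (T j).
Proof.
move=> lin DS DT; elim: r => [|j r IH].
  by rewrite !big_nil (linear_on0 lin)//; have := DS [::]; rewrite big_nil.
by rewrite !big_cons (lin _ _ _ (DT j) (DS r)) IH.
Qed.

Lemma fun_sumE (J : Type) (r : seq J) (P : pred J) (F : J -> l2op R X) f :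
  (\sum_(j <- r | P j) F j) f = \sum_(j <- r | P j) F j f.
Proof. by elim/big_rec2: _ => [//|j x y _ <-]. Qed.

Lemma im_off_diagonal (a b c d : R[i]) : 0 <= a -> 0 <= d ->
  0 <= a + b + (c + d) -> complex.Im (b + c) = 0.
Proof.
move: a b c d => [x1 y1] [x2 y2] [x3 y3] [x4 y4]; rewrite !lecE /=.
by move=> /andP[/eqP + _] /andP[/eqP + _] /andP[/eqP + _]; lra.
Qed.

Lemma complex_eq_ReIm (a b : R[i]) :
  complex.Im (a + b) = 0 -> complex.Im ('i%C * a - 'i%C * b) = 0 -> a = b^*%C.
Proof.
case: a => a1 a2; case: b => b1 b2 /= h1; rewrite !mul0r !mul1r !add0r => h2.
by apply/eqP; rewrite eq_complex /=; apply/andP; split; apply/eqP; lra.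
Qed.

(* phi is applied to the positive matrix ((1, T), (T^*, 1)), T being unitary *)
Lemma cp_unitary_adjoint (D : set (l2op R X)) (phi : l2op R X -> l2op R Y) T S :
  linear_on D phi -> completely_positive_on D phi -> D 0 -> D id -> D T -> D S ->
  bop (phi T) -> is_adjoint T S -> (forall f, l2norm (T f) = l2norm f) ->
  is_adjoint (phi T) (phi S).
Proof.
move=> lin cp D0 D1 DT DS Tb TS Ti.
have pos1 (f : l2 R Y) : 0 <= inner (phi id f) f.
  have := cp 1%N (fun _ _ => id) (fun _ _ => D1).
  move=> /(_ _ (fun=> f)); rewrite !big_ord1; apply=> xi.
  by rewrite !big_ord1; exact: inner_ge0.
pose a (i j : 'I_2) : l2op R X := if i == j then id else if i == 0 :> 'I_2 then T else S.
have apos : positive_mx (fun i j => phi (a i j)).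
  apply: cp => [i j|xi]; first by rewrite /a; case: ifP => // _; case: ifP.
  rewrite !big_ord_recl !big_ord0 /= !addr0 /a /=.
  set f := xi _; set g := xi _.
  have -> : inner f f + inner (T g) f + (inner (S f) g + inner g g) = inner (f + T g) (f + T g).
    rewrite innerDl !innerDr -[inner (S f) g]conjcK -innerJ -TS -innerJ.
    by rewrite !inner_self Ti; ring.
  exact: inner_ge0.
move=> f g; rewrite [RHS]innerJ.
have key (h : l2 R Y) : complex.Im (inner (phi T h) g + inner (phi S g) h) = 0.
  apply: im_off_diagonal (pos1 g) (pos1 h) _.
  have := apos (fun i => if i == 0 :> 'I_2 then g else h).
  by rewrite !big_ord_recl !big_ord0 !addr0 /a.
apply: complex_eq_ReIm; first exact: key.
have := key ('i%C *: f); rewrite (bopZ Tb) innerZl innerZr; congr (complex.Im _ = _).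
by congr (_ + _); rewrite -mulNr; congr (_ * _); apply/eqP; rewrite eq_complex /= oppr0 !eqxx.
Qed.

End CompletelyPositive.

(** * Completely positive maps into matrices approximated by vector functionals *)

Section VectorApproximation.
Variables (R : realType) (G : groupType).
Notation lam := (@left_regular R G).
Notation D := (@reduced_cstar R G).
Notation half := ((2^-1 : R)%:C%C : R[i]).

Lemma bop_lam_sum (r : seq (R[i] * G)) : bop (\sum_(p <- r) p.1 *: lam p.2 : l2op R G).
Proof.
rewrite (_ : \sum_(p <- r) _ = (fun f => \sum_(p <- r) p.1 *: lam p.2 f)).
  by apply: bop_bigsum => p; apply: bop_scale; exact: bop_lam.
by apply/funext => f; rewrite fun_sumE.
Qed.

Lemma reduced_cstar_sum (r : seq (R[i] * G)) : D (\sum_(p <- r) p.1 *: lam p.2).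
Proof.
split; first exact: bop_lam_sum.
move=> e e0; exists r; rewrite subrr; apply: le_lt_trans e0.
by apply: opnorm_le => // f; rewrite /= mul0r l2norm0.
Qed.

Lemma lam1_id : lam 1%g = id. Proof. by apply/funext => f; exact: lam1. Qed.

Lemma reduced_cstar_lam g : D (lam g).
Proof.
by have := reduced_cstar_sum [:: (1, g)]; rewrite big_seq1 scale1r.
Qed.

Lemma reduced_cstar_id : D id.
Proof. by rewrite -lam1_id; exact: reduced_cstar_lam. Qed.

Lemma reduced_cstar0 : D 0.
Proof. by have := reduced_cstar_sum [::]; rewrite big_nil. Qed.

Variables (k : nat).

Lemma sum_pick2 (p : 'I_k * 'I_k) (H : 'I_k -> 'I_k -> R[i]) :
  \sum_(i < k) \sum_(j < k) (if p == (i, j) then H i j else 0) = H p.1 p.2.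
Proof.
rewrite pair_bigA /= -big_mkcond (big_pred1 p) // => q /=.

Qed.

Section SeparatingMatrix.
Variables (A : {fset 'I_k * 'I_k * G}) (y : 'I_k * 'I_k * G -> R[i]) (t : R).

(** Entry (i, j) of t 1 minus the self-adjoint part of Y, as a list of coefficients and group
    elements; Y is the matrix over the group ring whose entry (i, j) has at g the conjugate of y at
    (i, j, g) as coefficient. *)
Definition separating_coef (i j : 'I_k) : seq (R[i] * G) :=
  ((if i == j then t%:C%C else 0), 1%g) ::
  [seq (- half * (if p.1 == (i, j) then (y p)^*%C else 0), p.2) | p <- A] ++
  [seq (- half * (if p.1 == (j, i) then y p else 0), p.2^-1%g) | p <- A].

(** Used for psi the identity and for psi = a: positivity of the separating matrix is translated
    into the inequality occurring in the cone argument, and conversely. *)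
Lemma separating_form (Y : choiceType) (psi : l2op R G -> l2op R Y) (f : 'I_k -> l2 R Y) :
  linear_on D psi -> (forall g, is_adjoint (psi (lam g)) (psi (lam g^-1)%g)) ->
  \sum_(i < k) \sum_(j < k)
    inner (psi (\sum_(q <- separating_coef i j) q.1 *: lam q.2) (f j)) (f i) =
  t%:C%C * (\sum_(i < k) inner (psi id (f i)) (f i)) -
  (complex.Re (\sum_(p <- A) inner (psi (lam p.2) (f p.1.2)) (f p.1.1) * (y p)^*%C))%:C%C.
Proof.
move=> lin psiJ.
have psiE i j : inner (psi (\sum_(q <- separating_coef i j) q.1 *: lam q.2) (f j)) (f i) =
    (if i == j then t%:C%C * inner (psi id (f j)) (f i) else 0) +
    (\sum_(p <- A) (if p.1 == (i, j) then
       - half * (inner (psi (lam p.2) (f j)) (f i) * (y p)^*%C) else 0) +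
     \sum_(p <- A) (if p.1 == (j, i) then
       - half * (inner (psi (lam p.2) (f i)) (f j) * (y p)^*%C)^*%C else 0)).
  rewrite (@linear_on_sum _ _ _ D)//; last 2 first.
  - by move=> r; have := reduced_cstar_sum r.
  - by move=> q; exact: reduced_cstar_lam.
  rewrite fun_sumE inner_suml /separating_coef big_cons big_cat !big_map /=.
  congr (_ + (_ + _)).
  - by rewrite lam1_id innerZl; case: ifP => //; rewrite mul0r.
  - apply: eq_bigr => p _; rewrite innerZl; case: ifP => _; last by rewrite mulr0 mul0r.
    by rewrite -mulrA (mulrC (y p)^*%C).
  - apply: eq_bigr => p _; rewrite innerZl; case: ifP => _; last by rewrite mulr0 mul0r.
    rewrite conjcM conjcK -mulrA (mulrC (y p)); congr (_ * (_ * _)).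
    by rewrite (psiJ p.2 (f i) (f j)) -innerJ.
under eq_bigr => i _ do under eq_bigr => j _ do rewrite psiE.
under eq_bigr => i _ do rewrite big_split.
rewrite big_split /=; congr (_ + _).
  rewrite mulr_sumr; apply: eq_bigr => i _; rewrite -big_mkcond (big_pred1 i)// => j /=.
under eq_bigr => i _ do rewrite big_split.
rewrite big_split /=.
under eq_bigr => i _ do rewrite exchange_big.
rewrite exchange_big /= (eq_bigr (fun p => - half * (inner (psi (lam p.2) (f p.1.2)) (f p.1.1) * (y p)^*%C))); last first.
  by move=> p _; rewrite (sum_pick2 p.1 (fun i j => - half * (inner (psi (lam p.2) (f j)) (f i) * (y p)^*%C))).
under [X in _ + X]eq_bigr => i _ do rewrite exchange_big.
rewrite [X in _ + X]exchange_big /= [X in _ + X](eq_bigr (fun p => - half * (inner (psi (lam p.2) (f p.1.2)) (f p.1.1) * (y p)^*%C)^*%C)); last first.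
  move=> p _; rewrite exchange_big.
  by rewrite (sum_pick2 p.1 (fun i j => - half * (inner (psi (lam p.2) (f j)) (f i) * (y p)^*%C)^*%C)).
rewrite -!mulr_sumr -conjc_sum; move: (\sum_(p <- A) _) => [u v].
by apply/eqP; rewrite eq_complex /=; apply/andP; split; apply/eqP; field.
Qed.

End SeparatingMatrix.

(** Tuples with finite supports, so that their functionals can later be expanded into finite sums
    over the group. *)
Definition finite_vectors : choiceType := {classic {v : 'I_k -> l2 R G |
  exists S : {fset G}, forall i z, z \notin S -> v i z = 0}}.

Definition vector_functional (v : finite_vectors) (p : 'I_k * 'I_k * G) : R[i] :=
  inner (lam p.2 (sval v p.1.2)) (sval v p.1.1).

Variable a : l2op R G -> l2op R 'I_k.
Hypothesis acp : ccp D a.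

(** A completely positive map into k x k matrices amounts to a positive functional on matrices over
    the reduced algebra, to be approximated by sums of vector functionals. If y nearly bounds all of
    these from above, the separating matrix is positive on finitely supported vectors, hence so is
    its image under [a], and this is the required inequality for the functional of [a]. *)
Lemma vector_approx (A : {fset 'I_k * 'I_k * G}) e : 0 < e ->
  exists L : seq finite_vectors, forall p, p \in A ->
    normc (inner (a (lam p.2) (delta R p.1.2)) (delta R p.1.1) -
           \sum_(v <- L) vector_functional v p) <= e.
Proof.
move=> e0; have [ab alin a1 apos] := acp.
pose vf (L : seq finite_vectors) : l2 R ('I_k * 'I_k * G)%type :=
  vec A (fun p => \sum_(v <- L) vector_functional v p).
pose C : set (l2 R ('I_k * 'I_k * G)%type) := [set c | exists L, c = vf L].
pose z : l2 R ('I_k * 'I_k * G)%type :=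
  vec A (fun p => inner (a (lam p.2) (delta R p.1.2)) (delta R p.1.1)).
(* The coordinates of the functional of a tuple are at most the sum of the squared norms of the
   tuple; n1 times this sum bounds their l2 norm over [A]. *)
pose n1 : R := (size A)%:R + 1.
have n10 : 0 < n1 by rewrite ltr_wpDl.
have C0 : C 0.
  by exists [::]; apply: l2_ext => p; rewrite vecE big_nil if_same.
have CD c d : C c -> C d -> C (c + d).
  move=> [L ->] [L' ->]; exists (L ++ L'); apply: l2_ext => p.
  by rewrite l2DE !vecE big_cat; case: ifP; rewrite ?addr0.
have CZ (s : R) c : 0 <= s -> C c -> C (s%:C%C *: c).
  move=> s0 [L ->].
  have sub (v : finite_vectors) : exists S : {fset G}, forall i z, z \notin S ->
      ((Num.sqrt s)%:C%C *: sval v i : l2 R G) z = 0.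
    by have [S hS] := svalP v; exists S => i x xS; rewrite l2ZE hS// mulr0.
  exists [seq exist _ (fun i => (Num.sqrt s)%:C%C *: sval v i) (sub v) | v <- L].
  apply: l2_ext => p; rewrite l2ZE !vecE; case: ifP; rewrite ?mulr0// => _.
  rewrite big_map mulr_sumr; apply: eq_bigr => v _.
  rewrite /vector_functional /= (bopZ (bop_lam R _)) innerZl innerZr mulrA conjc_real -realCM.
  by rewrite -expr2 sqr_sqrtr.
have a_adj g : is_adjoint (a (lam g)) (a (lam g^-1)%g).
  apply: (cp_unitary_adjoint alin apos reduced_cstar0 reduced_cstar_id);
    [exact: reduced_cstar_lam|exact: reduced_cstar_lam| | |exact: l2norm_lam].
    by apply: ab; exact: reduced_cstar_lam.
  exact: inner_lam.
have zK (y : l2 R ('I_k * 'I_k * G)%type) eta : 0 < eta ->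
    (forall c, C c -> complex.Re (inner c y) <= eta * l2norm c) ->
    complex.Re (inner z y) <= eta * (n1 * k%:R).
  move=> eta0 hy.
  pose X i j := \sum_(q <- separating_coef A y (eta * n1) i j) q.1 *: lam q.2 : l2op R G.
  have Xpos : positive_mx X.
    apply: positive_mx_dense => [i j|B u]; first exact: bop_lam_sum.
    pose v0 i : l2 R G := vec (B i) (u i).
    have v0f : exists S : {fset G}, forall i x, x \notin S -> v0 i x = 0.
      exists (\bigcup_(i <- enum 'I_k) B i)%fset => i x xS; rewrite vecE; case: ifP => // xB.
      by case/negP: xS; apply/bigfcupP; exists i; rewrite ?mem_enum.
    pose v : finite_vectors := exist _ v0 v0f.
    have := @separating_form A y (eta * n1) G id v0; rewrite -/(X _ _) => ->; last 2 first.
    - by [].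
    - by move=> g; exact: inner_lam.
    rewrite (_ : \sum_(p <- A) _ = inner (vf [:: v]) y); last first.
      rewrite innerJ inner_vec conjc_sum; apply: eq_bigr => p _.
      by rewrite conjcM conjcK mulrC big_seq1.
    have := hy _ (ex_intro _ [:: v] erefl).
    set S := \sum_(i < k) l2norm (v0 i) ^+ 2.
    have -> : \sum_(i < k) inner (v0 i) (v0 i) = S%:C%C.
      by rewrite realC_sum; apply: eq_bigr => i _; rewrite inner_self.
    have S0 : 0 <= S by apply: sumr_ge0 => i _; exact: sqr_ge0.
    have vS i : l2norm (v0 i) <= Num.sqrt S.
      rewrite -(@ler_pXn2r _ 2)// ?nnegrE ?l2norm_ge0 ?sqrtr_ge0// [leRHS]sqr_sqrtr//.
      by rewrite /S (bigD1 i)//= lerDl; apply: sumr_ge0 => j _; exact: sqr_ge0.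
    have vfS : l2norm (vf [:: v]) <= n1 * S.
      rewrite -(@ler_pXn2r _ 2)// ?nnegrE ?l2norm_ge0 ?mulr_ge0 ?(ltW n10)//.
      rewrite l2norm_vec /sqs; apply: (@le_trans _ _ (\sum_(p <- A) S ^+ 2)).
        apply: ler_sum => p _; rewrite big_seq1 ler_sqr ?nnegrE ?normc_ge0//.
        rewrite -[leRHS](sqr_sqrtr S0) expr2; apply: cauchy_schwarz_le => //.
        by rewrite l2norm_lam; exact: vS.
      rewrite big_const_seq count_predT iter_addr_0 exprMn -mulr_natl ler_wpM2r ?sqr_ge0//.
      have : 0 <= (size A)%:R :> R by [].
      by rewrite /n1; move: ((size A)%:R : R) => x x0; nra.
    move=> h; rewrite -realCM -realCB lecR subr_ge0; apply: le_trans h _.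
    by rewrite -mulrA ler_pM2l.
  have aXpos := apos _ X (fun i j => reduced_cstar_sum _) Xpos.
  have := aXpos (fun i => delta R i).
  have := @separating_form A y (eta * n1) _ a (fun i => delta R i) alin a_adj.
  rewrite -/(X _ _) => ->.
  rewrite (_ : \sum_(p <- A) _ = inner z y); last first.
    rewrite innerJ inner_vec conjc_sum; apply: eq_bigr => p _.
    by rewrite conjcM conjcK mulrC.
  move=> /ge0_Re; rewrite ReD ReN ReZ Re_sum subr_ge0 => /le_trans; apply.
  rewrite -mulrA ler_pM2l// ler_pM2l//.
  apply: (@le_trans _ _ (\sum_(i < k) 1)); last by rewrite sumr_const card_ord.
  apply: ler_sum => i _; apply: le_trans (Re_le _) _; apply: le_trans (cauchy_schwarz _ _) _.
  rewrite l2norm_delta mulr1; have aib : bop (a id) by apply: ab; exact: reduced_cstar_id.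
  have [n0 nb] := opnorm_bound aib; apply: le_trans (nb _) _.
  rewrite l2norm_delta mulr1; apply: le_trans (a1 _ reduced_cstar_id) _.
  by apply: opnorm_le => // f; rewrite mul1r.
have K0 : 0 <= n1 * k%:R by rewrite mulr_ge0// ltW.
have [c [L ->] cL] := cone_approx C0 CD CZ K0 zK e0.
exists L => p pA; apply: le_trans cL; apply: le_trans (normc_le_l2norm _ p).
by rewrite l2BE !vecE pA.
Qed.

End VectorApproximation.

(** Property A as amenability of the left translation action of G on itself: nu is almost
    equivariant, and all of its values live on one finite set. *)
Definition property_A (R : realType) (G : groupType) :=
  forall (F : {fset G}) (e : R), 0 < e -> exists (E : {fset G}) (nu : G -> G -> R),
  fibre_prob E nu /\ forall k t (A : {fset G}), k \in F ->
    \sum_(z <- A) `|nu (k * t)%g (k * z)%g - nu t z| <= e.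

(** From (b - a)^2 <= (a + b - 2 c)(a + b + 2 c) and the inequality of the means. Unlike a bound
    with a square root, this one is linear in a, b, c and can be summed. *)
Lemma hellinger_le (R : realType) (a b c r : R) : 0 <= a -> 0 <= b -> c ^+ 2 <= a * b -> 0 < r ->
  `|b - a| <= (a + b - 2 * c) / (2 * r) + r * (a + b).
Proof.
move=> a0 b0 cab r0.
have D0 : 0 <= a + b - 2 * c.
  have : `|2 * c| <= `|a + b|.
    by rewrite -ler_sqr ?nnegrE// !real_normK ?num_real//; have := sqr_ge0 (a - b); nra.
  by rewrite (ger0_norm (addr_ge0 a0 b0)) ler_norml => /andP[_]; lra.
have rhs0 : 0 <= (a + b - 2 * c) / (2 * r) + r * (a + b).
  have ab0 : 0 <= a + b by rewrite addr_ge0.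
  by apply: addr_ge0; [apply: divr_ge0 => //|]; apply: mulr_ge0 => //; exact: ltW.
rewrite -(@ler_pXn2r _ 2)//.
rewrite real_normK ?num_real//.
set D := a + b - 2 * c in D0 *; pose x := D / (2 * r).
have Dx : D = 2 * r * x by rewrite /x; field; rewrite lt0r_neq0.
rewrite -/x; apply: (@le_trans _ _ (4 * x * (r * (a + b)))); last first.
  by have := sqr_ge0 (x - r * (a + b)); nra.
rewrite (_ : 4 * x * (r * (a + b)) = D * (2 * (a + b))); last by rewrite Dx; ring.
apply: (@le_trans _ _ (D * (a + b + 2 * c))); last first.
  by rewrite ler_wpM2l//; move: D0; rewrite /D; lra.
by rewrite /D; nra.
Qed.

(** * Measures from positive kernels *)

Section KernelMeasures.
Variables (R : realType) (G : groupType) (Y : choiceType) (k : nat).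
Variables (B : 'I_k * 'I_k -> l2op R Y) (L : seq (finite_vectors R G k)).
Variables (zeta : G -> l2 R Y) (eps : R).
Hypothesis Bb : forall p, bop (B p).
Hypothesis Bpos : positive_mx (fun i j => B (i, j)).
Notation lam := (@left_regular R G).

Let kern g xi eta : R[i] :=
  \sum_p inner (B p xi) eta * \sum_(v <- L) vector_functional v (p, g).

Let form (w w' : 'I_k -> R[i]) xi eta : R[i] :=
  \sum_p w p.2 * (w' p.1)^*%C * inner (B p xi) eta.

Let val_at (v : finite_vectors R G k) z i := sval v i z.

Let formE w w' xi eta : form w w' xi eta =
  \sum_(i < k) \sum_(j < k) inner (B (i, j) (w j *: xi)) (w' i *: eta).
Proof.
rewrite pair_bigA; apply: eq_bigr => -[i j] _ /=.
by rewrite (bopZ (Bb _)) innerZl innerZr mulrA.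
Qed.

Let form_ge0 w xi : 0 <= form w w xi xi.
Proof. by rewrite formE; exact: (Bpos (fun i => w i *: xi)). Qed.

(** Positivity of [B] on the tuples w xi - s w' eta for real s gives a discriminant; real s see only
    the symmetrized real part. *)
Let form_cs w w' xi eta :
  ((complex.Re (form w w' xi eta) + complex.Re (form w' w eta xi)) / 2) ^+ 2 <=
  complex.Re (form w w xi xi) * complex.Re (form w' w' eta eta).
Proof.
apply: discriminant_le; first exact/ge0_Re/form_ge0.
move=> s; have := Bpos (fun i => w i *: xi - s%:C%C *: (w' i *: eta)) => /ge0_Re.
rewrite (_ : \sum_i _ = form w w xi xi - s%:C%C * (form w w' xi eta + form w' w eta xi) +
   (s ^+ 2)%:C%C * form w' w' eta eta); last first.
  rewrite !formE mulrDr !mulr_sumr -!big_split -sumrN -!big_split; apply: eq_bigr => i _ /=.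
  rewrite !mulr_sumr -!big_split -sumrN -!big_split; apply: eq_bigr => j _ /=.
  rewrite (bopB (Bb _)) (bopZ (Bb _) s%:C%C) innerBl !innerBr !innerZl !innerZr conjc_real.
  by rewrite expr2 realCM; ring.
rewrite !ReD ReN !ReZ ReD.
by move: (complex.Re (form w w xi xi)) (complex.Re _) (complex.Re _) (complex.Re _); move=> *; lra.
Qed.

Let fin_supp : exists S : {fset G}, forall v z i, v \in L ->
  z \notin S -> val_at v z i = 0.
Proof.
elim: L => [|v L' [S hS]]; first by exists fset0.
have [S' hS'] := svalP v; exists (S `|` S')%fset => w z i.
rewrite !inE negb_or => /orP[/eqP ->|wL] /andP[zS zS']; first exact: hS'.
exact: hS wL zS.
Qed.

Let mass t z : R := \sum_(v <- L) complex.Re (form (val_at v z) (val_at v z) (zeta t) (zeta t)).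

Let mass_ge0 t z : 0 <= mass t z.
Proof. by apply: sumr_ge0 => v _; exact/ge0_Re/form_ge0. Qed.

(** Expanding the finitely supported vectors over the group writes the kernel at g' g^-1 as a sum
    over z of forms at the points g z and g' z. *)
Let sum_form (A : {fset G}) g g' xi eta :
  (forall v i z, v \in L -> z \notin A -> val_at v (g * z)%g i = 0) ->
  \sum_(z <- A) \sum_(v <- L) form (val_at v (g * z)%g) (val_at v (g' * z)%g) xi eta =
  kern (g' * g^-1)%g xi eta.
Proof.
move=> AS; rewrite exchange_big /kern /form.
under eq_bigr => v _ do rewrite exchange_big.
rewrite exchange_big; apply: eq_bigr => p _; rewrite mulr_sumr.
rewrite big_seq [RHS]big_seq.
apply: eq_bigr => v vL.
rewrite -mulr_suml mulrC; congr (_ * _); rewrite /vector_functional /=.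
rewrite -lamM inner_lam.
have -> : lam g^-1%g (sval v p.2) = vec A (fun z => val_at v (g * z)%g p.2).
  apply: l2_ext => z; rewrite lamE invgK vecE; case: ifP => // /negbT zA.
  exact: AS.
rewrite innerJ inner_vec conjc_sum; apply: eq_bigr => z _.
by rewrite conjcM conjcK mulrC lamE invgK.
Qed.

Hypothesis eps1 : eps <= 1 / 2.
Definition good_kernel g :=
  forall t, normc (kern g (zeta t) (zeta (g * t)%g) - 1) <= eps.
Hypothesis good1 : good_kernel 1%g.

Let good_Re g t : good_kernel g -> `|complex.Re (kern g (zeta t) (zeta (g * t)%g)) - 1| <= eps.
Proof.
move=> /(_ t); apply: le_trans.
by have := normr_Re_le (kern g (zeta t) (zeta (g * t)%g) - 1); rewrite ReD ReN.
Qed.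

Let sum_mass (A : {fset G}) g t :
  (forall v i z, v \in L -> z \notin A -> val_at v (g * z)%g i = 0) ->
  `|\sum_(z <- A) mass t (g * z)%g - 1| <= eps.
Proof.
move=> AS; have := good_Re t good1; rewrite mul1g.
have := sum_form g (zeta t) (zeta t) AS; rewrite mulgV => <-.
rewrite Re_sum; under [X in _ -> `|X - _| <= _]eq_bigr => z _ do rewrite /mass -Re_sum.
by [].
Qed.

(** The measures are the normalized diagonal terms. Their total mass before normalization is within
    eps of 1, while the cross terms between t and h t sum to at least 1 - eps although, by
    [form_cs], they are dominated by geometric means of diagonal terms; this forces the two families
    to be close in l1. *)
Lemma kernel_measures : exists (E : {fset G}) (nu : G -> G -> R), fibre_prob E nu /\
  forall r h t (A : {fset G}), 0 < r -> good_kernel h -> good_kernel h^-1%g ->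
    \sum_(z <- A) `|nu (h * t)%g (h * z)%g - nu t z| <= 2 * eps / r + 3 * r + 2 * eps.
Proof.
have [S hS] := fin_supp.
pose N t := \sum_(z <- S) mass t z.
have supp0 t z : z \notin S -> mass t z = 0.
  move=> zS; rewrite /mass big_seq; apply: big1 => v vL.
  by rewrite /form big1// => p _; rewrite (hS v z p.2)// !mul0r.
have N1 t : `|N t - 1| <= eps.
  have := @sum_mass S 1%g t; under eq_bigr => z _ do rewrite mul1g.
  by apply => v i z vL zS; rewrite mul1g (hS v z i).
have Npos t : 0 < N t by move: eps1 (N1 t); rewrite ler_norml => e1 /andP[h _]; lra.
exists S, (fun t z => mass t z / N t); split.
  split=> [t z|t z zS|t].
  - by rewrite divr_ge0// ltW.
  - by rewrite supp0// mul0r.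
  - by rewrite -mulr_suml -/(N t) divff// lt0r_neq0.
move=> r h t A r0 gh ghV.
(* Large enough for the sums of mass t z and of mass (h t) (h z) over z to be complete. *)
pose A' := (A `|` S `|` ((fun z => h^-1 * z)%g @` S))%fset.
have A'S z : z \notin A' -> z \notin S.
  by apply: contra => zS; rewrite !inE zS orbT.
have A'hS z : z \notin A' -> (h * z)%g \notin S.
  apply: contra => zS; rewrite !inE; apply/orP; right.
  by apply/imfsetP; exists (h * z)%g; rewrite ?mulKg.
apply: (@le_trans _ _ (\sum_(z <- A') `|mass (h * t)%g (h * z)%g / N (h * t)%g - mass t z / N t|)).
  rewrite [leRHS](big_fsetID _ (mem A)) /= (_ : [fset x in A' | x \in A]%fset = A); last first.
    by apply/fsetP => z; rewrite !inE; case: (z \in A); rewrite ?andbF.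
  by rewrite lerDl sumr_ge0.
have sumN t' (g : G) : (forall z, z \notin A' -> (g * z)%g \notin S) ->
    `|\sum_(z <- A') mass t' (g * z)%g - 1| <= eps.
  by move=> gS; apply: sum_mass => v i z vL /gS; exact: hS.
have sumN1 := sumN t 1%g; have sumNh := sumN (h * t)%g h A'hS.
have {}sumN1 : `|\sum_(z <- A') mass t z - 1| <= eps.
  by move: sumN1; under eq_bigr => z _ do rewrite mul1g; apply => z /A'S; rewrite mul1g.
(* Symmetrized as in [form_cs]; its sum therefore involves the kernel at h and at h^-1. *)
pose cross z := \sum_(v <- L) (complex.Re (form (val_at v z) (val_at v (h * z)%g) (zeta t) (zeta (h * t)%g)) +
   complex.Re (form (val_at v (h * z)%g) (val_at v z) (zeta (h * t)%g) (zeta t))) / 2.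
have crossS : 1 - eps <= \sum_(z <- A') cross z.
  have h1 := @sum_form A' 1%g h (zeta t) (zeta (h * t)%g).
  have h2 := @sum_form A' h 1%g (zeta (h * t)%g) (zeta t).
  have {}h1 : \sum_(z <- A') \sum_(v <- L) form (val_at v z) (val_at v (h * z)%g) (zeta t) (zeta (h * t)%g) =
      kern h (zeta t) (zeta (h * t)%g).
    have c1 v i z : v \in L -> z \notin A' -> val_at v (1 * z)%g i = 0.
      by move=> vL /A'S zS; rewrite mul1g (hS v z i).
    have := h1 c1; rewrite invg1 mulg1 => <-.
    by apply: eq_bigr => z _; rewrite mul1g.
  have {}h2 : \sum_(z <- A') \sum_(v <- L) form (val_at v (h * z)%g) (val_at v z) (zeta (h * t)%g) (zeta t) =
      kern h^-1%g (zeta (h * t)%g) (zeta t).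
    have c1 v i z : v \in L -> z \notin A' -> val_at v (h * z)%g i = 0.
      by move=> vL /A'hS zS; rewrite (hS v _ i).
    have := h2 c1; rewrite mul1g => <-.
    by apply: eq_bigr => z _; rewrite mul1g.
  have := good_Re t gh; have := good_Re (h * t)%g ghV; rewrite mulKg -h1 -h2.
  rewrite /cross !Re_sum; under eq_bigr => z _ do rewrite Re_sum.
  under [X in _ -> `|X - _| <= _ -> _]eq_bigr => z _ do rewrite Re_sum.
  under [X in _ -> _ -> _ <= X]eq_bigr => z _ do rewrite -mulr_suml big_split /=.
  rewrite -mulr_suml big_split /= !ler_norml => /andP[+ _] /andP[+ _].
  by move: (\sum_(z <- A') _) (\sum_(z <- A') _) => x y; lra.
(* Both masses are at most 1 + eps and the cross terms at least 1 - eps, which gives 4 eps / (2 r);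
   the 3 r uses eps <= 1 / 2. *)
have d1 : \sum_(z <- A') `|mass (h * t)%g (h * z)%g - mass t z| <= 2 * eps / r + 3 * r.
  apply: (@le_trans _ _ (\sum_(z <- A') ((mass t z + mass (h * t)%g (h * z)%g - 2 * cross z) / (2 * r) +
     r * (mass t z + mass (h * t)%g (h * z)%g)))).
    apply: ler_sum => z _; rewrite /mass /cross -sumrB (le_trans (ler_norm_sum _ _ _))//.
    rewrite -big_split mulr_sumr -sumrB mulr_suml mulr_sumr -big_split /=.
    by apply: ler_sum => v _; apply: hellinger_le => //; exact/ge0_Re/form_ge0.
  rewrite big_split /= -mulr_suml -mulr_sumr sumrB big_split /= -mulr_sumr.
  move: sumN1 sumNh crossS; rewrite !ler_norml.
  set x := \sum_(z <- A') mass t z; set y := \sum_(z <- A') mass _ _.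
  set c := \sum_(z <- A') _; clearbody x y c.
  move=> /andP[_ x1] /andP[_ y1] c1; apply: lerD.
    rewrite [leLHS](_ : _ = ((x + y - 2 * c) / 2) / r); last by rewrite invfM mulrA.
    by rewrite ler_pM2r ?invr_gt0//; lra.
  by rewrite mulrC; apply: ler_wpM2r; [exact: ltW|move: eps1 => e1; lra].
have scal t' (f : G -> R) : (forall z, 0 <= f z) -> \sum_(z <- A') f z = N t' ->
    \sum_(z <- A') `|f z / N t' - f z| <= eps.
  move=> f0 fN; rewrite (eq_bigr (fun z => f z * `|(N t')^-1 - 1|)); last first.
    by move=> z _; rewrite -{2}[f z]mulr1 -mulrBr normrM ger0_norm.
  rewrite -mulr_suml fN -{1}(gtr0_norm (Npos t')) -normrM mulrBr divff ?lt0r_neq0// mulr1.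
  by rewrite distrC; exact: N1.
have eN1 : \sum_(z <- A') mass t z = N t.
  rewrite (big_fsetID _ (mem S)) /= [X in _ + X]big1_fset => [|z]; last first.
    by rewrite !inE => /andP[_ zS] _; exact: supp0.
  rewrite addr0; apply: eq_fbigl => z; rewrite !inE.
  by case: (z \in S); rewrite ?orbT ?andbF.
have eNh : \sum_(z <- A') mass (h * t)%g (h * z)%g = N (h * t)%g.
  transitivity (\sum_(z <- ((fun z => h * z)%g @` A')%fset) mass (h * t)%g z).
    by rewrite [RHS]big_imfset// => x y _ _ /mulgI.
  rewrite (big_fsetID _ (mem S)) /= [X in _ + X]big1_fset => [|z]; last first.
    by rewrite !inE => /andP[_ zS] _; exact: supp0.
  rewrite addr0; apply: eq_fbigl => z; rewrite !inE; apply/andP/idP => [[]//|zS]; split=> //.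
  apply/imfsetP; exists (h^-1 * z)%g; rewrite ?mulVKg//= !inE; apply/orP; right.
  by apply/imfsetP; exists z.
apply: (@le_trans _ _ (\sum_(z <- A') (`|mass (h * t)%g (h * z)%g / N (h * t)%g - mass (h * t)%g (h * z)%g| +
   (`|mass (h * t)%g (h * z)%g - mass t z| + `|mass t z / N t - mass t z|)))).
  apply: ler_sum => z _; apply: le_trans (ler_distD (mass (h * t)%g (h * z)%g) _ _) _.
  by rewrite lerD2l (le_trans (ler_distD (mass t z) _ _))// lerD2l distrC.
rewrite !big_split /=.
have := scal (h * t)%g _ (fun z => mass_ge0 _ (h * z)%g) eNh.
have := scal t _ (mass_ge0 t) eN1.
by move: d1; lra.
Qed.

End KernelMeasures.

Section ExactToPropertyA.
Variables (R : realType) (G : groupType).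
Notation lam := (@left_regular R G).
Notation D := (@reduced_cstar R G).

Section Cyclic.
Variables (Y : choiceType) (phi : l2op R G -> l2op R Y).
Hypothesis phiP : faithful_representation D phi.

(** The representation need not be unital: [phi] of the identity is only a nonzero projection, and
    the unit vector is chosen in its range. *)
Lemma cyclic_orbit : exists zeta : G -> l2 R Y,
  (forall t, l2norm (zeta t) = 1) /\ (forall g t, phi (lam g) (zeta t) = zeta (g * t)%g).
Proof.
have [pb plin pmul padj pinj] := phiP.
have p0 := linear_on0 plin (reduced_cstar0 R G).
have [xi xi0] : exists xi, phi id xi <> 0.
  apply: contrapT => /forallNP h.
  have : phi id = phi 0 by rewrite p0; apply/funext => xi; apply: contrapT => /h.
  move=> /(pinj _ _ (reduced_cstar_id R G) (reduced_cstar0 R G)) e.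
  have := congr1 (fun T : l2op R G => l2norm (T (delta R 1%g))) e.
  by rewrite /= l2norm_delta l2norm0 => /eqP; rewrite oner_eq0.
have plam g h f : phi (lam g) (phi (lam h) f) = phi (lam (g * h)%g) f.
  have := pmul _ _ (reduced_cstar_lam R g) (reduced_cstar_lam R h).
  rewrite (_ : lam g \o lam h = lam (g * h)%g) => [->//|].
  by apply/funext => x; exact: lamM.
have bphi g : bop (phi (lam g)) by apply: pb; exact: reduced_cstar_lam.
rewrite -lam1_id in xi0.
have n0 : l2norm (phi (lam 1%g) xi) != 0.
  by apply/eqP => /l2norm_eq0.
pose xi1 := (l2norm (phi (lam 1%g) xi))^-1%:C%C *: xi.
exists (fun t => phi (lam t) xi1); split; last by move=> g t; exact: plam.
have n1 : l2norm (phi (lam 1%g) xi1) = 1.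
  rewrite (bopZ (bphi _)) l2normZ normc_real ger0_norm ?invr_ge0 ?l2norm_ge0//.
  by rewrite mulVf.
move=> t; rewrite -n1; apply/eqP; rewrite -(@eqrXn2 _ 2) ?l2norm_ge0// !l2norm_sqE.
have adj g : is_adjoint (phi (lam g)) (phi (lam g^-1)%g).
  by apply: padj; [exact: reduced_cstar_lam|exact: reduced_cstar_lam|exact: inner_lam].
by rewrite (adj t) (adj 1%g) !plam mulVg invg1 mulg1.
Qed.

End Cyclic.

Definition matrix_unit k (p : 'I_k * 'I_k) : l2op R 'I_k :=
  fun f => f p.2 *: delta R p.1.

Lemma matrix_unit_bound k (p : 'I_k * 'I_k) : opbound (matrix_unit p) 1.
Proof. by move=> f; rewrite l2normZ l2norm_delta mulr1 mul1r normc_le_l2norm. Qed.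

Lemma bop_matrix_unit k (p : 'I_k * 'I_k) : bop (matrix_unit p).
Proof.
split; last by exists 1; exact: matrix_unit_bound.
by move=> c f g; rewrite /matrix_unit l2DE l2ZE scalerDl scalerA.
Qed.

(** As in Choi's theorem, complete positivity of a map on matrices enters through the image of this
    one positive matrix. *)
Lemma matrix_unit_positive k : positive_mx (fun i j : 'I_k => matrix_unit (i, j)).
Proof.
move=> xi; rewrite (_ : \sum_i _ = (\sum_(j < k) xi j j) * (\sum_(i < k) xi i i)^*%C).
  by rewrite mulcJ lecR sqr_ge0.
rewrite conjc_sum mulr_sumr; apply: eq_bigr => i _; rewrite mulr_suml.
by apply: eq_bigr => j _; rewrite innerZl inner_deltal.
Qed.

Lemma matrix_unit_sum k (T : l2op R 'I_k) : bop T ->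
  T = \sum_(p : 'I_k * 'I_k) inner (T (delta R p.2)) (delta R p.1) *: matrix_unit p.
Proof.
move=> Tb; apply/funext => f; rewrite fun_sumE.
have fE : f = \sum_(j < k) f j *: delta R j.
  apply: l2_ext => i; rewrite l2_sumE (eq_bigr (fun j => if i == j then f j else 0)).
    by rewrite -big_mkcond (big_pred1 i).
  by move=> j _; rewrite l2ZE deltaE; case: ifP; rewrite ?mulr1 ?mulr0.
rewrite [in LHS]fE (bop_sum Tb); apply: l2_ext => i.
rewrite l2_sumE [RHS]l2_sumE.
rewrite (eq_bigr (fun p : 'I_k * 'I_k => (if i == p.1 then f p.2 * T (delta R p.2) i else 0))); last first.
  move=> [i' j] _; transitivity (inner (T (delta R j)) (delta R i') * (matrix_unit (i', j) f i)) => //.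
  rewrite inner_delta /matrix_unit l2ZE deltaE /=.
  by case: eqP => [->|_]; rewrite ?mulr1 ?mulr0// mulrC.
rewrite -(pair_bigA _ (fun i' j => if i == i' then f j * T (delta R j) i else 0)) /=.
rewrite exchange_big; apply: eq_bigr => j _; rewrite (bopZ Tb) l2ZE.
by rewrite -big_mkcond (big_pred1 i).
Qed.

(* For almost factorizations b o a of phi through matrices, the kernel
   <b (a (lam (s t^-1))) zeta_t, zeta_s> with zeta_t = phi (lam t) zeta is close
   to 1 for s t^-1 in F.  Approximating a by vector functionals given by
   finitely supported families v_1, .., v_k, it splits as a sum over z, and the
   diagonal terms are the required measures. *)
Lemma exact_property_A : exact_group R G -> property_A R G.
Proof.
move=> [Y [phi [phiP nuc]]] F e e0.
have [zeta [z1 zE]] := cyclic_orbit phiP.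
(* With eps = r^2 / 2 the bound 2 eps / r + 3 r + 2 eps of [kernel_measures] is at most 5 r. *)
pose r := Num.min 1 (e / 10).
have r0 : 0 < r by rewrite lt_min ltr01 divr_gt0.
have r1 : r <= 1 by rewrite ge_min lexx.
have re : 10 * r <= e by rewrite mulrC -ler_pdivlMr// ge_min lexx orbT.
pose eps := r ^+ 2 / 2.
have eps0 : 0 < eps by rewrite divr_gt0// exprn_gt0.
have r21 : r ^+ 2 <= r by rewrite expr2 ler_piMr// ltW.
have eps1 : eps <= 1 / 2 by rewrite /eps; lra.
pose Fs : {fset G} := (1%g |` (F `|` (fun g => g^-1)%g @` F))%fset.
have [k [a [b [acp bcp ab]]]] : exists (k : nat) (a : l2op R G -> l2op R 'I_k)
    (b : l2op R 'I_k -> l2op R Y), [/\ ccp D a, ccp (@bounded_op R 'I_k) b &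
      forall g, g \in Fs -> opnorm (b (a (lam g)) - phi (lam g)) < eps / 2].
  have fin : finite_set [set lam g | g in [set` Fs]] by apply: finite_image; exact: finite_fset.
  have FD : [set lam g | g in [set` Fs]] `<=` D by move=> _ [g _ <-]; exact: reduced_cstar_lam.
  have [k [a [b [acp bcp ab]]]] := nuc _ _ fin FD (divr_gt0 eps0 (ltr0n _ 2)).
  by exists k, a, b; split=> // g gF; apply: ab; exists g.
pose kap := eps / 2 / (k * k).+1%:R.
have kap0 : 0 < kap by apply: (divr_gt0 (divr_gt0 eps0 (ltr0n _ 2))); rewrite ltr0n.
pose A : {fset 'I_k * 'I_k * G} :=
  [fset x in [seq (p, g) | p <- enum {: 'I_k * 'I_k}, g <- enum_fset Fs]]%fset.
have AP p g : g \in Fs -> (p, g) \in A.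
  by move=> gF; rewrite inE /=; apply: allpairs_f; rewrite ?mem_enum.
have [L LP] := vector_approx acp A kap0.
have [bb blin b1 bpos] := bcp; have [aab alin a1 apos] := acp.
pose B p := b (@matrix_unit k p).
have Bb p : bop (B p) by apply: bb; exact: bop_matrix_unit.
have Bpos : positive_mx (fun i j => B (i, j)).
  by apply: bpos => [i j|]; [exact: bop_matrix_unit|exact: matrix_unit_positive].
have B1 p xi : l2norm (B p xi) <= l2norm xi.
  have [_ nb] := opnorm_bound (Bb p); apply: le_trans (nb _) _.
  rewrite -[leRHS]mul1r ler_wpM2r ?l2norm_ge0//.
  apply: le_trans (b1 _ (bop_matrix_unit p)) _.
  by apply: opnorm_le => //; exact: matrix_unit_bound.
have good g : g \in Fs -> good_kernel B L zeta eps g.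
  move=> gF t.
  have aTb : bop (a (lam g)) by apply: aab; exact: reduced_cstar_lam.
  have baE : b (a (lam g)) (zeta t) = \sum_(p : 'I_k * 'I_k)
      inner (a (lam g) (delta R p.2)) (delta R p.1) *: B p (zeta t).
    rewrite [in LHS](matrix_unit_sum aTb) (@linear_on_sum _ _ _ _ _ _ _ _ _ blin) ?fun_sumE//.
      move=> s; rewrite (_ : \sum_(j <- s) _ = (fun f => \sum_(j <- s)
          inner (a (lam g) (delta R j.2)) (delta R j.1) *: matrix_unit j f)).
        by apply: bop_bigsum => p; apply: bop_scale; exact: bop_matrix_unit.
      by apply/funext => f; rewrite fun_sumE.
    by move=> p; exact: bop_matrix_unit.
  have h1 : normc (inner (b (a (lam g)) (zeta t)) (zeta (g * t)%g) - 1) <= eps / 2.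
    have -> : 1 = inner (phi (lam g) (zeta t)) (zeta (g * t)%g) :> R[i].
      by rewrite zE inner_self z1 expr1n.
    rewrite -innerBl; have bd : bop (b (a (lam g)) - phi (lam g)).
      apply: (@bop_sub _ _ _ (b (a (lam g))) (phi (lam g))); first exact: bb.
      by case: phiP => pb _ _ _ _; apply: pb; exact: reduced_cstar_lam.
    have [_ nb] := opnorm_bound bd.
    apply: le_trans (cauchy_schwarz _ _) _; rewrite z1 mulr1.
    apply: le_trans (nb (zeta t)) _; rewrite z1 mulr1; exact/ltW/ab.
  rewrite (_ : _ - 1 = (\sum_(p : 'I_k * 'I_k) inner (B p (zeta t)) (zeta (g * t)%g) *
     (\sum_(v <- L) vector_functional v (p, g) - inner (a (lam g) (delta R p.2)) (delta R p.1))) +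
     (inner (b (a (lam g)) (zeta t)) (zeta (g * t)%g) - 1)); last first.
    rewrite (eq_bigr _ (fun p _ => mulrBr _ _ _)) sumrB addrA; congr (_ - 1).
    rewrite baE inner_suml [X in _ + X](eq_bigr (fun p => inner (B p (zeta t)) (zeta (g * t)%g) *
      inner (a (lam g) (delta R p.2)) (delta R p.1))) ?subrK// => p _.
    by rewrite innerZl mulrC.
  apply: le_trans (le_normcD _ _) _; rewrite [leRHS](_ : _ = eps / 2 + eps / 2); last by field.
  apply: lerD h1; apply: le_trans (normc_sum _ _ _) _.
  apply: (@le_trans _ _ (\sum_(p : 'I_k * 'I_k) kap)).
    apply: ler_sum => p _; rewrite normcM -[leRHS]mul1r; apply: ler_pM; rewrite ?normc_ge0//.
      by rewrite -[leRHS]mul1r; apply: cauchy_schwarz_le; rewrite ?z1// -(z1 t).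
    by rewrite normcB; have := LP (p, g) (AP p g gF).
  have -> : \sum_(p : 'I_k * 'I_k) kap = kap * (k * k)%:R.
    by rewrite sumr_const card_prod !card_ord mulr_natr.
  rewrite /kap -[leLHS]mulrA; apply: ler_piMr; first exact/ltW/(divr_gt0 eps0 (ltr0n _ 2)).
  by rewrite mulrC ler_pdivrMr// mul1r ler_nat.
have g1 : good_kernel B L zeta eps 1%g by apply: good; rewrite !inE eqxx.
have [E [nu [nuP nuF]]] := kernel_measures Bb Bpos eps1 g1.
exists E, nu; split=> // h t A' hF.
apply: le_trans (nuF r h t A' r0 (good _ _) (good _ _)) _.
- by rewrite !inE hF orbT.
- by rewrite !inE; apply/orP; right; apply/orP; right; apply/imfsetP; exists h.
rewrite (_ : 2 * eps / r = r); last by rewrite /eps; field; rewrite lt0r_neq0.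
by move: re r21; rewrite /eps; lra.
Qed.

End ExactToPropertyA.

(** * Almost invariant probabilities on amenable groups *)

Lemma sum_const_seq (R : realType) (J : Type) (r : seq J) (x : R) :
  \sum_(j <- r) x = (size r)%:R * x.
Proof. by rewrite big_const_seq count_predT iter_addr_0 mulr_natl. Qed.

Lemma ln_diff_le (R : realType) (a b : R) : 0 < a -> 0 < b -> ln a - ln b <= a / b - 1.
Proof.
move=> a0 b0; have ab : 0 < a / b by rewrite divr_gt0.
rewrite -ln_div ?posrE//; have := @le_ln1Dx R (a / b - 1).
by rewrite addrCA subrr addr0; apply; lra.
Qed.

(** Provides the start of a Neumann series whose sum must be positive at every point, as its
    logarithm is taken; countability gives the weights 2^-n. *)
Lemma positive_l2 (R : realType) (X : choiceType) : countable [set: X] ->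
  exists psi : l2 R X, exists p : X -> R, forall x, 0 < p x /\ psi x = (p x)%:C%C.
Proof.
move=> /countable_injP[i iinj].
pose p x : R := 2^-1 ^+ i x.
have p0 x : 0 < p x by rewrite exprn_gt0// invr_gt0.
have p1 x : p x <= 1 by rewrite exprn_ile1 ?invr_ge0 ?invf_le1 ?ler1n.
have half : 2^-1 + 2^-1 = 1 :> R by field.
have geo n : \sum_(k < n) (2^-1 : R) ^+ k = 2 - 2 * 2^-1 ^+ n.
  elim: n => [|n IH]; first by rewrite big_ord0 expr0; lra.
  by rewrite big_ord_recr /= IH exprS; move: (_ ^+ n) half => q; nra.
have bound (A : {fset X}) : sqs (fun x => (p x)%:C%C) A <= 2.
  apply: (@le_trans _ _ (\sum_(x <- A) p x)).
    apply: ler_sum => x _; rewrite normc_real gtr0_norm// expr2.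
    by rewrite ler_piMr// ltW.
  have injA : {in A &, injective i} by move=> x y _ _; apply: iinj; rewrite in_setE.
  have -> : \sum_(x <- A) p x = \sum_(n <- (i @` A)%fset) (2^-1 : R) ^+ n.
    by rewrite big_imfset.
  pose N := (\max_(n <- (i @` A)%fset) n).+1.
  have -> : \sum_(n <- (i @` A)%fset) (2^-1 : R) ^+ n =
      \sum_(n <- (i @` A)%fset) (if n \in [fset x in iota 0 N]%fset then 2^-1 ^+ n else 0).
    rewrite big_seq [RHS]big_seq; apply: eq_bigr => n nA.
    have nN : (n < N)%N by rewrite /N ltnS (big_rem n)//= leq_maxl.
    have nI N' : (n < N')%N -> n \in [fset x in iota 0 N']%fset.
      by move=> h; rewrite inE /= mem_iota.
    by rewrite nI.
  apply: le_trans (sum_mem_le _ _ _) _ => [n|]; first by rewrite exprn_ge0// invr_ge0.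
  rewrite (_ : \sum_(n <- _) _ = \sum_(k < N) (2^-1 : R) ^+ k); last first.
    rewrite -(big_mkord xpredT (fun k => (2^-1 : R) ^+ k)) /index_iota subn0.
    apply: perm_big; apply: uniq_perm; rewrite ?fset_uniq ?iota_uniq// => n.
    by rewrite !inE.
  by rewrite geo lerBlDr lerDl mulr_ge0// exprn_ge0// invr_ge0.
exists (L2 (sqs_summable bound)), p => x; split=> //.
Qed.

Section AlmostInvariant.
Variables (R : realType) (G : groupType) (F : seq G) (M : mean R G) (c : R).
Hypothesis Gc : countable [set: G].
Hypothesis MF : forall k u, k \in F -> bdd u -> M (fun x => u (k * x)%g) = M u.
Hypothesis c0 : 0 < c.
Notation lam := (@left_regular R G).

(* Kesten's criterion: a spectral gap for the symmetric sum h over F and F^-1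
   yields a positive function f with h f <= (2 |F| - c / 2) f; since
   ln y <= y - 1, averaging ln (f (k x)) - ln (f x) over x contradicts the
   invariance of M. *)
Lemma almost_invariant_vector :
  exists xi : l2 R G, \sum_(k <- F) l2norm (lam k xi - xi) ^+ 2 < c * l2norm xi ^+ 2.
Proof.
apply: contrapT => /forallNP gap0.
have gap xi : c * l2norm xi ^+ 2 <= \sum_(k <- F) l2norm (lam k xi - xi) ^+ 2.
  by rewrite leNgt; apply/negP; exact: gap0.
pose n : R := (size F)%:R.
(* The multiple 2 n of the identity makes h positive, so that its norm can be read off from its
   quadratic form. *)
pose h (f : l2 R G) : l2 R G := \sum_(k <- F) (lam k f + lam k^-1%g f) + (2 * n)%:C%C *: f.
have hb : bop h.
  apply: bop_add; last by apply: bop_scale; exact: bop_id.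
  by apply: bop_bigsum => k; apply: bop_add; exact: bop_lam.
have hsa : is_adjoint h h.
  move=> f g; rewrite /h innerDl innerDr innerZl innerZr conjc_real; congr (_ + _).
  rewrite inner_suml inner_sumr; apply: eq_bigr => k _.
  by rewrite innerDl innerDr !inner_lam invgK addrC.
have hRe xi : complex.Re (inner (h xi) xi) =
    4 * n * l2norm xi ^+ 2 - \sum_(k <- F) l2norm (lam k xi - xi) ^+ 2.
  rewrite /h innerDl innerZl inner_self -realCM ReD [X in _ + X]/= inner_suml Re_sum.
  rewrite (eq_bigr (fun k => 2 * l2norm xi ^+ 2 - l2norm (lam k xi - xi) ^+ 2)); last first.
    move=> k _; rewrite l2norm_sqB l2norm_lam innerDl ReD (inner_lam k^-1%g) invgK.
    by rewrite (innerJ (lam k xi)) ReJ; lra.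
  rewrite sumrB sum_const_seq -/n.
  by move: (\sum_(k <- F) _) => x; ring.
have gap4 : c <= 4 * n.
  have := gap (delta R 1%g); rewrite l2norm_delta expr1n mulr1 => /le_trans; apply.
  apply: (@le_trans _ _ (\sum_(k <- F) (4 : R))).
    apply: ler_sum => k _; have := ler_l2normB (lam k (delta R 1%g)) (delta R 1%g).
    rewrite l2norm_lam l2norm_delta.
    by have := l2norm_ge0 (lam k (delta R 1%g) - delta R 1%g); nra.
  by rewrite sum_const_seq mulrC.
have hbound : opbound h (4 * n - c).
  apply: selfadjoint_bound => // [|xi]; first by rewrite subr_ge0.
  rewrite hRe ger0_norm; first by rewrite mulrBl lerD2l lerN2.
  rewrite subr_ge0; apply: (@le_trans _ _ (\sum_(k <- F) 4 * l2norm xi ^+ 2)).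
    apply: ler_sum => k _; have := ler_l2normB (lam k xi) xi; rewrite l2norm_lam.
    by have := l2norm_ge0 (lam k xi - xi); nra.
  by rewrite sum_const_seq -/n; lra.
(* Strictly above the norm bound 4 n - c, so that the Neumann series of h / rho converges, and
   strictly below 4 n, which leaves a definite gain. *)
pose rho := 4 * n - c / 2.
have rho0 : 0 < rho by move: c0 gap4; rewrite /rho => c1 g4; lra.
have [psi [p psiP]] := positive_l2 R Gc.
have p0 x : 0 < p x by case: (psiP x).
(* Partial sums of the Neumann series of h / rho at psi. They increase pointwise to a function u
   with h u <= rho u. *)
pose fix f j : l2 R G := if j is j'.+1 then psi + rho^-1%:C%C *: h (f j') else psi.
have fbound j : l2norm (f j) <= rho * l2norm psi / (c / 2).
  have e : rho * l2norm psi / (c / 2) = l2norm psi + (4 * n - c) * l2norm psi / (c / 2).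
    by rewrite /rho; field; rewrite lt0r_neq0.
  have q0 : 0 <= (4 * n - c) * l2norm psi / (c / 2).
    by rewrite divr_ge0 ?mulr_ge0 ?subr_ge0 ?l2norm_ge0 ?divr_ge0 ?(ltW c0).
  elim: j => [|j IH] /=; first by rewrite e lerDl.
  rewrite e; apply: le_trans (ler_l2normD _ _) _; rewrite lerD2l l2normZ normc_real.
  rewrite gtr0_norm ?invr_gt0// ler_pdivrMl//; apply: le_trans (hbound _) _.
  by rewrite [leRHS](_ : _ = (4 * n - c) * (rho * l2norm psi / (c / 2))) ?ler_wpM2l ?subr_ge0//; ring.
pose g j x := complex.Re (f j x).
have gS j x : g j.+1 x = p x + rho^-1 *
    (\sum_(k <- F) (g j (k^-1 * x)%g + g j (k * x)%g) + 2 * n * g j x).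
  rewrite /g -[f j.+1]/(psi + rho^-1%:C%C *: h (f j)) l2DE l2ZE ReD ReZ (psiP x).2 /=; congr (_ + _ * _).
  transitivity (complex.Re ((\sum_(k <- F) (lam k (f j) + lam k^-1%g (f j)) : l2 R G) x +
    (2 * n)%:C%C * f j x)) => //.
  rewrite ReD ReZ l2_sumE Re_sum; congr (_ + _); apply: eq_bigr => k _.
  transitivity (complex.Re (f j (k^-1 * x)%g + f j (k^-1^-1 * x)%g)) => //.
  by rewrite ReD invgK.
have n0 : 0 <= n by rewrite ler0n.
have gp j x : p x <= g j x.
  elim: j x => [|j IH] x; first by rewrite /g /= (psiP x).2.
  have g0 y : 0 <= g j y by apply: le_trans (IH y); exact: ltW.
  rewrite gS lerDl mulr_ge0 ?invr_ge0 ?(ltW rho0)// addr_ge0 ?mulr_ge0// sumr_ge0// => k _.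
  by rewrite addr_ge0.
have gmono j x : g j x <= g j.+1 x.
  elim: j x => [|j IH] x; first by rewrite {1}/g /= (psiP x).2; exact: gp.
  rewrite [leLHS]gS [leRHS]gS lerD2l ler_pM2l ?invr_gt0//; apply: lerD.
    by apply: ler_sum => k _; apply: lerD.
  by rewrite ler_wpM2l// mulr_ge0.
have gle i j x : (i <= j)%N -> g i x <= g j x.
  by move/subnK => <-; elim: (j - i)%N => [//|d IH]; apply: le_trans IH (gmono _ _).
have gb x : bdd (fun j => g j x).
  exists (rho * l2norm psi / (c / 2)) => j; apply: le_trans (normr_Re_le _) _.
  exact: le_trans (normc_le_l2norm _ _) (fbound j).
have [m mt] := nat_mean R.
pose u x := m (fun j => g j x).
have u0 x : 0 < u x.
  apply: lt_le_trans (p0 x) _; rewrite -(mean_cst m (p x)).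
  by apply: le_mean => //; exact: bdd_cst.
have gu j x : g j x <= u x.
  rewrite -subr_ge0 -(mean_cst m (g j x)) -meanB//; last exact: bdd_cst.
  apply: mt; first exact/bddB/bdd_cst.
  by exists j => i ji; rewrite subr_ge0; exact: gle.
have uh x : \sum_(k <- F) (u (k^-1 * x)%g + u (k * x)%g) + 2 * n * u x <= rho * u x.
  have -> : \sum_(k <- F) (u (k^-1 * x)%g + u (k * x)%g) + 2 * n * u x =
      m (fun j => \sum_(k <- F) (g j (k^-1 * x)%g + g j (k * x)%g) + 2 * n * g j x).
    rewrite meanD ?meanZ//; last 2 first.
    - by apply: bdd_sum => k _; exact: bddD.
    - exact: bddZ.
    rewrite mean_sum => [|k _]; last exact: bddD.
    by congr (_ + _); apply: eq_bigr => k _; rewrite meanD.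
  apply: mean_le => [|j].
    by apply: bddD; [apply: bdd_sum => k _; exact: bddD|exact: bddZ].
  rewrite -ler_pdivrMl//; apply: le_trans (gu j.+1 x).
  by rewrite gS lerDr ltW.
(* A Harnack inequality; it makes the logarithmic differences of u bounded, so that [M] can be
   applied to them. *)
have uk k x : k \in F -> u (k^-1 * x)%g <= rho * u x /\ u (k * x)%g <= rho * u x.
  move=> kF; have := uh x; rewrite (big_rem k)//=.
  have : 0 <= \sum_(y <- rem k F) (u (y^-1 * x)%g + u (y * x)%g).
    by apply: sumr_ge0 => y _; rewrite addr_ge0// ltW.
  have : 0 <= 2 * n * u x by rewrite !mulr_ge0// ltW.
  by have := u0 (k^-1 * x)%g; have := u0 (k * x)%g; move=> *; split; lra.
pose d k x := ln (u (k * x)%g) - ln (u x).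
have dle k x : d k x <= u (k * x)%g / u x - 1 by exact: ln_diff_le.
have db k : k \in F -> bdd (d k) /\ bdd (d k^-1%g).
  move=> kF.
  have up (z y : G) : u z <= rho * u y -> ln (u z) - ln (u y) <= rho.
    move=> zy; apply: le_trans (ln_diff_le (u0 z) (u0 y)) _.
    have : u z / u y <= rho by rewrite ler_pdivrMr.
    by lra.
  split; exists rho => x; rewrite ler_norml; apply/andP; split.
  - rewrite lerNl opprB; apply: up; have [+ _] := uk k (k * x)%g kF.
    by rewrite mulKg.
  - by apply: up; have [_] := uk k x kF.
  - rewrite lerNl opprB; apply: up; have [_] := uk k (k^-1 * x)%g kF.
    by rewrite mulVKg.
  - by apply: up; have [] := uk k x kF.
have dinv k : k \in F -> M (d k) + M (d k^-1%g) = 0.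
  move=> kF; have [b1 b2] := db k kF.
  have e : M (fun x => d k^-1%g (k * x)%g) = - M (d k).
    by rewrite -meanN//; apply: eq_mean => x; rewrite /d mulKg opprB.
  by rewrite -(MF kF b2) e subrr.
pose dd k x := if k \in F then d k x + d k^-1%g x else 0.
have ddb k : bdd (dd k).
  rewrite /dd; case: (boolP (k \in F)) => [/db[b1 b2]|_]; [exact: (bddD b1 b2)|exact: bdd_cst].
have : M (fun x => \sum_(k <- F) dd k x) <= - (c / 2).
  apply: mean_le => [|x].
    exact: bdd_sum.
  apply: (@le_trans _ _ (\sum_(k <- F) ((u (k^-1 * x)%g + u (k * x)%g) / u x - 2))).
    rewrite big_seq [leRHS]big_seq; apply: ler_sum => k kF; rewrite /dd kF.
    by have := dle k x; have := dle k^-1%g x; rewrite mulrDl; lra.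
  rewrite sumrB -mulr_suml sum_const_seq -/n.
  have : (\sum_(k <- F) (u (k^-1 * x)%g + u (k * x)%g)) / u x <= rho - 2 * n.
    by rewrite ler_pdivrMr//; have := uh x; move: (\sum_(k <- F) _) => y; lra.
  by rewrite /rho; move: (_ / u x) => y; lra.
rewrite mean_sum//.
rewrite big_seq big1 => [|k kF]; first by move: c0; lra.
by rewrite /dd kF; have [b1 b2] := db k kF; rewrite meanD ?dinv.
Qed.

End AlmostInvariant.

(** The probability consists of the normalized squares of a truncated almost invariant vector.
    Invariance of the mean is asked for [F] alone, which is what the product means on a direct sum
    provide. *)
Lemma reiter (R : realType) (G : groupType) (F : seq G) (M : mean R G) e :
  countable [set: G] -> (forall k u, k \in F -> bdd u -> M (fun x => u (k * x)%g) = M u) ->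
  0 < e -> exists (E : {fset G}) (p : G -> R), fibre_prob E (fun _ : unit => p) /\
  forall k (A : {fset G}), k \in F -> \sum_(z <- A) `|p (k * z)%g - p z| <= e.
Proof.
move=> Gc MF e0; pose r := e / 4; have r0 : 0 < r by rewrite divr_gt0.
have r20 : 0 < r / 2 by rewrite divr_gt0.
pose eta := Num.min (r / 4) (1 / 2); have eta0 : 0 < eta by rewrite lt_min !divr_gt0.
have eta1 : eta <= r / 4 by rewrite ge_min lexx.
have eta2 : eta <= 1 / 2 by rewrite ge_min lexx orbT.
have c0 : 0 < (r / 2) ^+ 2 by rewrite exprn_gt0// divr_gt0.
have [xi0 hxi0] := almost_invariant_vector Gc MF c0.
have xin0 : 0 < l2norm xi0.
  rewrite lt_def l2norm_ge0 andbT; apply/eqP => z; move: hxi0.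
  by rewrite z expr0n mulr0 ltNge sumr_ge0// => k _; exact: sqr_ge0.
pose xi : l2 R G := (l2norm xi0)^-1%:C%C *: xi0.
have xi1 : l2norm xi = 1.
  by rewrite l2normZ normc_real gtr0_norm ?invr_gt0// mulVf// lt0r_neq0.
have hxi k : k \in F -> l2norm (left_regular k xi - xi) <= r / 2.
  move=> kF; rewrite -(@ler_pXn2r _ 2)// ?nnegrE ?l2norm_ge0 ?(ltW r20)//.
  rewrite /xi (bopZ (bop_lam R k)) -scalerBr l2normZ normc_real gtr0_norm ?invr_gt0//.
  rewrite exprMn exprVn ler_pdivrMl ?exprn_gt0// mulrC; apply: le_trans (ltW hxi0).
  by rewrite (big_rem k)//= lerDl sumr_ge0// => y _; exact: sqr_ge0.
have [E hE] := vec_approx xi eta0; set v := vec E xi in hE.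
have v1 : 1 / 2 <= l2norm v.
  have := ler_l2normD (xi - v) v; rewrite subrK xi1; lra.
have vk k : k \in F -> l2norm (left_regular k^-1%g v - v) <= r.
  move=> kF; rewrite -(l2norm_lam k) (bopB (bop_lam R k)) lamM mulgV lam1 l2normB.
  rewrite (_ : _ - v = left_regular k (v - xi) + (left_regular k xi - xi) + (xi - v)); last first.
    by rewrite (bopB (bop_lam R k)) !addrA subrK addrNK.
  apply: le_trans (ler_l2normD _ _) _; apply: le_trans (lerD (ler_l2normD _ _) hE) _.
  rewrite l2norm_lam (l2normB v); have := hxi k kF; move: hE eta1; lra.
have v0 : 0 < l2norm v ^+ 2 by rewrite exprn_gt0//; lra.
exists E, (fun z => normc (v z) ^+ 2 / l2norm v ^+ 2); split.
  split=> [_ z|_ z zE|_].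
  - by rewrite divr_ge0 ?sqr_ge0.
  - by rewrite vecE (negbTE zE) normc0 expr0n mul0r.
  - rewrite -mulr_suml -[X in X / _](_ : l2norm v ^+ 2 = _) ?divff ?lt0r_neq0//.
    rewrite [in LHS]/v l2norm_vec /sqs big_seq [RHS]big_seq; apply: eq_bigr => z zE.
    by rewrite vecE zE.
move=> k A kF.
pose D := left_regular k^-1%g v - v.
(* A difference of squares is at most t (a + b) <= t^2 / (2 r) + r (a^2 + b^2), with a, b the two
   moduli and t the modulus of the difference; each term has a controlled sum. *)
apply: (@le_trans _ _ (\sum_(z <- A) (normc (D z) ^+ 2 / (2 * r) +
    r * (normc (left_regular k^-1%g v z) ^+ 2 + normc (v z) ^+ 2)) / l2norm v ^+ 2)).
  apply: ler_sum => z _; rewrite -mulrBl normrM (gtr0_norm (_ : 0 < (_ ^+ 2)^-1)) ?invr_gt0//.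
  rewrite ler_pM2r ?invr_gt0// /D l2BE lamE invgK.
  move: (v (k * z)%g) (v z) => x y.
  have xy : `|normc x - normc y| <= normc (x - y).
    rewrite ler_norml; apply/andP; split.
      by have := le_normcD (y - x) x; rewrite subrK (normcB y); lra.
    by have := le_normcD (x - y) y; rewrite subrK; lra.
  rewrite subr_sqr normrM [X in _ * X]ger0_norm ?addr_ge0 ?normc_ge0//.
  have := normc_ge0 x; have := normc_ge0 y; have := normc_ge0 (x - y).
  move: xy; move: `|normc x - normc y| (normc (x - y)) (normc x) (normc y) => q t a b qt t0 b0 a0.
  apply: (@le_trans _ _ (t * (a + b))); first by rewrite ler_wpM2r// addr_ge0.
  pose w := t / (2 * r); have -> : t = 2 * r * w by rewrite /w; field; rewrite lt0r_neq0.
  rewrite (_ : (2 * r * w) ^+ 2 / (2 * r) = 2 * r * w ^+ 2); last by field; rewrite lt0r_neq0.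
  have h : 0 <= r * (2 * w ^+ 2 + (a ^+ 2 + b ^+ 2) - 2 * w * (a + b)).
    rewrite mulr_ge0 ?(ltW r0)//; have := sqr_ge0 (w - a); have := sqr_ge0 (w - b); nra.
  by move: h; nra.
rewrite -mulr_suml big_split /= -mulr_suml -mulr_sumr big_split /= ler_pdivrMr//.
have h1 : \sum_(z <- A) normc (D z) ^+ 2 <= r ^+ 2.
  apply: le_trans (sqs_le D A) _; rewrite ler_sqr ?nnegrE ?l2norm_ge0 ?(ltW r0)//.
  exact: vk.
have h2 : \sum_(z <- A) normc (v z) ^+ 2 <= l2norm v ^+ 2 by exact: sqs_le.
have h3 : \sum_(z <- A) normc (left_regular k^-1%g v z) ^+ 2 <= l2norm v ^+ 2.
  by rewrite -(l2norm_lam k^-1%g v); exact: sqs_le.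
have v4 : 1 / 4 <= l2norm v ^+ 2 by nra.
move: h1 h2 h3; move: (\sum_(z <- A) _) (\sum_(z <- A) _) (\sum_(z <- A) _) => x y z x1 y1 z1.
have x2 : z / (2 * r) <= r / 2.
  by rewrite ler_pdivrMr ?mulr_gt0// (_ : r / 2 * (2 * r) = r ^+ 2)//; field.
by rewrite (_ : e = 4 * r); [nra|rewrite /r; field].
Qed.

(** * Invariant means on direct sums *)

Section MeanOnDirectSum.
Variables (R : realType) (I : Type) (A : groupType).

Section Bind.
Variables (Y Z : Type) (m : mean R Y) (k : Y -> mean R Z).

Let bind_bdd f : bdd f -> bdd (fun y => k y f).
Proof. by move=> [C fC]; exists C => y; exact: mean_abs. Qed.

Let bind_linear a f g : bdd f -> bdd g ->
  m (fun y => k y (fun z => a * f z + g z)) = a * m (fun y => k y f) + m (fun y => k y g).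
Proof.
move=> fb gb; rewrite -mean_linear; [|exact: bind_bdd|exact: bind_bdd].
by apply: eq_mean => y; rewrite mean_linear.
Qed.

Let bind_ge0 f : bdd f -> (forall z, 0 <= f z) -> 0 <= m (fun y => k y f).
Proof. by move=> fb f0; apply: mean_ge0 => [|y]; [exact: bind_bdd|exact: mean_ge0]. Qed.

Let bind1 : m (fun y => k y (fun=> 1)) = 1.
Proof. by rewrite -[RHS](mean_cst m); apply: eq_mean => y; exact: mean1. Qed.

(** Iterated integration. The order matters, since Fubini's theorem fails for means. *)
Definition mean_bind : mean R Z := Mean bind_linear bind_ge0 bind1.

End Bind.

Definition dirac_mean (Y : Type) (y : Y) : mean R Y :=
  @Mean R Y (fun f => f y) (fun _ _ _ _ _ => erefl) (fun _ _ f0 => f0 y) erefl.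

Let sub_single (j : I) (a : A) : finite_support (fun i : I => if `[< i = j >] then a else 1%g).
Proof.
apply/asboolP; apply: (@sub_finite_set _ _ [set j]) => //= i /=.
by case: asboolP => // ->.
Qed.

Definition single j a : direct_sum I A := exist _ (fun i : I => if `[< i = j >] then a else 1%g) (sub_single j a).

Lemma direct_sum_ext (f g : direct_sum I A) : (forall i, sval f i = sval g i) -> f = g.
Proof. by move=> fg; apply: val_inj; apply: funext => i; exact: fg. Qed.

Lemma direct_sumME (f g : direct_sum I A) i : sval (f * g)%g i = (sval f i * sval g i)%g.
Proof. by []. Qed.

Lemma singleM j a b : (single j a * single j b)%g = single j (a * b)%g.
Proof.
by apply: direct_sum_ext => i; rewrite direct_sumME /=; case: asboolP => // _; rewrite mulg1.
Qed.

Lemma singleC j j' a b : j <> j' ->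
  (single j a * single j' b)%g = (single j' b * single j a)%g.
Proof.
move=> jj; apply: direct_sum_ext => i; rewrite !direct_sumME /=.
case: asboolP => [->|_]; case: asboolP => [e|_]; rewrite ?mulg1 ?mul1g//.
Qed.

Lemma direct_sum_ind (P : direct_sum I A -> Prop) : P 1%g ->
  (forall j a f, P f -> P (single j a * f)%g) -> forall f, P f.
Proof.
move=> P1 PM f.
have [K fK] : exists K : seq {classic I}, forall i : I, (i : {classic I}) \notin K -> sval f i = 1%g.
  have fin : finite_set ([set i | sval f i <> 1%g] : set {classic I}).
    exact: (asboolW (svalP f)).
  exists (enum_fset (fset_set ([set i | sval f i <> 1%g] : set {classic I}))) => i h1.
  apply: contrapT => fi; case/negP: h1; rewrite in_fset_set//; apply/mem_set.
  exact: fi.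
elim: K f fK => [|j K IH] f fK.
  by rewrite (_ : f = 1%g)//; apply: direct_sum_ext => i; rewrite fK.
pose g := (single j (sval f j)^-1%g * f)%g.
have -> : f = (single j (sval f j) * g)%g.
  apply: direct_sum_ext => i; rewrite !direct_sumME /=.
  by case: asboolP => [->|_]; rewrite ?mul1g ?mulVKg.
apply/PM/IH => i iK; rewrite direct_sumME /=; case: asboolP => [->|ij]; first by rewrite mulVg.
by rewrite mul1g fK// inE negb_or iK andbT; apply/eqP.
Qed.

Variable m : mean R A.
Hypothesis mA : forall h f, bdd f -> m (fun x => f (h * x)%g) = m f.

Fixpoint product_mean (J : seq {classic I}) : mean R (direct_sum I A) :=
  if J is j :: J' then
    mean_bind m (fun a => mean_push (product_mean J') (fun x => single j a * x)%g)
  else dirac_mean 1%g.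

(** At the coordinate j the invariance of [m] applies; past any other coordinate the shift is
    carried inwards because elements of distinct summands commute. No two integrals are
    interchanged. *)
Lemma product_mean_single J j a u : j \in J -> bdd u ->
  product_mean J (fun x => u (single j a * x)%g) = product_mean J u.
Proof.
elim: J u => [|j' J IH] u jJ [C uC] //; have ub : bdd u by exists C.
pose w b := product_mean J (fun x => u (single j' b * x)%g).
have [jj|/eqP jj] := eqVneq j j'.
  have -> : product_mean (j' :: J) u = m w.
    by [].
  rewrite jj -(mA a (f := w)); last first.
    by exists C => b; exact: mean_abs.
  transitivity (m (fun b => product_mean J (fun x => u (single j' a * (single j' b * x))%g))) => //.
  apply: eq_mean => b; rewrite /w; apply: eq_mean => x.
  by rewrite mulgA singleM.
have -> : product_mean (j' :: J) u = m w by [].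
transitivity (m (fun b => product_mean J (fun x => u (single j a * (single j' b * x))%g))) => //.
apply: eq_mean => b; rewrite /w -[RHS]IH; last 2 first.
- by move: jJ; rewrite inE; case: eqP.
- by exists C.
by apply: eq_mean => x; rewrite !mulgA singleC.
Qed.

Lemma product_mean_invariant (J : seq {classic I}) (f : direct_sum I A) u :
  (forall i : I, (i : {classic I}) \notin J -> sval f i = 1%g) -> bdd u ->
  product_mean J (fun x => u (f * x)%g) = product_mean J u.
Proof.
have gen (K : seq {classic I}) : {subset K <= J} -> forall f : direct_sum I A,
    (forall i : I, (i : {classic I}) \notin K -> sval f i = 1%g) -> forall u, bdd u ->
    product_mean J (fun x => u (f * x)%g) = product_mean J u.
  elim: K => [|j K IH] KJ {}f fK {}u ub.
    rewrite (_ : f = 1%g); first by apply: eq_mean => x; rewrite mul1g.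
    by apply: direct_sum_ext => i; rewrite fK.
  pose g := (single j (sval f j)^-1%g * f)%g.
  have fg : f = (single j (sval f j) * g)%g.
    apply: direct_sum_ext => i; rewrite !direct_sumME /=.
    by case: asboolP => [->|_]; rewrite ?mul1g ?mulVKg.
  have [C uC] := ub.
  transitivity (product_mean J (fun x => u (single j (sval f j) * x)%g)); last first.
    by apply: product_mean_single => //; apply: KJ; rewrite inE eqxx.
  rewrite -[RHS](IH _ g).
  - by apply: eq_mean => x; rewrite mulgA -fg.
  - by move=> k kK; apply: KJ; rewrite inE kK orbT.
  - move=> i iK; rewrite direct_sumME /=; case: asboolP => [->|ij]; first by rewrite mulVg.
    by rewrite mul1g fK// inE negb_or iK andbT; apply/eqP.
  - by exists C.
by move=> fJ ub; exact: (gen J).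
Qed.

(** The supports of finitely many elements lie in a finite set of coordinates, and the iterated mean
    over these coordinates is invariant under all of them. *)
Lemma direct_sum_mean (F : seq (direct_sum I A)) : exists M : mean R (direct_sum I A),
  forall f u, f \in F -> bdd u -> M (fun x => u (f * x)%g) = M u.
Proof.
have [J hJ] : exists J : seq {classic I}, forall f, f \in F ->
    forall i : I, (i : {classic I}) \notin J -> sval f i = 1%g.
  elim: F => [|f F' [J hJ]]; first by exists [::].
  have fin : finite_set ([set i | sval f i <> 1%g] : set {classic I}).
    exact: (asboolW (svalP f)).
  exists (enum_fset (fset_set ([set i | sval f i <> 1%g] : set {classic I})) ++ J) => g.
  rewrite inE => /orP[/eqP ->|gF] i; rewrite mem_cat negb_or => /andP[h1 h2].
    apply: contrapT => fi; case/negP: h1; rewrite in_fset_set//; apply/mem_set.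
    exact: fi.
  exact: hJ gF _ h2.
exists (product_mean J) => f u fF ub; apply: product_mean_invariant => //.
exact: hJ.
Qed.

End MeanOnDirectSum.

(** * Lengths and bi-exactness *)

(** G is exhausted by S_(j+1), which is F S_j F together with the j-th element of an enumeration,
    and [ell x] is the first index at which x appears. These sets increase because 1 is in [F]. *)
Lemma length_exists (G : groupType) (S0 F : {fset G}) : countable [set: G] -> 1%g \in F ->
  exists ell : G -> nat, [/\ forall x, (ell x == 0)%N = (x \in S0),
    forall j, exists S : {fset G}, forall x, (ell x <= j)%N -> x \in S &
    forall u x v, u \in F -> v \in F -> (ell (u * x * v)%g <= (ell x).+1)%N].
Proof.
move=> /countable_injP[i iinj] F1.
have inj x y : i x = i y -> x = y by apply: iinj; rewrite in_setE.
have [pre preP] : exists pre : nat -> {fset G}, forall j x, i x = j -> x \in pre j.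
  suff h j : exists s : {fset G}, forall x, i x = j -> x \in s.
    by have [f hf] := choice h; exists f.
  have [[y yj]|no] := pselect (exists y, i y = j).
    by exists [fset y]%fset => x xj; rewrite inE; apply/eqP/inj; rewrite xj yj.
  by exists fset0 => x xj; case: no; exists x.
pose mulfs (A B : {fset G}) := [fset (x * y)%g | x in A, y in B]%fset.
pose fix S j := if j is j'.+1 then (mulfs (mulfs F (S j')) F `|` pre j')%fset else S0.
have SM j u x v : x \in S j -> u \in F -> v \in F -> (u * x * v)%g \in S j.+1.
  move=> xS uF vF; rewrite /= inE; apply/orP; left; apply/imfset2P.
  exists (u * x)%g; last by exists v.
  by apply/imfset2P; exists u => //; exists x.
have Sle i1 j x : (i1 <= j)%N -> x \in S i1 -> x \in S j.
  move=> /subnK <-; elim: (j - i1)%N => [//|d IH] /IH h.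
  by have := SM _ 1%g x 1%g h F1 F1; rewrite mul1g mulg1.
have Sall x : exists j, x \in S j.
  by exists (i x).+1; rewrite /= inE (preP (i x) x) ?orbT.
pose ell x := ex_minn (Sall x).
have ellP x j : (ell x <= j)%N = (x \in S j).
  rewrite /ell; case: ex_minnP => k xk kmin; apply/idP/idP; last exact: kmin.
  by move=> kj; exact: Sle xk.
exists ell; split.
- by move=> x; rewrite -leqn0 ellP.
- by move=> j; exists (S j) => x; rewrite ellP.
- by move=> u x v uF vF; rewrite ellP; apply: SM => //; rewrite -ellP.
Qed.

Section FiniteMean.
Variables (R : realType) (T : Type) (r : seq (R * T)).
Hypothesis r0 : all (fun x => 0 <= x.1) r.
Hypothesis r1 : \sum_(x <- r) x.1 = 1.

Let fm (f : T -> R) := \sum_(x <- r) x.1 * f x.2.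

Let fm_linear a f g : bdd f -> bdd g -> fm (fun y => a * f y + g y) = a * fm f + fm g.
Proof.
move=> _ _; rewrite /fm mulr_sumr -big_split; apply: eq_bigr => x _ /=.
by rewrite mulrDr mulrCA.
Qed.

Let fm_ge0 f : bdd f -> (forall y, 0 <= f y) -> 0 <= fm f.
Proof.
move=> _ f0; rewrite /fm; move: r0; elim: r => [|x s IH] /=; first by rewrite big_nil.
by move=> /andP[x0 /IH h]; rewrite big_cons addr_ge0// mulr_ge0.
Qed.

Let fm1 : fm (fun=> 1) = 1.
Proof. by rewrite /fm -[RHS]r1; apply: eq_bigr => x _; rewrite mulr1. Qed.

Definition finite_mean : mean R T := Mean fm_linear fm_ge0 fm1.

End FiniteMean.

Section Cutoff.
Variables (R : realType) (G : groupType).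

(** A truncated linear function of a length that changes by at most 1 in either direction; inverses
    are added to [F] for the second direction. *)
Lemma cutoff (S0 F : {fset G}) (d : R) : countable [set: G] -> 0 < d ->
  exists (chi : G -> R) (S1 : {fset G}), [/\ forall b, 0 <= chi b <= 1,
    forall b, b \in S0 -> chi b = 1, forall b, b \notin S1 -> chi b = 0 &
    forall h b k, h \in F -> k \in F -> `|chi (h * b * k)%g - chi b| <= d].
Proof.
move=> Gc d0; pose F' := (1%g |` (F `|` (fun g => g^-1)%g @` F))%fset.
have F'1 : 1%g \in F' by rewrite !inE eqxx.
have FF' g : g \in F -> g \in F' /\ g^-1%g \in F'.
  move=> gF; rewrite !inE gF orbT; split=> //; apply/orP; right; apply/orP; right.
  by apply/imfsetP; exists g.
have [ell [ell0 ellS ellM]] := length_exists S0 Gc F'1.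
pose chi b := Num.max 0 (1 - d * (ell b)%:R).
pose n := (Num.truncn d^-1).+1.
have dn : 1 <= d * n%:R.
  by rewrite -ler_pdivrMl// mulr1 ltW// truncnS_gt.
have [S1 hS1] := ellS n; exists chi, S1; split.
- by move=> b; rewrite le_max lexx /= ge_max ler01 lerBlDr lerDl mulr_ge0// ltW.
- by move=> b; rewrite -ell0 /chi => /eqP ->; rewrite mulr0 subr0; apply/max_idPr.
- move=> b bS; apply/max_idPl; rewrite subr_le0; apply: le_trans dn _.
  rewrite ler_pM2l// ler_nat; rewrite leqNgt; apply: contra bS => h.
  by apply: hS1; exact: ltnW.
move=> h b k /FF'[hF hF'] /FF'[kF kF'].
have l1 : (ell (h * b * k)%g <= (ell b).+1)%N by exact: ellM.
have l2 : (ell b <= (ell (h * b * k)%g).+1)%N.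
  by have := ellM h^-1%g (h * b * k)%g k^-1%g hF' kF'; rewrite !mulgA mulVg mul1g mulgK.
rewrite -(ler_nat R) -natr1 in l1; rewrite -(ler_nat R) -natr1 in l2.
have m1 : d * (ell (h * b * k)%g)%:R <= d * (ell b)%:R + d.
  by rewrite -{3}[d]mulr1 -mulrDr ler_pM2l.
have m2 : d * (ell b)%:R <= d * (ell (h * b * k)%g)%:R + d.
  by rewrite -{3}[d]mulr1 -mulrDr ler_pM2l.
rewrite /chi; move: m1 m2; move: (d * _) (d * _) => x y m1 m2.
by case: (lerP 0 (1 - y)) => hy; case: (lerP 0 (1 - x)) => hx;
  rewrite ler_norml; apply/andP; split; lra.
Qed.

End Cutoff.

Section BiexactMeans.
Variables (R : realType) (B : groupType).

Lemma prob_finite (mu : B -> R) d : Prob mu -> 0 < d ->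
  exists S0 : {fset B}, 1 - d <= \sum_(z <- S0) mu z.
Proof.
move=> [mu0 mu1] d0; have lt1 : ((1 - d)%:E < \esum_(g in [set: B]) (mu g)%:E)%E.
  by rewrite mu1 lte_fin ltrBlDr ltrDl.
have [_ [S [finS _] <-] h] := ereal_sup_gt lt1.
exists (fset_set S); move: h; rewrite fsbig_finite//= sumEFin lte_fin => /ltW h.
exact: h.
Qed.

Lemma prob_sum_le (mu : B -> R) (A : {fset B}) : Prob mu -> \sum_(z <- A) mu z <= 1.
Proof.
move=> [mu0 mu1]; rewrite -lee_fin -mu1 -sumEFin.
apply: ereal_sup_ubound; exists [set` A]; first by split.
by rewrite fsbig_finite//= set_fsetK.
Qed.

Lemma l1dist_sum (mu nu : B -> R) d (A : {fset B}) : (l1dist mu nu <= d%:E)%E ->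
  \sum_(z <- A) `|mu z - nu z| <= d.
Proof.
move=> h; rewrite -lee_fin; apply: le_trans h; rewrite -sumEFin.
apply: ereal_sup_ubound; exists [set` A]; first by split.
by rewrite fsbig_finite//= set_fsetK.
Qed.

(* mu b truncated to a finite set, the missing mass being put at 1 *)
Let trunc_mean (mu : B -> R) d : Prob mu -> 0 < d ->
  exists (p : mean R B) (S0 : {fset B}), forall (A : {fset B}) u, fsubset S0 A ->
    (forall z, `|u z| <= 1) -> `|p u - \sum_(z <- A) mu z * u z| <= 2 * d.
Proof.
move=> mup d0; have [S0 hS] := prob_finite mup d0; have [mu0 _] := mup.
pose m0 := \sum_(z <- S0) mu z.
have m1 : m0 <= 1 by exact: prob_sum_le.
pose r := (1 - m0, 1%g) :: [seq (mu z, z) | z <- S0].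
have r0 : all (fun x : R * B => 0 <= x.1) r.
  rewrite /= subr_ge0 m1; apply/allP => _ /mapP[z _ ->]; exact: mu0.
have r1 : \sum_(x <- r) x.1 = 1 by rewrite big_cons big_map /= subrK.
exists (finite_mean r0 r1), S0 => A u SA u1.
rewrite -[finite_mean r0 r1 u]/(\sum_(x <- r) x.1 * u x.2) big_cons big_map /=.
have -> : \sum_(z <- A) mu z * u z = \sum_(z <- S0) mu z * u z +
    \sum_(z <- (A `\` S0)%fset) mu z * u z.
  rewrite (big_fsetID _ (mem S0)) /=; congr (_ + _); apply: eq_fbigl => z; rewrite !inE.
    by apply/andP/idP => [[]//|zS]; split=> //; exact: (fsubsetP SA).
  by rewrite andbC.
have tail : `|\sum_(z <- (A `\` S0)%fset) mu z * u z| <= 1 - m0.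
  apply: le_trans (ler_norm_sum _ _ _) _.
  apply: (@le_trans _ _ (\sum_(z <- (A `\` S0)%fset) mu z)).
    by apply: ler_sum => z _; rewrite normrM ger0_norm// ler_piMr.
  rewrite lerBrDl /m0; have := prob_sum_le A mup; congr (_ <= _).
  rewrite (big_fsetID _ (mem S0)) /=; congr (_ + _); apply: eq_fbigl => z; rewrite !inE.
    by apply/andP/idP => [[]//|zS]; split=> //; exact: (fsubsetP SA).
  by rewrite andbC.
have h0 : `|(1 - m0) * u 1%g| <= 1 - m0.
  by rewrite normrM ger0_norm ?subr_ge0// ler_piMr ?subr_ge0.
move: tail h0 hS; rewrite -/m0 !ler_norml.
move: (\sum_(z <- (A `\` S0)%fset) _) (\sum_(z <- S0) _) ((1 - m0) * _) => x y z.
move=> /andP[t1 t2] /andP[t3 t4] hm; apply/andP; split; lra.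
Qed.

(** Bi-exactness restated for means: closeness that is uniform over functions bounded by 1 is the l1
    distance in dual form. *)
Lemma biexact_means (F : {fset B}) d : biexact R B -> 0 < d ->
  exists (p : B -> mean R B) (S : {fset B}), forall b k h u, b \notin S ->
    k \in F -> h \in F -> (forall z, `|u z| <= 1) ->
    `|p (k * b * h)%g u - p b (fun z => u (k * z)%g)| <= d.
Proof.
(* Of the five parts of d, two go to each of the two truncations and one to the asymptotic
   equivariance. *)
move=> [_ [mu [mup mulim]]] d0; have d5 : 0 < d / 5 by rewrite divr_gt0.
have [pS pSP] : exists pS : B -> mean R B * {fset B}, forall b (A : {fset B}) u,
    fsubset (pS b).2 A -> (forall z, `|u z| <= 1) ->
    `|(pS b).1 u - \sum_(z <- A) mu b z * u z| <= 2 * (d / 5).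
  suff h b : exists q : mean R B * {fset B}, forall (A : {fset B}) u,
    fsubset q.2 A -> (forall z, `|u z| <= 1) ->
    `|q.1 u - \sum_(z <- A) mu b z * u z| <= 2 * (d / 5).
    by have [f hf] := choice h; exists f.
  by have [p [S h]] := trunc_mean (mup b) d5; exists (p, S).
have [S SP] : exists S : {fset B}, forall b k h, b \notin S -> k \in F -> h \in F ->
    (l1dist (mu (k * b * h)%g) (translate k (mu b)) <= (d / 5)%:E)%E.
  have one k h : exists S : {fset B}, forall b, b \notin S ->
      (l1dist (mu (k * b * h)%g) (translate k (mu b)) <= (d / 5)%:E)%E.
    have := mulim h k; move=> /(_ [set x | (x <= (d / 5)%:E)%E]) h0.
    have fin : finite_set (~` [set b | (l1dist (mu (k * b * h)%g) (translate k (mu b)) <= (d / 5)%:E)%E]).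
      have lt0 : (0 < (d / 5)%:E)%E by rewrite lte_fin.
      by apply: h0; apply: filterS (open_ereal_lt' lt0) => x /ltW.
    exists (fset_set (~` [set b | (l1dist (mu (k * b * h)%g) (translate k (mu b)) <= (d / 5)%:E)%E])) => b.
    by rewrite in_fset_set// => /negP bS; apply: contrapT => nb; apply: bS; apply/mem_set.
  have [S hS] := choice (fun kh : B * B => one kh.1 kh.2).
  exists (\bigcup_(k <- F) \bigcup_(h <- F) S (k, h))%fset => b k h bS kF hF.
  apply: (hS (k, h)); apply: contra bS => bkh; apply/bigfcupP; exists k; rewrite ?kF//.
  by apply/bigfcupP; exists h; rewrite ?hF.
exists (fun b => (pS b).1), S => b k h u bS kF hF u1.
pose A := ((pS b).2 `|` (fun z => k^-1 * z)%g @` (pS (k * b * h)%g).2)%fset.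
have h1 := pSP b A (fun z => u (k * z)%g) (fsubsetUl _ _) (fun z => u1 _).
have h2 : `|(pS (k * b * h)%g).1 u - \sum_(z <- A) mu (k * b * h)%g (k * z)%g * u (k * z)%g| <= 2 * (d / 5).
  have -> : \sum_(z <- A) mu (k * b * h)%g (k * z)%g * u (k * z)%g =
     \sum_(z <- ((fun z => k * z)%g @` A)%fset) mu (k * b * h)%g z * u z.
    by rewrite [RHS]big_imfset// => x y _ _ /mulgI.
  apply: pSP => //; apply/fsubsetP => z zS; apply/imfsetP; exists (k^-1 * z)%g; rewrite ?mulVKg//=.
  by rewrite inE; apply/orP; right; apply/imfsetP; exists z.
have h3 : `|\sum_(z <- A) mu (k * b * h)%g (k * z)%g * u (k * z)%g -
    \sum_(z <- A) mu b z * u (k * z)%g| <= d / 5.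
  rewrite -sumrB (le_trans (ler_norm_sum _ _ _))//.
  apply: le_trans (l1dist_sum ((fun z => k * z)%g @` A)%fset (SP b k h bS kF hF)).
  rewrite [leRHS]big_imfset => [|x y _ _ /mulgI//].
  apply: ler_sum => z _; rewrite -mulrBl normrM /translate mulKg.
  by rewrite ler_piMr.
move: h1 h2 h3; rewrite !ler_norml.
set x := \sum_(z <- A) mu b z * _; set y := \sum_(z <- A) _.
set z := (pS b).1 _; set w := (pS _).1 _; clearbody x y z w.
by move=> /andP[? ?] /andP[? ?] /andP[? ?]; apply/andP; split; lra.
Qed.

End BiexactMeans.

(** * Wreath-like products *)

(** The factor 2 accounts for the change of the numerators and for that of the normalizing sum. *)
Lemma weights_close (R : realType) (K : Type) (r : seq K) (a a' u : K -> R) :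
  (forall i, 0 <= a i) -> (forall i, 0 <= a' i) -> (forall i, `|u i| <= 1) ->
  0 < \sum_(i <- r) a i -> 0 < \sum_(i <- r) a' i ->
  `|\sum_(i <- r) a' i / (\sum_(i <- r) a' i) * u i - \sum_(i <- r) a i / (\sum_(i <- r) a i) * u i| <=
  2 * (\sum_(i <- r) `|a' i - a i|) / \sum_(i <- r) a i.
Proof.
move=> a0 a'0 u1; set L := \sum_(i <- r) a i; set L' := \sum_(i <- r) a' i => L0 L'0.
set D := \sum_(i <- r) `|a' i - a i|.
have LD : `|L - L'| <= D.
  by rewrite distrC /L /L' -sumrB ler_norm_sum.
apply: (@le_trans _ _ (\sum_(i <- r) (a' i * `|L'^-1 - L^-1| + `|a' i - a i| / L))).
  rewrite -sumrB (le_trans (ler_norm_sum _ _ _))// ler_sum// => i _.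
  rewrite (_ : _ - _ = (a' i * (L'^-1 - L^-1) + (a' i - a i) / L) * u i); last by ring.
  rewrite normrM; apply: le_trans (ler_piMr _ (u1 i)) _ => //.
  apply: le_trans (ler_normD _ _) _; rewrite !normrM (ger0_norm (a'0 i)).
  by rewrite (@gtr0_norm _ L^-1) ?invr_gt0.
rewrite big_split /= -!mulr_suml -/L' -/D.
have -> : L' * `|L'^-1 - L^-1| = `|L - L'| / L.
  rewrite -{1}(gtr0_norm L'0) -normrM.
  rewrite (_ : L' * (L'^-1 - L^-1) = (L - L') / L); last by field; rewrite !lt0r_neq0.
  by rewrite normrM (@gtr0_norm _ L^-1) ?invr_gt0.
rewrite -mulrDl ler_pM2r ?invr_gt0//; lra.
Qed.

Lemma morph1 (G H : groupType) (f : {multiplicative G -> H}) : f 1%g = 1%g.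
Proof. by apply: (@mulgI _ (f 1%g)); rewrite -gmulfM !mulg1. Qed.

Lemma morphV (G H : groupType) (f : {multiplicative G -> H}) x : f x^-1%g = (f x)^-1%g.
Proof. by apply: (@mulgI _ (f x)); rewrite -gmulfM !mulgV morph1. Qed.

Section Wreath.
Variables (R : realType) (A B G : groupType) (I : Type) (act : B -> I -> I).
Variables (iota : {multiplicative direct_sum I A -> G}) (eps : {multiplicative G -> B}).
Hypothesis actP : is_group_action act.
Hypothesis iota_inj : injective iota.
Hypothesis iota_ker : range iota = eps @^-1` [set 1%g].
Hypothesis eps_surj : range eps = setT.
Hypothesis iota_conj : forall (g : G) (i : I),
  (fun x => g * x * g^-1)%g @` (iota @` @direct_summand I A i) =
  iota @` @direct_summand I A (act (eps g) i).
Notation DS := (direct_sum I A).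
Notation J := {classic I}.
Implicit Types (f : DS) (g h k x : G) (b : B) (i j : I).

Lemma eps_iota f : eps (iota f) = 1%g.
Proof. by have : (eps @^-1` [set 1%g]) (iota f) by rewrite -iota_ker; exists f. Qed.

Let iota_ex x : exists f, eps x = 1%g -> iota f = x.
Proof.
have [x1|x1] := pselect (eps x = 1%g); last by exists 1%g.
have : range iota x by rewrite iota_ker.
by move=> [f _ <-]; exists f.
Qed.

Definition iota_inv x : DS := projT1 (cid (iota_ex x)).

Lemma iota_invK x : eps x = 1%g -> iota (iota_inv x) = x.
Proof. by rewrite /iota_inv; case: cid. Qed.

Let sec_ex b : exists x, eps x = b.
Proof. by have : range eps b by [rewrite eps_surj]; move=> [x _ <-]; exists x. Qed.

Definition sec b : G := projT1 (cid (sec_ex b)).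

Lemma secK b : eps (sec b) = b.
Proof. by rewrite /sec; case: cid. Qed.

Definition normal_part g : DS := iota_inv (g * (sec (eps g))^-1)%g.

Lemma normal_partE g : iota (normal_part g) = (g * (sec (eps g))^-1)%g.
Proof. by rewrite iota_invK// gmulfM morphV secK mulgV. Qed.

Definition conj_part k f : DS := iota_inv (k * iota f * k^-1)%g.

Lemma conj_partE k f : iota (conj_part k f) = (k * iota f * k^-1)%g.
Proof. by rewrite iota_invK// !gmulfM morphV eps_iota mulg1 mulgV. Qed.

Lemma conj_partM k f f' : conj_part k (f * f')%g = (conj_part k f * conj_part k f')%g.
Proof.
apply: iota_inj; rewrite gmulfM !conj_partE gmulfM.
by rewrite !mulgA mulgVK.
Qed.

Lemma singleE i j (a : A) : j <> i -> sval (single i a) j = 1%g.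
Proof. by move=> ji /=; case: asboolP. Qed.

Lemma single_val i (a : A) : sval (single i a) i = a.
Proof. by rewrite /=; case: asboolP. Qed.

Lemma single1 i : single i (1%g : A) = 1%g.
Proof. by apply: direct_sum_ext => j /=; rewrite if_same. Qed.

Lemma conj_single k i a j : j <> act (eps k) i -> sval (conj_part k (single i a)) j = 1%g.
Proof.
move=> ji; have : (iota @` @direct_summand I A (act (eps k) i)) (iota (conj_part k (single i a))).
  rewrite -iota_conj conj_partE; exists (iota (single i a)) => //.
  by exists (single i a) => // i' /(@singleE i i' a).
by move=> [f fs /iota_inj <-]; exact: fs.
Qed.

Lemma act_inj b i j : act b i = act b j -> i = j.
Proof.
move=> /(congr1 (act b^-1%g)); have [a1 aM] := actP.
by rewrite -!aM mulVg !a1.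
Qed.

Lemma actVK b i : act b (act b^-1%g i) = i.
Proof. by have [a1 aM] := actP; rewrite -aM mulgV a1. Qed.

(** The hypothesis on conjugation only says that summands go to summands; building f from finitely
    many single components gives the effect on each coordinate. *)
Lemma conj_component k i f :
  single (act (eps k) i) (sval (conj_part k f) (act (eps k) i)) =
  conj_part k (single i (sval f i)).
Proof.
have conj1 : conj_part k 1%g = 1%g.
  by apply: iota_inj; rewrite conj_partE !morph1 mulg1 mulgV.
have key : sval (conj_part k f) (act (eps k) i) =
    sval (conj_part k (single i (sval f i))) (act (eps k) i).
  elim/direct_sum_ind: f => [|j a f IH]; first by rewrite single1.
  rewrite conj_partM direct_sumME {}IH direct_sumME.
  have [->|ij] := pselect (i = j).
    by rewrite single_val -singleM conj_partM.
  rewrite conj_single ?mul1g => [|/act_inj//].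
  by rewrite (singleE a ij) mul1g.
rewrite key; apply: direct_sum_ext => j.
have [->|ji] := pselect (j = act (eps k) i); first by rewrite single_val.
by rewrite singleE// conj_single.
Qed.

(** The component is kept in G rather than in A: conjugation by k identifies A_i with A_(k i) by an
    isomorphism over which A has no control, whereas in G it is multiplication by k and k^-1, which
    hardly changes a length on G. *)
Definition comp g i : G := iota (single i (sval (normal_part g) i)).

(** The defect of the section under b -> eps k b eps h. For fixed k, b, h it is one element, with
    finite support. *)
Definition err k b h : DS := iota_inv (k * sec b * h * (sec (eps k * b * eps h))^-1)%g.

Lemma errE k b h : iota (err k b h) = (k * sec b * h * (sec (eps k * b * eps h))^-1)%g.
Proof. by rewrite iota_invK// !gmulfM morphV !secK mulgV. Qed.

Lemma normal_partM k g h :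
  normal_part (k * g * h)%g = (conj_part k (normal_part g) * err k (eps g) h)%g.
Proof.
apply: iota_inj; rewrite gmulfM conj_partE errE !normal_partE !gmulfM.
by rewrite !mulgA mulgVK mulgVK.
Qed.

Lemma compM k g h i : comp (k * g * h)%g (act (eps k) i) =
  (k * comp g i * k^-1 * iota (single (act (eps k) i) (sval (err k (eps g) h) (act (eps k) i))))%g.
Proof.
by rewrite /comp normal_partM direct_sumME -singleM gmulfM conj_component conj_partE.
Qed.

Definition supp f : {fset J} := fset_set ([set i | sval f i <> 1%g] : set J).

Lemma suppP f i : reflect (sval f i <> 1%g) ((i : J) \in supp f).
Proof.
have fin : finite_set ([set i | sval f i <> 1%g] : set J) by exact: (asboolW (svalP f)).
by rewrite /supp in_fset_set//; apply: (iffP idP) => [/set_mem|fi]//; exact/mem_set.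
Qed.

Lemma comp_eq1 g i : comp g i = 1%g -> sval (normal_part g) i = 1%g.
Proof.
move=> h; have : single i (sval (normal_part g) i) = 1%g by apply: iota_inj; rewrite morph1.
by move=> /(congr1 (fun f => sval f i)); rewrite single_val.
Qed.

Lemma comp_inj g g' i j : comp g i <> 1%g -> comp g i = comp g' j -> i = j.
Proof.
move=> c1 /iota_inj e; apply: contrapT => ij; apply: c1.
have /(congr1 (fun f => sval f i)) := e; rewrite single_val singleE// => h.
by rewrite /comp h single1 morph1.
Qed.

Hypothesis Gc : countable [set: G].

Let err_comp k b h i : G := iota (single i (sval (err k b h) i)).

(* the elements by which components get multiplied when g is replaced by
   k g h with k, h in F and eps g in B0 *)
Definition twists (F : {fset G}) (B0 : {fset B}) : {fset G} :=
  (1%g |` \bigcup_(k <- F) \bigcup_(h <- F) \bigcup_(b <- B0)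
  ((fun i : J => err_comp k b h i) @` supp (err k b h)))%fset.

(** Chosen so that multiplications on both sides by elements of this set lead from a component of g
    to that of k g h and back. *)
Definition twist_set (F : {fset G}) (B0 : {fset B}) : {fset G} :=
  (1%g |` (F `|` (\bigcup_(k <- F) (((fun x => k^-1 * x)%g @` twists F B0) `|`
  ((fun x => x^-1 * k)%g @` twists F B0)))))%fset.

Definition act_sum b (y : I + B) : I + B :=
  match y with inl i => inl (act b i) | inr z => inr (b * z)%g end.

Section Length.
Variables (F : {fset G}) (B0 : {fset B}).
Notation F' := (twist_set F B0).

Let twistsP k b h i : k \in F -> h \in F -> b \in B0 -> err_comp k b h i \in twists F B0.
Proof.
move=> kF hF bB; rewrite inE.
have [e1|e1] := pselect (sval (err k b h) i = 1%g).
  by rewrite /err_comp e1 single1 morph1 inE eqxx.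
apply/orP; right; apply/bigfcupP; exists k; rewrite ?kF//.
apply/bigfcupP; exists h; rewrite ?hF//; apply/bigfcupP; exists b; rewrite ?bB//.
by apply/imfsetP; exists i => //; exact/suppP.
Qed.

Let F'F k : k \in F -> k \in F'. Proof. by move=> kF; rewrite !inE kF orbT. Qed.

Let F'V k x : k \in F -> x \in twists F B0 -> (k^-1 * x)%g \in F' /\ (x^-1 * k)%g \in F'.
Proof.
move=> kF xT; split; rewrite !inE; apply/orP; right; apply/orP; right; apply/bigfcupP;
  exists k; rewrite ?kF// inE; apply/orP; [left|right]; apply/imfsetP; by exists x.
Qed.

Variable ell : G -> nat.
Hypothesis ell0 : forall x, (ell x == 0)%N = (x \in [fset 1%g]%fset).
Hypothesis ellS : forall n : nat, exists S : {fset G}, forall x, (ell x <= n)%N -> x \in S.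
Hypothesis ellM : forall u x v, u \in F' -> v \in F' -> (ell (u * x * v)%g <= (ell x).+1)%N.

Definition weight g i : R := (ell (comp g i))%:R.

Local Notation wt := weight.

Let wt_ge0 g i : 0 <= wt g i. Proof. by rewrite ler0n. Qed.

Let ell1 : ell 1%g = 0%N.
Proof. by apply/eqP; rewrite ell0 inE. Qed.

Let wt_supp g i : (i : J) \notin supp (normal_part g) -> wt g i = 0.
Proof.
move=> /suppP ni; rewrite /weight /comp; have [->|//] := pselect (sval (normal_part g) i = 1%g).
by rewrite single1 morph1 ell1.
Qed.

(** The length changes by at most 1, and when i lies in neither support both components are
    trivial. *)
Let wt_diff k h g i : k \in F -> h \in F -> eps g \in B0 ->
  `|wt (k * g * h)%g (act (eps k) i) - wt g i| <=
  (((i : J) \in supp (normal_part g)) + ((act (eps k) i : J) \in supp (err k (eps g) h)))%:R.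
Proof.
move=> kF hF gB; rewrite /weight compM.
set c := comp g i; set x := iota _.
have xT : x \in twists F B0 by exact: twistsP.
have [v1 v2] := F'V kF xT.
have l1 : (ell (k * c * k^-1 * x)%g <= (ell c).+1)%N.
  by rewrite -mulgA; apply: ellM => //; exact: F'F.
have l2 : (ell c <= (ell (k * c * k^-1 * x)%g).+1)%N.
  have k1 : (k^-1)%g \in F'.
    have one : 1%g \in twists F B0 by rewrite inE inE eqxx.
    by have [+ _] := F'V kF one; rewrite mulg1.
  have := ellM (k * c * k^-1 * x)%g k1 v2.
  by rewrite !mulgA mulgK mulgVK mulVg mul1g.
have d1 : `|(ell (k * c * k^-1 * x)%g)%:R - (ell c)%:R| <= 1 :> R.
  rewrite -(ler_nat R) -natr1 in l1; rewrite -(ler_nat R) -natr1 in l2.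
  by rewrite ler_norml; apply/andP; split; lra.
have [i1|i1] := boolP ((i : J) \in supp (normal_part g)).
  by apply: le_trans d1 _; rewrite ler1n.
have [i2|i2] := boolP ((act (eps k) i : J) \in supp (err k (eps g) h)).
  by apply: le_trans d1 _; rewrite ler1n.
have c1 : c = 1%g.
  move/suppP: i1 => i1; rewrite /c /comp; have [->|//] := pselect (sval (normal_part g) i = 1%g).
  by rewrite single1 morph1.
have x1 : x = 1%g.
  move/suppP: i2 => i2; rewrite /x.
  have [->|//] := pselect (sval (err k (eps g) h) (act (eps k) i) = 1%g).
  by rewrite single1 morph1.
by rewrite c1 x1 !mulg1 mulgV subrr normr0.
Qed.

Definition total_length g : R := \sum_(i <- supp (normal_part g)) wt g i.

Local Notation tot := total_length.

Let tot_sum g (K : {fset J}) : fsubset (supp (normal_part g)) K -> \sum_(i <- K) wt g i = tot g.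
Proof.
move=> sK; rewrite (big_fsetID _ (mem (supp (normal_part g)))) /= [X in _ + X]big1_fset => [|i]; last first.
  by rewrite !inE => /andP[_ /wt_supp].
rewrite addr0; apply: eq_fbigl => i; rewrite !inE.
by apply/andP/idP => [[]//|iS]; split=> //; exact: (fsubsetP sK).
Qed.

(** Nontrivial components at distinct places are distinct elements of G, so a bounded number of them
    have length at most T, and every other one adds more than T to the total. Hence the size of the
    support is negligible against a large total length. *)
Let count_supp T : (0 < T)%N -> exists n : nat, forall g,
  (size (supp (normal_part g)))%:R <= n%:R + tot g / T%:R.
Proof.
move=> T0; have [S hS] := ellS T; exists (size S) => g.
have h0 : 0 < (T%:R : R) by rewrite ltr0n.
pose small := [fset i in supp (normal_part g) | (ell (comp g i) <= T)%N]%fset.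
have sS : (size small <= size S)%N.
  have inj : {in small &, injective (comp g)}.
    move=> i j; rewrite !inE => /andP[/suppP i1 _] _ e.
    by apply: comp_inj e => /comp_eq1.
  have e : #|` ((fun i : J => comp g i) @` small)%fset| = #|` small| by rewrite card_in_imfset.
  rewrite -e; apply: fsubset_leq_card; apply/fsubsetP => x /imfsetP[i /= ism ->].
  by apply: hS; move: ism; rewrite !inE => /andP[].
apply: (@le_trans _ _ (\sum_(i <- supp (normal_part g)) ((if (ell (comp g i) <= T)%N then 1 else 0) +
    wt g i / T%:R))).
  rewrite -[leLHS]mulr1 -(sum_const_seq (supp (normal_part g)) 1); apply: ler_sum => i _.
  case: leqP => [_|lt]; first by rewrite lerDl divr_ge0.
  by rewrite add0r ler_pdivlMr// mul1r /weight ler_nat ltnW.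
rewrite big_split /= -mulr_suml lerD2r -big_mkcond /= big_fset_condE.
rewrite -/small; have := sum_const_seq small (1 : R); rewrite mulr1 => ->.
by rewrite ler_nat.
Qed.

Let comp_bound g i (C : nat) : tot g <= C%:R -> (ell (comp g i) <= C)%N.
Proof.
have [iS|iS] := boolP ((i : J) \in supp (normal_part g)); last first.
  by move: (wt_supp iS) => /eqP; rewrite /weight pnatr_eq0 => /eqP ->.
move=> gC; rewrite -(ler_nat R); apply: le_trans gC.
rewrite /total_length (big_rem (i : J))//= lerDl.
by apply: sumr_ge0 => j _; exact: wt_ge0.
Qed.

(** g is determined by eps g and the set of its nontrivial components, as each of these remembers
    its place. A bound on the total length confines the components to one finite set. *)
Let finite_length (C : nat) : exists S : {fset G}, forall g, eps g \in B0 ->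
  tot g <= C%:R -> g \in S.
Proof.
have [SC hSC] := ellS C.
pose cset g := ((fun i : J => comp g i) @` supp (normal_part g))%fset.
pose f g := (cset g, eps g).
pose X : set ({fset G} * B) := [set` fpowerset SC] `*` [set` B0].
have Xfin : finite_set X by apply: finite_setX; exact: finite_fset.
have sub g g' : cset g = cset g' -> forall i, sval (normal_part g) i <> 1%g ->
    sval (normal_part g') i = sval (normal_part g) i.
  move=> e i ni; have ig : (i : J) \in supp (normal_part g) by exact/suppP.
  have : comp g i \in cset g' by rewrite -e; apply/imfsetP; exists i.
  move=> /imfsetP[j /= _ ce]; have ij : i = j by apply: comp_inj ce => /comp_eq1.
  move: ce; rewrite -ij => /iota_inj /(congr1 (fun f => sval f i)).
  by rewrite !single_val.
have inj : {in f @^-1` X &, injective f}.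
  move=> g g' _ _ [e be].
  have ne : normal_part g = normal_part g'.
    apply: direct_sum_ext => i.
    have [n1|/(sub _ _ e)//] := pselect (sval (normal_part g) i = 1%g).
    have [n2|/(sub _ _ (esym e))//] := pselect (sval (normal_part g') i = 1%g).
    by rewrite n1 n2.
  have := congr1 iota ne; rewrite !normal_partE be => /mulIg; exact.
have fin := finite_preimage inj Xfin.
exists (fset_set (f @^-1` X)) => g gB gC; rewrite in_fset_set//; apply/mem_set; split => //=.
rewrite fpowersetE; apply/fsubsetP => x /imfsetP[i /= _ ->].
by apply: hSC; exact: comp_bound.
Qed.

(** The normalized weights form a probability on I. After moving indices by k, the weights of k g h
    differ from those of g by at most 1 at each place, and only on supports whose size is negligible
    against the total length. *)
Lemma length_means e : 0 < e -> exists (m : G -> mean R (I + B)) (S : {fset G}),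
  forall g k h u, g \notin S -> eps g \in B0 -> k \in F -> h \in F -> (forall y, `|u y| <= 1) ->
  `|m (k * g * h)%g u - m g (fun y => u (act_sum (eps k) y))| <= e.
Proof.
(* The bound d <= 1 keeps the total length of k g h positive. *)
move=> e0; pose d := Num.min e 1; have d0 : 0 < d by rewrite lt_min e0 ltr01.
have d1 : d <= 1 by rewrite ge_min lexx orbT.
have de : d <= e by rewrite ge_min lexx.
have [m mE] : exists m : G -> mean R (I + B), forall g, 0 < tot g -> forall u,
    m g u = \sum_(i <- supp (normal_part g)) wt g i / tot g * u (inl i).
  suff one g : exists m : mean R (I + B), 0 < tot g -> forall u,
      m u = \sum_(i <- supp (normal_part g)) wt g i / tot g * u (inl i).
    by have [m hm] := choice one; exists m.
  have [g0|g0] := ltP 0 (tot g); last by exists (dirac_mean R (inr 1%g)).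
  pose r := [seq (wt g i / tot g, inl i : I + B) | i <- supp (normal_part g)].
  have r0 : all (fun x : R * (I + B) => 0 <= x.1) r.
    by rewrite /r; elim: (enum_fset _) => //= i s ->; rewrite andbT divr_ge0// ltW.
  have r1 : \sum_(x <- r) x.1 = 1.
    by rewrite big_map /= -mulr_suml -/(tot g) divff// lt0r_neq0.
  exists (finite_mean r0 r1) => _ u.
  by rewrite -[LHS]/(\sum_(x <- r) x.1 * u x.2) big_map.
(* For T >= 4 / d and a total length above C >= 4 (n + Ne) / d, each of tot / T and n + Ne is at
   most d / 4 times the total, so the error 2 (n + tot / T + Ne) / tot is at most d. *)
pose T := (Num.truncn (4 / d)).+1.
have Td : 4 / d <= T%:R by rewrite ltW// truncnS_gt.
have T0 : 0 < (T%:R : R) by rewrite ltr0n.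
have [n hn] := @count_supp T isT.
pose Ne := (\max_(k <- F) \max_(h <- F) \max_(b <- B0) size (supp (err k b h)))%N.
have NeP k b h : k \in F -> h \in F -> b \in B0 -> (size (supp (err k b h)) <= Ne)%N.
  move=> kF hF bB.
  pose f1 := size (supp (err k b h)).
  pose f2 := (\max_(b <- B0) size (supp (err k b h)))%N.
  pose f3 := (\max_(h <- F) \max_(b <- B0) size (supp (err k b h)))%N.
  have h1 : (f1 <= f2)%N by rewrite /f2; apply: leq_bigmax_seq bB isT.
  have h2 : (f2 <= f3)%N by rewrite /f3; apply: leq_bigmax_seq hF isT.
  have h3 : (f3 <= Ne)%N by rewrite /Ne; apply: leq_bigmax_seq kF isT.
  exact: leq_trans h1 (leq_trans h2 h3).
pose C := (Num.truncn (4 * (n + Ne)%:R / d)).+1.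
have Cd : 4 * (n + Ne)%:R / d <= C%:R by rewrite ltW// truncnS_gt.
have [S hS] := finite_length C.
exists m, S => g k h u gS gB kF hF u1.
have gC : C%:R < tot g by rewrite ltNge; apply: contra gS; exact: hS.
have g0 : 0 < tot g by apply: le_lt_trans gC; rewrite ler0n.
pose kinv (j : J) : J := act (eps k)^-1%g j.
pose K : {fset J} := (supp (normal_part g) `|` (kinv @` supp (normal_part (k * g * h)%g)
  `|` kinv @` supp (err k (eps g) h)))%fset.
pose kK : {fset J} := ((fun i : J => act (eps k) i : J) @` K)%fset.
have ainj : {in K &, injective (fun i : J => act (eps k) i : J)} by move=> i j _ _ /act_inj.
have memk (X : {fset J}) : fsubset (kinv @` X)%fset K -> fsubset X kK.
  move=> XK; apply/fsubsetP => j jX; apply/imfsetP; exists (kinv j); last by rewrite /kinv actVK.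
  by apply: (fsubsetP XK); apply/imfsetP; exists j.
have s1 : fsubset (supp (normal_part g)) K by exact: fsubsetUl.
have s2 : fsubset (supp (normal_part (k * g * h)%g)) kK.
  by apply: memk; apply/fsubsetP => j jX; rewrite !inE jX orbT.
have s3 : fsubset (supp (err k (eps g) h)) kK.
  by apply: memk; apply/fsubsetP => j jX; rewrite !inE jX !orbT.
pose a i := wt g i; pose a' i := wt (k * g * h)%g (act (eps k) i).
have aS : \sum_(i <- K) a i = tot g by exact: tot_sum.
have a'S : \sum_(i <- K) a' i = tot (k * g * h)%g.
  by rewrite -(tot_sum s2) /kK [RHS]big_imfset.
have DS' : \sum_(i <- K) `|a' i - a i| <= n%:R + tot g / T%:R + Ne%:R.
  apply: (@le_trans _ _ (\sum_(i <- K) (((i : J) \in supp (normal_part g))%:R +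
      ((act (eps k) i : J) \in supp (err k (eps g) h))%:R))).
    by apply: ler_sum => i _; rewrite -natrD; exact: wt_diff.
  have card_le (L X : {fset J}) : \sum_(i <- L) (i \in X)%:R <= (size X)%:R :> R.
    rewrite (eq_bigr (fun i => if i \in X then 1 else 0)) => [|i _]; last by case: (i \in X).
    apply: le_trans (@sum_mem_le R _ L X (fun=> 1) (fun=> ler01)) _.
    by rewrite sum_const_seq mulr1.
  rewrite big_split /=; apply: lerD; first exact: le_trans (card_le _ _) (hn g).
  apply: (@le_trans _ _ (\sum_(j <- kK) (j \in supp (err k (eps g) h))%:R)).
    by rewrite /kK [leRHS]big_imfset.
  by apply: le_trans (card_le _ _) _; rewrite ler_nat; exact: NeP.
have Dd : 2 * (\sum_(i <- K) `|a' i - a i|) / tot g <= d.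
  rewrite ler_pdivrMr//; apply: le_trans (ler_wpM2l _ DS') _ => //.
  have h1 : tot g / T%:R <= d / 4 * tot g.
    rewrite mulrC ler_pM2r// -(ler_pM2l T0) divff ?lt0r_neq0//.
    by move: Td; rewrite ler_pdivrMr// => Td; lra.
  have h2 : (n + Ne)%:R <= d / 4 * tot g.
    have : 4 * (n + Ne)%:R / d <= tot g by apply: le_trans Cd (ltW gC).
    by rewrite ler_pdivrMr// => h2; lra.
  move: h1 h2; rewrite natrD -mulrA [4^-1 * _]mulrC mulrA.
  by move: (tot g / T%:R) (d * tot g) (n%:R) (Ne%:R) => *; lra.
have g'0 : 0 < tot (k * g * h)%g.
  have : \sum_(i <- K) (a i - a' i) <= \sum_(i <- K) `|a' i - a i|.
    by apply: ler_sum => i _; rewrite distrC ler_norm.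
  rewrite sumrB aS a'S; move: Dd; rewrite ler_pdivrMr// => Dd.
  have : d * tot g <= tot g by rewrite ler_piMl// ltW.
  by move: (\sum_(i <- K) _) Dd => x Dd; lra.
rewrite (mE _ g'0) (mE _ g0).
have -> : \sum_(i <- supp (normal_part (k * g * h)%g)) wt (k * g * h)%g i / tot (k * g * h)%g * u (inl i) =
    \sum_(i <- K) a' i / (\sum_(i <- K) a' i) * u (inl (act (eps k) i)).
  rewrite a'S; transitivity (\sum_(j <- kK) wt (k * g * h)%g j / tot (k * g * h)%g * u (inl j)).
    rewrite [RHS](big_fsetID _ (mem (supp (normal_part (k * g * h)%g)))) /= [X in _ = _ + X]big1_fset => [|i]; last first.
      by rewrite !inE => /andP[_ iS] _; rewrite wt_supp// !mul0r.
    rewrite addr0; apply: eq_fbigl => i; rewrite !inE.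
    by apply/idP/andP => [iS|[]//]; split=> //; exact: (fsubsetP s2).
  by rewrite /kK [LHS]big_imfset.
have -> : \sum_(i <- supp (normal_part g)) wt g i / tot g * u (act_sum (eps k) (inl i)) =
    \sum_(i <- K) a i / (\sum_(i <- K) a i) * u (inl (act (eps k) i)).
  rewrite aS.
  rewrite [RHS](big_fsetID _ (mem (supp (normal_part g)))) /= [X in _ = _ + X]big1_fset => [|i]; last first.
    by rewrite !inE => /andP[_ iS] _; rewrite /a wt_supp// !mul0r.
  rewrite addr0; apply: eq_fbigl => i; rewrite !inE.
  by rewrite andbC; case: (i \in supp (normal_part g)).
apply: le_trans _ de; apply: le_trans (weights_close _ _ _ _ _) _; rewrite ?aS ?a'S//.
Qed.

End Length.
End Wreath.

Lemma convex_mean (R : realType) (Y : Type) (m m' : mean R Y) c : 0 <= c <= 1 ->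
  exists w : mean R Y, forall u, w u = c * m u + (1 - c) * m' u.
Proof.
move=> /andP[c0 c1].
have r0 : all (fun x : R * bool => 0 <= x.1) [:: (c, true); (1 - c, false)].
  by rewrite /= c0 subr_ge0 c1.
have r1 : \sum_(x <- [:: (c, true); (1 - c, false)]) x.1 = 1.
  by rewrite !big_cons big_nil /=; lra.
exists (mean_bind (finite_mean r0 r1) (fun b => if b then m else m')) => u.
rewrite -[LHS]/(\sum_(x <- [:: (c, true); (1 - c, false)]) x.1 * (if x.2 then m else m') u).
by rewrite !big_cons big_nil /= addr0.
Qed.

Lemma mean_l1_le (R : realType) (Y : Type) (Z : choiceType) (m : mean R Y) (f : Y -> Z -> R) e
    (A : {fset Z}) :
  (forall z, bdd (fun y => f y z)) -> (forall y, \sum_(z <- A) `|f y z| <= e) ->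
  \sum_(z <- A) `|m (fun y => f y z)| <= e.
Proof.
move=> fb fe.
have nb z : bdd (fun y => `|f y z|) by have [C fC] := fb z; exists C => y; rewrite normr_id.
apply: (@le_trans _ _ (\sum_(z <- A) m (fun y => `|f y z|))).
  apply: ler_sum => z _; rewrite ler_norml -meanN//; apply/andP; split; apply: le_mean => //.
  - exact: bddN.
  - by move=> y; rewrite lerNl -normrN ler_norm.
  - by move=> y; exact: ler_norm.
rewrite -mean_sum//; apply: mean_le => //; exact: bdd_sum.
Qed.

(** Pairing with the signs of the differences produces one test function bounded by 1 whose two
    integrals differ by the l1 norm. *)
Lemma mean_diff_l1 (R : realType) (Y Y' : Type) (Z : choiceType) (m : mean R Y) (m' : mean R Y')
    (s : Y' -> Y) (f : Y -> Z -> R) d (A : {fset Z}) :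
  (forall z, bdd (fun y => f y z)) ->
  (forall y, \sum_(z <- A) `|f y z| <= 1) ->
  (forall u, (forall y, `|u y| <= 1) -> `|m u - m' (fun y => u (s y))| <= d) ->
  \sum_(z <- A) `|m (fun y => f y z) - m' (fun y => f (s y) z)| <= d.
Proof.
move=> fb f1 mm.
pose sg z : R := Num.sg (m (fun y => f y z) - m' (fun y => f (s y) z)).
have sg1 z : `|sg z| <= 1 by rewrite /sg normr_sg; case: (_ != 0).
have := mm (fun y => \sum_(z <- A) sg z * f y z).
rewrite mean_sum => [|z _]; last exact: bddZ.
rewrite mean_sum => [|z _]; last by apply: bddZ; exact: (bdd_comp s (fb z)).
rewrite -sumrB => h.
have {}h : `|\sum_(z <- A) `|m (fun y => f y z) - m' (fun y => f (s y) z)| | <= d.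
  rewrite (eq_bigr (fun z => m (fun y => sg z * f y z) - m' (fun y => sg z * f (s y) z))).
    apply: h => y; apply: le_trans (f1 y); apply: le_trans (ler_norm_sum _ _ _) _.
    by apply: ler_sum => z _; rewrite normrM ler_piMl.
  move=> z _; rewrite !meanZ//; last exact: (bdd_comp s (fb z)).
  by rewrite -mulrBr normrEsg.
exact: le_trans (ler_norm _) h.
Qed.

Lemma fprob_le1 (R : realType) (T : Type) (Z : choiceType) (E : {fset Z})
    (mu : T -> Z -> R) t z : fibre_prob E mu -> 0 <= mu t z <= 1.
Proof.
move=> muP; rewrite (fprob_ge0 muP) /=.
by have := fprob_sum_le t [fset z]%fset muP; rewrite big_seq_fset1.
Qed.

(** * Property A for I + B, from exactness of B and amenable stabilizers *)

Section SumPropertyA.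
Variables (R : realType) (B : groupType) (I : Type) (act : B -> I -> I).
Hypothesis actP : is_group_action act.
Hypothesis stab_amenable : forall i, amenable R (stabilizer act i).

Let orb i : set I := [set j | exists b, act b i = j].

Let orb_ex i : exists j, orb i j.
Proof. by have [a1 _] := actP; exists i, 1%g. Qed.

Let rep i : I := projT1 (cid (orb_ex i)).

(** The representative is chosen from the orbit as a set, so equal orbits yield the same choice once
    the nonemptiness proofs are identified. *)
Let rep_act b i : rep (act b i) = rep i.
Proof.
have [_ aM] := actP; have e : orb (act b i) = orb i.
  apply/seteqP; split => j [c cj].
    by exists (c * b)%g; rewrite aM.
  by exists (c * b^-1)%g; rewrite -aM mulgVK.
rewrite /rep; move: (orb_ex (act b i)) (orb_ex i); rewrite e => p q.
by rewrite (Prop_irrelevance p q).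
Qed.

Let rep_ex i : exists g, act g (rep i) = i.
Proof.
have [a1 aM] := actP; rewrite /rep; case: cid => j [g gE] /=.
by exists g^-1%g; rewrite -gE -aM mulVg a1.
Qed.

(** For i = g_i r with r the representative of its orbit, nu (g_i x) is integrated in x against a
    mean invariant under the stabilizer of r. As g_(k i) = k g_i s with s in this stabilizer,
    invariance absorbs s, and the almost equivariance of nu takes care of k. On the free part B, nu
    itself serves. *)
Lemma sum_property_A : property_A R B -> forall (F : {fset B}) (e : R), 0 < e ->
  exists (E : {fset B}) (nb : I + B -> B -> R), fibre_prob E nb /\
  forall k y (A : {fset B}), k \in F ->
    \sum_(z <- A) `|nb (act_sum act k y) (k * z)%g - nb y z| <= e.
Proof.
move=> pA F e e0; have [E [nu [nuP nuF]]] := pA F e e0.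
have [g gE] := choice rep_ex.
have [a1 aM] := actP.
have mex i : exists m : mean R B, forall h f, act h i = i -> bdd f ->
    m (fun x => f (h * x)%g) = m f.
  have HM x y : stabilizer act i x -> stabilizer act i y -> stabilizer act i (x * y)%g.
    by rewrite /stabilizer /= aM => xi ->.
  have HV x : stabilizer act i x -> stabilizer act i (x^-1)%g.
    by rewrite /stabilizer /= => {1}<-; rewrite -aM mulVg a1.
  by have [m [_ mS]] := amenable_mean HM HV (stab_amenable i); exists m.
have [m mS] := choice mex.
have nub (s : B -> B) z : bdd (fun x => nu (s x) z).
  by exists 1 => x; have /andP[n0 n1] := fprob_le1 (s x) z nuP; rewrite ger0_norm.
pose nb (y : I + B) z : R := match y with
  | inl i => m (rep i) (fun x => nu (g i * x)%g z)
  | inr b => nu b z end.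
exists E, nb; split.
  split=> [[i|b] z|[i|b] z zE|[i|b]] /=.
  - by apply: mean_ge0 => [|x]; [exact: (nub (fun x => g i * x)%g)|exact: fprob_ge0 nuP _ _].
  - exact: fprob_ge0 nuP _ _.
  - by under eq_mean => x do rewrite (fprob_supp nuP _ zE); rewrite mean_cst.
  - exact: fprob_supp nuP _ _ zE.
  - rewrite -mean_sum => [|z _]; last exact: (nub (fun x => g i * x)%g).
    by under eq_mean => x do rewrite (fprob_sum nuP); rewrite mean1.
  - exact: fprob_sum nuP _.
move=> k [i|b] A kF /=; last exact: nuF.
pose s := ((g i)^-1 * k^-1 * g (act k i))%g.
have sS : act s (rep i) = rep i.
  have h1 : act (g (act k i)) (rep i) = act k i by rewrite -(rep_act k i) gE.
  have h2 : act (g i)^-1%g i = rep i.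
    by apply: (@act_inj B I act actP (g i)); rewrite gE -aM mulgV a1.
  by rewrite /s !aM h1 -(aM k^-1%g) mulVg a1.
rewrite rep_act; under eq_bigr => z _.
  rewrite -(mS (rep i) s^-1%g); [|by rewrite -{1}sS -aM mulVg a1|exact: (nub (fun x => g (act k i) * x)%g)].
  rewrite -meanB; [|exact: (nub (fun x => g (act k i) * (s^-1 * x))%g)|exact: (nub (fun x => g i * x)%g)].
  over.
apply: mean_l1_le => [z|x].
  apply: bddB; [exact: (nub (fun x => g (act k i) * (s^-1 * x))%g)|exact: (nub (fun x => g i * x)%g)].
have -> : (g (act k i) * (s^-1 * x) = k * (g i * x))%g.
  by rewrite -{2}(mulVKg s x); move: (s^-1 * x)%g => y; rewrite /s !mulgA mulgK mulgV mul1g.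
exact: nuF.
Qed.

End SumPropertyA.

(** * Asymptotically equivariant means on I + B *)

Section Boundary.
Variables (R : realType) (A B G : groupType) (I : Type) (act : B -> I -> I).
Variables (iota : {multiplicative direct_sum I A -> G}) (eps : {multiplicative G -> B}).
Hypothesis actP : is_group_action act.
Hypothesis iota_inj : injective iota.
Hypothesis iota_ker : range iota = eps @^-1` [set 1%g].
Hypothesis eps_surj : range eps = setT.
Hypothesis iota_conj : forall (g : G) (i : I),
  (fun x => g * x * g^-1)%g @` (iota @` @direct_summand I A i) =
  iota @` @direct_summand I A (act (eps g) i).
Hypotheses (Gc : countable [set: G]) (Bc : countable [set: B]).

(** Each of the two estimates is required only in proportion to its weight, so it may fail where the
    weight vanishes. *)
Lemma convex_close (c c' x x' y y' d : R) : 0 <= c <= 1 -> `|c' - c| <= d -> 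
  `|x'| <= 1 -> `|y'| <= 1 -> c * `|x' - x| <= d -> (1 - c) * `|y' - y| <= d ->
  `|(c' * x' + (1 - c') * y') - (c * x + (1 - c) * y)| <= 4 * d.
Proof.
move=> /andP[c0 c1] cd x1 y1 xd yd.
have -> : (c' * x' + (1 - c') * y') - (c * x + (1 - c) * y) =
  (c' - c) * (x' - y') + (c * (x' - x) + (1 - c) * (y' - y)) by ring.
have h1 : `|(c' - c) * (x' - y')| <= d * 2.
  rewrite normrM ler_pM//; apply: le_trans (ler_normB _ _) _; lra.
have h2 : `|c * (x' - x)| <= d by rewrite normrM (ger0_norm c0).
have h3 : `|(1 - c) * (y' - y)| <= d by rewrite normrM (@ger0_norm _ (1 - c))// subr_ge0.
apply: le_trans (ler_normD _ _) _; have := ler_normD (c * (x' - x)) ((1 - c) * (y' - y)); lra.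
Qed.

(** A slowly varying cutoff on B glues the two constructions: it equals 1 on the finite set where
    the probabilities of B are not yet asymptotically equivariant, and it vanishes off a finite set
    over which the length means are. *)
Lemma boundary_means (F : {fset G}) d : biexact R B -> 0 < d ->
  exists (w : G -> mean R (I + B)) (S : {fset G}), forall g k h u, g \notin S ->
    k \in F -> h \in F -> (forall y, `|u y| <= 1) ->
    `|w (k * g * h)%g u - w g (fun y => u (act_sum act (eps k) y))| <= d.
Proof.
move=> Bb d0; have d4 : 0 < d / 4 by rewrite divr_gt0.
pose FB := (eps @` F)%fset.
have FBP k : k \in F -> eps k \in FB by move=> kF; apply/imfsetP; exists k.
have [p [SB hp]] := biexact_means FB Bb d4.
have [chi [S1 [c01 c1 c0 cV]]] := cutoff SB FB Bc d4.
have T1 : 1%g \in twist_set iota_ker eps_surj F S1 by rewrite !inE eqxx.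
have [ell [ell0 ellS ellM]] := length_exists [fset 1%g]%fset Gc T1.
have [m [S hS]] := length_means actP iota_inj iota_conj ell0 ellS ellM d4.
have wex g : exists w : mean R (I + B), forall u,
    w u = chi (eps g) * m g u + (1 - chi (eps g)) * p (eps g) (fun z => u (inr z)).
  by have [w hw] := convex_mean (m g) (mean_push (p (eps g)) inr) (c01 (eps g)); exists w.
have [w wE] := choice wex; exists w, S => g k h u gS kF hF u1.
rewrite !wE !gmulfM [leRHS](_ : d = 4 * (d / 4)); last by field.
have pe x : chi x * 0 <= d / 4 by rewrite mulr0 ltW.
apply: convex_close; rewrite ?c01//.
- by apply: cV; exact: FBP.
- exact: mean_abs.
- by apply: mean_abs => z; exact: u1.
- have [gB|gB] := boolP (eps g \in S1); last by rewrite (c0 _ gB) mul0r ltW.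
  have /andP[x0 x1] := c01 (eps g).
  by apply: le_trans (ler_piMl _ x1) _ => //; exact: hS.
- have [gB|gB] := boolP (eps g \in SB); first by rewrite (c1 _ gB) subrr mul0r ltW.
  have /andP[x0 x1] := c01 (eps g).
  apply: le_trans (ler_piMl _ _) _ => //; first by rewrite lerBlDl lerDr.
  exact: (hp _ _ _ (fun z => u (inr z)) gB (FBP _ kF) (FBP _ hF)).
Qed.

End Boundary.

Lemma big_fsetM (R : realType) (K L : choiceType) (X : {fset K}) (Y : {fset L}) (g : K * L -> R) :
  \sum_(q <- (X `*` Y)%fset) g q = \sum_(b <- X) \sum_(f <- Y) g (b, f).
Proof.
rewrite -big_allpairs; apply: perm_big; apply: uniq_perm; first exact: fset_uniq.
  by apply: allpairs_uniq => [| |[b f] [b' f']]//; exact: fset_uniq.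
move=> [b f]; rewrite in_fsetM /=; apply/andP/allpairsP => [[bX fY]|[[b' f'] /= [bX fY [-> ->]]]]//.
by exists (b, f).
Qed.

Lemma prod_diff_le (R : realType) (a a' p p' : R) : 0 <= a -> 0 <= p' ->
  `|a' * p' - a * p| <= `|a' - a| * p' + a * `|p' - p|.
Proof.
move=> a0 p0; rewrite (_ : a' * p' - a * p = (a' - a) * p' + a * (p' - p)); last by ring.
by apply: le_trans (ler_normD _ _) _; rewrite !normrM (ger0_norm a0) (ger0_norm p0).
Qed.

(** * From I + B to probabilities on G *)

Section Extension.
Variables (R : realType) (A B G : groupType) (I : Type) (act : B -> I -> I).
Variables (iota : {multiplicative direct_sum I A -> G}) (eps : {multiplicative G -> B}).
Hypothesis actP : is_group_action act.
Hypothesis iota_inj : injective iota.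
Hypothesis iota_ker : range iota = eps @^-1` [set 1%g].
Hypothesis eps_surj : range eps = setT.
Hypothesis iota_conj : forall (g : G) (i : I),
  (fun x => g * x * g^-1)%g @` (iota @` @direct_summand I A i) =
  iota @` @direct_summand I A (act (eps g) i).
Hypotheses (Gc : countable [set: G]) (Bc : countable [set: B]).
Hypotheses (Aam : amenable R [set: A]) (stab_amenable : forall i, amenable R (stabilizer act i)).
Hypothesis Bex : property_A R B.
Notation DS := (direct_sum I A).

Let sc := sec eps_surj.
Let scK b : eps (sc b) = b. Proof. exact: secK. Qed.
Let pr := iota_inv iota_ker.
Let prK x : eps x = 1%g -> iota (pr x) = x. Proof. exact: iota_invK. Qed.
(** Here the section stands on the left, z = sc (eps z) iota (pi z), unlike in [normal_part]; left
    multiplication by an element of G then acts on this coordinate by left multiplication. *)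
Let pi z : DS := pr ((sc (eps z))^-1 * z)%g.

Let piE z : iota (pi z) = ((sc (eps z))^-1 * z)%g.
Proof. by rewrite prK// gmulfM morphV scK mulVg. Qed.

Let sg (q : B * DS) : G := (sc q.1 * iota q.2)%g.

Let eps_sg q : eps (sg q) = q.1.
Proof. by rewrite gmulfM scK (eps_iota iota_ker) mulg1. Qed.

Let pi_sg q : pi (sg q) = q.2.
Proof. by apply: iota_inj; rewrite piE eps_sg mulKg. Qed.

Let sgK : cancel sg (fun z => (eps z, pi z)).
Proof. by move=> q; rewrite eps_sg pi_sg -surjective_pairing. Qed.

Let sg_pi z : sg (eps z, pi z) = z.
Proof. by rewrite /sg /= piE mulVKg. Qed.

Let twist k b : DS := pr ((sc (eps k * b))^-1 * k * sc b)%g.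

Let pi_mul k z : pi (k * z)%g = (twist k (eps z) * pi z)%g.
Proof.
apply: iota_inj; rewrite gmulfM !piE /twist prK; last first.
  by rewrite !gmulfM morphV !scK -mulgA mulVg.
by rewrite gmulfM -!mulgA mulVKg.
Qed.

Lemma direct_sum_countable : countable [set: DS].
Proof.
have /countable_injP[i iinj] := Gc; apply/countable_injP; exists (i \o iota) => x y _ _ /= e.
by apply/iota_inj/iinj; rewrite ?in_setT.
Qed.

Lemma direct_sum_reiter (L : seq DS) e : 0 < e ->
  exists (E : {fset DS}) (p : DS -> R), fibre_prob E (fun _ : unit => p) /\
  forall k (X : {fset DS}), k \in L -> \sum_(z <- X) `|p (k * z)%g - p z| <= e.
Proof.
move=> e0.
have [m [_ mS]] : exists m : mean R A,
  (forall f, bdd f -> (forall y, [set: A] y -> 0 <= f y) -> 0 <= m f) /\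
  (forall h f, [set: A] h -> bdd f -> m (fun x => f (h * x)%g) = m f) by exact: amenable_mean.
have [M MP] := direct_sum_mean (I := I) (fun h f => mS h f Logic.I) L.
exact: reiter direct_sum_countable MP e0.
Qed.

(** The point with coordinates b and f receives the product weight nb y b times p f. Left
    multiplication by k multiplies f by [twist k b]; since nb lives on the finite set EB, p is
    chosen after it, almost invariant under the finitely many twists with b in EB. *)
Lemma extension_property_A (F : {fset G}) e : 0 < e ->
  exists (E : {fset G}) (nu : I + B -> G -> R), fibre_prob E nu /\
  forall k y (X : {fset G}), k \in F ->
    \sum_(z <- X) `|nu (act_sum act (eps k) y) (k * z)%g - nu y z| <= e.
Proof.
move=> e0; have e2 : 0 < e / 2 by rewrite divr_gt0.
have [EB [nb [nbP nbF]]] := sum_property_A actP stab_amenable Bex (eps @` F)%fset e2.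
pose L := [seq twist k b | k <- enum_fset F, b <- enum_fset EB].
have [EA [p [pP pL]]] := direct_sum_reiter L e2.
have p0 f : 0 <= p f by exact: fprob_ge0 pP tt f.
have p1 q (Y : {fset DS}) : \sum_(f <- Y) p (q * f)%g <= 1.
  have := fprob_sum_le tt ((fun f => q * f)%g @` Y)%fset pP.
  by rewrite big_imfset// => x y _ _ /mulgI.
pose nu y z := nb y (eps z) * p (pi z).
exists (sg @` (EB `*` EA))%fset, nu; split.
  split=> [y z|y z zE|y].
  - by rewrite mulr_ge0// (fprob_ge0 nbP).
  - have [bE|bE] := boolP (eps z \in EB); last by rewrite /nu (fprob_supp nbP _ bE) mul0r.
    have [fE|fE] := boolP (pi z \in EA); last by rewrite /nu (fprob_supp pP tt fE) mulr0.
    case/negP: zE; apply/imfsetP; exists (eps z, pi z); last by rewrite sg_pi.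
    by rewrite in_fsetM /= bE.
  - rewrite big_imfset /=; last by move=> q q' _ _ /(can_inj sgK).
    rewrite big_fsetM -(fprob_sum nbP y); apply: eq_bigr => b _.
    rewrite -[RHS]mulr1 -(fprob_sum pP tt) mulr_sumr; apply: eq_bigr => f _.
    by rewrite /nu eps_sg pi_sg.
move=> k y X kF.
pose XB := (eps @` X)%fset; pose XA := (pi @` X)%fset.
pose T1 b f := `|nb (act_sum act (eps k) y) (eps k * b)%g - nb y b| * p (twist k b * f)%g.
pose T2 b f := nb y b * `|p (twist k b * f)%g - p f|.
have T0 b f : 0 <= T1 b f + T2 b f by rewrite addr_ge0// mulr_ge0// (fprob_ge0 nbP).
apply: (@le_trans _ _ (\sum_(b <- XB) \sum_(f <- XA) (T1 b f + T2 b f))).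
  apply: (@le_trans _ _ (\sum_(z <- X) (T1 (eps z) (pi z) + T2 (eps z) (pi z)))).
    apply: ler_sum => z _; rewrite /nu gmulfM pi_mul /T1 /T2.
    by apply: prod_diff_le => //; exact: fprob_ge0 nbP _ _.
  pose phi z := (eps z, pi z).
  have phi_inj : {in X &, injective phi} by move=> z z' _ _ /(can_inj sg_pi).
  pose H q := T1 q.1 q.2 + T2 q.1 q.2.
  rewrite -(@big_fsetM R _ _ XB XA H).
  have -> : \sum_(z <- X) (T1 (eps z) (pi z) + T2 (eps z) (pi z)) = \sum_(q <- (phi @` X)%fset) H q.
    by rewrite [RHS]big_imfset.
  apply: le_trans (sum_mem_le (phi @` X)%fset (XB `*` XA)%fset (fun q => T0 q.1 q.2)).
  rewrite le_eqVlt; apply/orP; left; apply/eqP; rewrite big_seq [RHS]big_seq; apply: eq_bigr => q.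
  move=> /imfsetP[z /= zX ->]; rewrite in_fsetM /=.
  have -> : eps z \in XB by apply/imfsetP; exists z.
  by have -> : pi z \in XA by apply/imfsetP; exists z.
have -> : \sum_(b <- XB) \sum_(f <- XA) (T1 b f + T2 b f) =
    \sum_(b <- XB) \sum_(f <- XA) T1 b f + \sum_(b <- XB) \sum_(f <- XA) T2 b f.
  by rewrite -big_split; apply: eq_bigr => b _; rewrite -big_split.
have h1 : \sum_(b <- XB) \sum_(f <- XA) T1 b f <= e / 2.
  apply: le_trans (nbF (eps k) y XB _); last by apply/imfsetP; exists k.
  by apply: ler_sum => b _; rewrite -mulr_sumr ler_piMr.
have h2 : \sum_(b <- XB) \sum_(f <- XA) T2 b f <= e / 2.
  apply: (@le_trans _ _ (\sum_(b <- XB) nb y b * (e / 2))).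
    apply: ler_sum => b _; rewrite -mulr_sumr.
    have [bE|bE] := boolP (b \in EB); last by rewrite (fprob_supp nbP _ bE) !mul0r.
    apply: ler_wpM2l; first exact: fprob_ge0 nbP _ _.
    by apply: pL; apply/allpairsP; exists (k, b).
  rewrite -mulr_suml ler_piMl//; first exact: ltW.
  exact: fprob_sum_le nbP.
lra.
Qed.

(** mu t integrates nu against the mean at t^-1: the inverse turns asymptotic right invariance of
    the means into left invariance of mu, to within d. For the right condition both the means and nu
    contribute e / 2. The support comes from nu, hence precedes [F'] and [d]. *)
Lemma wreath_boundary_amenable : biexact R B -> boundary_amenable R G.
Proof.
move=> Bb F e e0; have e2 : 0 < e / 2 by rewrite divr_gt0.
have [E [nu [nuP nuF]]] := extension_property_A ((fun g => g^-1)%g @` F)%fset e2.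
exists E => F' d d0.
pose F3 := (1%g |` ((fun g => g^-1)%g @` F' `|` (fun g => g^-1)%g @` F))%fset.
have d3 : 0 < Num.min d (e / 2) by rewrite lt_min d0.
have [w [S hS]] := boundary_means actP iota_inj iota_ker eps_surj iota_conj Gc Bc F3 Bb d3.
have F31 : 1%g \in F3 by rewrite !inE eqxx.
have nub (z : G) : bdd (fun y => nu y z).
  by exists 1 => y; have /andP[n0 n1] := fprob_le1 y z nuP; rewrite ger0_norm.
pose mu (t z : G) := w t^-1%g (fun y => nu y z).
exists mu, ((fun g => g^-1)%g @` S)%fset.
have SV t : t \notin ((fun g => g^-1)%g @` S)%fset -> t^-1%g \notin S.
  by apply: contra => tS; apply/imfsetP; exists t^-1%g; rewrite ?invgK.
split.
- split=> [t z|t z zE|t].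
  + by apply: mean_ge0 => // y; exact: fprob_ge0 nuP _ _.
  + by rewrite /mu; under eq_mean => y do rewrite (fprob_supp nuP _ zE); rewrite mean_cst.
  + rewrite /mu -mean_sum//.
    by under eq_mean => y do rewrite (fprob_sum nuP); rewrite mean1.
- move=> t h X tS hF.
  have s1 y : act_sum act (eps 1%g) y = y.
    by have [a1 _] := actP; case: y => [i|b] /=; rewrite morph1 ?a1 ?mul1g.
  have -> : \sum_(z <- X) `|mu (h * t)%g z - mu t z| =
    \sum_(z <- X) `|w (1 * t^-1 * h^-1)%g (fun y => nu y z) -
      w t^-1%g (fun y => nu (act_sum act (eps 1%g) y) z)|.
    apply: eq_bigr => z _; rewrite /mu invgM mul1g; congr (`|_ - _|).
    by apply: eq_mean => y; rewrite s1.
  apply: (@mean_diff_l1 R (I + B)%type (I + B)%type) => // [y|u u1].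
    rewrite (eq_bigr (nu y)) => [|z _]; last by rewrite ger0_norm ?(fprob_ge0 nuP).
    exact: fprob_sum_le nuP.
  apply: le_trans (hS _ _ _ _ (SV _ tS) F31 _ u1) _; last by rewrite ge_min lexx.
  by rewrite !inE; apply/orP; right; apply/orP; left; apply/imfsetP; exists h.
- move=> t p X tS pF.
  have pV : p^-1%g \in ((fun g => g^-1)%g @` F)%fset by apply/imfsetP; exists p.
  have pF3 : p^-1%g \in F3 by rewrite !inE pV !orbT.
  pose s := act_sum act (eps p^-1%g).
  apply: (@le_trans _ _ (\sum_(z <- X) (
      `|w (p^-1 * t^-1 * 1)%g (fun y => nu y (p^-1 * z)%g) - w t^-1%g (fun y => nu (s y) (p^-1 * z)%g)| +
      `|w t^-1%g (fun y => nu (s y) (p^-1 * z)%g - nu y z)|))).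
    apply: ler_sum => z _; rewrite /mu invgM mulg1 meanB//; last exact: (bdd_comp s (nub _)).
    exact: ler_distD.
  rewrite big_split /= [e]splitr; apply: lerD.
    apply: (@mean_diff_l1 R (I + B)%type (I + B)%type _ _ _ s (fun y z => nu y (p^-1 * z)%g)) => // [y|u u1].
      rewrite (eq_bigr (fun z => nu y (p^-1 * z)%g)) => [|z _]; last by rewrite ger0_norm ?(fprob_ge0 nuP).
      have := fprob_sum_le y ((fun z => p^-1 * z)%g @` X)%fset nuP.
      by rewrite big_imfset// => x x' _ _ /mulgI.
    by apply: le_trans (hS _ _ _ _ (SV _ tS) pF3 F31 u1) _; rewrite ge_min lexx orbT.
  apply: mean_l1_le => [z|y]; last exact: nuF.
  by apply: bddB => //; exact: (bdd_comp s (nub _)).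
Qed.

End Extension.

Theorem corollary2 (R : realType) (A B G : groupType) (I : Type)
    (act : B -> I -> I) :
  countable [set: A] -> countable [set: B] -> countable [set: G] ->
  is_group_action act ->
  wreath_like A act G ->
  amenable R [set: A] ->
  biexact R B ->
  (forall i, amenable R (stabilizer act i)) ->
  solid (group_vna R G).
Proof.
move=> _ Bc Gc actP [iota [eps [iota_inj iota_ker eps_surj iota_conj]]] Aam Bb stab.
apply: solid_boundary_amenable.
have Bex : property_A R B by apply: exact_property_A; case: Bb.
exact: wreath_boundary_amenable actP iota_inj iota_ker eps_surj iota_conj Gc Bc Aam stab Bex Bb.
Qed.
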